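(* Let $H$ be the half plane uniform infinite planar triangulation (HUIPT). Then, almost surely, the simple random walk on $H$ is recurrent.
   Context: Planar maps are connected multigraphs properly embedded in the plane, up to orientation-preserving homeomorphism, rooted at a directed edge. Triangulations may have multiple edges but no self-loops. For $m\ge 2$, a triangulation of an $m$-gon is a planar map whose external face is bounded by a simple cycle of length $m$ (the boundary) and all of whose other faces are triangles; vertices not on the boundary are called internal. The local topology on rooted maps is generated by the metric $d(G,G')=e^{-R}$ with $R=\sup\{r: B_r(G)\cong B_r(G')\}$, where $B_r$ is the graph-distance ball of radius $r$ around the root and $\cong$ is isomorphism of rooted maps. HUIPT: let $T_{n,m}$ be a uniform triangulation of an $m$-gon with $n$ internal vertices, rooted at a boundary edge. The HUIPT $H$ is the limit in distribution of $T_{n,m}$ for the local topology as $m\to\infty$ and $n/m\to\infty$. It is almost surely a triangulation whose boundary $\partial H$ is a simple doubly infinite path, drawn in the upper half plane with the boundary along a line, rooted at a boundary edge. Its law is characterized as follows: for every finite simply connected triangulation $Q$ with simple boundary and a marked connected segment of $\partial Q$ containing the root, the event $A_Q$ that $Q$ is a sub-map of $H$ with the roots coinciding and with the marked segment being the intersection of $Q$ with $\partial H$ has probability $6^{v}9^{-f}$, where $v$ is the number of vertices of $Q$ not in $\partial H$ and $f$ is the number of (triangular) faces of $Q$; moreover, conditionally on $A_Q$, the complement $H\setminus Q$ again has the law of the HUIPT. *)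

(* Defs.v *)
From HB Require Import structures.
From mathcomp Require Import all_boot all_order all_algebra.
From mathcomp Require Import finmap zify.
From mathcomp Require Import all_classical all_reals all_analysis.
Set Implicit Arguments.
Unset Strict Implicit.
Unset Printing Implicit Defensive.
Import Order.TTheory GRing.Theory Num.Theory.
Import numFieldNormedType.Exports.
Local Open Scope classical_set_scope.
Local Open Scope card_scope.
Local Open Scope ring_scope.

(* A locally finite connected rooted map, encoded by its darts (oriented edges):
   [edge] reverses a dart and [rot] sends a dart to the next one, clockwise,
   with the same origin.  [rot_periodic] says at once that [rot] is a
   permutation and that vertices have finite degree. *)
Record rmap := RMap {
  dart : Type;
  edge : dart -> dart;
  rot : dart -> dart;
  root_dart : dart;
  edgeK : involutive edge;
  edge_neq : forall d, edge d <> d;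
  rot_periodic : forall d, exists2 k, (0 < k)%N & iter k rot d = d;
  rmap_connected : forall A : set dart,
    A root_dart -> (forall d, A d -> A (edge d) /\ A (rot d)) -> A = setT
}.
Arguments edge {G} d : rename.
Arguments rot {G} d : rename.
Arguments root_dart {G} : rename.

HB.instance Definition _ (G : rmap) := gen_eqMixin (dart G).
HB.instance Definition _ (G : rmap) := gen_choiceMixin (dart G).

Definition orbit_of (T : Type) (f : T -> T) (d : T) : set T :=
  range (fun k => iter k f d).

(* Vertices, edges and faces are the cycles of [rot], of [edge] and of
   [rot \o edge]; [vertex d] is the origin of [d] and [face d] is the face on
   the left of [d]. *)
Definition vertex (G : rmap) : dart G -> set (dart G) := orbit_of rot.
Definition face (G : rmap) : dart G -> set (dart G) := orbit_of (rot \o edge).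
Definition vertices (G : rmap) : set (set (dart G)) := range (@vertex G).
Definition edges (G : rmap) : set (set (dart G)) := range (orbit_of (@edge G)).
Definition faces (G : rmap) : set (set (dart G)) := range (@face G).

Arguments vertices : clear implicits.
Arguments edges : clear implicits.
Arguments faces : clear implicits.

Definition rmap_iso (G G' : rmap) : Prop :=
  exists f : dart G -> dart G', [/\ bijective f, f root_dart = root_dart,
    forall d, f (edge d) = edge (f d) & forall d, f (rot d) = rot (f d)].

(* Triangulations of an [m]-gon with [n] internal vertices.  The root is the
   boundary edge oriented with the external face on its left, so the external
   face is [face root_dart].  Planarity of a finite map is Euler's formula.
   [pt_simple_edge] only matters when [m = 2]: it excludes the map with a single
   edge, whose external face is not bounded by a simple cycle of length 2. *)
Record polygon_triangulation (n m : nat) (G : rmap) : Prop := {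
  pt_m : (2 <= m)%N;
  pt_planar : exists v e f : nat, [/\ vertices G #= `I_v, edges G #= `I_e,
    faces G #= `I_f & (v + f = e + 2)%N];
  pt_boundary : face (@root_dart G) #= `I_m;
  pt_simple : {in face (@root_dart G) &, injective (@vertex G)};
  pt_simple_edge : forall d, face (@root_dart G) d -> ~ face root_dart (edge d);
  pt_triangle : forall d : dart G, ~ face root_dart d -> face d #= `I_3;
  pt_loopless : forall d : dart G, vertex (edge d) <> vertex d;
  pt_internal : vertices G `\` (@vertex G @` face root_dart) #= `I_n
}.

(* [dist_le r d]: the origin of [d] is at graph distance at most [r] from the
   origin of the root. *)
Fixpoint dist_le (G : rmap) (r : nat) (d : dart G) : Prop :=
  match r with
  | 0 => vertex root_dart d
  | r.+1 => dist_le r d \/ exists2 d', vertex d d' & dist_le r (edge d')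
  end.

(* The darts of the ball of radius [r], i.e. of the sub-map spanned by the
   vertices at distance at most [r] from the root. *)
Definition dart_ball (G : rmap) (r : nat) : set (dart G) :=
  [set d | dist_le r d /\ dist_le r (edge d)].
Arguments dart_ball : clear implicits.

(* The rotation of the sub-map with set of darts [A]: [d'] is the first dart of
   [A] met after [d] when turning around the origin of [d]. *)
Definition next_in (G : rmap) (A : set (dart G)) (d d' : dart G) : Prop :=
  A d' /\ exists2 k, (0 < k)%N &
    d' = iter k rot d /\ forall j, (0 < j < k)%N -> ~ A (iter j rot d).

Definition ball_isom (r : nat) (G G' : rmap) (f : dart G -> dart G') : Prop :=
  [/\ set_bij (dart_ball G r) (dart_ball G' r) f,
      f root_dart = root_dart,
      forall d, dart_ball G r d -> f (edge d) = edge (f d) &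
      forall d d', dart_ball G r d -> dart_ball G r d' ->
        next_in (dart_ball G r) d d' <->
        next_in (dart_ball G' r) (f d) (f d')].

Definition ball_iso (r : nat) (G G' : rmap) : Prop :=
  exists f : dart G -> dart G', ball_isom r f.

Section local_distance.
Variable R : realType.

(* The supremum is taken in [0, +oo]: including 0 makes it 0 when no two balls
   agree, instead of the supremum -oo of the empty set. *)
Definition agreement_radius (G G' : rmap) : \bar R :=
  ereal_sup [set (r%:R)%:E | r in [set r | r = 0%N \/ ball_iso r G G']].

Definition local_dist (G G' : rmap) : R :=
  fine (expeR (- agreement_radius G G')).

End local_distance.

Section ball_iso_theory.

Lemma vertex_refl (G : rmap) (d : dart G) : vertex d d.
Proof. by exists 0%N. Qed.

Lemma vertex_trans (G : rmap) (a b c : dart G) :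
  vertex a b -> vertex b c -> vertex a c.
Proof.
by move=> [k _ <-] [l _ <-]; exists (l + k)%N => //; rewrite iterD.
Qed.

Lemma vertex_sym (G : rmap) (a b : dart G) : vertex a b -> vertex b a.
Proof.
move=> [k _ <-]; have [p p0 pa] := rot_periodic a.
have pM l : iter (l * p) rot a = a.
  by elim: l => // l IH; rewrite mulSn iterD IH.
exists (k * p - k)%N => //; rewrite -iterD subnK ?pM//.
by rewrite leq_pmulr.
Qed.

Lemma near_vertex (G : rmap) r (d d' : dart G) :
  vertex d d' -> dist_le r d -> dist_le r d'.
Proof.
elim: r => [|r IH] dd' /=; first by move=> h; apply: vertex_trans h dd'.
move=> [/(IH dd')|[c dc cr]]; [by left|right; exists c => //].
exact: vertex_trans (vertex_sym dd') dc.
Qed.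

Lemma near_le (G : rmap) r s (d : dart G) : (r <= s)%N -> dist_le r d -> dist_le s d.
Proof.
move=> /subnK <-; elim: (s - r)%N => [//|t IH] h.
by rewrite addSn /=; left; apply: IH.
Qed.

Lemma dart_ball_le (G : rmap) r s :
  (r <= s)%N -> dart_ball G r `<=` dart_ball G s.
Proof. by move=> rs d [a b]; split; exact: near_le rs _. Qed.

Lemma dart_ball_edge (G : rmap) r d :
  dart_ball G r d -> dart_ball G r (edge d).
Proof. by move=> [a b]; split => //; rewrite edgeK. Qed.

Lemma next_in_ex (G : rmap) (A : set (dart G)) d k : (0 < k)%N ->
  A (iter k rot d) ->
  exists j, [/\ (0 < j <= k)%N, next_in A d (iter j rot d) & A (iter j rot d)].
Proof.
move=> k0 Ak.
have ex : exists j, (0 < j)%N && `[< A (iter j rot d) >].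
  by exists k; rewrite k0; apply/asboolP.
case: (ex_minnP ex) => j /andP[j0 /asboolP Aj] jmin.
exists j; split => //.
  by rewrite j0 jmin// k0; apply/asboolP.
split => //; exists j => //; split => // i /andP[i0 ij] Ai.
by move: ij; rewrite ltnNge jmin// i0; apply/asboolP.
Qed.

Lemma ball_iso_vertex (G G' : rmap) (A : set (dart G)) (A' : set (dart G'))
    (f : dart G -> dart G') :
  (forall d d', A d -> A d' -> next_in A d d' -> next_in A' (f d) (f d')) ->
  forall d d', A d -> A d' -> vertex d d' -> vertex (f d) (f d').
Proof.
move=> fn d d' Ad Ad' [k _ kd]; move: Ad'; rewrite -{d'}kd.
elim/ltn_ind: k d Ad => k IH d Ad Ak.
have [->|k0] := posnP k; first exact: vertex_refl.
have [j [/andP[j0 jk] nj Aj]] := next_in_ex k0 Ak.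
have [_ [i _ [fj _]]] := fn _ _ Ad Aj nj.
apply: (@vertex_trans _ _ (f (iter j rot d))); first by exists i.
rewrite -(subnK jk) iterD; apply: IH => //; first by rewrite ltn_subrL j0 k0.
by rewrite -iterD subnK.
Qed.

Lemma near_ball (G G' : rmap) r s (f : dart G -> dart G') : (s < r)%N ->
  f root_dart = root_dart ->
  (forall d, dart_ball G r d -> f (edge d) = edge (f d)) ->
  (forall d d', dart_ball G r d -> dart_ball G r d' -> vertex d d' ->
     vertex (f d) (f d')) ->
  forall t, (t <= s)%N -> forall d, dart_ball G r d -> dist_le t d ->
  dist_le t (f d).
Proof.
move=> sr f0 fe fv; have broot : dart_ball G r root_dart.
  split; first by apply: (@near_le _ 0) => //; exact: vertex_refl.
  apply: (@near_le _ 1); first exact: leq_ltn_trans sr.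
  by right; exists (edge root_dart); [exact: vertex_refl|rewrite edgeK; exact: vertex_refl].
elim=> [_ d bd /= rd|t IH ts d bd /=]; first by rewrite -f0; apply: fv.
move=> [h|[d' dd' ed']]; first by left; apply: IH => //; exact: ltnW.
have bd' : dart_ball G r d'.
  split; first by apply: near_vertex dd' bd.1.
  by apply: near_le ed'; apply: ltnW; apply: leq_trans ts (ltnW sr).
right; exists (f d'); first exact: fv.
by rewrite -fe//; apply: IH; [exact: ltnW|exact: dart_ball_edge|].
Qed.

Lemma next_in_sub (G G' : rmap) (A C : set (dart G)) (A' C' : set (dart G'))
    (f : dart G -> dart G') :
  C `<=` A -> C' `<=` A' -> (forall d, A d -> C d <-> C' (f d)) ->
  (forall d d', A d -> A d' -> next_in A d d' -> next_in A' (f d) (f d')) ->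
  forall d d', A d -> next_in C d d' -> next_in C' (f d) (f d').
Proof.
move=> CA CA' CC fn d d' Ad [Cd' [k k0 [d'E nC]]]; subst d'.
elim/ltn_ind: k d Ad k0 Cd' nC => k IH d Ad k0 Cd' nC.
split; first by apply/CC => //; exact: CA.
have [j [/andP[j0 jk] nj Aj]] := next_in_ex k0 (CA _ Cd').
have [_ [i i0 [fj nA']]] := fn _ _ Ad Aj nj.
move: jk; rewrite leq_eqVlt => /predU1P[jk|jk].
  by subst j; exists i => //; split => // t /nA' h /CA'.
have kjE : iter (k - j) rot (iter j rot d) = iter k rot d.
  by rewrite -iterD subnK// ltnW.
have [||||_ [l l0 [fl nl]]] := IH (k - j)%N _ (iter j rot d) Aj.
- by rewrite ltn_subrL j0.
- by rewrite subn_gt0.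
- by rewrite kjE.
- move=> t /andP[t0 tk]; rewrite -iterD; apply: nC.
  by lia.
exists (l + i)%N; first by rewrite addn_gt0 l0.
split=> [|t /andP[t0 tl]]; first by rewrite iterD -fj -fl kjE.
have [ti|ti|ti] := ltngtP t i.
- by move/CA'; apply: nA'; rewrite t0.
- rewrite -(subnK (ltnW ti)) iterD -fj; apply: nl; lia.
- by rewrite ti -fj => /(CC _ Aj); apply: nC; rewrite j0.
Qed.

Lemma dart_ball_root (G : rmap) r : (0 < r)%N -> dart_ball G r root_dart.
Proof.
move=> r0; split; first by apply: (@near_le _ 0) => //; exact: vertex_refl.
apply: (@near_le _ 1) => //.
by right; exists (edge root_dart); [exact: vertex_refl|rewrite edgeK; exact: vertex_refl].
Qed.

Lemma ball_isom_inv r (G G' : rmap) (f : dart G -> dart G') : (0 < r)%N ->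
  ball_isom r f -> exists g : dart G' -> dart G, [/\ ball_isom r g,
    forall d, dart_ball G r d -> g (f d) = d &
    forall d, dart_ball G' r d -> f (g d) = d].
Proof.
move=> r0 [[fsub finj fsurj] f0 fe fn].
pose g d' := if pselect (dart_ball G' r d') is left h then
  projT1 (cid2 (fsurj _ h)) else root_dart.
have gP d' : dart_ball G' r d' -> dart_ball G r (g d') /\ f (g d') = d'.
  by rewrite /g; case: pselect => // h _; case: cid2.
have gf d : dart_ball G r d -> g (f d) = d.
  move=> bd; have [h1 h2] := gP _ (fsub _ bd).
  by apply: finj; rewrite ?inE.
exists g; split => //; last by move=> d /gP[].
split.
- split.
  + by move=> d' /gP[].
  + move=> a b; rewrite !inE => /gP[_ ha] /gP[_ hb] ab.
    by rewrite -ha -hb ab.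
  + by move=> d bd; exists (f d); [exact: fsub|exact: gf].
- by rewrite -f0 gf//; exact: dart_ball_root.
- move=> d /gP[bd fgd]; rewrite -[in LHS]fgd -fe// gf//.
  exact: dart_ball_edge.
- move=> d d' /gP[bd fgd] /gP[bd' fgd'].
  by rewrite (fn _ _ bd bd') fgd fgd'.
Qed.

Lemma ball_iso_refl r (G : rmap) : ball_iso r G G.
Proof. by exists id; split => //; split => // d bd; exists d. Qed.

Lemma ball_iso_sym r (G G' : rmap) : (0 < r)%N ->
  ball_iso r G G' -> ball_iso r G' G.
Proof. by move=> r0 [f /(ball_isom_inv r0)[g [bg _ _]]]; exists g. Qed.

Lemma ball_iso_trans r (G1 G2 G3 : rmap) :
  ball_iso r G1 G2 -> ball_iso r G2 G3 -> ball_iso r G1 G3.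
Proof.
move=> [f [bf f0 fe fn]] [g [bg g0 ge gn]]; exists (g \o f); split.
- exact: set_bij_comp bf bg.
- by rewrite /= f0 g0.
- by case: bf => fs _ _ d bd /=; rewrite fe// ge//; exact: fs.
- by case: bf => fs _ _ d d' bd bd' /=; rewrite fn//; apply: gn; exact: fs.
Qed.

Lemma ball_isom_sub r s (G G' : rmap) (f : dart G -> dart G') : (s < r)%N ->
  ball_isom r f -> forall d, dart_ball G r d -> dart_ball G s d ->
  dart_ball G' s (f d).
Proof.
move=> sr [[fsub _ _] f0 fe fn] d bd [d1 d2].
have fv := @ball_iso_vertex _ _ _ _ f (fun a b Aa Ab => (fn a b Aa Ab).1).
have nb := near_ball sr f0 fe fv (leqnn s).
by split; [exact: nb|rewrite -fe//; apply: nb => //; exact: dart_ball_edge].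
Qed.

Lemma ball_iso_le r s (G G' : rmap) : (s <= r)%N ->
  ball_iso r G G' -> ball_iso s G G'.
Proof.
rewrite leq_eqVlt => /predU1P[->//|sr] [f fP].
have r0 : (0 < r)%N by apply: leq_trans sr.
have [g [gP gf fg]] := ball_isom_inv r0 fP.
have fs := ball_isom_sub sr fP; have gs := ball_isom_sub sr gP.
have le := @dart_ball_le _ _ _ (ltnW sr).
case: (fP) => -[fsub finj fsurj] f0 fe fn.
case: (gP) => -[gsub ginj gsurj] g0 ge gn.
have fC d : dart_ball G r d -> dart_ball G s d <-> dart_ball G' s (f d).
  move=> bd; split; first exact: fs.
  by move=> /(gs _ (fsub _ bd)); rewrite gf.
have gC d : dart_ball G' r d -> dart_ball G' s d <-> dart_ball G s (g d).
  move=> bd; split; first exact: gs.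
  by move=> /(fs _ (gsub _ bd)); rewrite fg.
exists f; split => //.
- split.
  + by move=> d bd; apply: fs => //; exact: le.
  + by move=> a b; rewrite !inE => ha hb; apply: finj; rewrite inE; exact: le.
  + move=> d bd; exists (g d); last by apply: fg; exact: le.
    by apply: gs => //; exact: le.
- by move=> d bd; apply: fe; exact: le.
- move=> d d' bd bd'; split.
    apply: (@next_in_sub _ _ (dart_ball G r) _ (dart_ball G' r)) => //.
    + by move=> a b ha hb /(fn _ _ ha hb).
    + exact: le.
  rewrite -[in X in _ -> X](gf d (le _ _ bd)) -[in X in _ -> X](gf d' (le _ _ bd')).
  apply: (@next_in_sub _ _ (dart_ball G' r) _ (dart_ball G r)) => //.
  + by move=> a b ha hb /(gn _ _ ha hb).
  + by apply: fsub; exact: le.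
Qed.

Lemma rmap_iso_ball r (G G' : rmap) : rmap_iso G G' -> ball_iso r G G'.
Proof.
move=> [f [fbij f0 fe fr]]; have [g gf fg] := fbij.
have fi k d : f (iter k rot d) = iter k rot (f d).
  by elim: k => //= k <-; rewrite fr.
have fv a b : vertex (f a) (f b) <-> vertex a b.
  split=> -[k _ kb]; exists k => //; last by rewrite -fi kb.
  by apply: (can_inj gf); rewrite fi.
have fd t d : dist_le t (f d) <-> dist_le t d.
  elim: t d => [|t IH] d /=; first by rewrite -f0 fv.
  split=> -[/IH|[d' dd' h]]; [by left| |by left|].
  - right; exists (g d'); first by apply/fv; rewrite fg.
    by apply/IH; rewrite fe fg.
  - right; exists (f d'); first exact/fv.
    by rewrite -fe; apply/IH.
have fb d : dart_ball G' r (f d) <-> dart_ball G r d.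
  by rewrite /dart_ball /= -fe !fd.
exists f; split => //.
- split.
  + by move=> d /fb.
  + by move=> a b _ _; exact: can_inj gf _ _.
  + by move=> d bd; exists (g d); rewrite ?fg//; apply/fb; rewrite fg.
- move=> d d' bd bd'; split=> -[h [k k0 [dE nb]]].
  + split; first exact/fb.
    by exists k => //; split=> [|j /nb]; [rewrite dE fi|rewrite -fi fb].
  + split=> //; exists k => //; split=> [|j /nb]; last by rewrite -fi fb.
    by apply: (can_inj gf); rewrite fi.
Qed.

End ball_iso_theory.

(* Rooted maps with the topology generated by [local_dist], which is a
   pseudometric: isomorphic maps are at distance 0. *)
Definition local_map (R : realType) : Type := rmap.

Definition single_edge : rmap.
Proof.
apply: (@RMap bool negb id true).
- exact: negbK.
- by case.
- by move=> d; exists 1%N.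
- move=> A At AE; apply/seteqP; split => // -[] _ //.
  by have [] := AE _ At.
Defined.

Section local_topology.
Variable R : realType.
Implicit Types G : local_map R.

Lemma agreement_ge0 (G G' : rmap) : (0 <= agreement_radius R G G')%E.
Proof. by apply: ereal_sup_ubound; exists 0%N => //; left. Qed.

Lemma agreement_refl (G : rmap) : agreement_radius R G G = +oo%E.
Proof.
apply/eqyP => x x0; apply: le_trans (_ : ((Num.truncn x).+1%:R)%:E <= _)%E.
  by rewrite lee_fin ltW// truncnS_gt.
by apply: ereal_sup_ubound; exists (Num.truncn x).+1 => //; right; exact: ball_iso_refl.
Qed.

Lemma agreement_sym (G G' : rmap) :
  agreement_radius R G G' = agreement_radius R G' G.
Proof.
rewrite /agreement_radius; congr (ereal_sup (_ @` _)).
by apply/seteqP; split => -[|r] /= [//|h]; by [left|right; exact: ball_iso_sym].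
Qed.

Lemma agreement_trans (G1 G2 G3 : rmap) :
  (mine (agreement_radius R G1 G2) (agreement_radius R G2 G3) <=
   agreement_radius R G1 G3)%E.
Proof.
rewrite leNgt; apply/negP; rewrite lt_min => /andP[].
move=> /ereal_sup_gt[_ [r rP <-]] hr /ereal_sup_gt[_ [s sP <-]] hs.
pose t := minn r s.
have : ball_iso t G1 G3 \/ t = 0%N.
  case: rP => [r0|rP]; first by right; rewrite /t r0 min0n.
  case: sP => [s0|sP]; first by right; rewrite /t s0 minn0.
  left; apply: (@ball_iso_trans _ _ G2).
    by apply: ball_iso_le rP; exact: geq_minl.
  by apply: ball_iso_le sP; exact: geq_minr.
move=> tP; have : (t%:R%:E <= agreement_radius R G1 G3)%E.
  by apply: ereal_sup_ubound; exists t => //; case: tP; [right|left].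
by rewrite /t /minn; case: ifP => _; rewrite leNgt ?hr ?hs.
Qed.

Lemma expeR_agreement (G G' : rmap) :
  expeR (- agreement_radius R G G') = (local_dist R G G')%:E.
Proof.
rewrite /local_dist; have := agreement_ge0 G G'.
by case: agreement_radius => [x| |].
Qed.

Let lball G (e : R) : set (local_map R) := [set G' | local_dist R G G' < e].

Let lball_center G (e : R) : 0 < e -> lball G e G.
Proof. by rewrite /lball /= /local_dist agreement_refl. Qed.

Let lball_sym G G' (e : R) : lball G e G' -> lball G' e G.
Proof. by rewrite /lball /= /local_dist agreement_sym. Qed.

Let lball_triangle G1 G2 G3 (e1 e2 : R) :
  lball G1 e1 G2 -> lball G2 e2 G3 -> lball G1 (e1 + e2) G3.
Proof.
rewrite /lball /= => h1 h2.
have e10 : 0 < e1 by apply: le_lt_trans h1; rewrite fine_ge0// expeR_ge0.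
have e20 : 0 < e2 by apply: le_lt_trans h2; rewrite fine_ge0// expeR_ge0.
have := agreement_trans G1 G2 G3.
rewrite ge_min => /orP[] h.
  rewrite -lte_fin -expeR_agreement.
  apply: (@le_lt_trans _ _ (expeR (- agreement_radius R G1 G2))).
    by rewrite lee_expeR leeN2.
  by rewrite expeR_agreement lte_fin ltr_wpDr// ltW.
rewrite -lte_fin -expeR_agreement.
apply: (@le_lt_trans _ _ (expeR (- agreement_radius R G2 G3))).
  by rewrite lee_expeR leeN2.
by rewrite expeR_agreement lte_fin ltr_wpDl// ltW.
Qed.

Let lent : set_system (local_map R * local_map R) := entourage_ lball.
Let lnbhs G : set_system (local_map R) := nbhs_ lent G.
Let lnbhsE : lnbhs = nbhs_ lent. Proof. by []. Qed.
Let lentE : lent = entourage_ lball. Proof. by []. Qed.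

HB.instance Definition _ := gen_eqMixin (local_map R).
HB.instance Definition _ := gen_choiceMixin (local_map R).
HB.instance Definition _ := isPointed.Build (local_map R) single_edge.
HB.instance Definition _ := hasNbhs.Build (local_map R) lnbhs.
HB.instance Definition _ := @Nbhs_isPseudoMetric.Build R (local_map R)
  lent lnbhsE lball lball_center lball_sym lball_triangle lentE.

Lemma rmap_iso_local_dist (G G' : rmap) :
  rmap_iso G G' -> local_dist R G G' = 0.
Proof.
move=> /rmap_iso_ball h; rewrite /local_dist.
suff -> : agreement_radius R G G' = +oo%E by [].
apply/eqyP => x x0; apply: le_trans (_ : ((Num.truncn x).+1%:R)%:E <= _)%E.
  by rewrite lee_fin ltW// truncnS_gt.
by apply: ereal_sup_ubound; exists (Num.truncn x).+1 => //; right.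
Qed.

End local_topology.

(* Rooted maps with the Borel sigma-algebra of the local topology. *)
Notation borel_map R := (g_sigma_algebraType (@open (local_map R))).

Definition iso_class (R : realType) (G : local_map R) : set (local_map R) :=
  [set G' | rmap_iso G G'].

Definition triangulation_classes (R : realType) (n m : nat) :
    set (set (local_map R)) :=
  @iso_class R @` [set G | polygon_triangulation n m G].
Arguments triangulation_classes : clear implicits.

(* The expectation of [phi T], for [T] uniform among the (finitely many)
   isomorphism classes of triangulations of an [m]-gon with [n] internal
   vertices.  Continuous functions are constant on isomorphism classes, so the
   choice of representatives by [get] is immaterial for them. *)
Definition uniform_mean (R : realType) (n m : nat) (phi : local_map R -> R) : R :=
  (\sum_(c \in triangulation_classes R n m) phi (get c)) /
  #|` fset_set (triangulation_classes R n m)|%:R.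

(* [H] is distributed as the limit in distribution of uniform triangulations of
   an [m]-gon with [n] internal vertices as [m] and [n / m] tend to infinity. *)
Definition is_HUIPT (R : realType) (d : measure_display) (Omega : measurableType d)
    (P : probability Omega R) (H : {RV P >-> borel_map R}) : Prop :=
  forall n m : nat -> nat, m k @[k --> \oo] --> \oo ->
    ((n k)%:R / (m k)%:R : R) @[k --> \oo] --> +oo ->
  forall phi : local_map R -> R, continuous phi -> bounded_fun phi ->
    (uniform_mean (n k) (m k) phi)%:E @[k --> \oo] --> 'E_P[phi \o H]%E.

(* A vertex is the set of darts issued from it, so the number of darts of [u] is
   its degree and parallel edges are counted with multiplicity. *)
Definition walk_step (R : realType) (G : rmap) (u v : set (dart G)) : R :=
  #|` fset_set [set d | u d /\ vertex (edge d) = v]|%:R / #|` fset_set u|%:R.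

Arguments walk_step R {G} u v.

Definition simple_random_walk (R : realType) (G : rmap) (x : set (dart G))
    (d : measure_display) (Omega : measurableType d) (P : probability Omega R)
    (X : nat -> Omega -> set (dart G)) : Prop :=
  [/\ forall i v, measurable [set w | X i w = v],
      forall i w, vertices G (X i w) &
      forall (v : nat -> set (dart G)) k, (forall i, vertices G (v i)) ->
        v 0%N = x ->
        P [set w | forall i, (i <= k)%N -> X i w = v i] =
          (\prod_(i < k) walk_step R (v i) (v i.+1))%:E].

Definition recurrent (R : realType) (G : rmap) : Prop :=
  forall (x : set (dart G)), vertices G x ->
  forall (d : measure_display) (Omega : measurableType d)
    (P : probability Omega R) (X : nat -> Omega -> set (dart G)),
  simple_random_walk x P X ->
  {ae P, forall w, exists2 k, (0 < k)%N & X k w = x}.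

(* Main.v *)
(* A triangulation of a polygon is coded by the tree of its successive root removals, so
   that sums over triangulations obey Tutte's quadratic recursion, solved in closed form.
   For each dyadic scale 2^t one looks for a potential equal to 1 on a boundary block of
   length 2^t and to 0 on the boundary outside a window of comparable length, with energy
   O(t). By duality of extremal length, two interleaved pairs of boundary arcs cannot both
   be cheaply connected; peeling from a random boundary edge, each re-rooting provides a
   new interleaved pair, which makes such a potential exist with probability close to 1.
   Let g_t be a potential of almost minimal energy. It is almost harmonic off the block and
   the outside of the window, so that, averaging over the position of the root, the cross
   terms <g_s, g_t> are so small that the average of the g_t with weights 1/t has energy
   O(1 / sum 1/t). Hence, with probability close to 1, the resistance from the root to the
   complement of some fixed ball is arbitrarily large; this passes to the local limit, and
   an infinite resistance makes the walk recurrent. *)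

(* Vertex degrees are unbounded: among the polynomially many vertices met at scale 2^t the largest
   degree may be of order t, and the duality argument controls the energy only up to the largest
   degree. A potential at one scale therefore costs O(t) and is not small by itself; the divergence
   of the sum of 1/t is just enough for the average over scales to win. All estimates are made on
   weighted triangulations of fixed perimeter with a free number of inner vertices, where removing
   the root edge gives a closed recursion. The weight depends only on the perimeter and on the
   number of inner vertices, so a bound on the weighted mass yields, by pigeonhole, arbitrarily
   large numbers of inner vertices for which the uniform law obeys the same bound up to a constant.
   Re-rooting is injective and preserves the weight; it stands for the invariance of the law along
   the boundary and turns a statement on most boundary vertices into one on the root. For a given
   perimeter there are infinitely many codes, and a mass is handled only through its finite partial
   sums. *)
From HB Require structures.
From mathcomp Require all_boot all_order all_algebra all_fingroup finmap zify ring lra.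
From mathcomp Require boolp classical_sets reals all_classical all_reals all_analysis.
Require Defs.
Set Implicit Arguments.
Unset Strict Implicit.
Unset Printing Implicit Defensive.

(** * Codes of triangulations, their weights and partition functions *)

Module Codes.
Import structures.
Import all_boot all_order all_algebra.
Import zify ring lra.
Import Order.TTheory GRing.Theory Num.Theory.
Local Open Scope ring_scope.

(* A triangulation of a polygon is a single edge, seen as a 2-gon ([CE]), or removing its
   root edge leaves a triangulation, if the third corner of the root triangle is an inner
   vertex ([CI]), or two triangulations glued at this corner, if it is on the boundary
   ([CS]). The boundary of the map coded by [c] has [(per c).+1] edges. *)
Inductive code := CE | CI of code | CS of code & code.

Lemma code_eq_dec : comparable code.
Proof. by rewrite /comparable /decidable; decide equality. Defined.
HB.instance Definition _ := hasDecEq.Build code (compareP code_eq_dec).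

Fixpoint per (c : code) : nat :=
  match c with CE => 1 | CI c => (per c).-1 | CS c1 c2 => per c1 + per c2 end.
Fixpoint wf (c : code) : bool :=
  match c with
  | CE => true
  | CI c => wf c && (1 < per c)%N
  | CS c1 c2 => wf c1 && wf c2
  end.
Fixpoint nin (c : code) : nat :=
  match c with CE => 0 | CI c => (nin c).+1 | CS c1 c2 => nin c1 + nin c2 end.
Fixpoint hgt (c : code) : nat :=
  match c with CE => 1 | CI c => (hgt c).+1 | CS c1 c2 => (maxn (hgt c1) (hgt c2)).+1 end.

Definition okc (P : nat) (c : code) := wf c && (per c == P).

Lemma per_gt0 c : wf c -> (0 < per c)%N.
Proof.
elim: c => //= [c IH /andP[/IH]|c1 IH1 c2 IH2 /andP[/IH1 h1 /IH2 h2]]; lia.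
Qed.

Lemma hgt_gt0 c : (0 < hgt c)%N. Proof. by case: c. Qed.

Lemma okc_CI P c : okc P (CI c) -> okc P.+1 c.
Proof. by rewrite /okc /= => /andP[/andP[-> h] /eqP <-] /=; rewrite prednK// (ltn_trans _ h). Qed.

Lemma okc_CIE P c : (0 < P)%N -> okc P.+1 c -> okc P (CI c).
Proof. by rewrite /okc /= => P0 /andP[-> /eqP ->] /=; rewrite eqxx ltnS P0. Qed.

Lemma okc_CS P c1 c2 : okc P (CS c1 c2) ->
  [/\ (0 < per c1 < P)%N, okc (per c1) c1 & okc (P - per c1) c2].
Proof.
rewrite /okc /= => /andP[/andP[w1 w2] /eqP <-].
have := per_gt0 w1; have := per_gt0 w2 => p2 p1.
by rewrite w1 w2 eqxx addKn eqxx; split => //; lia.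
Qed.

Section sums.
Variable R : realFieldType.
Implicit Types (P k n : nat) (c : code) (W : code -> R) (s : seq code).

(* [av k] is the total weight of the codes of size [k], i.e. [9 ^- k] times the
   critical partition function of the [k.+1]-gon. *)
Fixpoint av (k : nat) : R :=
  match k with
  | 0 => 0
  | k'.+1 => if k' is k''.+1 then av k' * ((2 * k' - 1)%:R / (2 * (k' + 2))%:R) else 8^-1
  end.

Arguments av : simpl never.

Lemma av0 : av 0 = 0. Proof. by []. Qed.

Lemma avS k : (0 < k)%N -> av k.+1 = av k * ((2 * k - 1)%:R / (2 * (k + 2))%:R).
Proof. by case: k. Qed.

Lemma av1 : av 1 = 8^-1. Proof. by []. Qed.
Lemma av2 : av 2 = 48^-1.
Proof. by rewrite avS// av1 /=; rewrite -[(2 * 1 - 1)%N]/1%N -[(2 * (1 + 2))%N]/6%N; field. Qed.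

Lemma avSn k : (0 < k)%N -> av k.+1 * (2 * (k%:R + 2)) = av k * (2 * k%:R - 1).
Proof.
move=> k0; rewrite avS//.
have -> : (2 * (k + 2))%:R = 2 * (k%:R + 2) :> R by rewrite natrM natrD.
have -> : (2 * k - 1)%:R = 2 * k%:R - 1 :> R by rewrite natrB ?natrM// muln_gt0.
by field; apply/eqP; have : 0 <= k%:R :> R by []; lra.
Qed.

Lemma av_gt0 k : (0 < k)%N -> 0 < av k.
Proof.
elim: k => // k IH _; case: k IH => [|k] IH; first by rewrite av1 invr_gt0.
rewrite avS// mulr_gt0 ?IH// divr_gt0// ltr0n; lia.
Qed.

Lemma av_ge0 k : 0 <= av k.
Proof. by case: k => // k; apply/ltW/av_gt0. Qed.

Definition conv (f g : nat -> R) P := \sum_(k < P.+1) f k * g (P - k)%N.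

Lemma convC f g P : conv f g P = conv g f P.
Proof.
rewrite /conv (reindex_inj rev_ord_inj) /=; apply: eq_bigr => k _.
by rewrite mulrC subSS subKn// -ltnS.
Qed.

Lemma conv_int f g P : f 0%N = 0 -> g 0%N = 0 ->
  conv f g P = \sum_(1 <= k < P) f k * g (P - k)%N.
Proof.
move=> f0 g0; rewrite /conv -(big_mkord xpredT (fun k => f k * g (P - k)%N)).
rewrite big_nat_recl// f0 mul0r add0r.
case: P => [|P]; first by rewrite !big_geq.
by rewrite big_nat_recr//= subnn g0 mulr0 addr0 big_add1.
Qed.

Let id_av (k : nat) : R := k%:R * av k.

Lemma conv_id P : 2 * conv id_av av P = P%:R * conv av av P.
Proof.
rewrite mulr2n mulrDl mul1r {1}convC /conv -big_split/= mulr_sumr.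
apply: eq_bigr => k _; rewrite /id_av mulrCA -mulrA -mulrDl -natrD subnK ?mulrA//.
by rewrite -ltnS.
Qed.

(** By [avSn], the terms (2 k + 4) av (k + 1) av (P - k) of the convolution at P + 1 are the terms
    (2 k - 1) av k av (P - k) of the one at P. By the symmetry used in [conv_id], the factor k may
    be replaced by half of the total index, so both sides become multiples of the plain
    convolution. *)
Lemma conv_av_rec P : (0 < P)%N ->
  (P%:R + 3) * conv av av P.+1 = (P%:R - 1) * conv av av P + av P / 2.
Proof.
move=> P0.
have E : 2 * conv id_av av P.+1 + 2 * conv av av P.+1 = av P / 2 + (P%:R - 1) * conv av av P.
  have -> : (P%:R - 1) * conv av av P =
     \sum_(k < P) (2 * k.+1%:R - 1) * av k.+1 * av (P - k.+1)%N.
    have -> : (P%:R - 1) * conv av av P = 2 * conv id_av av P - conv av av P.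
      by rewrite conv_id mulrBl mul1r.
    rewrite /conv mulr_sumr -sumrB big_ord_recl/= /id_av av0 !(mul0r, mulr0) subr0 add0r.
    by apply: eq_bigr => k _; rewrite /bump /= add1n; ring.
  rewrite /conv !mulr_sumr -big_split/= 2!big_ord_recl/=.
  rewrite /bump /= add1n subn1 /= /id_av av0 !(mul0r, mulr0) !add0r.
  congr (_ + _); first by rewrite av1; field.
  apply: eq_bigr => k _; rewrite /bump /= !add1n subSS.
  have := @avSn k.+1 isT; set A := av k.+2; set B := av k.+1; set C := av _ => h.
  have -> : (2 * k.+1%:R - 1) * B = A * (2 * (k.+1%:R + 2)) by rewrite h mulrC.
  by rewrite -!(natr1 k.+1); ring.
rewrite conv_id in E; rewrite -natr1 in E.
by rewrite [RHS]addrC -E; ring.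
Qed.

(** This is Tutte's quadratic equation for P > 1: the closed form is checked against the linear
    recursion [conv_av_rec]. At P = 1 the convolution is empty and the right-hand side is 1/9, the
    weight of [CE], which is how [av_rec] covers that case. *)
Lemma conv_av P : (1 < P)%N -> conv av av P = av P - 2 / 3 * av P.+1.
Proof.
case: P => // P; rewrite ltnS; elim: P => // P IH _.
have [->|P0] := posnP P.
  by rewrite conv_int// big_nat1 -[(2 - 1)%N]/1%N (@avS 2)// av2 av1 -[(2 * 2 - 1)%N]/3%N -[(2 * (2 + 2))%N]/8%N; field.
have := conv_av_rec (ltn0Sn P); rewrite (IH P0) => E.
have h1 := @avSn P.+1 isT; have h2 := @avSn P.+2 isT.
have p3 : P.+1%:R + 3 != 0 :> R by rewrite -natr1; apply/eqP; have : 0 <= P%:R :> R by []; lra.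
apply: (mulfI p3); rewrite E; move: h1 h2.
rewrite -!(natr1 P.+1) -!(natr1 P).
set x := P%:R; set A := av P.+1; set B := av P.+2; set C := av P.+3.
move=> h1 h2.
have -> : (x + 1 + 3) * (B - 2 / 3 * C) =
  (x + 4) * B - 3^-1 * (C * (2 * (x + 1 + 1 + 2))) by field.
rewrite h2.
have -> : (x + 1 - 1) * (A - 2 / 3 * B) + A / 2 = 2^-1 * (A * (2 * (x + 1) - 1)) - 2 / 3 * x * B by field.
by rewrite -h1; field.
Qed.

(** Same shift of index as in [conv_av_rec], with one more factor k. This second moment enters the
    off-critical solution and the counts of nodes and of inner vertices. *)
Lemma conv_idid P : (1 < P)%N ->
  conv id_av id_av P = 2 / 3 * (P%:R + 1) * av P.+1.
Proof.
case: P => // P; rewrite ltnS; elim: P => // P IH _.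
have [->|P0] := posnP P.
  by rewrite conv_int /id_av ?mul0r// big_nat1 -[(2 - 1)%N]/1%N (@avS 2)// av2 av1 -[(2 * 2 - 1)%N]/3%N -[(2 * (2 + 2))%N]/8%N; field.
have E : 2 * conv id_av id_av P.+2 + 2 * conv av id_av P.+2 = P.+1%:R * av P.+1 / 2 +
     2 * conv id_av id_av P.+1 - conv av id_av P.+1.
  rewrite -addrA; have -> : 2 * conv id_av id_av P.+1 - conv av id_av P.+1 =
     \sum_(k < P.+1) (2 * k.+1%:R - 1) * av k.+1 * id_av (P.+1 - k.+1)%N.
    rewrite /conv mulr_sumr -sumrB big_ord_recl/= /id_av av0 !(mul0r, mulr0) subr0 add0r.
    by apply: eq_bigr => k _; rewrite /bump /= add1n; ring.
  rewrite /conv !mulr_sumr -big_split/= 2!big_ord_recl/=.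
  rewrite /bump /= add1n subn1 /= /id_av av0 !(mul0r, mulr0) !add0r.
  congr (_ + _); first by rewrite av1; field.
  apply: eq_bigr => k _; rewrite /bump /= !add1n subSS.
  have := @avSn k.+1 isT; set A := av k.+2; set B := av k.+1; set C := av _; set D := (_ - _)%:R => h.
  have -> : (2 * k.+1%:R - 1) * B = A * (2 * (k.+1%:R + 2)) by rewrite h mulrC.
  by rewrite -!(natr1 k.+1); ring.
have two0 : 2 != 0 :> R by rewrite pnatr_eq0.
have e1 : conv av id_av P.+2 = P.+2%:R / 2 * conv av av P.+2.
  by apply: (mulfI two0); rewrite convC conv_id; field.
have e2 : conv av id_av P.+1 = P.+1%:R / 2 * conv av av P.+1.
  by apply: (mulfI two0); rewrite convC conv_id; field.
move: E; rewrite e1 e2 IH// !conv_av// => E.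
have h1 := @avSn P.+1 isT; have h2 := @avSn P.+2 isT.
apply: (mulfI two0); apply: (addIr (2 * (P.+2%:R / 2 * (av P.+2 - 2 / 3 * av P.+3)))).
rewrite E; move: h1 h2.
rewrite -!(natr1 P.+1) -!(natr1 P).
set x := P%:R; set A := av P.+1; set B := av P.+2; set C := av P.+3.
move=> h1 h2.
have x0 : 0 <= x by exact: ler0n.
have n0 : 2 * x + 1 != 0 by rewrite gt_eqF//; lra.
have n1 : 2 * (x + 1 + 1 + 2) != 0 by rewrite gt_eqF//; lra.
have hA : A = 2 * (x + 1 + 2) * B / (2 * x + 1).
  apply: (mulIf n0); rewrite divfK//.
  have -> : 2 * x + 1 = 2 * (x + 1) - 1 by ring.
  by rewrite -h1; ring.
have hC : C = B * (2 * (x + 1 + 1) - 1) / (2 * (x + 1 + 1 + 2)).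
  by rewrite -h2 mulfK.
rewrite hA hC; field; rewrite n0 /= gt_eqF//; lra.
Qed.

Lemma av_rec P : (0 < P)%N ->
  av P = (P == 1%N)%:R / 9 + 2 / 3 * av P.+1 + conv av av P.
Proof.
move=> P0; have [->|P1] := eqVneq P 1%N.
  by rewrite conv_int// big_geq// av2 av1 -[(true)%:R]/(1 : R); field.
by rewrite conv_av ?mul0r ?add0r; [ring|lia].
Qed.

(** Stands for the infinite sum of [W] over all codes of size P being at most x. For a nonnegative
    [W] the least such x is the total mass. *)
Definition sb W P (x : R) := forall s, uniq s -> all (okc P) s -> \sum_(c <- s) W c <= x.
Definition sb2 (W : code -> code -> R) P1 P2 (x : R) := forall s : seq (code * code),
  uniq s -> all (fun p => okc P1 p.1 && okc P2 p.2) s -> \sum_(p <- s) W p.1 p.2 <= x.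

Lemma sb_ge0 W P x : sb W P x -> 0 <= x.
Proof. by move=> /(_ [::]); rewrite big_nil; apply. Qed.

Lemma sb_le W W' P x x' : (forall c, okc P c -> W c <= W' c) -> x' <= x ->
  sb W' P x' -> sb W P x.
Proof.
move=> WW xx h s us os; apply: le_trans xx; apply: le_trans (h s us os).
by rewrite big_seq [leRHS]big_seq ler_sum// => c /(allP os); apply: WW.
Qed.

Lemma sbD W W' P x x' : sb W P x -> sb W' P x' -> sb (fun c => W c + W' c) P (x + x').
Proof. by move=> h h' s us os; rewrite big_split lerD ?h ?h'. Qed.

Lemma sbZ W P x a : 0 <= a -> sb W P x -> sb (fun c => a * W c) P (a * x).
Proof. by move=> a0 h s us os; rewrite -mulr_sumr ler_wpM2l// h. Qed.

Lemma sb_sum (I : Type) (r : seq I) (W : I -> code -> R) P (x : I -> R) :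
  (forall i, sb (W i) P (x i)) -> sb (fun c => \sum_(i <- r) W i c) P (\sum_(i <- r) x i).
Proof. by move=> h s us os; rewrite exchange_big ler_sum// => i _; apply: h. Qed.

Lemma sum_undup (T U : eqType) (s : seq T) (f : T -> U) (F : T -> R) :
  \sum_(p <- s) F p = \sum_(c <- undup (map f s)) \sum_(p <- s | f p == c) F p.
Proof.
rewrite (exchange_big_dep xpredT)//= big_seq [RHS]big_seq; apply: eq_bigr => p ps.
rewrite big_mkcond (bigD1_seq (f p)) ?undup_uniq//=; last by rewrite mem_undup map_f.
by rewrite eqxx big1 ?addr0// => c /negbTE; rewrite eq_sym => ->.
Qed.

(** Fubini for finite families: pairs are grouped by first component, and the nonnegativity of [W1]
    lets the bound on [W2] be applied inside each group. *)
Lemma sb2_mul W1 W2 P1 P2 x1 x2 : (forall c, okc P1 c -> 0 <= W1 c) ->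
  sb W1 P1 x1 -> sb W2 P2 x2 -> sb2 (fun c1 c2 => W1 c1 * W2 c2) P1 P2 (x1 * x2).
Proof.
move=> W10 h1 h2 s us os; rewrite (sum_undup _ fst).
have oU : all (okc P1) (undup (map fst s)).
  by apply/allP => c; rewrite mem_undup => /mapP[p ps ->]; have /andP[] := allP os _ ps.
apply: le_trans (_ : \sum_(c <- undup (map fst s)) W1 c * x2 <= _).
  rewrite big_seq [leRHS]big_seq ler_sum// => c cU.
  rewrite (eq_bigr (fun p => W1 c * W2 p.2)); last by move=> p /eqP ->.
  rewrite -mulr_sumr ler_wpM2l ?W10//; first exact: allP oU _ cU.
  rewrite -big_filter -(big_map snd xpredT); apply: h2.
    rewrite map_inj_in_uniq ?filter_uniq// => -[a b] [a' b'] /=.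
    by rewrite !mem_filter /= => /andP[/eqP -> _] /andP[/eqP -> _] ->.
  apply/allP => d /mapP[p]; rewrite mem_filter => /andP[_ ps] ->.
  by have /andP[] := allP os _ ps.
rewrite -mulr_suml ler_wpM2r//; first exact: sb_ge0 h2.
by apply: h1; rewrite ?undup_uniq.
Qed.

Definition isE c := if c is CE then true else false.
Definition getI c := if c is CI c then Some c else None.
Definition getS c := if c is CS c1 c2 then Some (c1, c2) else None.

Lemma sum_cases s W : \sum_(c <- s) W c = \sum_(c <- s | isE c) W c +
  \sum_(c <- pmap getI s) W (CI c) + \sum_(p <- pmap getS s) W (CS p.1 p.2).
Proof.
elim: s => [|c s IH]; first by rewrite !big_nil !addr0.
case: c => [|c|c1 c2] /=; rewrite !big_cons IH /=; ring.
Qed.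

Lemma sb_step W P (e x1 : R) (y : nat -> R) : (0 < P)%N -> 0 <= e ->
  (P = 1%N -> W CE <= e) -> sb (W \o CI) P.+1 x1 ->
  (forall k, (0 < k < P)%N -> sb2 (fun c1 c2 => W (CS c1 c2)) k (P - k) (y k)) ->
  sb W P ((P == 1%N)%:R * e + x1 + \sum_(1 <= k < P) y k).
Proof.
move=> P0 e0 hE hI hS s us os; rewrite sum_cases lerD ?lerD//.
- have [sE|sE] := boolP (CE \in s); last first.
    rewrite big_seq_cond big_pred0 ?mulr_ge0// => c.
    by case: c => [|c|c1 c2]; rewrite ?andbF// (negbTE sE).
  have /eqP P1 : 1%N == P by have := allP os _ sE.
  rewrite -P1 eqxx mul1r big_mkcond (bigD1_seq CE)//= big1 ?addr0 ?hE//.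
  by case=> //=; rewrite eqxx.
- apply: hI.
    by rewrite (pmap_uniq (g := CI)) => // -[].
  apply/allP => c; rewrite mem_pmap => /mapP[[|d|] //= /(allP os) ds [->]].
  exact: okc_CI.
- have uS : uniq (pmap getS s) by rewrite (pmap_uniq (g := fun p => CS p.1 p.2)) => // -[].
  have oS p : p \in pmap getS s -> okc P (CS p.1 p.2).
    by rewrite mem_pmap => /mapP[[|d|d1 d2] //= /(allP os) ds [->]].
  have -> : \sum_(p <- pmap getS s) W (CS p.1 p.2) =
      \sum_(1 <= k < P) \sum_(p <- [seq p <- pmap getS s | per p.1 == k]) W (CS p.1 p.2).
    under [RHS]eq_bigr do rewrite big_filter.
    rewrite (exchange_big_dep xpredT)//= big_seq [RHS]big_seq; apply: eq_bigr => p /oS /okc_CS[pP _ _].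
    rewrite big_mkcond (bigD1_seq (per p.1)) ?iota_uniq//=; last by rewrite mem_index_iota.
    by rewrite eqxx big1 ?addr0// => c /negbTE; rewrite eq_sym => ->.
  rewrite big_nat [leRHS]big_nat ler_sum// => k kP; apply: hS => //.
    exact: filter_uniq.
  apply/allP => p; rewrite mem_filter => /andP[/eqP <- /oS /okc_CS[_ -> ->]] //.
Qed.

(** In the [CI] case removing the root edge raises the size, so no induction on P is available.
    Truncation by the height supplies the induction, and a finite family has bounded height. *)
Lemma sb_hgt W P x : (forall c, okc P c -> 0 <= W c) ->
  (forall d, sb (fun c => (hgt c <= d)%:R * W c) P x) -> sb W P x.
Proof.
move=> W0 h s us os; apply: le_trans (h (\sum_(c <- s) hgt c)%N s us os).
rewrite big_seq [leRHS]big_seq ler_sum// => c cs.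
by rewrite (big_rem c cs)/= leq_addr mul1r.
Qed.

(** A well-formed code with p = [per c] and n = [nin c] has p + n leaves, so [wt 1 c] equals 9^(-p)
    (2/27)^n: the factor 2/27 per inner vertex is the critical one for loopless triangulations. The
    parameter x tilts this law by the number of inner vertices. *)
Fixpoint wt (x : R) c : R :=
  match c with
  | CE => 9^-1
  | CI c => 2 / 3 * x * wt x c
  | CS c1 c2 => wt x c1 * wt x c2
  end.

Lemma wt_ge0 (x : R) c : 0 <= x -> 0 <= wt x c.
Proof.
move=> x0; elim: c => /= [|c h|c1 h1 c2 h2]; rewrite ?invr_ge0 ?mulr_ge0 ?invr_ge0//.
Qed.

Lemma wtE (x : R) c : wt x c = x ^+ nin c * wt 1 c.
Proof.
elim: c => /= [|c ->|c1 -> c2 ->]; first by rewrite mul1r.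
  by rewrite exprS; ring.
by rewrite exprD; ring.
Qed.

(* A solution of the linearised recursion bounds the total weight. *)
Lemma sb_wt (x : R) (b : nat -> R) : 0 <= x -> (forall P, 0 <= b P) ->
  (forall P, (0 < P)%N -> (P == 1%N)%:R / 9 + 2 / 3 * x * b P.+1 +
     \sum_(1 <= k < P) b k * b (P - k)%N <= b P) ->
  forall P, (0 < P)%N -> sb (wt x) P (b P).
Proof.
move=> x0 b0 hb P P0; apply: sb_hgt => [c _|d]; first exact: wt_ge0.
have ge0 d' c : 0 <= (hgt c <= d')%:R * wt x c by rewrite mulr_ge0 ?wt_ge0.
elim: d P P0 => [|d IH] P P0.
  move=> s _ _; rewrite big1// => c _.
  by rewrite leqn0 (gtn_eqF (hgt_gt0 c)) mul0r.
apply: (sb_le (W' := fun c => (hgt c <= d.+1)%:R * wt x c) _ (hb P P0)) => //.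
apply: sb_step => //.
- by rewrite invr_ge0.
- by move=> _ /=; rewrite mul1r.
- apply: sb_le (lexx _) (sbZ (mulr_ge0 _ x0) (IH P.+1 isT)) => //=.
    by move=> c _; rewrite ltnS mulrCA.
  by rewrite mulr_ge0 ?invr_ge0.
- move=> k /andP[k0 kP].
  move=> s us os; apply: le_trans (sb2_mul (fun c _ => ge0 d c) (IH k k0) (IH (P - k)%N _) us os); last by rewrite subn_gt0.
  apply: ler_sum => p _ /=; rewrite ltnS geq_max.
  by case: leqP => _; case: leqP => _; rewrite ?mul0r ?mulr0 ?mul1r//= mulr_ge0 ?wt_ge0.
Qed.

Lemma conv_av_int P : conv av av P = \sum_(1 <= k < P) av k * av (P - k)%N.
Proof. by rewrite conv_int. Qed.

Lemma mass_le P : (0 < P)%N -> sb (wt 1) P (av P).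
Proof.
apply: sb_wt => // [k|{}P P0]; first exact: av_ge0.
by rewrite mulr1 -conv_av_int -av_rec.
Qed.

(* The total number of nodes, resp. of internal vertices, weighted by [wt 1]. *)
Definition nodesum (P : nat) : R := av P * ((2 * P%:R - 1) * (P%:R + 1)).
Definition ninsum (P : nat) : R := av P * (P%:R * (2 * P%:R - 1) / 3).

Lemma conv_sqr P : 2 * conv (fun k => k%:R ^+ 2 * av k) av P =
  P%:R ^+ 2 * conv av av P - 2 * conv id_av id_av P.
Proof.
rewrite mulr2n mulrDl mul1r {1}convC /conv -big_split/= !mulr_sumr -sumrB.
apply: eq_bigr => k _; rewrite /id_av.
have {1}-> : P%:R = k%:R + (P - k)%:R :> R by rewrite -natrD subnKC// -ltnS.
ring.
Qed.

Lemma nodesum_rec P : (0 < P)%N ->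
  av P + 2 / 3 * nodesum P.+1 + 2 * conv nodesum av P = nodesum P.
Proof.
move=> P0; have -> : 2 * conv nodesum av P =
    2 * (2 * conv (fun k => k%:R ^+ 2 * av k) av P) + 2 * conv id_av av P - 2 * conv av av P.
  rewrite /conv !mulr_sumr -big_split -sumrB/=; apply: eq_bigr => k _.
  by rewrite /nodesum /id_av; ring.
rewrite conv_sqr conv_id /nodesum; have [->|P1] := eqVneq P 1%N.
  by rewrite !conv_int /id_av ?mul0r// !big_geq// av2 av1; field.
by rewrite conv_av ?conv_idid -?natr1; [field|lia..].
Qed.

Lemma ninsum_rec P : (0 < P)%N ->
  2 / 3 * (ninsum P.+1 + av P.+1) + 2 * conv ninsum av P = ninsum P.
Proof.
move=> P0; have -> : 2 * conv ninsum av P =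
    2 / 3 * (2 * conv (fun k => k%:R ^+ 2 * av k) av P) - 3^-1 * (2 * conv id_av av P).
  rewrite /conv !mulr_sumr -sumrB/=; apply: eq_bigr => k _.
  by rewrite /ninsum /id_av; field.
rewrite conv_sqr conv_id /ninsum; have [->|P1] := eqVneq P 1%N.
  by rewrite !conv_int /id_av ?mul0r// !big_geq// av2 av1; field.
by rewrite conv_av ?conv_idid -?natr1; [field|lia..].
Qed.

Lemma nodesum_ge0 P : 0 <= nodesum P.
Proof.
case: P => [|P]; first by rewrite /nodesum av0 mul0r.
rewrite /nodesum mulr_ge0 ?av_ge0// mulr_ge0//; last by rewrite addr_ge0.
by rewrite -natr1; have := ler0n R P; lra.
Qed.

Lemma ninsum_ge0 P : 0 <= ninsum P.
Proof.
case: P => [|P]; first by rewrite /ninsum av0 mul0r.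
rewrite /ninsum mulr_ge0 ?av_ge0// divr_ge0// mulr_ge0// -natr1.
by have := ler0n R P; lra.
Qed.

Lemma ninsum_le P : ninsum P <= av P * P%:R ^+ 2.
Proof. by rewrite ler_wpM2l ?av_ge0//; have := ler0n R P; nra. Qed.

Lemma conv_twice (f g : nat -> R) P : f 0%N = 0 -> g 0%N = 0 ->
  2 * conv f g P = \sum_(1 <= k < P) (f k * g (P - k)%N + g k * f (P - k)%N).
Proof. by move=> f0 g0; rewrite big_split/= -!conv_int// (convC g) mulr2n mulrDl mul1r. Qed.

(** [F] grows by at most [G] at each [CI] node and is subadditive at [CS] nodes. Every inner vertex
    thus contributes g on average, and [ninsum] solves the resulting linear recursion, with [av] as
    its source. *)
Lemma sb_lin (F G : code -> R) (g : R) : (forall c, 0 <= F c) -> (forall c, 0 <= G c) -> 0 <= g ->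
  F CE = 0 -> (forall c, wf c -> F (CI c) <= F c + G c) ->
  (forall c1 c2, wf c1 -> wf c2 -> F (CS c1 c2) <= F c1 + F c2) ->
  (forall P, (0 < P)%N -> sb (fun c => wt 1 c * G c) P (g * av P)) ->
  forall P, (0 < P)%N -> sb (fun c => wt 1 c * F c) P (g * ninsum P).
Proof.
move=> F0 G0 g0 FE FI FS hG P P0.
have w0 c : 0 <= wt 1 c by exact: wt_ge0.
have wF0 c : 0 <= wt 1 c * F c by rewrite mulr_ge0.
have n0 : ninsum 0 = 0 by rewrite /ninsum av0 mul0r.
apply: sb_hgt => // d; elim: d P P0 => [|d IH] P P0.
  move=> s _ _; rewrite big1 => [|c _]; first by apply: mulr_ge0 => //; exact: ninsum_ge0.
  by rewrite leqn0 (gtn_eqF (hgt_gt0 c)) mul0r.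
have ge0 c : 0 <= (hgt c <= d)%:R * (wt 1 c * F c) by rewrite mulr_ge0.
apply: (sb_le (W' := fun c => (hgt c <= d.+1)%:R * (wt 1 c * F c))
  (x' := (P == 1%N)%:R * 0 + (2 / 3 * (g * ninsum P.+1 + g * av P.+1)) +
    \sum_(1 <= k < P) (g * ninsum k * av (P - k)%N + av k * (g * ninsum (P - k)%N)))) => //.
  have -> : g * ninsum P = 2 / 3 * (g * ninsum P.+1 + g * av P.+1) + g * (2 * conv ninsum av P).
    by rewrite -[ninsum P]ninsum_rec//; ring.
  rewrite mulr0 add0r lerD2l conv_twice// mulr_sumr ler_sum// => k _.
  by rewrite mulrDr !mulrA (mulrC g (av k)).
apply: sb_step => //.
- by rewrite FE mulr0 mulr0.
- apply: sb_le (lexx _) (sbZ _ (sbD (IH P.+1 isT) (hG P.+1 isT))); last by rewrite divr_ge0.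
  move=> c /andP[wc _] /=; rewrite mulr1 ltnS.
  case: (leqP (hgt c)) => _; rewrite ?mul1r ?mul0r ?add0r; last by rewrite !mulr_ge0 ?invr_ge0.
  by have := ler_wpM2l (w0 c) (FI c wc); lra.
- move=> k /andP[k0 kP] s us os.
  have kP' : (0 < P - k)%N by rewrite subn_gt0.
  have h1 := sb2_mul (fun c _ => ge0 c) (IH k k0) (mass_le kP') us os.
  have h2 := sb2_mul (fun c _ => w0 c) (mass_le k0) (IH (P - k)%N kP') us os.
  apply: le_trans (lerD h1 h2); rewrite -big_split/= big_seq [leRHS]big_seq ler_sum// => -[c1 c2] /(allP os).
  move=> /= /andP[/andP[w1 _] /andP[w2 _]]; rewrite ltnS geq_max.
  case: (leqP (hgt c1)) => h1'; case: (leqP (hgt c2)) => h2'; rewrite /= ?mul0r ?mul1r ?mulr0 ?addr0 ?add0r.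
  + by have := ler_wpM2l (mulr_ge0 (w0 c1) (w0 c2)) (FS _ _ w1 w2); lra.
  + by rewrite mulr_ge0.
  + by rewrite mulr_ge0.
  + by [].
Qed.

Lemma sb_nin P : (0 < P)%N -> sb (fun c => wt 1 c * (nin c)%:R) P (ninsum P).
Proof.
move=> P0; rewrite -[ninsum P]mul1r.
apply: (@sb_lin _ (fun=> 1)) => //= [c _|c1 c2 _ _|k k0].
- by rewrite natr1.
- by rewrite natrD.
- by rewrite mul1r; apply: sb_le (lexx _) (mass_le k0) => // c _; rewrite mulr1.
Qed.

Fixpoint codesd (d P : nat) : seq code :=
  if d is d'.+1 then (if P == 1%N then [:: CE] else [::]) ++ map CI (codesd d' P.+1) ++
    [seq CS p.1 p.2 | k <- iota 1 P.-1, p <- allpairs pair (codesd d' k) (codesd d' (P - k)%N)]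
  else [::].

Lemma codesd_ok d P c : (0 < P)%N -> c \in codesd d P -> okc P c.
Proof.
elim: d P c => // d IH P c P0 /=; rewrite !mem_cat => /or3P[].
- by case: eqP => // ->; rewrite inE => /eqP ->.
- by move=> /mapP[c' /(IH _ _ (ltn0Sn _)) h ->]; exact: okc_CIE.
- move=> /allpairsPdep[k [p [kP /allpairsP[[c1 c2] [/= h1 h2 ->]] ->]]] /=.
  move: kP; rewrite mem_iota => /andP[k0 kP].
  have kP' : (k < P)%N by move: kP; rewrite add1n prednK.
  have /andP[w1 /eqP p1] := IH _ _ k0 h1.
  have := IH _ _ _ h2; rewrite subn_gt0 => /(_ kP')/andP[w2 /eqP p2].
  by rewrite /okc /= w1 w2 p1 p2 subnKC ?eqxx// ltnW.
Qed.

Lemma codesd_uniq d P : (0 < P)%N -> uniq (codesd d P).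
Proof.
elim: d P => // d IH P P0 /=; rewrite !cat_uniq; apply/and3P; split.
- by case: eqP.
- apply/hasPn => c; rewrite mem_cat => /orP[/mapP[c' _ ->]|/allpairsPdep[? [? [_ _ ->]]]].
    by case: (P == 1%N); rewrite /= ?inE.
  by case: (P == 1%N); rewrite /= ?inE.
- rewrite map_inj_uniq ?IH//=; last by move=> ? ? [].
  apply/andP; split.
    by apply/hasPn => c /allpairsPdep[k [p [_ _ ->]]]; apply/mapP => -[].
  have kP k : k \in iota 1 P.-1 -> (0 < k < P)%N.
    by rewrite mem_iota add1n prednK.
  rewrite allpairs_uniq_dep ?iota_uniq// => [k /kP /andP[k0 kP']|].
    by rewrite allpairs_uniq ?IH ?subn_gt0// => -[? ?] [].
  move=> _ _ /allpairsPdep[k [p [/kP/andP[k0 _] hp ->]]] /allpairsPdep[k' [p' [/kP/andP[k0' _] hp' ->]]] /=.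
  case/allpairsP: hp => -[c1 c2] [/= h1 _ ->]; case/allpairsP: hp' => -[c1' c2'] [/= h1' _ ->] /= [e1 e2].
  rewrite e1 e2; congr existT.
  have /andP[_ /eqP <-] := codesd_ok k0 h1; have /andP[_ /eqP <-] := codesd_ok k0' h1'.
  by rewrite e1.
Qed.

Let ms d P := \sum_(c <- codesd d P) wt 1 c.

Let ms_rec d P : (0 < P)%N -> ms d.+1 P = (P == 1%N)%:R / 9 + 2 / 3 * ms d P.+1 +
  \sum_(1 <= k < P) ms d k * ms d (P - k)%N.
Proof.
move=> P0; rewrite /ms /= !big_cat/= addrA; congr (_ + _ + _).
- by case: eqP => _; rewrite ?big_seq1 ?big_nil ?mul0r ?mul1r.
- by rewrite big_map mulr_sumr; apply: eq_bigr => c _ /=; rewrite mulr1.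
- rewrite big_allpairs_dep/= /index_iota subn1; apply: eq_bigr => k _.
  by rewrite big_allpairs/= mulr_suml; apply: eq_bigr => c _; rewrite mulr_sumr.
Qed.

(** [sb] provides upper bounds only; this is the matching lower bound. The mass r d of the codes
    higher than d has, summed over d, the size of a mean height, which is at most the mean number of
    nodes [nodesum]. So one of the first n + 1 values of r is at most [nodesum] divided by n + 1. *)
Lemma mass_ge P n : (0 < P)%N -> exists s, [/\ uniq s, all (okc P) s &
  av P - nodesum P / n.+1%:R <= \sum_(c <- s) wt 1 c].
Proof.
move=> P0; pose r d k := av k - ms d k.
have ms0 d k : 0 <= ms d k by apply: sumr_ge0 => c _; exact: wt_ge0.
have r0 d k : (0 < k)%N -> 0 <= r d k.
  move=> k0; rewrite subr_ge0; apply: mass_le => //; first exact: codesd_uniq.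
  by apply/allP => c; exact: codesd_ok.
(* The quadratic term is linearised: the full product exceeds the truncated one by at most one
   defect on either side, as in the recursion [nodesum_rec]. *)
have T d k : (0 < k)%N -> r d.+1 k <= 2 / 3 * r d k.+1 +
    \sum_(1 <= i < k) (r d i * av (k - i)%N + av i * r d (k - i)%N).
  move=> k0; have -> : r d.+1 k = 2 / 3 * r d k.+1 + (\sum_(1 <= i < k) av i * av (k - i)%N -
      \sum_(1 <= i < k) ms d i * ms d (k - i)%N).
    by rewrite /r ms_rec// (av_rec k0) conv_av_int; ring.
  rewrite lerD2l -sumrB.
  rewrite big_nat [leRHS]big_nat ler_sum// => i /andP[i0 ik].
  have h1 := r0 d i i0; have := r0 d (k - i)%N; rewrite subn_gt0 => /(_ ik) h2.
  move: h1 h2; rewrite /r; have := ms0 d i; have := ms0 d (k - i)%N; nra.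
have S d k : (0 < k)%N -> \sum_(i < d) r i k <= nodesum k.
  elim: d k => [|d IH] k k0; first by rewrite big_ord0 nodesum_ge0.
  have r00 : r 0%N k <= av k by rewrite /r gerBl.
  rewrite big_ord_recl -nodesum_rec// -[leRHS]addrA; apply: lerD r00 _.
  apply: (@le_trans _ _ (\sum_(i < d) (2 / 3 * r i k.+1 +
    \sum_(1 <= j < k) (r i j * av (k - j)%N + av j * r i (k - j)%N)))).
    by apply: ler_sum => i _; exact: T.
  rewrite big_split/= -mulr_sumr lerD ?ler_wpM2l ?divr_ge0 ?IH//.
  rewrite conv_twice; [|by rewrite /nodesum av0 mul0r|by []].
  rewrite exchange_big/= big_nat [leRHS]big_nat ler_sum// => i /andP[i0 ik].
  rewrite big_split/= -mulr_suml -mulr_sumr lerD//.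
    by rewrite ler_wpM2r ?av_ge0 ?IH.
  by rewrite ler_wpM2l ?av_ge0 ?IH// subn_gt0.
have [d rd] : exists d, r d P <= nodesum P / n.+1%:R.
  have [/existsP[i h]|/existsPn h] := boolP [exists i : 'I_n.+1, r i P <= nodesum P / n.+1%:R].
    by exists i.
  have := S n.+1 P P0; rewrite leNgt => /negP[].
  rewrite -[ltLHS](@divfK _ n.+1%:R) ?pnatr_eq0// mulr_natr -[X in _ *+ X](card_ord n.+1) -sumr_const.
  apply: ltr_sum => [|i _]; last by rewrite ltNge h.
  by apply/hasP; exists ord0 => //; rewrite mem_index_enum.
exists (codesd d P); split; first exact: codesd_uniq.
  by apply/allP => c; exact: codesd_ok.
by rewrite lerBlDr -lerBlDl.
Qed.

End sums.

(** * Off-critical weights: large perimeter forces many inner vertices *)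

Section off_critical.
Variable R : archiRealFieldType.
Implicit Types (h : R) (P : nat).

Lemma bernoulli (x : R) n : 0 <= x <= 1 -> 1 - n%:R * (1 - x) <= x ^+ n.
Proof.
move=> /andP[x0 x1]; elim: n => [|n IH]; first by rewrite mul0r subr0.
rewrite exprS -natr1; have := ler_wpM2l x0 IH; have := mulr_ge0 (ler0n R n) (sqr_ge0 (1 - x)); lra.
Qed.

Lemma bernoulli2 (h : R) n : 0 <= h ->
  1 + n%:R * h + n%:R * (n%:R - 1) / 2 * h ^+ 2 <= (1 + h) ^+ n.
Proof.
move=> h0; elim: n => [|n IH]; first by rewrite !mul0r !addr0.
have h1 : 0 <= 1 + h by lra.
rewrite [leRHS]exprS; apply: le_trans (ler_wpM2l h1 IH).
rewrite -natr1; set N := n%:R; rewrite -subr_ge0.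
have -> : (1 + h) * (1 + N * h + N * (N - 1) / 2 * h ^+ 2) -
  (1 + (N + 1) * h + (N + 1) * (N + 1 - 1) / 2 * h ^+ 2) = N * (N - 1) / 2 * h ^+ 3 by field.
have -> : N * (N - 1) = n%:R * (n.-1)%:R.
  by rewrite /N; case: n {IH N} => [|n]; rewrite ?mul0r//= -natr1 addrK.
by rewrite mulr_ge0 ?exprn_ge0// divr_ge0// mulr_ge0.
Qed.

(* Off-critical partition function: at [x = (1 - 6 h) (1 + 3 h) ^ 2] it decays
   like [(1 + 3 h) ^- (2 P)], while [1 - x] is only of order [h ^ 2]. *)
Lemma sb_off_critical h P : 0 <= h <= 6^-1 -> (0 < P)%N ->
  sb (wt ((1 - 6 * h) * (1 + 3 * h) ^+ 2)) P
     ((1 + 6 * h * P%:R) * ((1 + 3 * h) ^+ 2) ^- P * av R P).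
Proof.
move=> /andP[h0 h6] P0; set u := (1 + 3 * h) ^+ 2.
have u0 : 0 < u by rewrite exprn_gt0//; lra.
have un0 : u != 0 by rewrite gt_eqF.
have hP Q : 0 <= 1 + 6 * h * Q%:R by rewrite addr_ge0// !mulr_ge0.
apply: (@sb_wt _ _ (fun Q => (1 + 6 * h * Q%:R) * u ^- Q * av R Q)) => // [|Q|{P0}].
- by rewrite mulr_ge0 ?(ltW u0)//; lra.
- apply: mulr_ge0; last exact: av_ge0.
  by apply: mulr_ge0; [exact: hP|rewrite invr_ge0 exprn_ge0 ?(ltW u0)].
move=> {}P P0.
(* The product of 1 + 6 h k and 1 + 6 h (P - k) is 1 + 6 h P + 36 h^2 k (P - k), so exactly the two
   convolutions with closed forms appear. *)
have -> : \sum_(1 <= k < P) (1 + 6 * h * k%:R) * u ^- k * av R k *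
     ((1 + 6 * h * (P - k)%:R) * u ^- (P - k) * av R (P - k)) =
   u ^- P * ((1 + 6 * h * P%:R) * conv (av R) (av R) P + 36 * h ^+ 2 * conv (fun k => k%:R * av R k) (fun k => k%:R * av R k) P).
  rewrite !conv_int ?mul0r ?mul0rn// !mulr_sumr -big_split mulr_sumr/=.
  rewrite big_nat [RHS]big_nat; apply: eq_bigr => k /andP[k0 kP].
  have -> : u ^- P = u ^- k * u ^- (P - k) by rewrite -invfM -exprD subnKC// ltnW.
  have -> : P%:R = k%:R + (P - k)%:R :> R by rewrite -natrD subnKC// ltnW.
  ring.
have [->|P1] := eqVneq P 1%N.
  rewrite !conv_int ?mul0r// !big_geq// av2 av1 !expr1 expr2 invfM /u.
  rewrite le_eqVlt -[true%:R]/(1 : R); apply/orP; left; apply/eqP; field.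
  by rewrite gt_eqF//; lra.
rewrite conv_idid ?conv_av; [|lia..].
have E : u ^- P.+1 = u ^- P / u by rewrite exprS invfM mulrC.
rewrite E mul0r add0r le_eqVlt; apply/orP; left; apply/eqP; rewrite -natr1.
by field; rewrite expf_neq0.
Qed.

Lemma expn_split (x u e : R) m P :
  x ^- (m * P.+1) * (e / u ^+ P) = (x ^+ m)^-1 * e / (u * x ^+ m) ^+ P.
Proof. by rewrite mulnS exprD exprM exprMn !invfM; ring. Qed.

(** Exponential Chebyshev inequality: for x at most 1, the indicator that [nin c] is at most om (P +
    1) is bounded by x^(nin c) / x^(om (P + 1)). Since 1 - x is at most 81 h^2, the choice of h
    gives x^om at least 1 - h, whereas the off-critical mass gains a factor u of at least 1 + 6 h
    per unit of perimeter. The product is at least 1 + h, and its P-th power beats the linear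
    prefactor 1 + 6 h P. *)
Lemma nin_large (om : nat) (eps : R) : 0 < eps -> exists P0, forall P, (P0 <= P)%N ->
  sb (fun c => (nin c <= om * P.+1)%N%:R * wt 1 c) P (eps * av R P).
Proof.
move=> eps0; pose h : R := (81 * om%:R + 20)^-1.
have om0 := ler0n R om.
have d0 : 0 < 81 * om%:R + 20 :> R by lra.
have h0 : 0 < h by rewrite invr_gt0.
have hd : h * (81 * om%:R + 20) = 1 by rewrite mulVf// gt_eqF.
have omh0 : 0 <= om%:R * h by rewrite mulr_ge0// ltW.
have h6 : h <= 20^-1 by rewrite -[20^-1]mul1r ler_pdivlMr ?ltr0n//; lra.
pose u : R := (1 + 3 * h) ^+ 2; pose x : R := (1 - 6 * h) * u.
have hh : h ^+ 2 <= h / 20 by rewrite expr2; have := ler_wpM2l (ltW h0) h6; lra.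
have u1 : 1 + 6 * h <= u by rewrite /u; have := sqr_ge0 h; lra.
have omh : 81 * om%:R * h <= 1 by lra.
have xl : 1 - 81 * h ^+ 2 <= x.
  rewrite -subr_ge0; have -> : x - (1 - 81 * h ^+ 2) = 54 * h ^+ 2 * (1 - h) by rewrite /x /u; ring.
  by rewrite mulr_ge0// ?mulr_ge0 ?exprn_ge0 ?(ltW h0)//; lra.
have x1 : x <= 1.
  rewrite -subr_ge0; have -> : 1 - x = 27 * h ^+ 2 * (1 + 2 * h) by rewrite /x /u; ring.
  by rewrite mulr_ge0// ?mulr_ge0 ?exprn_ge0 ?(ltW h0)//; lra.
have x0 : 0 < x by apply: (lt_le_trans _ xl); lra.
have xom : 1 - h <= x ^+ om.
  apply: le_trans (bernoulli om _); last by rewrite x1 ltW.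
  have : om%:R * (1 - x) <= om%:R * (81 * h ^+ 2) by rewrite ler_wpM2l//; lra.
  have := ler_wpM2r (ltW h0) omh; lra.
have xom0 : 0 < x ^+ om by rewrite exprn_gt0.
have z1 : 1 + h <= u * x ^+ om.
  apply: le_trans (_ : (1 + 6 * h) * (1 - h) <= _); first by lra.
  by apply: ler_pM => //; lra.
pose K := (x ^+ om)^-1.
have K0 : 0 < K by rewrite invr_gt0.
pose B : R := 28 * K / (eps * h ^+ 2).
have eh0 : 0 < eps * h ^+ 2 by rewrite mulr_gt0// exprn_gt0.
exists (Num.truncn B).+2 => P PB.
have P0 : (0 < P)%N by exact: leq_trans PB.
have BP : B <= P%:R.
  have /ltW h' := truncnS_gt B; apply: le_trans h' _.
  by rewrite ler_nat ltnW.
have P2 : 2 <= P%:R :> R by rewrite ler_nat; exact: leq_trans PB.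
apply: (sb_le (W' := fun c => x ^- (om * P.+1) * wt x c)
   (x' := x ^- (om * P.+1) * ((1 + 6 * h * P%:R) * u ^- P * av R P))).
- move=> c _; case: leqP => cn; last by rewrite mul0r mulr_ge0 ?wt_ge0 ?invr_ge0 ?exprn_ge0 ?(ltW x0).
  rewrite mul1r [wt x c]wtE mulrA -[leLHS]mul1r ler_wpM2r ?wt_ge0//.
  by rewrite mulrC ler_pdivlMr ?exprn_gt0// mul1r ler_wiXn2l// ltW.
- rewrite mulrA ler_wpM2r ?av_ge0//.
  have -> : x ^- (om * P.+1) * ((1 + 6 * h * P%:R) / u ^+ P) = K * (1 + 6 * h * P%:R) / (u * x ^+ om) ^+ P.
    exact: expn_split.
  have zP : 0 < (u * x ^+ om) ^+ P by rewrite exprn_gt0// mulr_gt0//; lra.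
  rewrite ler_pdivrMr//.
  have zP2 : P%:R ^+ 2 / 4 * h ^+ 2 <= (u * x ^+ om) ^+ P.
    apply: le_trans (_ : (1 + h) ^+ P <= _); last by rewrite lerXn2r// nnegrE; lra.
    apply: le_trans (bernoulli2 P (ltW h0)).
    have : 0 <= (P%:R * (P%:R - 1) / 2 - P%:R ^+ 2 / 4) * h ^+ 2.
      rewrite mulr_ge0 ?exprn_ge0 ?(ltW h0)//.
      by have := ler_wpM2r (ler0n R P) P2; lra.
    have : 0 <= P%:R * h by rewrite mulr_ge0// ltW.
    by lra.
  apply: le_trans (_ : eps * (P%:R ^+ 2 / 4 * h ^+ 2) <= _); last by rewrite ler_wpM2l// ltW.
  apply: le_trans (_ : K * (7 * P%:R) <= _); first rewrite ler_wpM2l ?(ltW K0)//.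
    by have : h * P%:R <= 20^-1 * P%:R; [rewrite ler_wpM2r|lra].
  move: BP; rewrite ler_pdivrMr// => BP.
  have := ler_wpM2r (ler0n R P) BP; lra.
- apply: sbZ; first by rewrite invr_ge0 exprn_ge0// ltW.
  by apply: sb_off_critical => //; rewrite (ltW h0)/=; lra.
Qed.

End off_critical.

End Codes.

(** * Nonnegativity of the genus, for permutations *)

Module Euler.
Import structures.
Import all_boot all_fingroup.
Import zify.

Section euler.
Local Open Scope group_scope.
Variable D : finType.
Implicit Types (s t : {perm D}) (A : {set D}) (L : seq (D * D)).

Lemma mem_porbit1 s x : s x \in porbit s x.
Proof. by have := mem_porbit s 1 x; rewrite expg1. Qed.

Definition prodt L : {perm D} := \prod_(p <- L) tperm p.1 p.2.

Lemma porbits1 : #|porbits (1 : {perm D})| = #|D|.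
Proof.
rewrite /porbits card_imset ?cardsT// => x y /setP/(_ x).
rewrite porbit_id => /esym; case/porbitP => i; rewrite expg1n perm1 => ->//.
Qed.

(** Each transposition splits off one fixed point, so their number is the number of points minus the
    number of cycles. *)
Lemma perm_prodt s : exists L, [/\ all (fun p => p.1 != p.2) L, s = prodt L &
  size L + #|porbits s| = #|D|].
Proof.
have [n] := ubnP (#|D| - #|porbits s|); elim: n s => // n IH s.
have [/existsP[x sx]|/existsPn s1] := boolP [exists x, s x != x]; last first.
  have -> : s = 1 by apply/permP => x; rewrite perm1; apply/eqP/negPn/s1.
  by exists [::]; rewrite porbits1 /prodt big_nil.
have := porbits_mul_tperm s x (s x).
rewrite porbit_sym mem_porbit1 /= addn0 eq_sym sx addn1 => E.
have lD : #|porbits (tperm x (s x) * s)| <= #|D|.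
  by rewrite (leq_trans (leq_imset_card _ _))// cardsT.
move=> h; have [|L [aL sL eL]] := IH (tperm x (s x) * s).
  rewrite E in lD *; move: h lD; move: #|porbits s| #|D| => a b; lia.
exists ((x, s x) :: L); split => /=; first by rewrite eq_sym sx.
  by rewrite /prodt big_cons -/(prodt L) -sL mulgA tperm2 mul1g.
by rewrite -eL E addSnnS.
Qed.

Lemma prodt_inv (T : eqType) (f : D -> T) L : (forall p, p \in L -> f p.1 = f p.2) ->
  forall z, f (prodt L z) = f z.
Proof.
rewrite /prodt; elim: L => [|p L IH] h z; first by rewrite big_nil perm1.
rewrite big_cons permM IH => [|q qL]; last by rewrite h ?inE ?qL ?orbT.
have := h p (mem_head _ _); case: tpermP => // -> //.
Qed.

(* Each transposition of the product either joins two components of the graph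
   with edge set [L], and then it also joins two cycles, or it changes the number
   of cycles by one. *)
Lemma prodt_forest L : all (fun p => p.1 != p.2) L -> exists f : D -> D,
  (forall p, p \in L -> f p.1 = f p.2) /\
  #|porbits (prodt L)| + #|D| <= size L + (#|f @: [set: D]|).*2.
Proof.
elim: L => [_|[x y] L IH /= /andP[xy /IH[f [fL fc]]]].
  by exists id; split => //; rewrite imset_id /prodt big_nil porbits1 cardsT addnn.
have := porbits_mul_tperm (prodt L) x y; rewrite /prodt big_cons -/(prodt L) xy addn1 /= => E.
have [fxy|fxy] := eqVneq (f x) (f y).
  exists f; split; last first.
    move: E fc; move: #|porbits (tperm x y * prodt L)| #|porbits (prodt L)| => a b.
    by case: (x \notin _) => /=; lia.
  by move=> p; rewrite inE => /predU1P[->//|/fL].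
exists (fun z => if f z == f y then f x else f z); split.
  move=> p; rewrite inE => /predU1P[->/=|/fL -> //].
  by rewrite eqxx (negbTE fxy).
have nxy : x \notin porbit (prodt L) y.
  apply: contra fxy => /porbitP[i ->]; elim: i => [|i IHi]; first by rewrite expg0 perm1.
  by rewrite expgSr permM (prodt_inv fL).
have : #|f @: [set: D]| <= #|f y |: [set if f z == f y then f x else f z | z in [set: D]]|.
  apply/subset_leq_card/subsetP => _ /imsetP[z _ ->]; rewrite !inE.
  have [//|zy] := eqVneq (f z) (f y); apply/imsetP; exists z => //.
  by rewrite (negbTE zy).
rewrite cardsU1; move: E; rewrite nxy /=; move: fc.
move: #|porbits (tperm x y * prodt L)| #|porbits (prodt L)| => a b.
case: (_ \notin _) => /=; lia.
Qed.

(** The factorisations of [s], [t] and the inverse of [s * t] are concatenated: the product is the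
    identity, with #|D| cycles, while transitivity on [A] leaves at most one component besides the
    points outside [A]. [prodt_forest] compares the two counts. *)
Lemma euler_perm A x0 s t : x0 \in A ->
  (forall x, x \notin A -> s x = x) -> (forall x, x \notin A -> t x = x) ->
  (forall C : {set D}, x0 \in C -> (forall x, x \in C -> s x \in C) ->
     (forall x, x \in C -> t x \in C) -> A \subset C) ->
  #|porbits s| + #|porbits t| + #|porbits (s * t)| <= #|D| + 2 * (#|~: A|).+1.
Proof.
move=> x0A sA tA conn.
have [L1 [a1 e1 c1]] := perm_prodt s; have [L2 [a2 e2 c2]] := perm_prodt t.
have [L3 [a3 e3 c3]] := perm_prodt (s * t)^-1; rewrite porbitsV in c3.
have [|f [fL fc]] := @prodt_forest (L1 ++ L2 ++ L3); first by rewrite !all_cat a1 a2 a3.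
move: fc; rewrite /prodt !big_cat /= -/(prodt L1) -/(prodt L2) -/(prodt L3) -e1 -e2 -e3.
rewrite mulgA mulgV porbits1 !size_cat => fc.
have fs z : f (s z) = f z.
  by rewrite e1; apply: prodt_inv => p pL; apply: fL; rewrite mem_cat pL.
have ft z : f (t z) = f z.
  by rewrite e2; apply: prodt_inv => p pL; apply: fL; rewrite !mem_cat pL orbT.
have : #|f @: [set: D]| <= (#|~: A|).+1.
  have sub : f @: [set: D] \subset f x0 |: (f @: ~: A).
    apply/subsetP => _ /imsetP[z _ ->]; rewrite !inE.
    have [zA|zA] := boolP (z \in A); last by rewrite imset_f ?orbT// inE.
    have /subsetP/(_ _ zA) : A \subset [set z | f z == f x0].
      apply: conn => [|x|x]; rewrite !inE ?fs ?ft//.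
    by rewrite inE => ->.
  apply: leq_trans (subset_leq_card sub) _.
  by rewrite cardsU1 -add1n leq_add ?leq_b1 ?leq_imset_card.
move: fc c1 c2 c3; move: #|porbits s| #|porbits t| #|porbits (s * t)| #|D| #|~: A|.
by move: #|[set f x | x in [set: D]]| => a b c d e g; lia.
Qed.

Definition cyc s A := #|porbit s @: A|.

Lemma porbit_eq s x y : (porbit s x == porbit s y) = (x \in porbit s y).
Proof. by rewrite eq_porbit_mem. Qed.

Lemma stab_iter s A x i : (forall x, x \in A -> s x \in A) -> x \in A -> (s ^+ i) x \in A.
Proof.
move=> sA xA; elim: i => [|i IH]; first by rewrite expg0 perm1.
by rewrite expgSr permM sA.
Qed.

Lemma stab_porbit s A x y : (forall x, x \in A -> s x \in A) -> x \in A -> y \in porbit s x -> y \in A.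
Proof. by move=> sA xA /porbitP[i ->]; apply: stab_iter. Qed.

Lemma stab_inv s A x : (forall x, x \in A -> s x \in A) -> (s x \in A) = (x \in A).
Proof.
move=> sA; apply/idP/idP => [sxA|/sA//].
by apply: (stab_porbit sA sxA); rewrite porbit_sym mem_porbit1.
Qed.

Lemma stab_astabs s A : (forall x, x \in A -> s x \in A) -> s \in 'N(A | 'P).
Proof.
by move=> sA; apply/astabsP => x /=; rewrite apermE stab_inv.
Qed.

Lemma porbits_split s A : (forall x, x \in A -> s x \in A) -> (forall x, x \notin A -> s x = x) ->
  #|porbits s| = cyc s A + #|~: A|.
Proof.
move=> sA sN; have -> : porbits s = porbit s @: (A :|: ~: A).
  by rewrite setUCr; apply/setP => B; apply/imsetP/imsetP => -[x _ ->]; exists x.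
rewrite imsetU cardsU /cyc.
have -> : #|porbit s @: ~: A| = #|~: A|.
  rewrite card_in_imset// => x y; rewrite !inE => xA yA /eqP; rewrite porbit_eq.
  case/porbitP => i ->; elim: i => [|i IH]; first by rewrite expg0 perm1.
  by rewrite expgSr permM IH sN.
rewrite (_ : _ :&: _ = set0) ?cards0 ?subn0//; apply/setP => B; rewrite !inE.
apply/negbTE/andP => -[/imsetP[x xA ->] /imsetP[y]]; rewrite inE => yA /eqP.
rewrite eq_sym porbit_eq => yx; by case/negP: yA; apply: (stab_porbit sA xA).
Qed.

Lemma restr_out s A x : (forall x, x \in A -> s x \in A) -> x \notin A -> restr_perm A s x = x.
Proof. by move=> sA xA; apply: (out_perm (restr_perm_on A s)). Qed.

Lemma restr_in s A x : (forall x, x \in A -> s x \in A) -> x \in A -> restr_perm A s x = s x.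
Proof. by move=> sA xA; apply: restr_permE => //; exact: stab_astabs. Qed.

Lemma porbit_restr s A x : (forall x, x \in A -> s x \in A) -> x \in A ->
  porbit (restr_perm A s) x = porbit s x.
Proof.
move=> sA xA; have E i : (restr_perm A s ^+ i) x = (s ^+ i) x.
  elim: i => [|i IH]; first by rewrite !expg0.
  by rewrite !expgSr !permM IH restr_in// stab_iter.
by apply/setP => y; apply/porbitP/porbitP => -[i ->]; exists i; rewrite E.
Qed.

(** Planar maps are the case of equality. The inequality is what forces both halves of a planar map
    cut at a vertex to be planar. *)
Lemma euler_cyc A x0 s t : x0 \in A ->
  (forall x, x \in A -> s x \in A) -> (forall x, x \in A -> t x \in A) ->
  (forall C : {set D}, x0 \in C -> C \subset A -> (forall x, x \in C -> s x \in C) ->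
     (forall x, x \in C -> t x \in C) -> A \subset C) ->
  cyc s A + cyc t A + cyc (s * t) A <= #|A| + 2.
Proof.
move=> x0A sA tA conn.
have stA x : x \in A -> (s * t) x \in A by move=> xA; rewrite permM tA ?sA.
pose r (u : {perm D}) : {perm D} := restr_perm A u.
have rin (u : {perm D}) x : (forall x, x \in A -> u x \in A) -> x \in A -> r u x \in A.
  by move=> uA xA; rewrite /r restr_in// uA.
have rcyc (u : {perm D}) : (forall x, x \in A -> u x \in A) -> #|porbits (r u)| = cyc u A + #|~: A|.
  move=> uA; rewrite (@porbits_split _ A) => [|x xA|x xA]; last 2 first.
  - exact: rin.
  - exact: restr_out.
  by congr (_ + _); rewrite /cyc (eq_in_imset (g := porbit u))// => x xA; rewrite porbit_restr.
have rM : r (s * t) = r s * r t.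
  by apply: morphM => /=; exact: stab_astabs.
have := @euler_perm A x0 (r s) (r t) x0A; rewrite -rM !rcyc//.
move=> /(_ (fun x => restr_out sA) (fun x => restr_out tA)) h.
have {h}: cyc s A + #|~: A| + (cyc t A + #|~: A|) + (cyc (s * t) A + #|~: A|) <=
   #|D| + 2 * (#|~: A|).+1.
  apply: h => C x0C sC tC; apply: subset_trans (subsetIr A C).
  apply: conn => [||x|x]; rewrite ?inE ?x0A ?subsetIl// => /andP[xA xC].
    by rewrite sA//= -(restr_in sA xA) sC.
  by rewrite tA//= -(restr_in tA xA) tC.
by rewrite -(cardsC A); lia.
Qed.

End euler.

End Euler.

(** * The combinatorial map of a code *)

Module CodeMaps.
Import structures.
Import all_boot all_order all_algebra.
Import zify.
Import Codes.

(* The darts of the map coded by [c]; below, [alpha] is their reversal, [phi] the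
   face permutation and [tl c] lists the non-root darts of the external face. *)
Fixpoint dt (c : code) : finType :=
  match c with
  | CE => bool : finType
  | CI c => (dt c + bool)%type : finType
  | CS c1 c2 => (dt c1 + dt c2 + bool)%type : finType
  end.

Fixpoint alpha (c : code) : dt c -> dt c :=
  match c with
  | CE => negb
  | CI c => fun x => match x with inl d => inl (alpha d) | inr b => inr (~~ b) end
  | CS c1 c2 => fun x => match x with
    | inl (inl d) => inl (inl (alpha d))
    | inl (inr d) => inl (inr (alpha d))
    | inr b => inr (~~ b) end
  end.

Definition root (c : code) : dt c :=
  match c with CE => true | CI c => inr true | CS c1 c2 => inr true end.

Definition dlast (T : Type) (s : seq T) := take (size s).-1 s.

Fixpoint tl (c : code) : seq (dt c) :=
  match c with
  | CE => [:: false]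
  | CI c => map inl (dlast (tl c))
  | CS c1 c2 => map (inl \o inl) (tl c1) ++ map (inl \o inr) (tl c2)
  end.

Definition lst (c : code) : dt c := last (root c) (tl c).
Definition ext (c : code) : seq (dt c) := root c :: tl c.

(** For [CI] the root triangle is the cycle [inr false], [inl (lst c)], [inl (root c)]: the root
    edge closes the outer corner between the last dart and the root, whose vertex becomes inner. For
    [CS] it is the cycle of [inr false] and the roots of [c2] and [c1], and the rest of the outer
    face of [c1] is continued by that of [c2]. *)
Fixpoint phi (c : code) : dt c -> dt c :=
  match c with
  | CE => negb
  | CI c => fun x => match x with
    | inl d => if d == root c then inr false
               else if phi d == lst c then inr true else inl (phi d)
    | inr true => inl (phi (root c))
    | inr false => inl (lst c) end
  | CS c1 c2 => fun x => match x with
    | inl (inl d) => if d == root c1 then inr false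
        else if phi d == root c1 then inl (inr (phi (root c2))) else inl (inl (phi d))
    | inl (inr d) => if d == root c2 then inl (inl (root c1))
        else if phi d == root c2 then inr true else inl (inr (phi d))
    | inr true => inl (inl (phi (root c1)))
    | inr false => inl (inr (root c2)) end
  end.

Lemma dlast_rcons (T : Type) (s : seq T) x : dlast (rcons s x) = s.
Proof. by rewrite /dlast size_rcons /= -cats1 take_size_cat. Qed.

Lemma alphaK c : involutive (@alpha c).
Proof.
elim: c => [|c IH|c1 IH1 c2 IH2] /=; first exact: negbK.
  by case=> [d|b]; rewrite ?IH ?negbK.
by case=> [[d|d]|b]; rewrite ?IH1 ?IH2 ?negbK.
Qed.

Lemma alpha_neq c (d : dt c) : alpha d != d.
Proof.
elim: c d => [|c IH|c1 IH1 c2 IH2] /=; first by case.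
  by case=> [d|[]] //; rewrite (inj_eq (@inl_inj _ _)).
by case=> [[d|d]|[]] //; rewrite !(inj_eq (@inl_inj _ _)) ?(inj_eq (@inr_inj _ _)).
Qed.

Lemma size_tl c : wf c -> size (tl c) = per c.
Proof.
elim: c => //= [c IH /andP[/IH E p1]|c1 IH1 c2 IH2 /andP[/IH1 E1 /IH2 E2]].
  by rewrite size_map size_takel ?leq_pred// E.
by rewrite size_cat !size_map E1 E2.
Qed.

Lemma tl_rcons c : wf c -> exists m, tl c = rcons m (lst c) /\ size m = (per c).-1.
Proof.
move=> wc; have := size_tl wc; have := per_gt0 wc; rewrite /lst.
case/lastP: (tl c) => [|m x]; rewrite ?size_rcons => p0 E; first by rewrite -E in p0.
by exists m; rewrite last_rcons -E.
Qed.

Definition fpath_tl c := path (fun x y => phi x == y) (root c) (tl c).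

Record inv (c : code) : Prop := {
  inv_path : fpath_tl c;
  inv_lst : phi (lst c) = root c;
  inv_uniq : uniq (ext c);
  inv_phi : injective (@phi c);
  inv_tri : forall d, d \notin ext c -> phi d != d /\ phi (phi (phi d)) = d }.

Lemma inv_head c : inv c -> wf c -> exists m, tl c = phi (root c) :: m.
Proof.
move=> [h _ _ _ _] wc; have := size_tl wc; have := per_gt0 wc; move: h.
by rewrite /fpath_tl; case: (tl c) => [|x m] /= => [_ p0 E|/andP[/eqP -> _] _ _]; [rewrite -E in p0|exists m].
Qed.

Lemma path_next (T : eqType) (f : T -> T) x s y : path (fun a b => f a == b) x s ->
  y \in x :: s -> y != last x s -> f y \in s.
Proof.
elim: s x y => [|z s IH] x y /=; first by rewrite inE => _ /eqP ->; rewrite eqxx.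
move=> /andP[/eqP xz zs]; rewrite inE => /predU1P[->|ys] yl; first by rewrite xz mem_head.
by rewrite inE (IH z) ?orbT.
Qed.

Lemma path_prev (T : eqType) (f : T -> T) x s y : path (fun a b => f a == b) x s ->
  y \in s -> exists2 z, z \in belast x s & f z = y.
Proof.
elim: s x => //= z s IH x /andP[/eqP xz zs]; rewrite inE => /predU1P[->|ys].
  by exists x; rewrite ?mem_head.
by have [w wb wy] := IH z zs ys; exists w; rewrite ?inE ?wb ?orbT.
Qed.

Lemma inv_ext c d : inv c -> (phi d \in ext c) = (d \in ext c).
Proof.
move=> [hp hl hu hi ht]; apply/idP/idP => [|dE].
  rewrite inE => /predU1P[|]; first by rewrite -hl => /hi ->; rewrite mem_last.
  by move=> /(path_prev hp)[z zb /hi <-]; exact: mem_belast.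
have [->|dl] := eqVneq d (lst c); first by rewrite hl mem_head.
by rewrite inE (path_next hp) ?orbT.
Qed.

Lemma inv_rootE c d : inv c -> (phi d == root c) = (d == lst c).
Proof. by move=> [_ hl _ hi _]; rewrite -hl (inj_eq hi). Qed.

Lemma inl_path (T U : eqType) (f : T -> T) (g : U -> U) (i : T -> U) x s :
  {in belast x s, forall y, g (i y) = i (f y)} ->
  path (fun a b => f a == b) x s -> path (fun a b => g a == b) (i x) (map i s).
Proof.
elim: s x => //= y s IH x h /andP[/eqP xy ys].
by rewrite h ?mem_head// xy eqxx IH// => z zs; rewrite h// inE zs orbT.
Qed.

Lemma lst_neq_root c : inv c -> wf c -> lst c != root c.
Proof.
move=> ic wc; have [m [tE _]] := tl_rcons wc; have := inv_uniq ic.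
rewrite /ext tE cons_uniq mem_rcons inE negb_or => /andP[/andP[h _] _].
by rewrite eq_sym.
Qed.

Lemma inv_CE : inv CE.
Proof.
split => //; first by case=> -[].
by move=> [].
Qed.

Lemma inv_CI c : wf (CI c) -> inv c -> inv (CI c).
Proof.
move=> /= /andP[wc p1] ic; have [hp hl hu hi ht] := ic.
have [m [tE sm]] := tl_rcons wc.
have m0 : m != [::] by rewrite -size_eq0 sm; lia.
have rl := lst_neq_root ic wc.
have tlE : tl (CI c) = map inl m by rewrite /= tE dlast_rcons.
move: (hp); rewrite /fpath_tl tE rcons_path => /andP[mp /eqP ml].
move: (hu); rewrite /ext tE -rcons_cons rcons_uniq inE negb_or /= => /and3P[/andP[_ lm] rm um].
have [x [m' mE]] : exists x m', m = x :: m' by case: (m) m0 => // x m' _; exists x, m'.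
have lstE : lst (CI c) = inl (last (root c) m) by rewrite /lst tlE mE /= last_map.
have mN y : y \in m -> phi (c := CI c) (inl y) = if phi y == lst c then inr true else inl (phi y).
  by move=> ym /=; case: eqP ym => // ->; rewrite (negbTE rm).
have rx : phi (root c) = x by move: mp; rewrite mE /= => /andP[/eqP].
have lastm : last (root c) m \in m by rewrite mE /= mem_last.
split.
- rewrite /fpath_tl tlE mE /= rx eqxx /=.
  move: mp; rewrite mE /= => /andP[_ mp]; apply: inl_path mp => y yb.
  have ym : y \in m by rewrite mE; exact: mem_belast yb.
  rewrite -[LHS]/(phi (c := CI c) (inl y)) mN//; case: eqP => // yl; exfalso.
  have : y = last (root c) m by apply: hi; rewrite ml.
  rewrite mE /= => yE; move: um; rewrite mE lastI rcons_uniq -yE => /andP[].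
  by rewrite yb.
- by rewrite lstE mN// ml eqxx.
- rewrite /ext tlE /= map_inj_uniq ?um ?andbT; last by move=> ? ? [].
  by apply/mapP => -[].
- have lr : lst c <> phi (root c).
    by rewrite rx => lx; move: lm; rewrite lx mE mem_head.
  have E1 y : phi y = lst c -> y <> root c by move=> yl yr; apply: lr; rewrite -yl yr.
  move=> [y|[]] [z|[]] /=; do ?(case: eqP => ?);
    first [congruence | by move=> [/hi ?]; congruence | by move=> _; congr inl; apply: hi; congruence].
- have F1 : phi (c := CI c) (inl (lst c)) = inl (root c).
    by rewrite /= (negbTE rl) hl eq_sym (negbTE rl).
  have F2 : phi (c := CI c) (inl (root c)) = inr false by rewrite /= eqxx.
  have F3 : phi (c := CI c) (inr false) = inl (lst c) by [].
  move=> [d|[]]; last 2 first.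
  + by rewrite /ext mem_head.
  + by move=> _; rewrite F3 F1 F2.
  rewrite /ext tlE inE negb_or => /andP[_]; rewrite mem_map => [dm|? ? [] //].
  have [->|dr] := eqVneq d (root c).
    by rewrite F2 F3 F1.
  have [dl|dl] := eqVneq d (lst c).
    rewrite dl F1 F2 F3; split => //.
    by apply/eqP => -[rl']; move: rl; rewrite -rl' eqxx.
  have dE : d \notin ext c by rewrite /ext tE inE (negbTE dr) mem_rcons inE (negbTE dl).
  have [nd d3] := ht d dE.
  have nE e : e \notin ext c -> phi (c := CI c) (inl e) = inl (phi e) /\ phi e \notin ext c.
    move=> eE; rewrite inv_ext//; split=> //=.
    case: eqP => [er|_]; first by move: eE; rewrite er mem_head.
    by case: eqP => // el; move: eE; rewrite -(inv_ext _ ic) el /lst mem_last.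
  have [-> p1E] := nE d dE; split; first by rewrite (inj_eq (@inl_inj _ _)).
  by have [-> p2E] := nE _ p1E; have [-> _] := nE _ p2E; rewrite d3.
Qed.

Lemma inner_steps c : wf c -> inv c -> exists m, [/\ tl c = phi (root c) :: m,
  path (fun a b => phi a == b) (phi (root c)) m,
  last (phi (root c)) m = lst c &
  {in belast (phi (root c)) m, forall y, y != root c /\ phi y != root c}].
Proof.
move=> wc ic; have [hp hl hu hi ht] := ic; have [m tE] := inv_head ic wc.
exists m; split => //.
- by move: hp; rewrite /fpath_tl tE /= => /andP[].
- by rewrite /lst tE.
move=> y yb; have yt : y \in tl c by rewrite tE; exact: mem_belast yb.
have yr : y != root c.
  by apply: contraTneq yt => ->; move: hu; rewrite /ext cons_uniq => /andP[].
split => //; rewrite (inv_rootE _ ic); apply: contraTneq yb => ->.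
move: hu; rewrite /ext tE cons_uniq lastI rcons_uniq => /and3P[_ h _].
by rewrite /lst tE /=.
Qed.

Lemma inv_CS c1 c2 : wf c1 -> wf c2 -> inv c1 -> inv c2 -> inv (CS c1 c2).
Proof.
move=> w1 w2 i1 i2; have [hp1 hl1 hu1 hi1 ht1] := i1; have [hp2 hl2 hu2 hi2 ht2] := i2.
have rl1 := lst_neq_root i1 w1; have rl2 := lst_neq_root i2 w2.
pose ii (d : dt c1) : dt (CS c1 c2) := inl (inl d).
pose ir (d : dt c2) : dt (CS c1 c2) := inl (inr d).
have iiI : injective ii by move=> ? ? [].
have irI : injective ir by move=> ? ? [].
have F1 : phi (ii (root c1)) = inr false by rewrite /= eqxx.
have F2 : phi (c := CS c1 c2) (inr false) = ir (root c2) by [].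
have F3 : phi (ir (root c2)) = ii (root c1) by rewrite /= eqxx.
have F4 : phi (ii (lst c1)) = ir (phi (root c2)) by rewrite /= (negbTE rl1) hl1 eqxx.
have F5 : phi (ir (lst c2)) = inr true by rewrite /= (negbTE rl2) hl2 eqxx.
have F6 y : y != root c1 -> phi y != root c1 -> phi (ii y) = ii (phi y).
  by move=> /= /negbTE -> /negbTE ->.
have F7 y : y != root c2 -> phi y != root c2 -> phi (ir y) = ir (phi y).
  by move=> /= /negbTE -> /negbTE ->.
have [m1 [t1 p1 l1 s1]] := inner_steps w1 i1.
have [m2 [t2 p2 l2 s2]] := inner_steps w2 i2.
have tlE : tl (CS c1 c2) = map ii (tl c1) ++ map ir (tl c2) by [].
have lE : lst (CS c1 c2) = ir (lst c2).
  by rewrite /lst tlE last_cat [tl c2]t2 /= last_map.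
have rE : root (CS c1 c2) = inr true by [].
split.
- rewrite /fpath_tl tlE cat_path; apply/andP; split.
    rewrite t1 map_cons; apply/andP; split; first exact: eqxx.
    by apply: (@inl_path _ _ _ _ ii) p1 => y /s1[h1 h2]; exact: F6.
  have -> : last (root (CS c1 c2)) (map ii (tl c1)) = ii (lst c1).
    by rewrite t1 /= last_map l1.
  rewrite t2 map_cons; apply/andP; split; first by rewrite F4.
  by apply: (@inl_path _ _ _ _ ir) p2 => y /s2[h1 h2]; exact: F7.
- by rewrite lE F5.
- rewrite /ext tlE cons_uniq cat_uniq !map_inj_uniq// mem_cat.
  move: hu1 hu2; rewrite /ext !cons_uniq => /andP[_ ->] /andP[_ ->].
  rewrite andbT /=; apply/andP; split.
    by apply/negP => /orP[] /mapP[].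
  by apply/hasPn => y /mapP[z _ ->]; apply/mapP => -[].
- have E1 y : phi y = phi (root c1) -> y = root c1 by move=> /hi1.
  have E2 y : phi y = phi (root c2) -> y = root c2 by move=> /hi2.
  have N1 : phi (root c1) <> root c1 by apply/eqP; rewrite (inv_rootE _ i1) eq_sym.
  have N2 : phi (root c2) <> root c2 by apply/eqP; rewrite (inv_rootE _ i2) eq_sym.
  move=> [[y|y]|[]] [[z|z]|[]] /=; do ?(case: eqP => ?);
    first [congruence | by move=> [/E1 ?]; congruence | by move=> [/E2 ?]; congruence
     | by move=> [/esym/E1 ?]; congruence | by move=> [/esym/E2 ?]; congruence
     | by move=> [/hi1 ->] | by move=> [/hi2 ->]
     | by move=> _; congr (inl (inl _)); apply: hi1; congruence
     | by move=> _; congr (inl (inr _)); apply: hi2; congruence].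
- move=> [[d|d]|[]]; last 2 first.
  + by rewrite /ext mem_head.
  + by move=> _; rewrite F2 F3 F1.
  + rewrite /ext tlE inE negb_or mem_cat => /andP[_]; rewrite negb_or => /andP[h _].
    have dt1 : d \notin tl c1 by apply: contra h => h; exact: map_f.
    have [->|dr] := eqVneq d (root c1); first by rewrite F1 F2 F3.
    have dE : d \notin ext c1 by rewrite /ext inE negb_or dr.
    have [nd d3] := ht1 d dE.
    have nE e : e \notin ext c1 -> phi (ii e) = ii (phi e) /\ phi e \notin ext c1.
      move=> eE; rewrite inv_ext//; split=> //; rewrite F6//.
        by apply: contraNneq eE => ->; rewrite mem_head.
      by rewrite (inv_rootE _ i1); apply: contraNneq eE => ->; exact: mem_last.
    rewrite -/(ii d); have [-> p1E] := nE d dE; split; first by rewrite (inj_eq iiI).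
    by have [-> p2E] := nE _ p1E; have [-> _] := nE _ p2E; rewrite d3.
  + rewrite /ext tlE inE negb_or mem_cat => /andP[_]; rewrite negb_or => /andP[_ h].
    have dt1 : d \notin tl c2 by apply: contra h => h; exact: map_f.
    have [->|dr] := eqVneq d (root c2); first by rewrite F3 F1 F2.
    have dE : d \notin ext c2 by rewrite /ext inE negb_or dr.
    have [nd d3] := ht2 d dE.
    have nE e : e \notin ext c2 -> phi (ir e) = ir (phi e) /\ phi e \notin ext c2.
      move=> eE; rewrite inv_ext//; split=> //; rewrite F7//.
        by apply: contraNneq eE => ->; rewrite mem_head.
      by rewrite (inv_rootE _ i2); apply: contraNneq eE => ->; exact: mem_last.
    rewrite -/(ir d); have [-> p1E] := nE d dE; split; first by rewrite (inj_eq irI).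
    by have [-> p2E] := nE _ p1E; have [-> _] := nE _ p2E; rewrite d3.
Qed.

Lemma invP c : wf c -> inv c.
Proof.
elim: c => [_|c IH wc|c1 IH1 c2 IH2 /= /andP[w1 w2]]; first exact: inv_CE.
  by apply: inv_CI => //; apply: IH; case/andP: wc.
by apply: inv_CS => //; [exact: IH1|exact: IH2].
Qed.

(* [lab bs k d] is the name of the origin of [d] when the outer vertices are
   named by [bs] (so that [root c] goes from [last bs] to [head bs]) and the
   inner ones by [k, k.+1, ...]. *)
Fixpoint lab (c : code) (bs : seq nat) (k : nat) : dt c -> nat :=
  match c with
  | CE => fun b => if b then last 0 bs else head 0 bs
  | CI c => fun x => match x with
     | inl d => lab (rcons bs k) k.+1 d
     | inr b => if b then last 0 bs else head 0 bs end
  | CS c1 c2 => fun x => match x with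
     | inl (inl d) => lab (take (per c1).+1 bs) k d
     | inl (inr d) => lab (drop (per c1) bs) (k + nin c1) d
     | inr b => if b then last 0 bs else head 0 bs end
  end.

(** One ordered pair of labels per edge, with multiplicity. Energies and degrees are computed on
    this list, without any reference to darts. *)
Fixpoint es (c : code) (bs : seq nat) (k : nat) : seq (nat * nat) :=
  (last 0 bs, head 0 bs) ::
  match c with
  | CE => [::]
  | CI c => es c (rcons bs k) k.+1
  | CS c1 c2 => es c1 (take (per c1).+1 bs) k ++ es c2 (drop (per c1) bs) (k + nin c1)
  end.

Fixpoint dl (c : code) : seq (dt c) :=
  match c with
  | CE => [:: true]
  | CI c => inr true :: map inl (dl c)
  | CS c1 c2 => inr true :: map (inl \o inl) (dl c1) ++ map (inl \o inr) (dl c2)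
  end.

Lemma lab_root c bs k : lab bs k (root c) = last 0 bs.
Proof. by case: c. Qed.

Lemma lab_alpha_root c bs k : lab bs k (alpha (root c)) = head 0 bs.
Proof. by case: c. Qed.

Lemma es_dl c bs k : es c bs k = [seq (lab bs k d, lab bs k (alpha d)) | d <- dl c].
Proof.
elim: c bs k => //= [c IH bs k|c1 IH1 c2 IH2 bs k]; first by rewrite IH -map_comp.
by rewrite IH1 IH2 map_cat -!map_comp.
Qed.

Lemma mem_map_alpha c (d : dt c) s : (d \in map (@alpha c) s) = (alpha d \in s).
Proof. by rewrite -{1}[d]alphaK mem_map//; exact: inv_inj (@alphaK c). Qed.

Lemma dl_perm c : perm_eq (dl c ++ map (@alpha c) (dl c)) (enum (dt c)).
Proof.
apply: uniq_perm; rewrite ?enum_uniq//; last first.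
  move=> d; rewrite mem_enum inE mem_cat mem_map_alpha.
  elim: c d => [|c IH|c1 IH1 c2 IH2] /=; first by case.
    by case=> [d|[]]; rewrite !inE ?orbT//= !(mem_map (@inl_inj _ _)) IH.
  have i1 : injective (inl \o inl : dt c1 -> dt c1 + dt c2 + bool) by move=> ? ? [].
  have i2 : injective (inl \o inr : dt c2 -> dt c1 + dt c2 + bool) by move=> ? ? [].
  case=> [[d|d]|[]]; rewrite !inE ?orbT//= !mem_cat.
    by have := IH1 d; rewrite -(mem_map i1) -(mem_map i1 _ (alpha d)) => /orP[] ->; rewrite ?orbT.
  by have := IH2 d; rewrite -(mem_map i2) -(mem_map i2 _ (alpha d)) => /orP[] ->; rewrite ?orbT.
rewrite cat_uniq (map_inj_uniq (inv_inj (@alphaK c))).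
suff [-> h] : uniq (dl c) /\ {in dl c, forall d, alpha d \notin dl c}.
  by rewrite andbT; apply/hasPn => _ /mapP[d /h dN ->].
elim: c => [|c [u IH]|c1 [u1 IH1] c2 [u2 IH2]] /=; first by split=> // d; rewrite inE => /eqP ->.
  rewrite (map_inj_uniq (@inl_inj _ _)) u; split.
    by rewrite andbT; apply/mapP => -[].
  move=> d; rewrite inE => /predU1P[->|/mapP[e /IH eN ->]]; rewrite inE /=; first by apply/mapP => -[].
  by rewrite (mem_map (@inl_inj _ _)).
have i1 : injective (inl \o inl : dt c1 -> dt c1 + dt c2 + bool) by move=> ? ? [].
have i2 : injective (inl \o inr : dt c2 -> dt c1 + dt c2 + bool) by move=> ? ? [].
rewrite cat_uniq !map_inj_uniq// u1 u2 andbT mem_cat; split.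
  apply/andP; split; first by apply/negP => /orP[] /mapP[].
  by apply/hasPn => _ /mapP[d _ ->]; apply/mapP => -[].
move=> d; rewrite inE mem_cat => /or3P[/eqP ->|/mapP[e /IH1 eN ->]|/mapP[e /IH2 eN ->]]; rewrite inE mem_cat /=.
- by apply/negP => /orP[] /mapP[].
- rewrite negb_or; apply/andP; split; last by apply/mapP => -[].
  by rewrite -[inl (inl _)]/((inl \o inl) _) (mem_map i1).
- rewrite negb_or; apply/andP; split; first by apply/mapP => -[].
  by rewrite -[inl (inr _)]/((inl \o inr) _) (mem_map i2).
Qed.

End CodeMaps.

(** * Every planar triangulation of a polygon has a code *)

Module Peeling.
Import structures.
Import all_boot all_fingroup.
Import zify.
Import Codes Euler CodeMaps.
Local Open Scope group_scope.

Section surjectivity.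
Variable D : finType.
Implicit Types (s t f g : {perm D}) (A C : {set D}).

Lemma porbitV1 s y : porbit s^-1 y = porbit s y.
Proof. by rewrite porbit.unlock cycleV. Qed.

Lemma cyc_stab s A : (forall x, x \in A -> s x \in A) ->
  #|porbits s| = cyc s A + cyc s (~: A).
Proof.
move=> sA; rewrite /cyc.
have -> : porbits s = porbit s @: (A :|: ~: A).
  by rewrite setUCr; apply/setP => B; apply/imsetP/imsetP => -[x _ ->]; exists x.
rewrite imsetU cardsU (_ : _ :&: _ = set0) ?cards0 ?subn0//; apply/setP => B; rewrite !inE.
apply/negbTE/andP => -[/imsetP[x xA ->] /imsetP[y]]; rewrite inE => yA /eqP.
by rewrite eq_sym porbit_eq => yx; case/negP: yA; apply: (stab_porbit sA xA).
Qed.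

Lemma cyc_eq s t A : (forall x, x \in A -> s x \in A) -> {in A, s =1 t} -> cyc s A = cyc t A.
Proof.
move=> sA st; rewrite /cyc (eq_in_imset (g := porbit t))// => x xA.
have E i : (s ^+ i) x = (t ^+ i) x.
  elim: i => [|i IH]; first by rewrite !expg0.
  by rewrite !expgSr !permM -IH st// stab_iter.
by apply/setP => y; apply/porbitP/porbitP => -[i ->]; exists i; rewrite E.
Qed.

Lemma stab_tperm s A x y : (forall x, x \in A -> s x \in A) -> x \in A -> y \in A ->
  forall z, z \in A -> (s * tperm x y) z \in A.
Proof. by move=> sA xA yA z zA; rewrite permM; case: tpermP => // *; exact: sA. Qed.

Lemma cyc_tperm s A x y : (forall x, x \in A -> s x \in A) -> x \in A -> y \in A ->
  cyc (s * tperm x y) A + (x \notin porbit s y).*2 = cyc s A + (x != y).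
Proof.
move=> sA xA yA.
have : #|porbits (tperm x y * s^-1)| + (x \notin porbit s^-1 y).*2 = #|porbits s^-1| + (x != y).
  exact: porbits_mul_tperm.
have -> : tperm x y * s^-1 = (s * tperm x y)^-1 by rewrite invMg tpermV.
rewrite !porbitsV porbitV1.
rewrite (cyc_stab sA) (cyc_stab (stab_tperm sA xA yA)).
have <- : cyc s (~: A) = cyc (s * tperm x y) (~: A).
  apply: cyc_eq => z; rewrite !inE; first by rewrite stab_inv.
  move=> zA; rewrite permM tpermD//; apply: contraNneq zA => E.
    by rewrite -(stab_inv z sA) -E.
  by rewrite -(stab_inv z sA) -E.
by move=> h; apply: (@addIn (cyc s (~: A))); rewrite addnAC h addnAC.
Qed.

Lemma cyc_split s A x y : (forall x, x \in A -> s x \in A) -> x \in A -> y \in A ->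
  x != y -> x \in porbit s y -> cyc (s * tperm x y) A = (cyc s A).+1.
Proof. by move=> sA xA yA xy xs; have := cyc_tperm sA xA yA; rewrite xs xy /= addn0 addn1. Qed.

Lemma cyc_merge s A x y : (forall x, x \in A -> s x \in A) -> x \in A -> y \in A ->
  x \notin porbit s y ->
  (cyc (s * tperm x y) A).+1 = cyc s A /\ x \in porbit (s * tperm x y) y.
Proof.
move=> sA xA yA xs; have xy : x != y by apply: contraNneq xs => ->; exact: porbit_id.
have h1 := cyc_tperm sA xA yA; have := cyc_tperm (stab_tperm sA xA yA) xA yA.
rewrite -mulgA tperm2 mulg1; move: h1; rewrite xs xy /=.
by case: (x \in _) => /=; lia.
Qed.

Lemma cyc_disj s A C : (forall x, x \in A -> s x \in A) -> [disjoint A & C] ->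
  cyc s (A :|: C) = cyc s A + cyc s C.
Proof.
move=> sA AC; rewrite /cyc imsetU cardsU (_ : _ :&: _ = set0) ?cards0 ?subn0//.
apply/setP => B; rewrite !inE; apply/negbTE/andP => -[/imsetP[x xA ->] /imsetP[y yC] /eqP].
rewrite eq_sym porbit_eq => yx; have := stab_porbit sA xA yx.
by rewrite (disjointFl AC yC).
Qed.

Variable al : {perm D}.
Hypothesis alK : forall x, al (al x) = x.
Hypothesis alN : forall x, al x != x.

(* Planar maps with a simple external face, that of [r], and triangular inner faces;
   [al] reverses darts, [f] is the face permutation and [al * f] the vertex one. *)
Record tri (A : {set D}) (f : {perm D}) (r : D) : Prop := Tri {
  t_r : r \in A;
  t_al : forall x, x \in A -> al x \in A;
  t_f : forall x, x \in A -> f x \in A;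
  t_conn : forall C : {set D}, r \in C -> C \subset A -> (forall x, x \in C -> al x \in C) ->
     (forall x, x \in C -> f x \in C) -> A \subset C;
  t_euler : cyc al A + cyc f A + cyc (al * f) A = #|A| + 2;
  t_size : f r != r;
  t_simple : {in porbit f r &, forall x y, y \in porbit (al * f) x -> x = y};
  t_tri : forall x, x \in A -> x \notin porbit f r -> f x != x /\ f (f (f x)) = x;
  t_loop : forall x, x \in A -> al x \notin porbit (al * f) x }.

Definition coded (A : {set D}) (f : {perm D}) (r : D) (c : code) (h : dt c -> D) :=
  [/\ wf c, injective h, h @: [set: dt c] = A, h (root c) = r
   & forall x, h (alpha x) = al (h x) /\ h (phi x) = f (h x)].

Section peel.
Variables (A : {set D}) (f : {perm D}) (r : D).
Hypothesis T : tri A f r.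
Let b := al r.
Let l := f b.
Let r' := f l.
Let w := f r.
Let z := f^-1 r.
Let rho := al * f.
Let rhoE x : rho x = f (al x). Proof. by rewrite permM. Qed.

Hypothesis bE : b \notin porbit f r.

Let bA : b \in A. Proof. exact (t_al T (t_r T)). Qed.
Let rA := t_r T.
Let fA := t_f T.
Let lA : l \in A. Proof. exact: fA. Qed.
Let r'A : r' \in A. Proof. exact: fA. Qed.
Let wA : w \in A. Proof. exact: fA. Qed.
Let extf x : (f x \in porbit f r) = (x \in porbit f r).
Proof.
apply: stab_inv => y; rewrite -!porbit_eq => /eqP <-.
by rewrite porbit_eq mem_porbit1.
Qed.
Let rE : r \in porbit f r. Proof. exact: porbit_id. Qed.
Let lE : l \notin porbit f r. Proof. by rewrite extf. Qed.
Let r'E : r' \notin porbit f r. Proof. by rewrite extf. Qed.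
Let wE : w \in porbit f r. Proof. by rewrite extf. Qed.
Let fz : f z = r. Proof. by rewrite permKV. Qed.
Let zE : z \in porbit f r. Proof. by rewrite -extf fz. Qed.
Let zA : z \in A. Proof. by rewrite -(stab_inv z fA) fz. Qed.
Let fr' : f r' = b. Proof. by have [_] := t_tri T bA bE. Qed.
Let lb : l != b. Proof. by have [] := t_tri T bA bE. Qed.
Let r'l : r' != l. Proof. by have [] := t_tri T lA lE. Qed.
Let r'b : r' != b.
Proof. by apply: contraNneq lb => E; move: fr'; rewrite E -/l => ->. Qed.
Let wr : w != r. Proof. exact: t_size T. Qed.
Let zr : z != r. Proof. by apply: contraNneq wr => E; rewrite /w -[X in f X]E fz. Qed.
Let neqE x y : x \in porbit f r -> y \notin porbit f r -> x != y.
Proof. by move=> xE; apply: contraNneq => <-. Qed.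
Let rl := neqE rE lE. Let rr' := neqE rE r'E. Let rb := neqE rE bE.
Let wl := neqE wE lE. Let wr' := neqE wE r'E. Let wb := neqE wE bE.
Let zl := neqE zE lE. Let zr' := neqE zE r'E. Let zb := neqE zE bE.

Let symn (x y : D) : x != y -> (x != y) * (y != x).
Proof. by move=> xy; rewrite [y == x]eq_sym xy. Qed.
Let nes := (symn lb, symn r'l, symn r'b, symn wr, symn zr, symn rl, symn rr', symn rb,
  symn wl, symn wr', symn wb, symn zl, symn zr', symn zb).

(** The first transposition merges the two faces along the root edge, the other two split off [b]
    and [r] as fixed points. The darts [z] and [r'], which led to [r] and [b], now lead to [l] and
    [w]. *)
Definition peelp : {perm D} := f * tperm r b * tperm b l * tperm r w.
Let f1 := peelp.
Let A1 := A :\ r :\ b.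

Let f1z : f1 z = l.
Proof. by rewrite !permM fz tpermL tpermL tpermD ?nes. Qed.
Let f1r' : f1 r' = w.
Proof. by rewrite !permM fr' tpermR [tperm b l r]tpermD ?nes// tpermL. Qed.
Let f1r : f1 r = r.
Proof. by rewrite !permM -/w [tperm r b w]tpermD ?nes// [tperm b l w]tpermD ?nes// tpermR. Qed.
Let f1b : f1 b = b.
Proof. by rewrite !permM -/l [tperm r b l]tpermD ?nes// tpermR tpermD ?nes. Qed.
Let f1N x : x != z -> x != r' -> x != r -> x != b -> f1 x = f x.
Proof.
move=> xz xr' xr xb; have n1 : r != f x.
  by apply: contraNneq xz => E; rewrite /z E permK.
have n2 : b != f x by rewrite -fr' (inj_eq perm_inj) eq_sym.
have n3 : l != f x by rewrite (inj_eq perm_inj) eq_sym.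
have n4 : w != f x by rewrite (inj_eq perm_inj) eq_sym.
by rewrite !permM !tpermD.
Qed.
Let f1l : f1 l = r'. Proof. by rewrite f1N ?nes. Qed.
Let A1E x : (x \in A1) = [&& x != b, x != r & x \in A].
Proof. by rewrite !inE. Qed.
Let r'A1 : r' \in A1. Proof. by rewrite A1E !nes. Qed.
Let lA1 : l \in A1. Proof. by rewrite A1E !nes. Qed.
Let wA1 : w \in A1. Proof. by rewrite A1E !nes. Qed.
Let zA1 : z \in A1. Proof. by rewrite A1E !nes. Qed.
Let f1A x : x \in A -> f1 x \in A.
Proof. exact: (stab_tperm (stab_tperm (stab_tperm fA rA bA) bA lA) rA wA). Qed.
Let f1A1 x : x \in A1 -> f1 x \in A1.
Proof.
rewrite !A1E => /and3P[xb xr xA]; rewrite f1A// -{1}f1b -{1}f1r.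
by rewrite !(inj_eq perm_inj) xb xr.
Qed.
Let alA1 x : x \in A1 -> al x \in A1.
Proof.
rewrite !A1E => /and3P[xb xr xA]; rewrite (t_al T xA) andbT -{1}(alK r) -/b.
by rewrite (inj_eq perm_inj) xb /b (inj_eq perm_inj) xr.
Qed.

Let A1U : A = A1 :|: [set r; b].
Proof.
apply/setP => x; rewrite !inE; have [->|] := eqVneq x r; first by rewrite rA orbT.
by have [->|] := eqVneq x b; rewrite ?bA ?orbT//= orbF.
Qed.
Let A1D : [disjoint A1 & [set r; b]].
Proof. by rewrite disjoint_sym disjoints_subset; apply/subsetP => x; rewrite !inE => /orP[] /eqP ->; rewrite eqxx ?andbF. Qed.
Let cardA : #|A| = (#|A1| + 2)%N.
Proof. by rewrite A1U cardsU (disjoint_setI0 A1D) cards0 subn0 cards2 rb. Qed.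

Let cycA s : (forall x, x \in A1 -> s x \in A1) -> cyc s A = (cyc s A1 + cyc s [set r; b])%N.
Proof. by move=> sA1; rewrite {1}A1U cyc_disj. Qed.

Let cyc2 s : s r = b -> s b = r -> cyc s [set r; b] = 1%N.
Proof.
move=> sr sb; rewrite /cyc imsetU1 imset_set1.
have -> : porbit s b = porbit s r by apply/eqP; rewrite porbit_eq -sr mem_porbit1.
by rewrite setUid cards1.
Qed.

Let rho1 := al * f1.
Let rho1E x : rho1 x = f1 (al x). Proof. by rewrite permM. Qed.
Let rho1M : rho1 = rho * tperm r b * tperm b l * tperm r w.
Proof. by rewrite /rho1 /f1 /peelp !mulgA. Qed.
Let alb : al b = r. Proof. exact: alK. Qed.
Let rhor : rho r = l. Proof. by rewrite rhoE. Qed.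
Let rhob : rho b = w. Proof. by rewrite rhoE alb. Qed.
Let rhoA x : x \in A -> rho x \in A.
Proof. by move=> xA; rewrite rhoE fA// (t_al T). Qed.

Let cyc_f1 : (cyc f1 A1).+1 = cyc f A.
Proof.
have E : cyc f1 A = (cyc f1 A1 + 2)%N.
  rewrite cycA//; congr addn; rewrite /cyc imsetU1 imset_set1 cardsU1 cards1 inE porbit_eq.
  suff -> : r \in porbit f1 b = false by [].
  apply/negbTE/negP => /porbitP[i]; suff -> : (f1 ^+ i) b = b by move/eqP; rewrite (negbTE rb).
  by elim: i => [|i IH]; [rewrite expg0 perm1|rewrite expgSr permM IH f1b].
have bE' : r \notin porbit f b by rewrite porbit_sym.
have [m1 _] := cyc_merge fA rA bA bE'.
have fa := stab_tperm fA rA bA; have fb := stab_tperm fa bA lA.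
have e2 : cyc (f * tperm r b * tperm b l) A = (cyc (f * tperm r b) A).+1.
  apply: cyc_split => //; first by rewrite eq_sym.
  rewrite porbit_sym; have <- : (f * tperm r b) b = l; last exact: mem_porbit1.
  by rewrite permM tpermD// eq_sym.
have e3 : cyc f1 A = (cyc (f * tperm r b * tperm b l) A).+1.
  apply: cyc_split => //; first by rewrite eq_sym.
  rewrite porbit_sym; have <- : (f * tperm r b * tperm b l) r = w; last exact: mem_porbit1.
  by rewrite !permM -/w !tpermD// eq_sym.
move: E m1 e2 e3; clear; lia.
Qed.

Let cyc_rho1 : cyc rho1 A1 = cyc rho A.
Proof.
have rho1A1 x : x \in A1 -> rho1 x \in A1 by move=> xA; rewrite rho1E f1A1// alA1.
have E : cyc rho1 A = (cyc rho1 A1 + 1)%N.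
  by rewrite cycA// cyc2// rho1E ?alb ?f1r// -/b f1b.
have bE' : r \notin porbit rho b by rewrite porbit_sym; exact: t_loop T _ rA.
have [m1 rb1] := cyc_merge rhoA rA bA bE'.
have fa := stab_tperm rhoA rA bA; have fb := stab_tperm fa bA lA.
have ral : (rho * tperm r b) r = l by rewrite permM rhor tpermD// eq_sym.
have rab : (rho * tperm r b) b = w by rewrite permM rhob tpermD// eq_sym.
have e2 : cyc (rho * tperm r b * tperm b l) A = (cyc (rho * tperm r b) A).+1.
  apply: cyc_split => //; first by rewrite eq_sym.
  rewrite porbit_sym -ral.
  have /eqP <- : porbit (rho * tperm r b) r == porbit (rho * tperm r b) b by rewrite porbit_eq.
  exact: mem_porbit1.
have e3 : cyc rho1 A = (cyc (rho * tperm r b * tperm b l) A).+1.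
  rewrite rho1M; apply: cyc_split => //; first by rewrite eq_sym.
  rewrite porbit_sym; apply/porbitP; exists 2.
  have s1 : (rho * tperm r b * tperm b l) r = b by rewrite permM ral tpermR.
  have s2 : (rho * tperm r b * tperm b l) b = w by rewrite permM rab tpermD// eq_sym.
  by rewrite expgS expg1 permM s1 s2.
move: E m1 e2 e3; clear; lia.
Qed.

(** One edge and one face are lost and no vertex, so Euler's relation survives the removal. *)
Let euler1 : (cyc al A1 + cyc f1 A1 + cyc rho1 A1 = #|A1| + 2)%N.
Proof.
have := t_euler T; rewrite -cyc_f1 -/rho -cyc_rho1 cardA cycA// cyc2// ?alb//; clear; lia.
Qed.

Let rho1_sub x y : x \in A1 -> y \in porbit rho1 x -> y \in porbit rho x.
Proof.
move=> xA /porbitP[i ->]; elim: i => [|i IH]; first by rewrite expg0 perm1 porbit_id.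
have : (rho1 ^+ i) x \in A1 by apply: stab_iter => // y' h; rewrite rho1E f1A1// alA1.
rewrite expgSr permM; move: ((rho1 ^+ i) x) IH => u uP uA; rewrite rho1E.
have up v : v \in porbit rho u -> v \in porbit rho x.
  by move: uP; rewrite -!porbit_eq => /eqP -> .
have [E|nz] := eqVneq (al u) z.
  rewrite E f1z -rhor; apply: up.
  by apply/porbitP; exists 2; rewrite expgS expg1 [RHS]permM [rho u]rhoE E fz.
have [E|nr'] := eqVneq (al u) r'.
  rewrite E f1r' -rhob; apply: up.
  by apply/porbitP; exists 2; rewrite expgS expg1 [RHS]permM [rho u]rhoE E fr'.
have := alA1 uA; rewrite A1E => /and3P[ub ur _].
by rewrite f1N// -rhoE; apply: up; exact: mem_porbit1.
Qed.

Let rho1_sup x y : x \in A1 -> y \in A1 -> y \in porbit rho x -> y \in porbit rho1 x.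
Proof.
move=> xA yA yx; pose C := [set u | [|| u \in porbit rho1 x, (u == r) && (l \in porbit rho1 x) | (u == b) && (w \in porbit rho1 x)]].
have p1 u : u \in porbit rho1 x -> rho1 u \in porbit rho1 x.
  by rewrite -!porbit_eq => /eqP <-; rewrite porbit_eq mem_porbit1.
have CP u : u \in C -> rho u \in C.
  rewrite !inE => /or3P[uP|/andP[/eqP -> lP]|/andP[/eqP -> wP]]; last 2 first.
  - by rewrite rhor lP.
  - by rewrite rhob wP.
  have := p1 u uP; rewrite rho1E rhoE.
  have [E|nz] := eqVneq (al u) z; first by rewrite E f1z fz eqxx => ->; rewrite orbT.
  have [E|nr'] := eqVneq (al u) r'; first by rewrite E f1r' fr' eqxx => ->; rewrite !orbT.
  have uA : u \in A1 by apply: (stab_porbit (s := rho1) _ xA) => // v h; rewrite rho1E f1A1// alA1.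
  have := alA1 uA; rewrite A1E => /and3P[ub ur _].
  by rewrite f1N// => ->.
have : y \in C by apply: (stab_porbit CP _ yx); rewrite inE porbit_id.
by move: yA; rewrite A1E inE => /and3P[/negbTE -> /negbTE -> _]; rewrite !orbF.
Qed.

Let p1 u : u \in porbit f1 r' -> f1 u \in porbit f1 r'.
Proof. by rewrite -!porbit_eq => /eqP <-; rewrite porbit_eq mem_porbit1. Qed.

Let ext1E x : (x \in porbit f1 r') = [|| (x \in porbit f r) && (x != r), x == l | x == r'].
Proof.
have l1 : l \in porbit f1 r' by rewrite -(stab_inv l p1) f1l porbit_id.
have w1 : w \in porbit f1 r' by rewrite -f1r' mem_porbit1.
apply/idP/idP => [h|/or3P[/andP[xE xr]|/eqP ->|/eqP ->]]; last 2 first.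
- exact: l1.
- exact: porbit_id.
- pose C := [set u in [pred u | [|| (u \in porbit f r) && (u != r), u == l | u == r']]].
  have : x \in C; last by rewrite !inE.
  apply: (stab_porbit _ _ h); last by rewrite !inE eqxx !orbT.
  move=> u; rewrite !inE => /or3P[/andP[uE ur]|/eqP ->|/eqP ->]; last 2 first.
  + by rewrite f1l eqxx !orbT.
  + by rewrite f1r' wE wr.
  have [->|uz] := eqVneq u z; first by rewrite f1z eqxx orbT.
  rewrite f1N// ?(neqE uE)// extf uE /=; apply/orP; left.
  by apply: contraNneq uz => E; rewrite /z -E permK.
pose C := [set u | (u \in porbit f r) && ((u == r) || (u \in porbit f1 r'))].
have : x \in C; last by rewrite inE xE (negbTE xr).
apply: (stab_porbit _ _ xE); last by rewrite inE eqxx rE.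
move=> u; rewrite !inE => /andP[uE]; rewrite extf uE /=; have [->|ur] := eqVneq u r; first by rewrite w1 orbT.
move=> /= uP; have [->|uz] := eqVneq u z; first by rewrite fz eqxx.
have fu : f1 u = f u by rewrite f1N ?(neqE uE r'E) ?(neqE uE bE).
by have := p1 uP; rewrite fu => ->; rewrite orbT.
Qed.

Let conn1 C : r' \in C -> C \subset A1 -> (forall x, x \in C -> al x \in C) ->
  (forall x, x \in C -> f1 x \in C) -> A1 \subset C.
Proof.
move=> r'C /subsetP CA Cal Cf.
have lC : l \in C by rewrite -(stab_inv l Cf) f1l.
have wC : w \in C by rewrite -f1r' Cf.
have : A \subset C :|: [set r; b].
  apply: (t_conn T) => [|||x]; rewrite ?inE ?eqxx ?orbT//.
  - apply/subsetP => x; rewrite !inE => /orP[/CA|/orP[] /eqP ->]; rewrite ?rA ?bA//.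
    by rewrite A1E => /and3P[].
  - move=> x; rewrite !inE => /orP[/Cal ->//|/orP[] /eqP ->]; rewrite -/b ?alb eqxx ?orbT//.
  - case/orP => [xC|/orP[] /eqP ->]; last 2 first.
    + by rewrite -/w wC.
    + by rewrite -/l lC.
    have [->|xz] := eqVneq x z; first by rewrite fz eqxx orbT.
    have [->|xr'] := eqVneq x r'; first by rewrite fr' eqxx !orbT.
    have := CA _ xC; rewrite A1E => /and3P[xb xr _].
    by rewrite -f1N// Cf.
move/subsetP => sub; apply/subsetP => x; rewrite A1E => /and3P[/negbTE xb /negbTE xr /sub].
by rewrite !inE xb xr !orbF.
Qed.

Let tri1 x : x \in A1 -> x \notin porbit f1 r' -> f1 x = f x /\ x \notin porbit f r.
Proof.
rewrite A1E => /and3P[xb xr xA]; rewrite ext1E !negb_or negb_and negbK (negbTE xr) orbF.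
move=> /and3P[xE xl xr']; split => //; rewrite f1N//.
by apply: contraNneq xE => ->.
Qed.

Let tri3 x : x \in A1 -> x \notin porbit f1 r' -> f1 x != x /\ f1 (f1 (f1 x)) = x.
Proof.
move=> xA xE; have xe u : (f1 u \in porbit f1 r') = (u \in porbit f1 r') by exact: stab_inv.
have [e1 xf] := tri1 xA xE; have xA' : x \in A by move: xA; rewrite A1E => /and3P[].
have [n3 t3] := t_tri T xA' xf.
have xA2 := f1A1 xA; have xA3 := f1A1 xA2.
have xE2 : f1 x \notin porbit f1 r' by rewrite xe.
have xE3 : f1 (f1 x) \notin porbit f1 r' by rewrite xe.
have [e2 _] := tri1 xA2 xE2; have [e3 _] := tri1 xA3 xE3.
by rewrite e3 e2 e1.
Qed.

Let loop1 x : x \in A1 -> al x \notin porbit rho1 x.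
Proof.
move=> xA; apply: contraNN (rho1_sub xA) _.
by apply: (t_loop T); move: xA; rewrite A1E => /and3P[].
Qed.

Let simple1 x y : x \in porbit f1 r' -> y \in porbit f1 r' -> x \in A1 ->
  x != r' -> y != r' -> y \in porbit rho x -> x = y.
Proof.
have lr u : (u \in porbit rho l) = (u \in porbit rho r).
  by rewrite -!porbit_eq -rhor; congr (_ == _); apply/eqP; rewrite porbit_eq mem_porbit1.
rewrite !ext1E => xE yE xA xr' yr'; move: xE yE; rewrite (negbTE xr') (negbTE yr') !orbF.
move=> /orP[/andP[xE xr]|/eqP ->] /orP[/andP[yE yr]|/eqP ->]; first by move=> h; apply: (t_simple T) h.
- rewrite porbit_sym lr porbit_sym => h; have xr2 : x = r by apply: (t_simple T) h.
  by rewrite xr2 eqxx in xr.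
- rewrite lr => h; have xr2 : r = y by apply: (t_simple T) h.
  by move: yr; rewrite -xr2 eqxx.
- by [].
Qed.

(** The third corner is not on the boundary. It joins the boundary after the removal, as the origin
    of the new root [r'], and the boundary stays simple because no other outer dart issues from
    it. *)
Let peelI c (h : dt c -> D) : {in porbit f r, forall y, y \notin porbit rho r'} ->
  tri A1 f1 r' /\ (coded A1 f1 r' h -> exists h', coded A f r (c := CI c) h').
Proof.
move=> nE; split.
  split => //; first by rewrite f1r'.
  move=> x y xE yE yx.
  have xA : x \in A1 by exact: (stab_porbit f1A1 r'A1 xE).
  have {}yx := rho1_sub xA yx.
  have ne u : u \in porbit f1 r' -> u != r' -> u \notin porbit rho r'.
    rewrite ext1E => /or3P[/andP[uE _] _|/eqP -> _|/eqP ->]; last by rewrite eqxx.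
      exact: nE.
    rewrite porbit_sym -rhor; have /eqP -> : porbit rho (rho r) == porbit rho r by rewrite porbit_eq mem_porbit1.
    by rewrite porbit_sym nE.
  have [xr|xr] := eqVneq x r'; have [yr|yr] := eqVneq y r'; rewrite ?xr ?yr//.
  - by move: yx; rewrite xr => yx; have := ne _ yE yr; rewrite yx.
  - by move: yx; rewrite yr porbit_sym => yx; have := ne _ xE xr; rewrite yx.
  - exact: simple1.
move=> [wc hi hA hr hE].
have hf1 x : h (phi x) = f1 (h x) by case: (hE x).
have ic := invP wc.
have hl : h (lst c) = l.
  by apply: (@perm_inj _ f1); rewrite f1l -hf1 (inv_lst ic).
have hA1 x : h x \in A1 by rewrite -hA imset_f ?inE.
pose h' (x : dt (CI c)) := match x with inl d => h d | inr e => if e then r else b end.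
have p1c : (1 < per c)%N.
  have := per_gt0 wc; rewrite leq_eqVlt => /predU1P[p1E|//].
  have := size_tl wc; rewrite -p1E => s1; have [m tE] := inv_head ic wc.
  have m0 : m = [::] by move: s1; rewrite tE; case: (m).
  have lE' : lst c = phi (root c) by rewrite /lst tE m0.
  move: hl; rewrite lE' hf1 hr f1r' => wl'; by move: wl; rewrite wl' eqxx.
exists h'; split => //=.
- by rewrite wc.
- have hN d : (h d == r = false) * (h d == b = false).
    by have := hA1 d; rewrite A1E => /and3P[/negbTE -> /negbTE ->].
  move=> [d|[]] [e|[]] //=; try by move=> E; have := hN d; rewrite E eqxx => -[].
  + by move=> /hi ->.
  + by move=> E; have := hN e; rewrite -E eqxx => -[].
  + by move=> E; move: rb; rewrite E eqxx.
  + by move=> E; have := hN e; rewrite -E eqxx => -[].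
  + by move=> E; move: rb; rewrite E eqxx.
- apply/setP => x; apply/imsetP/idP => [[[d|[]] _ ->]|xA] /=; rewrite ?rA ?bA//.
    by have := hA1 d; rewrite A1E => /and3P[].
  have [->|xr] := eqVneq x r; first by exists (inr true); rewrite ?inE.
  have [->|xb] := eqVneq x b; first by exists (inr false); rewrite ?inE.
  have : x \in h @: [set: dt c] by rewrite hA A1E xr xb.
  by case/imsetP => d _ ->; exists (inl d); rewrite ?inE.
- have fE d : h d != z -> h d != r' -> f (h d) = f1 (h d).
    by move=> n1 n2; have := hA1 d; rewrite A1E => /and3P[n3 n4 _]; rewrite f1N.
  have hz d : (phi d == lst c) = (h d == z).
    by rewrite -(inj_eq hi) hf1 hl -f1z (inj_eq perm_inj).
  move=> [d|[]] /=; split; rewrite ?alb//.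
  + by case: (hE d).
  + rewrite hz -(inj_eq hi) hr; case: eqP => [->|/eqP n1] /=; first by rewrite fr'.
    by case: eqP => [->|/eqP n2] /=; rewrite ?fz// hf1 fE.
  + by rewrite hf1 hr f1r'.
Qed.

(* The third corner [y0] of the root triangle is on the boundary: the map without
   its root edge is cut at that vertex. *)
Section split.
Variable y0 : D.
Hypothesis y0E : y0 \in porbit f r.
Hypothesis y0r' : y0 \in porbit rho r'.

Let prho x : porbit rho (rho x) = porbit rho x.
Proof. by apply/eqP; rewrite porbit_eq mem_porbit1. Qed.

Let y0r : y0 != r.
Proof.
apply: contraNneq (t_loop T lA) => y0r; have : r \in porbit rho r' by rewrite -y0r.
have -> : porbit rho r' = porbit rho (al l) by rewrite -(prho (al l)) rhoE alK.
by rewrite porbit_sym -prho rhor.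
Qed.
Let y0w : y0 != w.
Proof.
apply: contraNneq (t_loop T r'A) => y0w; have : w \in porbit rho r' by rewrite -y0w.
rewrite porbit_sym -rhob prho.
have -> : b = rho (al r') by rewrite rhoE alK fr'.
by rewrite prho porbit_sym.
Qed.
Let y0A : y0 \in A. Proof. exact: (stab_porbit fA rA). Qed.
Let y0l := neqE y0E lE. Let y0r'' := neqE y0E r'E. Let y0b := neqE y0E bE.
Let z1 := f^-1 y0.
Let fz1 : f z1 = y0. Proof. by rewrite permKV. Qed.
Let z1E : z1 \in porbit f r. Proof. by rewrite -extf fz1. Qed.
Let z1r : z1 != r. Proof. by apply: contraNneq y0w => E; rewrite -fz1 E. Qed.
Let z1z : z1 != z. Proof. by apply: contraNneq y0r => E; rewrite -fz1 E fz. Qed.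
Let z1l := neqE z1E lE. Let z1r' := neqE z1E r'E. Let z1b := neqE z1E bE.
Let nes2 := (nes, symn y0r, symn y0w, symn y0l, symn y0r'', symn y0b, symn z1r, symn z1z,
  symn z1l, symn z1r', symn z1b).
Let z1A : z1 \in A. Proof. exact: (stab_porbit fA rA). Qed.
Let f1z1 : f1 z1 = y0. Proof. by rewrite f1N ?nes2. Qed.
Let y0A1 : y0 \in A1. Proof. by rewrite A1E !nes2. Qed.
Let z1A1 : z1 \in A1. Proof. by rewrite A1E !nes2. Qed.

(** The outer darts [r'] and [y0] issue from the same vertex. The transposition separates them in
    the face permutation and in the vertex permutation at once, which is cutting the map at this
    vertex. *)
Definition splitp : {perm D} := f1 * tperm r' y0.
Let f2 := splitp.
Let rho2 := al * f2.
Let f2l : f2 l = y0. Proof. by rewrite permM f1l tpermL. Qed.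
Let f2z1 : f2 z1 = r'. Proof. by rewrite permM f1z1 tpermR. Qed.
Let f2N x : x != l -> x != z1 -> f2 x = f1 x.
Proof.
move=> xl xz; rewrite permM tpermD// eq_sym.
  by rewrite -f1l (inj_eq perm_inj).
by rewrite -f1z1 (inj_eq perm_inj).
Qed.
Let f2r' : f2 r' = w. Proof. by rewrite f2N ?nes2. Qed.
Let f2z : f2 z = l. Proof. by rewrite f2N ?nes2. Qed.
Let f2A1 : forall x, x \in A1 -> f2 x \in A1.
Proof. exact: (stab_tperm f1A1 r'A1 y0A1). Qed.
Let rho2M : rho2 = rho1 * tperm r' y0. Proof. by rewrite /rho2 /f2 /splitp mulgA. Qed.
Let rho2E x : rho2 x = f2 (al x). Proof. by rewrite permM. Qed.
Let rho1A1 x : x \in A1 -> rho1 x \in A1.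
Proof. by move=> xA; rewrite rho1E f1A1// alA1. Qed.
Let y0r1 : y0 \in porbit rho1 r'. Proof. exact: rho1_sup. Qed.

Let rho2_sub x y : x \in A1 -> y \in porbit rho2 x -> y \in porbit rho x.
Proof.
move=> xA yx; apply: rho1_sub => //.
apply: (stab_porbit (s := rho2) _ (porbit_id rho1 x)) => // u; rewrite rho2M permM => ux.
have ux1 : rho1 u \in porbit rho1 x.
  by move: ux; rewrite -!porbit_eq => /eqP <-; rewrite porbit_eq mem_porbit1.
have e0 : porbit rho1 y0 = porbit rho1 r' by apply/eqP; rewrite porbit_eq.
case: tpermP => [E|E|//]; move: ux1; rewrite E porbit_sym ?e0 porbit_sym => h.
  by move: h; rewrite -!porbit_eq e0.
by move: h; rewrite -!porbit_eq -e0.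
Qed.

(** The outer face and the third corner are both split in two, hence 4 in place of 2, which is too
    much for a connected map. *)
Let euler2 : (cyc al A1 + cyc f2 A1 + cyc rho2 A1 = #|A1| + 4)%N.
Proof.
have rE1 : r' \in porbit f1 y0 by rewrite porbit_sym ext1E y0E y0r.
have e1 := cyc_split f1A1 r'A1 y0A1 (symn y0r'').2 rE1.
have rE2 : r' \in porbit rho1 y0 by rewrite porbit_sym.
have e2 := cyc_split rho1A1 r'A1 y0A1 (symn y0r'').2 rE2.
rewrite -/f2 in e1; rewrite -rho2M in e2.
have := euler1; move: e1 e2; rewrite /f2 /splitp; clear; lia.
Qed.

Let rel2 : rel D := fun x y => (y == al x) || (y == f2 x).
Let comp x := [set y | connect rel2 x y].
Let compA x : x \in A1 -> comp x \subset A1.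
Proof.
move=> xA; apply/subsetP => y; rewrite inE => /connectP[p]; elim: p x xA => [x xA _ -> //|u p IH x xA /=].
by move=> /andP[/orP[] /eqP -> up yE]; apply: IH up yE; [exact: alA1|exact: f2A1].
Qed.
Let comp_al x y : y \in comp x -> al y \in comp x.
Proof. by rewrite !inE => h; apply: connect_trans h (connect1 _); rewrite /rel2 eqxx. Qed.
Let comp_f x y : y \in comp x -> f2 y \in comp x.
Proof. by rewrite !inE => h; apply: connect_trans h (connect1 _); rewrite /rel2 eqxx orbT. Qed.
Let comp_id x : x \in comp x. Proof. by rewrite inE connect0. Qed.
Let comp_min x C : x \in C -> (forall y, y \in C -> al y \in C) ->
  (forall y, y \in C -> f2 y \in C) -> comp x \subset C.
Proof.
move=> xC Cal Cf; apply/subsetP => y; rewrite inE => /connectP[p]; elim: p x xC => [x xC _ -> //|u p IH x xC /=].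
by move=> /andP[/orP[] /eqP -> up yE]; apply: IH up yE; [exact: Cal|exact: Cf].
Qed.

Let C1 := comp r'.
Let C2 := comp l.
Let C1A := compA r'A1.
Let C2A := compA lA1.

(** Otherwise the cut map would be connected, and [euler_cyc] would contradict [euler2]. *)
Let lC1 : l \notin C1.
Proof.
apply/negP => lC; have y0C : y0 \in C1 by rewrite -f2l comp_f.
have sub : A1 \subset C1.
  apply: (@conn1 C1); [exact: comp_id|exact: C1A|exact: comp_al|] => x xC.
  have [->|xl] := eqVneq x l; first by rewrite f1l comp_id.
  have [->|xz] := eqVneq x z1; first by rewrite f1z1.
  by rewrite -f2N// comp_f.
have := @euler_cyc _ A1 r' al f2 r'A1 alA1 f2A1; rewrite -/rho2 => h.
have {h}: (cyc al A1 + cyc f2 A1 + cyc rho2 A1 <= #|A1| + 2)%N.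
  apply: h => C rC CA Cal Cf; apply: subset_trans sub _; exact: comp_min.
by rewrite euler2; clear; lia.
Qed.

Let C12 : [disjoint C1 & C2].
Proof.
rewrite disjoint_sym disjoints_subset; apply: comp_min => [|y|y]; rewrite ?inE//.
- by move: lC1; rewrite inE.
- by move=> /negP h; apply/negP => h'; apply: h; rewrite -(alK y); have := @comp_al r' (al y); rewrite !inE; apply.
- move=> h; apply: contraNN h => h; have := @stab_inv _ f2 C1 y (@comp_f r').
  by rewrite !inE h => <-.
Qed.

Let C12U : A1 = C1 :|: C2.
Proof.
apply/eqP; rewrite eqEsubset subUset C1A C2A !andbT; apply: (@conn1 (C1 :|: C2)).
- by rewrite inE comp_id.
- by rewrite subUset C1A C2A.
- by move=> x; rewrite !(in_setU _ C1 C2) => /orP[] /comp_al ->; rewrite ?orbT.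
move=> x; rewrite !(in_setU _ C1 C2) => xC.
have [->|xl] := eqVneq x l; first by rewrite f1l comp_id.
have [->|xz] := eqVneq x z1; first by rewrite f1z1 -f2l (@comp_f l l) ?comp_id ?orbT.
by rewrite -f2N//; case/orP: xC => /comp_f ->; rewrite ?orbT.
Qed.

(** [euler_cyc] bounds each component, and the two bounds add up to the exact value of [euler2]; so
    both are equalities and both components are planar. *)
Let eulers : (cyc al C1 + cyc f2 C1 + cyc rho2 C1 = #|C1| + 2)%N /\
  (cyc al C2 + cyc f2 C2 + cyc rho2 C2 = #|C2| + 2)%N.
Proof.
have h1 : (cyc al C1 + cyc f2 C1 + cyc rho2 C1 <= #|C1| + 2)%N.
  apply: (euler_cyc (comp_id r')); [exact: comp_al|exact: comp_f|].
  by move=> C rC _ Cal Cf; exact: comp_min.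
have h2 : (cyc al C2 + cyc f2 C2 + cyc rho2 C2 <= #|C2| + 2)%N.
  apply: (euler_cyc (comp_id l)); [exact: comp_al|exact: comp_f|].
  by move=> C rC _ Cal Cf; exact: comp_min.
have rhoC x u : u \in comp x -> rho2 u \in comp x by move=> h; rewrite rho2E comp_f// comp_al.
have := euler2; rewrite {1 2 3}C12U !cyc_disj//; last 3 first.
- exact: rhoC. - exact: comp_f. - exact: comp_al.
have -> : #|A1| = (#|C1| + #|C2|)%N by rewrite C12U cardsU (disjoint_setI0 C12) cards0 subn0.
move: h1 h2; clear; lia.
Qed.

Let ext12 x : x \in porbit f1 r' -> (x \in porbit f2 r') || (x \in porbit f2 l).
Proof.
have q u v : v \in porbit f2 u -> f2 v \in porbit f2 u.
  by rewrite -!porbit_eq => /eqP <-; rewrite porbit_eq mem_porbit1.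
move=> xE; pose C := porbit f2 r' :|: porbit f2 l.
have : x \in C; last by rewrite inE.
apply: (stab_porbit _ _ xE); last by rewrite inE porbit_id.
move=> u; rewrite !inE => uC.
have [->|xl] := eqVneq u l; first by rewrite f1l porbit_id.
have [->|xz] := eqVneq u z1; first by rewrite f1z1 -f2l mem_porbit1 orbT.
by rewrite -f2N//; case/orP: uC => /q ->; rewrite ?orbT.
Qed.

Let ext2_sub u x : u \in porbit f1 r' -> x \in porbit f2 u -> x \in porbit f1 r'.
Proof.
move=> uE xE; apply: (@stab_porbit _ f2 (porbit f1 r') u x) => // v vE.
rewrite permM; case: tpermP => [_|_|_ _].
- by rewrite ext1E y0E y0r.
- exact: porbit_id.
- exact: p1.
Qed.
Let lE1 : l \in porbit f1 r'. Proof. by rewrite ext1E eqxx orbT. Qed.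

Let tri_comp u : u \in A1 -> u \in porbit f1 r' ->
  (forall x, x \in comp u -> x \in porbit f1 r' -> x \in porbit f2 u) ->
  forall x, x \in comp u -> x \notin porbit f2 u -> f2 x != x /\ f2 (f2 (f2 x)) = x.
Proof.
move=> uA uE hu x xC xE; have /subsetP CA := compA uA.
have nE y : y \in comp u -> y \notin porbit f2 u -> y \notin porbit f1 r' /\ f2 y = f1 y.
  move=> yC yE; have yE1 : y \notin porbit f1 r' by apply: contra yE; exact: hu.
  split => //; rewrite f2N//; apply: contraNneq yE1 => ->//.
  by rewrite ext1E z1E z1r.
have q v : (f2 v \in porbit f2 u) = (v \in porbit f2 u).
  apply: stab_inv => {}v; rewrite -!porbit_eq => /eqP <-; by rewrite porbit_eq mem_porbit1.
have [x1 e1] := nE x xC xE; have [n3 t3] := tri3 (CA _ xC) x1.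
have xC2 := comp_f xC; have xE2 : f2 x \notin porbit f2 u by rewrite q.
have xC3 := comp_f xC2; have xE3 : f2 (f2 x) \notin porbit f2 u by rewrite q.
have [_ e2] := nE _ xC2 xE2; have [_ e3] := nE _ xC3 xE3.
by rewrite e3 e2 e1.
Qed.

Let loop2 u x : u \in A1 -> x \in comp u -> al x \notin porbit rho2 x.
Proof.
move=> uA /(subsetP (compA uA)) xA; apply: contraNN (rho2_sub xA) _.
by apply: (t_loop T); move: xA; rewrite A1E => /and3P[].
Qed.

Let porbit_comp u x : x \in porbit f2 u -> x \in comp u.
Proof. by move=> xE; apply: (stab_porbit (@comp_f u) (comp_id u) xE). Qed.

Let triC1 : tri C1 f2 r'.
Proof.
split.
- exact: comp_id.
- exact: comp_al.
- exact: comp_f.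
- by move=> C rC _ Cal Cf; exact: comp_min.
- by case: eulers.
- by rewrite f2r'.
- move=> x y xE yE yx.
  have [xC yC] := (porbit_comp xE, porbit_comp yE).
  have xA := subsetP C1A _ xC; have yA := subsetP C1A _ yC.
  have xE1 := ext2_sub (porbit_id f1 r') xE; have yE1 := ext2_sub (porbit_id f1 r') yE.
  have {}yx := rho2_sub xA yx.
  have y0C : y0 \notin C1.
    by rewrite (disjointFl C12)// -f2l comp_f ?comp_id.
  have key v : v \in C1 -> v \in porbit f1 r' -> v != r' -> v \notin porbit rho r'.
    move=> vC vE vr'; apply: contraNN y0C => vr.
    have vA := subsetP C1A _ vC.
    have -> // : y0 = v.
    apply: (t_simple T) => //.
      move: vE; rewrite ext1E (negbTE vr') orbF => /orP[/andP[]//|/eqP vl].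
      by move: vC; rewrite vl (negbTE lC1).
    by move: vr y0r'; rewrite -!porbit_eq => /eqP -> /eqP ->.
  have [xr|xr] := eqVneq x r'; have [yr|yr] := eqVneq y r'; rewrite ?xr ?yr//.
  + by move: yx; rewrite xr => yx; have := key _ yC yE1 yr; rewrite yx.
  + by move: yx; rewrite yr porbit_sym => yx; have := key _ xC xE1 xr; rewrite yx.
  + exact: simple1.
- apply: tri_comp => //; first exact: porbit_id.
  move=> x xC /ext12/orP[//|/porbit_comp xC2].
  by move: xC; rewrite (disjointFl C12 xC2).
- by move=> x; apply: loop2.
Qed.

Let triC2 : tri C2 f2 l.
Proof.
have r'C2 : r' \notin C2 by rewrite (disjointFr C12) ?comp_id.
split.
- exact: comp_id.
- exact: comp_al.
- exact: comp_f.
- by move=> C rC _ Cal Cf; exact: comp_min.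
- by case: eulers.
- by rewrite f2l !nes2.
- move=> x y xE yE yx.
  have [xC yC] := (porbit_comp xE, porbit_comp yE).
  have xA := subsetP C2A _ xC.
  have nr v : v \in C2 -> v != r' by apply: contraTneq => ->.
  apply: simple1 => //; rewrite ?nr ?(ext2_sub lE1)//.
  exact: rho2_sub.
- apply: tri_comp => // x xC /ext12/orP[/porbit_comp xC1|//].
  by move: xC; rewrite (disjointFr C12 xC1).
- by move=> x; apply: loop2.
Qed.

Let peelS c1 c2 (h1 : dt c1 -> D) (h2 : dt c2 -> D) :
  coded C1 f2 r' h1 -> coded C2 f2 l h2 -> exists h, coded A f r (c := CS c1 c2) h.
Proof.
move=> [w1 i1 A1h r1 E1] [w2 i2 A2h r2 E2].
have h1f x : h1 (phi x) = f2 (h1 x) by case: (E1 x).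
have h2f x : h2 (phi x) = f2 (h2 x) by case: (E2 x).
have h1C x : h1 x \in C1 by rewrite -A1h imset_f ?inE.
have h2C x : h2 x \in C2 by rewrite -A2h imset_f ?inE.
have CA v : v \in A1 -> (v == r = false) * (v == b = false) * (v \in A).
  by rewrite A1E => /and3P[/negbTE -> /negbTE -> ->].
have h1A x := CA _ (subsetP C1A _ (h1C x)); have h2A x := CA _ (subsetP C2A _ (h2C x)).
have h12 x y : (h1 x == h2 y) = false.
  by apply/eqP => E; have := h1C x; rewrite E (disjointFl C12 (h2C y)).
pose h (x : dt (CS c1 c2)) := match x with
  inl (inl d) => h1 d | inl (inr d) => h2 d | inr e => if e then r else b end.
exists h; split => //=.
- by rewrite w1.
- have n1 x : h1 x <> r by move=> E; have := h1A x; rewrite E eqxx => -[[]].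
  have n2 x : h1 x <> b by move=> E; have := h1A x; rewrite E eqxx => -[[]].
  have n3 x : h2 x <> r by move=> E; have := h2A x; rewrite E eqxx => -[[]].
  have n4 x : h2 x <> b by move=> E; have := h2A x; rewrite E eqxx => -[[]].
  have n5 x y : h1 x <> h2 y by apply/eqP; rewrite h12.
  have n6 : r <> b by apply/eqP; rewrite rb.
  move=> [[x|x]|[]] [[y|y]|[]] //= E; first
    [by rewrite (i1 _ _ E)|by rewrite (i2 _ _ E)|by case: (n1 _ E)|by case: (n2 _ E)
    |by case: (n3 _ E)|by case: (n4 _ E)|by case: (n5 _ _ E)|by case: (n6 E)|by case: (n1 _ (esym E))
    |by case: (n2 _ (esym E))|by case: (n3 _ (esym E))|by case: (n4 _ (esym E))
    |by case: (n5 _ _ (esym E))|by case: (n6 (esym E))].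
- apply/setP => x; apply/imsetP/idP => [[[[d|d]|[]] _ ->]|xA] /=; rewrite ?rA ?bA ?h1A ?h2A//.
  have [->|xr] := eqVneq x r; first by exists (inr true); rewrite ?inE.
  have [->|xb] := eqVneq x b; first by exists (inr false); rewrite ?inE.
  have : x \in C1 :|: C2 by rewrite -C12U A1E xr xb.
  rewrite inE -A1h -A2h => /orP[] /imsetP[d _ ->]; first by exists (inl (inl d)); rewrite ?inE.
  by exists (inl (inr d)); rewrite ?inE.
- have zC : z \in C2 by rewrite -(stab_inv z (@comp_f l)) f2z comp_id.
  have z1C : z1 \in C1 by rewrite -(stab_inv z1 (@comp_f r')) f2z1 comp_id.
  have nC1 x v : v \in C2 -> h1 x != v.
    by move=> vC; apply/eqP => E; have := disjointFr C12 (h1C x); rewrite E vC.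
  have nC2 x v : v \in C1 -> h2 x != v.
    by move=> vC; apply/eqP => E; have := disjointFl C12 (h2C x); rewrite E vC.
  have nz x := nC1 x z zC; have nl x := nC1 x l (comp_id l).
  have nz1 x := nC2 x z1 z1C; have nr' x := nC2 x r' (comp_id r').
  have g1 x : h1 x != r' -> h1 x != z1 -> f (h1 x) = f2 (h1 x).
    by move=> ? ?; rewrite f2N// f1N// ?h1A.
  have g2 x : h2 x != l -> h2 x != z -> f (h2 x) = f2 (h2 x).
    by move=> ? ?; rewrite f2N// f1N// ?h2A.
  have e1 x : (phi x == root c1) = (h1 x == z1).
    by rewrite -(inj_eq i1) h1f r1 -f2z1 (inj_eq perm_inj).
  have e2 x : (phi x == root c2) = (h2 x == z).
    by rewrite -(inj_eq i2) h2f r2 -f2z (inj_eq perm_inj).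
  move=> [[d|d]|[]] /=; split; rewrite ?alb//.
  + by case: (E1 d).
  + rewrite e1 -(inj_eq i1) r1; case: eqP => [->|/eqP n1]; first by rewrite /= fr'.
    case: eqP => [->|/eqP n2] /=; first by rewrite fz1 h2f r2 f2l.
    by rewrite h1f g1.
  + by case: (E2 d).
  + rewrite e2 -(inj_eq i2) r2; case: eqP => [->|/eqP n1]; first by rewrite /= r1.
    case: eqP => [->|/eqP n2] /=; first by rewrite fz.
    by rewrite h2f g2.
  + by rewrite h1f r1 f2r'.
Qed.

Lemma peel_split : exists C1 C2 f2 u1 u2, [/\ tri C1 f2 u1, tri C2 f2 u2,
  (#|C1| < #|A|)%N, (#|C2| < #|A|)%N &
  forall c1 c2 (h1 : dt c1 -> D) (h2 : dt c2 -> D), coded C1 f2 u1 h1 -> coded C2 f2 u2 h2 ->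
   exists h, coded A f r (c := CS c1 c2) h].
Proof.
exists C1, C2, f2, r', l; split.
- exact: triC1.
- exact: triC2.
- by rewrite cardA addn2 leqW// ltnS; exact: subset_leq_card C1A.
- by rewrite cardA addn2 leqW// ltnS; exact: subset_leq_card C2A.
- exact: peelS.
Qed.
End split.

Lemma peel_step : exists (cs : code -> code -> code) C1 C2 f2 u1 u2, [/\ tri C1 f2 u1, tri C2 f2 u2,
  (#|C1| < #|A|)%N, (#|C2| < #|A|)%N &
  forall c1 c2 (h1 : dt c1 -> D) (h2 : dt c2 -> D), coded C1 f2 u1 h1 -> coded C2 f2 u2 h2 ->
   exists h, coded A f r (c := cs c1 c2) h].
Proof.
have [/exists_inP[y0 y0E y0r']|nE] := boolP [exists y in porbit f r, y \in porbit rho r'].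
  by have [C1 [C2 [f2 [u1 [u2 H]]]]] := peel_split y0E y0r'; exists CS, C1, C2, f2, u1, u2.
have {}nE : {in porbit f r, forall y, y \notin porbit rho r'}.
  by move=> y yE; apply: contra nE => h; apply/exists_inP; exists y.
have lA1' : (#|A1| < #|A|)%N by rewrite cardA addn2 leqW.
exists (fun c _ => CI c), A1, A1, f1, r', r'; have t1 := (peelI (c := CE) (fun=> r) nE).1.
by split => // c1 c2 h1 h2 H1 _; exact: (peelI h1 nE).2.
Qed.
End peel.

Lemma tri_coded A f r : tri A f r -> exists c (h : dt c -> D), coded A f r h.
Proof.
have [n] := ubnP #|A|; elim: n A f r => // n IH A f r An T.
have [bE|bE] := boolP (al r \in porbit f r); last first.
  have [cs [C1 [C2 [f2 [u1 [u2 [t1 t2 l1 l2 H]]]]]]] := peel_step T bE.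
  have [|c1 [h1 H1]] := IH _ _ _ _ t1; first exact: leq_trans l1 _.
  have [|c2 [h2 H2]] := IH _ _ _ _ t2; first exact: leq_trans l2 _.
  by have [h Hh] := H _ _ _ _ H1 H2; exists (cs c1 c2), h.
(* When both sides of the root edge are on the outer face, simplicity of that face makes it the
   cycle of [r] and [al r], and connectedness makes the map a single edge. *)
have fE x : x \in porbit f r -> f x \in porbit f r.
  by rewrite -!porbit_eq => /eqP <-; rewrite porbit_eq mem_porbit1.
have e1 : al r = f r.
  apply: (t_simple T) => //; first exact/fE/porbit_id.
  by have := mem_porbit1 (al * f) (al r); rewrite permM alK.
have e2 : r = f (al r).
  apply: (t_simple T) => //; [exact: porbit_id|exact: fE|].
  by have := mem_porbit1 (al * f) r; rewrite permM.
exists CE, (fun x => if x then r else al r); split => //=.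
- move=> [] [] // E; first by have := alN r; rewrite -E eqxx.
  by have := alN r; rewrite E eqxx.
- apply/eqP; rewrite eqEsubset; apply/andP; split.
    by apply/subsetP => x /imsetP[[] _ ->]; rewrite ?(t_al T) ?(t_r T).
  apply: (t_conn T).
  + by apply/imsetP; exists true.
  + by apply/subsetP => x /imsetP[[] _ ->]; rewrite ?(t_al T) ?(t_r T).
  + by move=> x /imsetP[[] _ ->]; apply/imsetP; [exists false|exists true; rewrite ?alK].
  + by move=> x /imsetP[[] _ ->]; apply/imsetP; [exists false; rewrite ?e1|exists true; rewrite -?e2].
- by case; split => //=; rewrite ?alK.
Qed.
End surjectivity.

End Peeling.

(** * Labels name the vertices; a rooted map determines its code *)

Module Labels.
Import structures.
Import all_boot all_fingroup.
Import zify.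
Import Codes Euler CodeMaps Peeling.

Definition rt c (d : dt c) := phi (alpha d).

Lemma rt_inj c : wf c -> injective (@rt c).
Proof. by move=> /invP[_ _ _ h _] x y /h /(inv_inj (@alphaK c)). Qed.

Lemma lab_tl c bs k : wf c -> size bs = (per c).+1 -> map (lab bs k) (tl c) = take (per c) bs.
Proof.
elim: c bs k => [|c IH|c1 IH1 c2 IH2] bs k /=; first by case: bs => [|b [|b' []]].
  move=> /andP[wc p1] sb; have p0 := ltnW p1.
  have sb' : size (rcons bs k) = (per c).+1 by rewrite size_rcons sb prednK.
  rewrite -map_comp /dlast size_tl// map_take.
  change (take (per c).-1 (map (lab (rcons bs k) k.+1) (tl c)) = take (per c).-1 bs); rewrite IH//.
  by rewrite -cats1 take_size_cat// sb prednK.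
move=> /andP[w1 w2] sb; rewrite map_cat -!map_comp.
change (map (lab (take (per c1).+1 bs) k) (tl c1) ++ map (lab (drop (per c1) bs) (k + nin c1)) (tl c2)
  = take (per c1 + per c2) bs).
rewrite IH1//; last by rewrite size_takel// sb ltnS leq_addr.
rewrite IH2//; last by rewrite size_drop sb; lia.
by rewrite -take_min (minn_idPl (leqnSn _)) takeD.
Qed.

Lemma lab_lst c bs k : wf c -> size bs = (per c).+1 -> lab bs k (lst c) = last 0 (take (per c) bs).
Proof.
move=> wc sb; rewrite -(lab_tl k wc sb) /lst; have [m [-> _]] := tl_rcons wc.
by rewrite map_rcons !last_rcons.
Qed.

Lemma lab_phi_root c bs k : wf c -> size bs = (per c).+1 -> lab bs k (phi (root c)) = head 0 bs.
Proof.
move=> wc sb; have [m tE] := inv_head (invP wc) wc.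
have := lab_tl k wc sb; rewrite tE; have := per_gt0 wc; case: bs {sb} => [|b bs]; case: (per c) => //= p _; by case.
Qed.

Lemma last_drop (T : Type) (x : T) n s : n < size s -> last x (drop n s) = last x s.
Proof. by move=> ns; rewrite -[in RHS](cat_take_drop n s) last_cat; case: (drop n s) (size_drop n s) => //= /eqP; rewrite eq_sym subn_eq0 leqNgt ns. Qed.

Lemma last_take (T : Type) (x : T) n s : n < size s -> last x (take n.+1 s) = nth x s n.
Proof. by move=> ns; rewrite (take_nth x ns) last_rcons. Qed.

Lemma head_drop (T : Type) (x : T) n s : head x (drop n s) = nth x s n.
Proof. by rewrite -nth0 nth_drop addn0. Qed.

Lemma lab_rt c bs k (d : dt c) : wf c -> size bs = (per c).+1 -> lab bs k (rt d) = lab bs k d.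
Proof.
elim: c bs k d => [|c IH|c1 IH1 c2 IH2] bs k d; first by case: d.
  move=> /= /andP[wc p1] sb; have p0 := ltnW p1.
  have sb' : size (rcons bs k) = (per c).+1 by rewrite size_rcons sb prednK.
  have b0 : 0 < size bs by rewrite sb.
  have hE : head 0 (rcons bs k) = head 0 bs by case: (bs) b0.
  have lE : lab (rcons bs k) k.+1 (lst c) = last 0 bs.
    by rewrite lab_lst// -cats1 take_size_cat// sb prednK.
  case: d => [x|[]]; rewrite /rt /=; last 2 first.
  - by rewrite lE.
  - by rewrite lab_phi_root// hE.
  case: eqP => [ax|_] /=; first by rewrite -hE -(@lab_alpha_root c (rcons bs k) k.+1) -ax alphaK.
  case: eqP => [ax|_] /=; last exact: IH.
  by rewrite -lE -ax; apply: IH.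
move=> /= /andP[w1 w2] sb.
have s1 : size (take (per c1).+1 bs) = (per c1).+1 by rewrite size_takel// sb ltnS leq_addr.
have s2 : size (drop (per c1) bs) = (per c2).+1 by rewrite size_drop sb; lia.
have n1 : per c1 < size bs by rewrite sb ltnS leq_addr.
have hE : head 0 (take (per c1).+1 bs) = head 0 bs by case: (bs).
have lE : last 0 (take (per c1).+1 bs) = head 0 (drop (per c1) bs) by rewrite last_take// head_drop.
case: d => [[x|x]|[]]; rewrite /rt /=; last 2 first.
- by rewrite lab_root last_drop.
- by rewrite lab_phi_root.
- case: eqP => [ax|_] /=; first by rewrite -hE -(@lab_alpha_root c1 _ k) -ax alphaK.
  case: eqP => [ax|_] /=; last exact: IH1.
  by rewrite lab_phi_root// -lE -(@lab_root c1 _ k) -ax; apply: IH1.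
- case: eqP => [ax|_] /=.
    by rewrite lab_root lE -(@lab_alpha_root c2 _ (k + nin c1)) -ax alphaK.
  case: eqP => [ax|_] /=; last exact: IH2.
  by rewrite -(last_drop 0 n1) -(@lab_root c2 _ (k + nin c1)) -ax; apply: IH2.
Qed.

Definition labs c (bs : seq nat) k := bs ++ iota k (nin c).

Lemma mem_labs c bs k x : (x \in labs c bs k) = (x \in bs) || (k <= x < k + nin c).
Proof. by rewrite mem_cat mem_iota. Qed.

Lemma lab_mem c bs k (d : dt c) : wf c -> size bs = (per c).+1 -> lab bs k d \in labs c bs k.
Proof.
have hl (bs' : seq nat) m : size bs' = m.+1 -> (last 0 bs' \in bs') * (head 0 bs' \in bs').
  by case: bs' => //= b s _; rewrite mem_last mem_head.
elim: c bs k d => [|c IH|c1 IH1 c2 IH2] bs k d /= wc sb; rewrite mem_labs.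
- by case: d; rewrite (hl _ _ sb).
- case: d => [d|b]; last by case: b; rewrite (hl _ _ sb).
  case/andP: wc => wc p1.
  have := IH (rcons bs k) k.+1 d wc; rewrite size_rcons sb prednK ?(ltnW p1)// => /(_ erefl).
  rewrite mem_labs mem_rcons inE /=; case: (_ \in bs); rewrite ?orbT//= orbF; lia.
case: d => [[d|d]|b]; last by case: b; rewrite (hl _ _ sb).
  case/andP: wc => w1 w2.
  have := IH1 (take (per c1).+1 bs) k d w1; rewrite size_takel ?sb ?ltnS ?leq_addr// => /(_ erefl).
  rewrite mem_labs => /orP[/mem_take ->//|h]; apply/orP; right; rewrite /=; lia.
case/andP: wc => w1 w2.
have := IH2 (drop (per c1) bs) (k + nin c1) d w2; rewrite size_drop sb => /(_ ltac:(lia)).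
rewrite mem_labs => /orP[/mem_drop ->//|h]; apply/orP; right; rewrite /=; lia.
Qed.

Lemma lab_surj c bs k x : wf c -> size bs = (per c).+1 -> x \in labs c bs k -> exists d : dt c, lab bs k d = x.
Proof.
elim: c bs k => [|c IH|c1 IH1 c2 IH2] bs k /=.
- rewrite mem_labs /=; case: bs => [|b [|b' []]] //= _ _; rewrite !inE => /orP[/orP[]|] /eqP xE.
  + by exists false. + by exists true. + by move/eqP: xE; lia.
- move=> /andP[wc p1] sb; rewrite mem_labs => xm.
  have [|||d dE] := IH (rcons bs k) k.+1 => //; last by exists (inl d).
    by rewrite size_rcons sb prednK// ltnW.
  by rewrite mem_labs mem_rcons inE; case: (x \in bs) xm; rewrite ?orbT//=; lia.
move=> /andP[w1 w2] sb; rewrite mem_labs => xm.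
have [h|h] : x \in labs c1 (take (per c1).+1 bs) k \/ x \in labs c2 (drop (per c1) bs) (k + nin c1).
- rewrite !mem_labs; case/orP: xm => /= [|xm].
    rewrite -{1}(cat_take_drop (per c1) bs) mem_cat => /orP[h|->]; last by right.
    by left; rewrite -addn1 takeD mem_cat h.
  case: (ltnP x (k + nin c1)) => h; [left|right]; apply/orP; right; move: xm h; clear; lia.
- have [|d dE] := IH1 _ _ w1 _ h; first by rewrite size_takel ?sb ?ltnS ?leq_addr//.
  by exists (inl (inl d)).
- have [|d dE] := IH2 _ _ w2 _ h; first by rewrite size_drop sb; lia.
  by exists (inl (inr d)).
Qed.

(** By induction on the code. In a [CI], adding the root edge only inserts a dart in two vertex
    cycles. In a [CS], the cycles of the pieces stay apart except the two at the gluing vertex,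
    which [lnk] joins; the bounds on the labels exclude any other coincidence between the pieces. *)
Lemma lab_inj c bs k (x y : dt c) : wf c -> size bs = (per c).+1 -> uniq bs -> all (fun b => b < k) bs ->
  lab bs k x = lab bs k y -> fconnect (@rt c) x y.
Proof.
elim: c bs k x y => [|c IH|c1 IH1 c2 IH2] bs k x y wc sb ub ab.
- case: bs sb ub {ab} => [|b [|b' []]] //= _; rewrite inE andbT => nb.
  by case: x; case: y => //= E; rewrite ?connect0//; move: nb; rewrite E eqxx.
- have wcI := wc; case/andP: wc => wc p1; have p0 := ltnW p1.
  have ri := rt_inj wcI; have ric := rt_inj wc; have ic := invP wc.
  have sb' : size (rcons bs k) = (per c).+1 by rewrite size_rcons sb prednK.
  have b0 : 0 < size bs by rewrite sb.
  have lE : lab (rcons bs k) k.+1 (lst c) = last 0 bs.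
    by rewrite lab_lst// -cats1 take_size_cat// sb prednK.
  have hE : lab (rcons bs k) k.+1 (phi (root c)) = head 0 bs by rewrite lab_phi_root//; case: (bs) b0.
  have st u : fconnect (@rt (CI c)) (inl u) (inl (rt u)).
    have E : rt (inl u : dt (CI c)) = if alpha u == root c then inr false else
       if rt u == lst c then inr true else inl (rt u) by [].
    have r1 : rt (inr false : dt (CI c)) = inl (phi (root c)) by [].
    have r2 : rt (inr true : dt (CI c)) = inl (lst c) by [].
    apply: (connect_trans (fconnect1 _ _)); rewrite E; case: eqP => [au|_].
      by rewrite /rt au -r1 fconnect1.
    by case: eqP => [->|_]; rewrite ?connect0// -r2 fconnect1.
  have tr u v : fconnect (@rt c) u v -> fconnect (@rt (CI c)) (inl u) (inl v).
    move=> /iter_findex <-; elim: (findex _ _ _) => [|n IHn]; first exact: connect0.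
    by rewrite iterS; apply: connect_trans IHn (st _).
  have ub' : uniq (rcons bs k).
    by rewrite rcons_uniq ub andbT; apply/negP => /(allP ab); rewrite ltnn.
  have ab' : all (fun b => b < k.+1) (rcons bs k).
    by rewrite all_rcons ltnSn; apply: sub_all ab => b /ltnW.
  have inn u : exists2 u', fconnect (@rt (CI c)) u (inl u') & lab bs k u = lab (rcons bs k) k.+1 u'.
    case: u => [u|[]]; first by exists u; rewrite ?connect0.
      by exists (lst c); [exact: fconnect1|rewrite lE].
    by exists (phi (root c)); [exact: fconnect1|rewrite hE].
  have [x' xx' ->] := inn x; have [y' yy' ->] := inn y => /(IH _ _ _ _ wc sb' ub' ab')/tr h.
  by apply: connect_trans xx' (connect_trans h _); rewrite fconnect_sym.
have wcS := wc; case/andP: wc => w1 w2.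
have ri := rt_inj wcS; have i1 := invP w1; have i2 := invP w2.
have s1 : size (take (per c1).+1 bs) = (per c1).+1 by rewrite size_takel// sb ltnS leq_addr.
have s2 : size (drop (per c1) bs) = (per c2).+1 by rewrite size_drop sb /=; lia.
have n1 : per c1 < size bs by rewrite sb ltnS leq_addr.
set b := nth 0 bs (per c1).
have sy := fconnect_sym ri.
have l1 : lab (take (per c1).+1 bs) k (root c1) = b by rewrite lab_root last_take.
have l2 : lab (drop (per c1) bs) (k + nin c1) (phi (root c2)) = b by rewrite lab_phi_root// head_drop.
have E1 u : rt (inl (inl u) : dt (CS c1 c2)) = if alpha u == root c1 then inr false else
   if rt u == root c1 then inl (inr (phi (root c2))) else inl (inl (rt u)) by [].
have E2 u : rt (inl (inr u) : dt (CS c1 c2)) = if alpha u == root c2 then inl (inl (root c1)) else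
   if rt u == root c2 then inr true else inl (inr (rt u)) by [].
have r1 : rt (inr false : dt (CS c1 c2)) = inl (inl (phi (root c1))) by [].
have r2 : rt (inr true : dt (CS c1 c2)) = inl (inr (root c2)) by [].
pose F := fconnect (@rt (CS c1 c2)).
have st1 u : rt u = root c1 \/ F (inl (inl u)) (inl (inl (rt u))).
  have [h|h] := eqVneq (rt u) (root c1); [by left|right].
  apply: (connect_trans (fconnect1 _ _)); rewrite E1 (negbTE h); case: eqP => [au|_]; last exact: connect0.
  by rewrite /rt au -r1; exact: fconnect1.
have st2 u : alpha u = root c2 \/ F (inl (inr u)) (inl (inr (rt u))).
  have [h|h] := eqVneq (alpha u) (root c2); [by left|right].
  apply: (connect_trans (fconnect1 _ _)); rewrite E2 (negbTE h); case: eqP => [->|_]; last exact: connect0.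
  by rewrite -r2; exact: fconnect1.
have o1 u : fconnect (@rt c1) (root c1) u -> F (inl (inl (root c1))) (inl (inl u)).
  move=> /iter_findex <-; elim: (findex _ _ _) => [|n IHn]; first exact: connect0.
  by rewrite iterS; case: (st1 (iter n (@rt c1) (root c1))) => [->|h]; [exact: connect0|exact: connect_trans h].
have o2 u : fconnect (@rt c2) (phi (root c2)) u -> F (inl (inr (phi (root c2)))) (inl (inr u)).
  move=> /iter_findex <-; elim: (findex _ _ _) => [|n IHn]; first exact: connect0.
  rewrite iterS; case: (st2 (iter n (@rt c2) (phi (root c2)))) => [|h]; last exact: connect_trans h.
  by rewrite {2}/rt => ->; exact: connect0.
have tr1 u v : fconnect (@rt c1) u v -> F (inl (inl u)) (inl (inl v)).
  have [h|h] := boolP (fconnect (@rt c1) (root c1) u).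
    by move=> uv; apply: (connect_trans (y := inl (inl (root c1)))); [rewrite sy; exact: o1|apply: o1; exact: connect_trans h uv].
  move=> /iter_findex <-; elim: (findex _ _ _) => [|n IHn]; first exact: connect0.
  rewrite iterS; case: (st1 (iter n (@rt c1) u)) => [E|h']; last exact: connect_trans h'.
  by case/negP: h; rewrite (fconnect_sym (rt_inj w1)) -E -iterS; exact: fconnect_iter.
have tr2 u v : fconnect (@rt c2) u v -> F (inl (inr u)) (inl (inr v)).
  have [h|h] := boolP (fconnect (@rt c2) (phi (root c2)) u).
    by move=> uv; apply: (connect_trans (y := inl (inr (phi (root c2))))); [rewrite sy; exact: o2|apply: o2; exact: connect_trans h uv].
  move=> /iter_findex <-; elim: (findex _ _ _) => [|n IHn]; first exact: connect0.
  rewrite iterS; case: (st2 (iter n (@rt c2) u)) => [E|h']; last exact: connect_trans h'.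
  case/negP: h; rewrite (fconnect_sym (rt_inj w2)) -E -[phi (alpha _)]/(rt _) -iterS; exact: fconnect_iter.
have lnk : F (inl (inl (root c1))) (inl (inr (phi (root c2)))).
  pose u := alpha (lst c1); have ru : rt u = root c1 by rewrite /rt alphaK (inv_lst i1).
  have lr := lst_neq_root i1 w1.
  have E : rt (inl (inl u) : dt (CS c1 c2)) = inl (inr (phi (root c2))).
    by rewrite E1 ru eqxx alphaK (negbTE lr).
  rewrite -E; apply: (connect_trans (y := inl (inl u))); last exact: fconnect1.
  by apply: tr1; rewrite (fconnect_sym (rt_inj w1)) -ru; exact: fconnect1.
have u1 : uniq (take (per c1).+1 bs) by exact: take_uniq.
have u2 : uniq (drop (per c1) bs) by exact: drop_uniq.
have a1 : all (fun b => b < k) (take (per c1).+1 bs) by apply/allP => z /mem_take /(allP ab).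
have a2 : all (fun b => b < k + nin c1) (drop (per c1) bs).
  by apply/allP => z /mem_drop /(allP ab) h; apply: leq_trans h (leq_addr _ _).
have cross u v : lab (take (per c1).+1 bs) k u = lab (drop (per c1) bs) (k + nin c1) v ->
    F (inl (inl u)) (inl (inr v)).
  move=> E; have m1 := lab_mem k u w1 s1; have m2 := lab_mem (k + nin c1) v w2 s2.
  have Eb : lab (take (per c1).+1 bs) k u = b.
    move: m1 m2; rewrite -E !mem_labs => /orP[h1|h1] /orP[h2|h2]; last 3 first.
    - case/andP: h2 => h2 _; have := leq_ltn_trans (leq_trans (leq_addr (nin c1) k) h2) (allP a1 _ h1).
      by rewrite ltnn.
    - by case/andP: h1 => h1 _; have := leq_ltn_trans h1 (allP ab _ (mem_drop h2)); rewrite ltnn.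
    - by case/andP: h1 => _ h1; case/andP: h2 => h2 _; have := leq_ltn_trans h2 h1; rewrite ltnn.
    move: h1 h2; rewrite (take_nth 0 n1) mem_rcons inE => /predU1P[//|h1] h2.
    move: ub; rewrite -(cat_take_drop (per c1) bs) cat_uniq => /and3P[_ /hasPn/(_ _ h2)]; by rewrite h1.
  apply: (connect_trans (y := inl (inl (root c1)))).
    by apply: tr1; apply: (IH1 (take (per c1).+1 bs) k) => //; rewrite Eb l1.
  apply: connect_trans lnk _.
  by apply: tr2; apply: (IH2 (drop (per c1) bs) (k + nin c1)) => //; rewrite -E Eb l2.
have inn u : exists2 u', F u (inl u') & lab bs k u = lab bs k (inl u' : dt (CS c1 c2)).
  case: u => [u|[]]; first by exists u => //; exact: connect0.
    exists (inr (root c2)); first exact: fconnect1.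
    by rewrite /= lab_root last_drop.
  exists (inl (phi (root c1))); first exact: fconnect1.
  by rewrite /= lab_phi_root//; case: (bs).
have [x' xx' ->] := inn x; have [y' yy' ->] := inn y.
move=> h; apply: connect_trans xx' _; rewrite sy; apply: connect_trans yy' _; rewrite sy.
case: x' y' h => [u|u] [v|v] /= h.
- by apply: tr1; apply: (IH1 (take (per c1).+1 bs) k).
- exact: cross.
- by rewrite sy; apply: cross.
- by apply: tr2; apply: (IH2 (drop (per c1) bs) (k + nin c1)).
Qed.

Lemma lab_eq c bs k (x y : dt c) : wf c -> size bs = (per c).+1 -> uniq bs -> all (fun b => b < k) bs ->
  (lab bs k x == lab bs k y) = fconnect (@rt c) x y.
Proof.
move=> wc sb ub ab; apply/eqP/idP => [|/iter_findex <-]; first exact: lab_inj.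
by elim: (findex _ _ _) => //= n ->; rewrite lab_rt.
Qed.

Lemma card_dt c : wf c -> #|dt c| = (2 * per c - 1 + 3 * nin c).*2.
Proof.
elim: c => [|c IH /= /andP[/IH E p1]|c1 IH1 c2 IH2 /= /andP[w1 w2]]; first by rewrite card_bool.
  by rewrite card_sum card_bool E; lia.
have := per_gt0 w1; have := per_gt0 w2; rewrite !card_sum card_bool IH1// IH2//; lia.
Qed.

Lemma alpha_phi_closed c (A : {set dt c}) : wf c -> root c \in A ->
  (forall d, d \in A -> alpha d \in A) -> (forall d, d \in A -> phi d \in A) -> A = setT.
Proof.
elim: c A => [|c IH|c1 IH1 c2 IH2] A wc rA aA pA; apply/setP => x; rewrite [RHS]inE.
- by case: x; [exact: rA|exact: (aA true)].
- have ic : inv (CI c) := invP wc; case/andP: wc => wc p1; have icc := invP wc.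
  have fA : inr false \in A by exact: (aA (inr true)).
  have h1 : inl (phi (root c)) \in A := pA _ rA.
  have h2 : inl (lst c) \in A := pA _ fA.
  have lr := lst_neq_root icc wc.
  have B : [set d | inl d \in A] = setT.
    apply: IH => // [|d|d]; rewrite !inE.
    - by have := pA _ h2; rewrite /= (negbTE lr) (inv_lst icc) eq_sym (negbTE lr).
    - exact: aA.
    - move=> /pA /=; have [->//|_] := eqVneq d (root c).
      by have [->|] := eqVneq (phi d) (lst c).
  case: x => [x|[]] //; have : x \in [set d | inl d \in A] by rewrite B inE.
  by rewrite inE.
case/andP: wc => w1 w2; have i1 := invP w1; have i2 := invP w2.
have fA : inr false \in A by exact: (aA (inr true)).
have h1 : inl (inl (phi (root c1))) \in A := pA _ rA.
have h2 : inl (inr (root c2)) \in A := pA _ fA.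
have h3 : inl (inl (root c1)) \in A by have := pA _ h2; rewrite /= eqxx.
have B1 : [set d | inl (inl d) \in A] = setT.
  apply: IH1 => // [|d|d]; rewrite !inE ?h3//; first exact: aA.
  move=> /pA /=; have [->//|_] := eqVneq d (root c1).
  by have [->|] := eqVneq (phi d) (root c1).
have h4 : inl (inr (phi (root c2))) \in A.
  have : lst c1 \in [set d | inl (inl d) \in A] by rewrite B1 inE.
  by rewrite inE => /pA /=; rewrite (negbTE (lst_neq_root i1 w1)) (inv_lst i1) eqxx.
have B2 : [set d | inl (inr d) \in A] = setT.
  apply: IH2 => // [|d|d]; rewrite !inE ?h2//; first exact: aA.
  move=> /pA /=; have [->//|_] := eqVneq d (root c2).
  by have [->|] := eqVneq (phi d) (root c2).
case: x => [[x|x]|[]] //.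
- have : x \in [set d | inl (inl d) \in A] by rewrite B1 inE.
  by rewrite inE.
- have : x \in [set d | inl (inr d) \in A] by rewrite B2 inE.
  by rewrite inE.
Qed.

Section cycles.
Variables (D : finType) (s : {perm D}).

Lemma iter_perm i x : iter i s x = (s ^+ i)%g x.
Proof. by elim: i => [|i IH]; rewrite ?expg0 ?perm1// expgSr permM -IH. Qed.

Lemma porbit_fconnect x y : (y \in porbit s x) = fconnect s x y.
Proof.
apply/porbitP/idP => [[i ->]|/iter_findex <-]; first by rewrite -iter_perm fconnect_iter.
by exists (findex s x y); rewrite iter_perm.
Qed.

Lemma card_cycles : \sum_(B in porbit s @: [set: D]) #|B| = #|D|.
Proof.
have tI : trivIset (porbit s @: [set: D]).
  apply/trivIsetP => _ _ /imsetP[x _ ->] /imsetP[y _ ->] xy; rewrite -setI_eq0.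
  apply/eqP/setP => z; rewrite !inE; apply/negbTE; apply: contra xy => /andP[].
  by rewrite -!porbit_eq => /eqP -> /eqP ->.
rewrite -cardsT; move/eqP: tI => ->; apply: eq_card => x; rewrite inE; apply/bigcupP.
by exists (porbit s x); rewrite ?porbit_id// imset_f.
Qed.

Lemma card_porbit2 x : s x != x -> s (s x) = x -> #|porbit s x| = 2.
Proof.
move=> n1 e; have -> : porbit s x = [set x; s x]; last by rewrite cards2 eq_sym n1.
apply/eqP; rewrite eqEsubset; apply/andP; split; apply/subsetP => y.
  move=> h; have : y \in [set x; s x]; last by [].
  apply: (stab_porbit _ _ h); rewrite ?inE ?eqxx// => z.
  by rewrite !inE => /orP[] /eqP ->; rewrite ?e eqxx ?orbT.
by rewrite !inE => /orP[] /eqP ->; rewrite ?porbit_id ?mem_porbit1.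
Qed.

Lemma card_porbit3 x : s x != x -> s (s (s x)) = x -> #|porbit s x| = 3.
Proof.
move=> n1 e; have -> : porbit s x = x |: [set s x; s (s x)].
  apply/eqP; rewrite eqEsubset; apply/andP; split; apply/subsetP => y.
    move=> h; have : y \in x |: [set s x; s (s x)]; last by [].
    apply: (stab_porbit _ _ h); rewrite ?inE ?eqxx// => z.
    by rewrite !inE => /or3P[] /eqP ->; rewrite ?e eqxx ?orbT.
  rewrite !inE => /or3P[] /eqP ->; rewrite ?porbit_id ?mem_porbit1//.
  have := mem_porbit1 s (s x); have := mem_porbit1 s x; rewrite -!porbit_eq => /eqP ->.
  by move/eqP ->.
have n2 : s x != s (s x) by rewrite (inj_eq perm_inj) eq_sym.
rewrite cardsU1 cards2 n2 !inE negb_or eq_sym n1 /=.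
by have -> : x != s (s x) by apply: contra n1 => /eqP h; rewrite -{2}e -h.
Qed.

Lemma card_cyc_lab (T : eqType) (g : D -> T) : (forall x y, (g x == g y) = (y \in porbit s x)) ->
  cyc s [set: D] = size (undup (map g (enum D))).
Proof.
move=> H; pose F (B : {set D}) := omap g [pick x in B].
have FE x : F (porbit s x) = Some (g x).
  rewrite /F; case: pickP => [y /= xy|/(_ x)]; last by rewrite porbit_id.
  by congr Some; apply/eqP; rewrite eq_sym H.
have -> : cyc s [set: D] = size (undup (map (porbit s) (enum D))).
  rewrite /cyc -(card_uniqP (undup_uniq _)); apply: eq_card => B; rewrite mem_undup; apply/imsetP/mapP => -[x _ ->].
    by exists x; rewrite ?mem_enum.
  by exists x; rewrite ?inE.
rewrite -[LHS](size_map F) -[RHS](size_map Some).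
apply/eqP; rewrite eqn_leq; apply/andP; split; apply: uniq_leq_size.
- rewrite map_inj_in_uniq ?undup_uniq// => A B; rewrite !mem_undup => /mapP[x _ ->] /mapP[y _ ->].
  by rewrite !FE => -[] /eqP; rewrite H -porbit_eq => /eqP.
- move=> y /mapP[A]; rewrite mem_undup => /mapP[x xe AE] yE; rewrite yE AE FE.
  by apply: map_f; rewrite mem_undup map_f.
- by rewrite map_inj_uniq ?undup_uniq// => ? ? [].
- move=> y /mapP[a]; rewrite mem_undup => /mapP[x xe aE] yE; rewrite yE aE -FE.
  by apply: map_f; rewrite mem_undup map_f.
Qed.
End cycles.

Definition stdb P := iota 0 P.+1.

Section counts.
Variable c : code.
Hypothesis wc : wf c.
Let ic := invP wc.

Definition pal : {perm dt c} := perm (inv_inj (@alphaK c)).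
Definition pph : {perm dt c} := perm (inv_phi ic).

Lemma palE x : pal x = alpha x. Proof. by rewrite permE. Qed.
Lemma pphE x : pph x = phi x. Proof. by rewrite permE. Qed.
Lemma prtE x : (pal * pph)%g x = rt x. Proof. by rewrite permM palE pphE. Qed.

Lemma fconnect_eq (T : finType) (f g : T -> T) : f =1 g -> fconnect f =2 fconnect g.
Proof. by move=> fg; apply: eq_fconnect. Qed.

Lemma porbit_rt x y : (y \in porbit (pal * pph)%g x) = fconnect (@rt c) x y.
Proof. by rewrite porbit_fconnect; apply: fconnect_eq; exact: prtE. Qed.

Lemma stdb_size : size (stdb (per c)) = (per c).+1. Proof. by rewrite size_iota. Qed.
Lemma stdb_uniq : uniq (stdb (per c)). Proof. exact: iota_uniq. Qed.
Lemma stdb_lt : all (fun b => b < (per c).+1) (stdb (per c)).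
Proof. by apply/allP => b; rewrite mem_iota. Qed.

Definition slab (d : dt c) := lab (stdb (per c)) (per c).+1 d.

Lemma slab_eq x y : (slab x == slab y) = fconnect (@rt c) x y.
Proof. exact: (lab_eq x y wc stdb_size stdb_uniq stdb_lt). Qed.

Lemma slab_mem x : slab x < (per c).+1 + nin c.
Proof. by have := lab_mem (per c).+1 x wc stdb_size; rewrite mem_labs mem_iota -/(slab x); move: (slab x) => l; case/orP => /andP[_]; [exact: ltn_addr|]. Qed.

Lemma slab_surj l : l < (per c).+1 + nin c -> exists d : dt c, slab d = l.
Proof.
move=> lb; apply: (lab_surj wc stdb_size); rewrite mem_labs mem_iota.
by move: lb; rewrite add0n; case: (ltnP l (per c).+1) => //= h; rewrite h.
Qed.

Lemma card_vertices : cyc (pal * pph)%g [set: dt c] = ((per c).+1 + nin c)%N.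
Proof.
rewrite (@card_cyc_lab _ _ _ slab) => [|x y]; last by rewrite porbit_rt slab_eq.
rewrite -(size_iota 0 ((per c).+1 + nin c)); apply/perm_size/uniq_perm; rewrite ?undup_uniq ?iota_uniq//.
move=> l; rewrite mem_undup mem_iota add0n /=; apply/mapP/idP => [[d _ ->]|/slab_surj[d <-]]; first exact: slab_mem.
by exists d; rewrite ?mem_enum.
Qed.

Lemma card_edges : (cyc pal [set: dt c]).*2 = #|dt c|.
Proof.
rewrite -(card_cycles pal) /cyc -sum1_card -muln2 big_distrl /=; apply: eq_bigr => _ /imsetP[x _ ->].
by rewrite card_porbit2 ?palE ?alpha_neq// alphaK.
Qed.

Lemma ext_cycle : fcycle (@phi c) (ext c).
Proof.
rewrite /ext /=; have := inv_path ic; rewrite /fpath_tl rcons_path => ->.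
by rewrite /= -/(lst c) (inv_lst ic) eqxx.
Qed.

Lemma ext_fconnect d : (d \in ext c) = fconnect (@phi c) (root c) d.
Proof. by rewrite (fconnect_cycle ext_cycle)// mem_head. Qed.

Lemma ext_porbit d : (d \in porbit pph (root c)) = (d \in ext c).
Proof. by rewrite porbit_fconnect ext_fconnect; apply: fconnect_eq; exact: pphE. Qed.

Lemma size_ext : size (ext c) = (per c).+1. Proof. by rewrite /= size_tl. Qed.

Lemma card_faces : (per c).+1 + 3 * (cyc pph [set: dt c]).-1 = #|dt c|.
Proof.
rewrite -(card_cycles pph) /cyc (bigD1 (porbit pph (root c))) ?imset_f//=; congr addn.
  rewrite -size_ext; apply/esym; rewrite -(card_uniqP (inv_uniq ic)); apply: eq_card => x; exact: ext_porbit.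
rewrite (cardD1 (porbit pph (root c))) imset_f//= mulnC -sum_nat_const; apply: eq_big => [B|B]; first by rewrite !inE andbC.
rewrite inE => /andP[xr /imsetP[x _ BE]]; rewrite {}BE in xr *.
apply/esym/card_porbit3; rewrite !pphE.
  have xe : x \notin ext c by rewrite -ext_porbit -porbit_eq.
  by case: (inv_tri ic xe).
have xe : x \notin ext c by rewrite -ext_porbit -porbit_eq.
by case: (inv_tri ic xe).
Qed.

Lemma slab_tl : map slab (tl c) = iota 0 (per c).
Proof. by rewrite (lab_tl _ wc stdb_size) /stdb -addn1 iotaD take_size_cat// size_iota. Qed.

Lemma slab_root : slab (root c) = per c.
Proof. by rewrite /slab lab_root /stdb -addn1 iotaD last_cat. Qed.

Lemma ext_vertex x y : x \in ext c -> y \in ext c -> fconnect (@rt c) x y -> x = y.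
Proof.
move=> xe ye; rewrite -slab_eq => /eqP E.
have um : uniq (map slab (ext c)).
  by rewrite /ext map_cons slab_tl slab_root cons_uniq iota_uniq mem_iota ltnn.
rewrite -(nth_index (root c) xe) -(nth_index (root c) ye); congr nth.
apply/eqP; rewrite -(nth_uniq 0 _ _ um) ?size_map ?index_mem//.
by rewrite !(nth_map (root c)) ?index_mem// !nth_index// E.
Qed.

Lemma ext_lab x : x \in ext c -> slab x <= per c.
Proof. by rewrite inE => /predU1P[->|/(map_f slab)]; rewrite ?slab_root// slab_tl mem_iota => /ltnW. Qed.

Lemma no_loop x : ~~ fconnect (@rt c) x (alpha x).
Proof.
have G : forall c bs k (x : dt c), wf c -> size bs = (per c).+1 -> uniq bs -> all (fun b => b < k) bs ->
    lab bs k x != lab bs k (alpha x).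
  clear; elim=> [|c IH|c1 IH1 c2 IH2] bs k x.
  - by case: bs => [|b [|b' []]] //= _ _; rewrite inE andbT => nb _; case: x => //; rewrite eq_sym.
  - have rN : wf (CI c) -> size bs = (per (CI c)).+1 -> uniq bs -> last 0 bs != head 0 bs.
      move=> w; have := per_gt0 w; case: bs => [|b [|b' s]] //= => [p0 [E]|_ _ /andP[h _]].
        by rewrite -E in p0.
      by apply: contraNneq h => <-; exact: mem_last.
    move=> w sb ub ab; case: x => [x|[]] /=; last 2 first.
    + exact: rN.
    + by rewrite eq_sym rN.
    case/andP: w => w p1; apply: IH => //.
    + by rewrite size_rcons sb /= prednK// ltnW.
    + by rewrite rcons_uniq ub andbT; apply/negP => /(allP ab); rewrite ltnn.
    + by rewrite all_rcons ltnSn; apply: sub_all ab => b /ltnW.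
  have rN : wf (CS c1 c2) -> size bs = (per (CS c1 c2)).+1 -> uniq bs -> last 0 bs != head 0 bs.
    move=> w; have := per_gt0 w; case: bs => [|b [|b' s]] //= => [p0 [E]|_ _ /andP[h _]].
      by rewrite -E in p0.
    by apply: contraNneq h => <-; exact: mem_last.
  move=> w sb ub ab; case: x => [[x|x]|[]] /=; last 2 first.
  - exact: rN.
  - by rewrite eq_sym rN.
  - case/andP: w => w1 w2; apply: IH1 => //; rewrite ?take_uniq//.
      by rewrite size_takel// sb ltnS leq_addr.
    by apply/allP => z /mem_take /(allP ab).
  case/andP: w => w1 w2; apply: IH2 => //; rewrite ?drop_uniq//.
    by rewrite size_drop sb /=; lia.
  by apply/allP => z /mem_drop /(allP ab) h; apply: leq_trans h (leq_addr _ _).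
by rewrite -slab_eq; exact: (G _ _ _ _ wc stdb_size stdb_uniq stdb_lt).
Qed.

Lemma card_codesE : (cyc pal setT = 2 * per c - 1 + 3 * nin c)%N /\ (cyc pph setT = per c + 2 * nin c)%N.
Proof.
have p0 := per_gt0 wc; have := card_edges; have := card_faces; rewrite card_dt//.
have : 0 < cyc pph [set: dt c] by rewrite card_gt0; apply/set0Pn; exists (porbit pph (root c)); rewrite imset_f.
move: (cyc pph _) (cyc pal _) p0; clear => a b; lia.
Qed.

(** The root may be any dart of the outer face: this freedom is what makes re-rooting possible. *)
Lemma tri_code r : r \in ext c -> tri pal setT pph r.
Proof.
move=> re; have rE x : (x \in porbit pph r) = (x \in ext c).
  by rewrite -!ext_porbit in re *; move: re; rewrite -!porbit_eq => /eqP ->.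
split; rewrite ?inE//.
- move=> C rC _ Cal Cf; rewrite (alpha_phi_closed (A := C) wc) ?subxx// => [|d|d].
  + have : root c \in porbit pph r by rewrite rE mem_head.
    by move=> h; apply: (stab_porbit Cf rC h).
  + by move/Cal; rewrite palE.
  + by move/Cf; rewrite pphE.
- have [e1 e2] := card_codesE; rewrite e1 e2 card_vertices cardsT card_dt//.
  have := per_gt0 wc; clear; lia.
- rewrite pphE; apply/eqP => E; have := ext_cycle; have := inv_uniq ic; have := size_ext.
  have p0 := per_gt0 wc; have rF : fconnect (@phi c) r =i pred1 r.
    move=> y; apply/idP/idP => [/iter_findex <-|/eqP ->]; last exact: connect0.
    by rewrite inE; elim: (findex _ _ _) => //= n /eqP ->; rewrite E.
  have eE : ext c =i pred1 r.
    by move=> y; rewrite -rE porbit_fconnect (fconnect_eq pphE); exact: rF.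
  move=> sE uE _; have := card_uniqP uE; rewrite sE (eq_card eE) card1 => -[] /esym/eqP.
  by rewrite -leqn0 leqNgt p0.
- move=> x y; rewrite !rE porbit_rt; exact: ext_vertex.
- by move=> x _; rewrite rE !pphE; exact: (inv_tri ic).
- by move=> x _; rewrite palE porbit_rt no_loop.
Qed.
End counts.

(** An isomorphism from the map of [c] to that of [c'] re-rooted at [r]. Only injectivity is asked;
    surjectivity follows from connectedness ([rooted_bij]). *)
Record rooted (c c' : code) (r : dt c') (f : dt c -> dt c') : Prop := Rooted {
  r_inj : injective f;
  r_root : f (root c) = r;
  r_alpha : forall x, f (alpha x) = alpha (f x);
  r_phi : forall x, f (phi x) = phi (f x) }.

Section rooted.
Variables (c c' : code) (r : dt c') (f : dt c -> dt c').
Hypothesis fr : rooted r f.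

Lemma rooted_rt x : f (rt x) = rt (f x).
Proof. by rewrite /rt (r_phi fr) (r_alpha fr). Qed.

Lemma rooted_iter g g' x i : (forall x, f (g x) = g' (f x)) -> f (iter i g x) = iter i g' (f x).
Proof. by move=> h; elim: i => //= i <-; rewrite h. Qed.

Lemma rooted_fconnect g g' x y : (forall x, f (g x) = g' (f x)) ->
  fconnect g' (f x) (f y) = fconnect g x y.
Proof.
move=> h; apply/idP/idP => [H|/iter_findex <-]; last by rewrite (rooted_iter _ _ h) fconnect_iter.
have := iter_findex H; rewrite -(rooted_iter _ _ h) => /(r_inj fr) <-; exact: fconnect_iter.
Qed.

Hypotheses (wc : wf c) (wc' : wf c') (re : r \in ext c').

Lemma rooted_card : #|dt c| = #|dt c'|.
Proof.
rewrite -cardsT -(card_imset _ (r_inj fr)) (_ : f @: setT = setT) ?cardsT//.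
apply: alpha_phi_closed => // [|d /imsetP[x _ ->]|d /imsetP[x _ ->]]; last 2 first.
- by rewrite -(r_alpha fr) imset_f.
- by rewrite -(r_phi fr) imset_f.
have : fconnect (@phi c') r (root c').
  by rewrite (fconnect_sym (inv_phi (invP wc'))) -(ext_fconnect wc').
move=> /iter_findex <-; elim: (findex _ _ _) => [|n /imsetP[x _ E]].
  by rewrite /= -(r_root fr) imset_f.
by rewrite iterS E -(r_phi fr) imset_f.
Qed.

Lemma rooted_bij : bijective f.
Proof. by apply: inj_card_bij (r_inj fr) _; rewrite rooted_card. Qed.

Lemma rooted_ext x : (f x \in ext c') = (x \in ext c).
Proof.
have -> : (f x \in ext c') = fconnect (@phi c') r (f x).
  rewrite (ext_fconnect wc'); have : fconnect (@phi c') (root c') r by rewrite -(ext_fconnect wc').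
  by move/(same_connect (fconnect_sym (inv_phi (invP wc')))) ->.
by rewrite -(r_root fr) (rooted_fconnect _ _ (r_phi fr)) -(ext_fconnect wc).
Qed.

Lemma rooted_per : per c = per c' /\ nin c = nin c'.
Proof.
have sE : size (ext c) = size (ext c').
  rewrite -(card_uniqP (inv_uniq (invP wc))) -(card_uniqP (inv_uniq (invP wc'))).
  rewrite -(card_image (r_inj fr)); apply: eq_card => y; have [g gf fg] := rooted_bij.
  by rewrite -[y]fg mem_image ?rooted_ext//; exact: r_inj fr.
move: sE; rewrite !size_ext// => -[pE]; split => //.
have := rooted_card; rewrite !card_dt// pE => /double_inj; have := per_gt0 wc'; clear; lia.
Qed.
End rooted.

(* Tells a [CS] from a [CI] in terms of the map: the third corner of the root triangle
   is on the boundary. *)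
Definition cut c := [exists x in ext c, fconnect (@rt c) x (phi (phi (alpha (root c))))].

Lemma cut_CI c : wf (CI c) -> ~~ cut (CI c).
Proof.
move=> wI; apply/exists_inP => -[x xe]; rewrite -(slab_eq wI) => /eqP E.
have := ext_lab wI xe; rewrite {}E; case/andP: (wI) => wc p1; have ic := invP wc.
have lr := lst_neq_root ic wc.
have -> : phi (phi (alpha (root (CI c)))) = inl (root c).
  by rewrite /= (negbTE lr) (inv_lst ic) eq_sym (negbTE lr).
rewrite /slab -[lab _ _ (inl (root c) : dt (CI c))]/(lab (rcons (stdb (per (CI c))) (per (CI c)).+1) (per (CI c)).+2 (root c)).
by rewrite lab_root last_rcons ltnn.
Qed.

Lemma third_CS c1 c2 : phi (phi (alpha (root (CS c1 c2)))) = inl (inl (root c1)).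
Proof. by rewrite /= eqxx. Qed.

Lemma cut_dart c1 c2 : wf (CS c1 c2) -> let x := inl (inr (phi (root c2))) : dt (CS c1 c2) in
  x \in ext (CS c1 c2) /\ fconnect (@rt (CS c1 c2)) x (inl (inl (root c1))).
Proof.
move=> wS x; case/andP: (wS) => w1 w2; split.
  have [m tE] := inv_head (invP w2) w2.
  rewrite /ext in_cons; apply/orP; right.
  change (x \in map (inl \o inl) (tl c1) ++ map (inl \o inr) (tl c2)).
  by rewrite mem_cat; apply/orP; right; apply/mapP; exists (phi (root c2)); rewrite // tE mem_head.
rewrite -(slab_eq wS); pose bs := stdb (per (CS c1 c2)); pose k := (per (CS c1 c2)).+1.
change (lab (drop (per c1) bs) (k + nin c1) (phi (root c2)) == lab (take (per c1).+1 bs) k (root c1)).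
rewrite lab_root lab_phi_root//; last by rewrite size_drop size_iota /=; lia.
by rewrite last_take ?size_iota ?ltnS ?leq_addr// head_drop.
Qed.

Lemma rooted_cut c c' (f : dt c -> dt c') : wf c -> wf c' -> rooted (root c') f -> cut c = cut c'.
Proof.
move=> wc wc' fr; have re := mem_head (root c') (tl c'); have [g gf fg] := rooted_bij fr wc' re.
have tE : f (phi (phi (alpha (root c)))) = phi (phi (alpha (root c'))).
  by rewrite !(r_phi fr) (r_alpha fr) (r_root fr).
apply/exists_inP/exists_inP => -[x xe H]; [exists (f x)|exists (g x)].
- by rewrite (rooted_ext fr wc wc' re).
- by rewrite -tE (rooted_fconnect fr _ _ (rooted_rt fr)).
- by rewrite -(rooted_ext fr wc wc' re) fg.
- by rewrite -(rooted_fconnect fr _ _ (rooted_rt fr)) fg tE.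
Qed.

(** [cut] recognises the first constructor. The isomorphism preserves the root triangle, hence
    restricts to the map or to each of the two maps left by its removal, and induction applies. *)
Lemma rooted_code c c' (f : dt c -> dt c') : wf c -> wf c' -> rooted (root c') f -> c = c'.
Proof.
elim: c c' f => [|c IH|c1 IH1 c2 IH2] c' f wc wc' fr.
- have [pE nE] := rooted_per fr wc wc' (mem_head _ _).
  case: c' wc' pE nE {f fr} => //= c1 c2 /andP[/per_gt0 + /per_gt0]; clear; lia.
- have [pE nE] := rooted_per fr wc wc' (mem_head _ _).
  have cE := rooted_cut wc wc' fr.
  case: c' f wc' fr pE nE cE => [|c'|c1 c2] f wc' fr pE nE cE //; last first.
    have [h1 h2] := cut_dart wc'; have := cut_CI wc; rewrite cE => /exists_inP[].
    by exists (inl (inr (phi (root c2)))); rewrite ?third_CS.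
  have [fi f0' fa fp] := fr; have f0 : f (inr true) = inr true := f0'.
  have f1 : f (inr false) = inr false by rewrite -[inr false]/(alpha (root (CI c))) fa f0'.
  pose g x := if f (inl x) is inl y then y else root c'.
  have gE x : f (inl x) = inl (g x).
    rewrite /g; case E: (f (inl x)) => [y|b] //.
    by have /fi : f (inl x) = f (inr b) by rewrite E; case: (b).
  case/andP: (wc) => w p1; case/andP: (wc') => w' p1'.
  have ic := invP w; have ic' := invP w'.
  have gl : g (lst c) = lst c'.
    by apply: (@inl_inj _ bool); rewrite -gE -[inl (lst c)]/(phi (inr false : dt (CI c))) fp f1.
  have gpr : g (phi (root c)) = phi (root c').
    by apply: (@inl_inj _ bool); rewrite -gE -[inl (phi (root c))]/(phi (root (CI c))) fp f0'.
  have gr : g (root c) = root c'.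
    have E (d : code) : wf d -> phi (inl (lst d) : dt (CI d)) = inl (root d).
      move=> wd; have lr := lst_neq_root (invP wd) wd.
      by rewrite /= (negbTE lr) (inv_lst (invP wd)) eq_sym (negbTE lr).
    by apply: (@inl_inj _ bool); rewrite -gE -!E// fp gE gl.
  have gi : injective g.
    by move=> x y E; have /fi[] : f (inl x) = f (inl y) by rewrite !gE E.
  congr CI; apply: (IH c' g) => //; split => // x.
    by apply: (@inl_inj _ bool); rewrite -gE -[inl (alpha x)]/(alpha (inl x : dt (CI c))) fa gE.
  have [->|xr] := eqVneq x (root c); first by rewrite gpr gr.
  have gxr : g x == root c' = false by rewrite -gr (inj_eq gi) (negbTE xr).
  have := fp (inl x); rewrite gE /= (negbTE xr) gxr.
  case: eqP => [->|n1].
    by rewrite f0 gl; case: eqP => [->|].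
  by rewrite gE; case: eqP => [//|_ [->]].
have [pE nE] := rooted_per fr wc wc' (mem_head _ _).
have cE := rooted_cut wc wc' fr.
case: c' f wc' fr pE nE cE => [|c'|c1' c2'] f wc' fr pE nE cE.
- by case/andP: wc pE => /per_gt0 + /per_gt0 + /= => + + pE; move: pE; clear; lia.
- have [h1 h2] := cut_dart wc; have := cut_CI wc'; rewrite -cE => /exists_inP[].
  by exists (inl (inr (phi (root c2)))); rewrite ?third_CS.
have [fi f0' fa fp] := fr; have f0 : f (inr true) = inr true := f0'.
have f1 : f (inr false) = inr false by rewrite -[inr false]/(alpha (root (CS c1 c2))) fa f0'.
case/andP: (wc) => w1 w2; case/andP: (wc') => w1' w2'.
have i1 := invP w1; have i2 := invP w2; have i1' := invP w1'; have i2' := invP w2'.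
have fr2 : f (inl (inr (root c2))) = inl (inr (root c2')).
  by rewrite -[inl (inr (root c2))]/(phi (inr false : dt (CS c1 c2))) fp f1.
have fr1 : f (inl (inl (root c1))) = inl (inl (root c1')).
  by rewrite -[inl (inl (root c1))]third_CS !fp fa f0' third_CS.
have fpr1 : f (inl (inl (phi (root c1)))) = inl (inl (phi (root c1'))).
  by rewrite -[inl (inl (phi (root c1)))]/(phi (inr true : dt (CS c1 c2))) fp f0.
have fpr2 : f (inl (inr (phi (root c2)))) = inl (inr (phi (root c2'))).
  have [h1 h2] := cut_dart wc; have [h1' h2'] := cut_dart wc'.
  apply: (ext_vertex wc') => //; first by rewrite (rooted_ext fr wc wc' (mem_head _ _)).
  have : fconnect (@rt (CS c1' c2')) (f (inl (inr (phi (root c2))))) (f (inl (inl (root c1)))).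
    by rewrite (rooted_fconnect fr _ _ (rooted_rt fr)).
  rewrite fr1 => h; apply: connect_trans h _.
  by rewrite (fconnect_sym (rt_inj wc')).
pose g1 x := if f (inl (inl x)) is inl (inl y) then y else root c1'.
pose g2 x := if f (inl (inr x)) is inl (inr y) then y else root c2'.
have phi1 (d1 d2 : code) x : x != root d1 -> phi (inl (inl x) : dt (CS d1 d2)) =
    if phi x == root d1 then inl (inr (phi (root d2))) else inl (inl (phi x)).
  by move=> /= /negbTE ->.
have phi2 (d1 d2 : code) x : x != root d2 -> phi (inl (inr x) : dt (CS d1 d2)) =
    if phi x == root d2 then inr true else inl (inr (phi x)).
  by move=> /= /negbTE ->.
have gE1 x : f (inl (inl x)) = inl (inl (g1 x)).
  pose B := [set x | if f (inl (inl x)) is inl (inl y) then true else false].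
  have BT : B = setT.
    apply: (alpha_phi_closed w1) => [|d|d]; rewrite ?inE ?fr1//.
      by rewrite -[inl (inl (alpha d))]/(alpha (inl (inl d) : dt (CS c1 c2))) fa; case: (f _) => // -[].
    case E: (f _) => [[y|]|] // _.
    have [->|dr] := eqVneq d (root c1); first by rewrite fpr1.
    have yr : y != root c1'.
      by apply: contraNneq dr => yr; move: E; rewrite yr -fr1 => /fi [->].
    have := fp (inl (inl d)); rewrite E !phi1//; case: eqP => [->|_]; first by rewrite fr1.
    by case: eqP => [_|_ -> //]; rewrite -fpr2 => /fi.
  have : x \in B by rewrite BT inE.
  by rewrite inE /g1; case: (f _) => // -[].
have gE2 x : f (inl (inr x)) = inl (inr (g2 x)).
  pose B := [set x | if f (inl (inr x)) is inl (inr y) then true else false].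
  have BT : B = setT.
    apply: (alpha_phi_closed w2) => [|d|d]; rewrite ?inE ?fr2//.
      by rewrite -[inl (inr (alpha d))]/(alpha (inl (inr d) : dt (CS c1 c2))) fa; case: (f _) => // -[].
    case E: (f _) => [[|y]|] // _.
    have [->|dr] := eqVneq d (root c2); first by rewrite fpr2.
    have yr : y != root c2'.
      by apply: contraNneq dr => yr; move: E; rewrite yr -fr2 => /fi [->].
    have := fp (inl (inr d)); rewrite E !phi2//; case: eqP => [->|_]; first by rewrite fr2.
    by case: eqP => [_|_ -> //]; rewrite -f0 => /fi.
  have : x \in B by rewrite BT inE.
  by rewrite inE /g2; case: (f _) => // -[].
have [e1 e2] : c1 = c1' /\ c2 = c2'; last by rewrite e1 e2.
split.
- have gi : injective g1.
    by move=> x y E; have /fi[] : f (inl (inl x)) = f (inl (inl y)) by rewrite !gE1 E.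
  have iI : injective (inl \o inl : dt c1' -> dt (CS c1' c2')) by move=> ? ? [].
  have gr : g1 (root c1) = root c1' by move: fr1; rewrite gE1 => -[].
  apply: (IH1 c1' g1) => //; split => // x.
    apply: iI; rewrite /= -gE1 -[inl (inl (alpha x))]/(alpha (inl (inl x) : dt (CS c1 c2))) fa gE1//.
  have [->|xr] := eqVneq x (root c1); first by rewrite gr; move: fpr1; rewrite gE1 => -[].
  have gxr : g1 x != root c1' by rewrite -gr (inj_eq gi).
  have := fp (inl (inl x)); rewrite gE1 !phi1//.
  case: eqP => [->|n1]; first by rewrite fpr2 gr; case: eqP => [->|].
  by rewrite gE1; case: eqP => [//|_ [->]].
have gi : injective g2.
  by move=> x y E; have /fi[] : f (inl (inr x)) = f (inl (inr y)) by rewrite !gE2 E.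
have iI : injective (inl \o inr : dt c2' -> dt (CS c1' c2')) by move=> ? ? [].
have gr : g2 (root c2) = root c2' by move: fr2; rewrite gE2 => -[].
apply: (IH2 c2' g2) => //; split => // x.
  apply: iI; rewrite /= -gE2 -[inl (inr (alpha x))]/(alpha (inl (inr x) : dt (CS c1 c2))) fa gE2//.
have [->|xr] := eqVneq x (root c2); first by rewrite gr; move: fpr2; rewrite gE2 => -[].
have gxr : g2 x != root c2' by rewrite -gr (inj_eq gi).
have := fp (inl (inr x)); rewrite gE2 !phi2//.
case: eqP => [->|n1]; first by rewrite f0 gr; case: eqP => [->|].
by rewrite gE2; case: eqP => [//|_ [->]].
Qed.

(** Moving the root may change the whole tree, so the new code is obtained from the existence
    theorem [tri_coded] and not by transforming [c]. *)
Lemma reroot c (r : dt c) : wf c -> r \in ext c ->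
  exists c' (f : dt c' -> dt c), wf c' /\ rooted r f.
Proof.
move=> wc re; have := tri_code wc re => T.
have [||c' [f [wc' fi _ fr fE]]] := tri_coded _ _ T.
- by move=> x; rewrite !palE alphaK.
- by move=> x; rewrite palE alpha_neq.
exists c', f; split => //; split => // x; have [h1 h2] := fE x; by rewrite ?h1 ?h2 ?palE ?pphE.
Qed.

End Labels.

(** * Re-rooting along the boundary *)

Module Rotation.
Import structures.
Import all_boot all_order all_algebra all_fingroup.
Import zify.
Import boolp.
Import Codes Euler CodeMaps Peeling Labels.
Import GRing.Theory Num.Theory.

Lemma slab_iter c i : wf c -> slab (iter i (@phi c) (root c)) = (per c + i) %% (per c).+1.
Proof.
move=> wc; have ic := invP wc.
have E j : j <= per c -> slab (iter j (@phi c) (root c)) = (per c + j) %% (per c).+1.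
  move=> jP; have jx : j < size (ext c) by rewrite size_ext.
  have -> : iter j (@phi c) (root c) = nth (root c) (ext c) j.
    have /fpathP[n tE] : fpath (@phi c) (root c) (tl c) := inv_path ic.
    have nE : n = per c by rewrite -(size_tl wc) tE size_traject.
    by rewrite /ext tE -trajectS nth_traject// nE ltnS.
  case: j jP jx => [|j] jP jx; first by rewrite slab_root// addn0 modn_small.
  rewrite /= -(nth_map _ 0) ?size_tl// slab_tl// nth_iota// addnS -addSn modnDl modn_small//.
  exact: ltnW.
have P1 : iter (per c).+1 (@phi c) (root c) = root c.
  have /fpathP[n tE] : fpath (@phi c) (root c) (tl c) := inv_path ic.
  have nE : n = per c by rewrite -(size_tl wc) tE size_traject.
  rewrite iterS -nE -last_traject -tE; exact: inv_lst.
have PM k : iter (k * (per c).+1) (@phi c) (root c) = root c.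
  by elim: k => // k IH; rewrite mulSn iterD IH.
rewrite {1}(divn_eq i (per c).+1) addnC iterD PM E; last by rewrite -ltnS ltn_mod.
by rewrite modnDmr.
Qed.

Definition ees c := es c (stdb (per c)) (per c).+1.

Definition vn c := (per c).+1 + nin c.

Lemma eesE c : ees c = [seq (slab d, slab (alpha d)) | d <- dl c].
Proof. exact: es_dl. Qed.

Lemma sum_ees (M : zmodType) c (F : nat -> nat -> M) : (forall u v, F u v = F v u) ->
  ((\sum_(e <- ees c) F e.1 e.2) *+ 2 = \sum_(d : dt c) F (slab d) (slab (alpha d)))%R.
Proof.
move=> sF; rewrite -[RHS]big_enum /= -(perm_big _ (dl_perm c)) big_cat /= big_map mulr2n.
have -> : (\sum_(e <- ees c) F e.1 e.2 = \sum_(d <- dl c) F (slab d) (slab (alpha d)))%R by rewrite eesE big_map.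
by congr (_ + _)%R; apply: eq_bigr => d _; rewrite sF alphaK.
Qed.

Section rotation.
Variables (s : nat) (c : code).
Hypothesis wc : wf c.
Let r := iter s (@phi c) (root c).

Lemma rot_ext : r \in ext c.
Proof. by rewrite ext_fconnect// fconnect_iter. Qed.

Lemma rot_ex : exists c' (f : dt c' -> dt c), wf c' /\ rooted r f.
Proof. exact: (reroot wc rot_ext). Qed.

Definition rotc0 := projT1 (cid rot_ex).
Let c' := rotc0.
Let f : dt c' -> dt c := projT1 (cid (projT2 (cid rot_ex))).

Lemma rotc_f : wf c' /\ rooted r f.
Proof. exact: projT2 (cid (projT2 (cid rot_ex))). Qed.

Let w' : wf c' := rotc_f.1.
Let fr : rooted r f := rotc_f.2.

Lemma rot_per : per c' = per c /\ nin c' = nin c.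
Proof. exact: (rooted_per fr w' wc rot_ext). Qed.

(** Carries vertex labels through the isomorphism of darts; the default value concerns only numbers
    that name no vertex. *)
Definition rot_lab l := if pselect (exists d : dt c', slab d = l) is left h then slab (f (projT1 (cid h))) else l.

Lemma rot_labE d : rot_lab (slab d) = slab (f d).
Proof.
rewrite /rot_lab; case: pselect => [h|]; last by case; exists d.
case: cid => /= e; move/eqP; rewrite slab_eq// => ed; apply/eqP.
by rewrite slab_eq// (rooted_fconnect fr _ _ (rooted_rt fr)).
Qed.

Lemma rot_lab_ext l : l <= per c -> rot_lab l = (l + s) %% (per c).+1.
Proof.
move=> lP; have [pE _] := rot_per.
have <- : slab (iter l.+1 (@phi c') (root c')) = l.
  by rewrite slab_iter// pE addnS -addSn modnDl modn_small.
rewrite rot_labE (rooted_iter _ _ (r_phi fr)) (r_root fr) /r -iterD slab_iter//.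
rewrite slab_iter// pE !addnS -!addSn !addSn -[(per c + l).+1]addSn -[(per c + (l + s)).+1]addSn !modnDl.
by rewrite (modn_small (m := l)).
Qed.

Lemma rot_lab_inj : {in gtn (vn c) &, injective rot_lab}.
Proof.
have [pE nE] := rot_per; move=> x y; rewrite !inE /vn -pE -nE => xl yl.
have [d <-] := slab_surj w' xl; have [e <-] := slab_surj w' yl.
by rewrite !rot_labE => /eqP; rewrite slab_eq// (rooted_fconnect fr _ _ (rooted_rt fr)) -slab_eq// => /eqP.
Qed.

Lemma rot_lab_lt x : x < vn c -> rot_lab x < vn c.
Proof.
have [pE nE] := rot_per; rewrite {1}/vn -pE -nE => xl.
by have [d <-] := slab_surj w' xl; rewrite rot_labE; exact: slab_mem.
Qed.

Lemma rot_lab_surj y : y < vn c -> exists2 x, x < vn c & rot_lab x = y.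
Proof.
move=> yl; have [d <-] := slab_surj wc yl; have [g gf fg] := rooted_bij fr wc rot_ext.
exists (slab (g d)); last by rewrite rot_labE fg.
by have [pE nE] := rot_per; rewrite /vn -pE -nE; exact: slab_mem.
Qed.

Lemma rot_sum (R : numDomainType) (F : nat -> nat -> R) : (forall u v, F u v = F v u) ->
  (\sum_(e <- ees c') F (rot_lab e.1) (rot_lab e.2) = \sum_(e <- ees c) F e.1 e.2)%R.
Proof.
move=> sF; apply: (@mulIf _ 2%:R%R); first by rewrite pnatr_eq0.
rewrite !mulr_natr (@sum_ees _ c' (fun u v => F (rot_lab u) (rot_lab v)))// sum_ees//.
have [g gf fg] := rooted_bij fr wc rot_ext.
rewrite (reindex f) /=; last by exists g => d _.
by apply: eq_bigr => d _; rewrite !rot_labE (r_alpha fr).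
Qed.

Definition adj c u v := ((u, v) \in ees c) || ((v, u) \in ees c).

Lemma rot_adj u v : u < vn c -> v < vn c -> adj c (rot_lab u) (rot_lab v) = adj c' u v.
Proof.
have adjE (d : code) (wd : wf d) x y : adj d x y = [exists z : dt d, (slab z == x) && (slab (alpha z) == y)].
  rewrite /adj eesE; apply/orP/existsP => [[] /mapP[z _ [-> ->]]|[z /andP[/eqP <- /eqP <-]]].
  - by exists z; rewrite !eqxx.
  - by exists (alpha z); rewrite alphaK !eqxx.
  have : z \in enum (dt d) by rewrite mem_enum.
  rewrite -(perm_mem (dl_perm d)) mem_cat mem_map_alpha => /orP[h|h]; [left|right]; apply/mapP.
    by exists z.
  by exists (alpha z); rewrite // alphaK.
have [pE nE] := rot_per; rewrite {1 2}/vn -pE -nE => ul vl; rewrite !adjE//.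
have [d dE] := slab_surj w' ul; have [e eE] := slab_surj w' vl.
have [g gf fg] := rooted_bij fr wc rot_ext.
have inj x y : x < vn c -> y < vn c -> (rot_lab x == rot_lab y) = (x == y).
  by move=> h1 h2; apply/eqP/eqP => [|->//]; apply: rot_lab_inj.
have sm (x : dt c') : slab x < vn c by rewrite /vn -pE -nE slab_mem.
apply/existsP/existsP => -[z /andP[/eqP h1 /eqP h2]].
  exists (g z); rewrite -inj ?sm//; last by rewrite /vn -pE -nE.
  rewrite rot_labE fg h1 eqxx -inj ?sm//; last by rewrite /vn -pE -nE.
  by rewrite rot_labE (r_alpha fr) fg h2 eqxx.
by exists (f z); rewrite -(r_alpha fr) -!rot_labE h1 h2 !eqxx.
Qed.

End rotation.

(** Both maps are recovered from the common re-rooted map by going back s steps along the outer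
    face, so they are isomorphic and [rooted_code] applies. *)
Lemma rotc0_inj s c d (wc : wf c) (wd : wf d) : rotc0 s wc = rotc0 s wd -> c = d.
Proof.
move=> E; have [f [w1 f1]] : exists f : dt (rotc0 s wc) -> dt c, wf (rotc0 s wc) /\
  rooted (iter s (@phi c) (root c)) f by eexists; exact: rotc_f.
have [f' [w2 f2]] : exists f : dt (rotc0 s wd) -> dt d, wf (rotc0 s wd) /\
  rooted (iter s (@phi d) (root d)) f by eexists; exact: rotc_f.
move: E f w1 f1 f' w2 f2; move: (rotc0 s wc) (rotc0 s wd) => a b E; case: _ / E => {b} f w1 f1 f' _ f2.
have [g gf fg] := rooted_bij f1 wc (rot_ext s wc).
apply: (@rooted_code c d (f' \o g)) => //; split => [|||x] /=.
- by apply: inj_comp (r_inj f2) _; exact: can_inj fg.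
- have pi := inv_phi (invP wd).
  have II : injective (iter s (@phi d)) by elim: (s) => [|n IH] x y //= /pi/IH.
  apply: II.
  have H x : f' (g (phi x)) = phi (f' (g x)) by rewrite -(r_phi f2) -{1}[x]fg -(r_phi f1) gf.
  have -> : iter s (@phi d) (f' (g (root c))) = f' (g (iter s (@phi c) (root c))).
    by elim: (s) => //= n ->; rewrite H.
  by rewrite -(r_root f1) gf (r_root f2).
- by move=> x; rewrite -{1}[x]fg -(r_alpha f1) gf (r_alpha f2).
- by rewrite -{1}[x]fg -(r_phi f1) gf (r_phi f2).
Qed.

Definition rotc s c := if pselect (wf c) is left wc then rotc0 s wc else c.

(** All that is used of re-rooting in the sequel: the code and the relabelling come from a choice,
    which is not opened again. *)
Record rot_spec s c (c' : code) (sg : nat -> nat) : Prop := RotSpec {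
  rs_wf : wf c';
  rs_per : per c' = per c;
  rs_nin : nin c' = nin c;
  rs_ext : forall l, l <= per c -> sg l = (l + s) %% (per c).+1;
  rs_inj : {in gtn (vn c) &, injective sg};
  rs_lt : forall x, x < vn c -> sg x < vn c;
  rs_surj : forall y, y < vn c -> exists2 x, x < vn c & sg x = y;
  rs_sum : forall (R : numDomainType) (F : nat -> nat -> R), (forall u v, F u v = F v u) ->
    (\sum_(e <- ees c') F (sg e.1) (sg e.2) = \sum_(e <- ees c) F e.1 e.2)%R;
  rs_adj : forall u v, u < vn c -> v < vn c -> adj c (sg u) (sg v) = adj c' u v }.

Lemma rotcP s c : wf c -> exists sg, rot_spec s c (rotc s c) sg.
Proof.
move=> wc; rewrite /rotc; case: pselect => // {}wc; exists (rot_lab s wc).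
have [w' _] := rotc_f s wc; have [p n] := rot_per s wc; split => //.
- exact: rot_lab_ext. - exact: rot_lab_inj. - exact: rot_lab_lt. - exact: rot_lab_surj.
- exact: rot_sum. - exact: rot_adj.
Qed.

Lemma rotc_inj s c d : wf c -> wf d -> rotc s c = rotc s d -> c = d.
Proof. by move=> wc wd; rewrite /rotc; case: pselect => // ?; case: pselect => // ?; exact: rotc0_inj. Qed.

(** Invariance of the mass under re-rooting: a finite family of distinct codes is sent to another
    one of the same size. *)
Lemma sb_rot (R : realFieldType) (W : code -> R) P x s :
  sb W P x -> sb (fun c => W (rotc s c)) P x.
Proof.
move=> h l ul ol; rewrite -(big_map (rotc s) xpredT); apply: h.
  rewrite map_inj_in_uniq// => c d /(allP ol)/andP[wc _] /(allP ol)/andP[wd _]; exact: rotc_inj.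
apply/allP => _ /mapP[c /(allP ol)/andP[wc /eqP pc] ->]; have [sg h'] := rotcP s wc.
by rewrite /okc (rs_wf h') (rs_per h') pc eqxx.
Qed.

End Rotation.

(** * Planarity: paths with interleaved ends meet *)

Module Crossing.
Import structures.
Import all_boot all_order all_algebra.
Import zify ring lra.
Import boolp classical_sets reals.
Import Codes CodeMaps Labels Rotation.
Import Order.TTheory GRing.Theory Num.Theory.

(** The level sets of [f] form a non-crossing partition of the first N integers. *)
Definition nc (f : nat -> nat) N := forall i j k l, i < j -> j < k -> k < l -> l < N ->
  f i = f k -> f j = f l -> f i = f j.

(** Effect of the root edge, which joins the first and the last boundary vertices: no boundary
    vertex lies outside this pair, so merging their classes creates no crossing. *)
Lemma nc_merge f P : nc f P.+1 -> nc (fun i => if f i == f 0 then f P else f i) P.+1.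
Proof.
move=> h; set g := (g in nc g _); move=> i j k l ij jk kl lP E1 E2; apply: contrapT => ne.
have gP u : g u <> f P -> g u = f u /\ f u <> f 0.
  by rewrite /g; case: eqP.
have gE u : g u = f P -> f u = f 0 \/ f u = f P by rewrite /g; case: eqP; [left|right].
have [a|a] := eqVneq (g i) (f P).
- have b : g j <> f P by rewrite -a => /esym.
  have [fj nj] := gP _ b; have b' : g l <> f P by rewrite -E2.
  have [fl nl] := gP _ b'; have jl : f j = f l by rewrite -fj -fl.
  have lP' : l < P by move: lP; rewrite ltnS leq_eqVlt => /predU1P[lP|//]; case: b'; rewrite fl lP.
  have j0 : 0 < j by apply: leq_ltn_trans ij.
  have nfj : f j <> f P by rewrite -fj.
  have a' : g k = f P by rewrite -E1.
  case: (gE _ a') => fk; last by apply: nfj; rewrite (h _ _ _ _ jk kl lP' (ltnSn _) jl fk).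
  by apply: nj; rewrite (h _ _ _ _ j0 jk kl lP (esym fk) jl).
have {a} a : g i <> f P by apply/eqP.
have [fi ni] := gP _ a; have a' : g k <> f P by rewrite -E1.
have [fk nk] := gP _ a'; have ik : f i = f k by rewrite -fi -fk.
have i0 : 0 < i by rewrite lt0n; apply/eqP => i0; apply: ni; rewrite i0.
have [b|b] := eqVneq (g j) (f P); last first.
  have [fj nj] := gP _ (elimN eqP b); have [|fl nl] := gP l; first by rewrite -E2; apply/eqP.
  by apply: ne; rewrite fi fj (h _ _ _ _ ij jk kl lP)// -fj -fl.
have nfi : f i <> f P by rewrite -fi.
have kP : k < P by apply: leq_trans kl _.
case: (gE _ b) => fj; last by apply: nfi; rewrite (h _ _ _ _ ij jk kP (ltnSn _) ik fj).
by apply: ni; rewrite (h _ _ _ _ i0 ij jk (ltn_trans kl lP) (esym fj) ik).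
Qed.

(** Gluing of two polygons at the vertex P1. Even and odd values keep the classes of the two sides
    apart, except the class of the common vertex, which is shared. *)
Lemma nc_glue f1 f2 P1 P2 : nc f1 P1.+1 -> nc f2 P2.+1 ->
  nc (fun i => if i <= P1 then (f1 i).*2 else
      if f2 (i - P1) == f2 0 then (f1 P1).*2 else (f2 (i - P1)).*2.+1) (P1 + P2).+1.
Proof.
move=> h1 h2; set f := (f in nc f _); move=> i j k l ij jk kl lN.
have f1E u : u <= P1 -> f u = (f1 u).*2 by rewrite /f => ->.
have f2E u : P1 <= u -> f u = if f2 (u - P1) == f2 0 then (f1 P1).*2 else (f2 (u - P1)).*2.+1.
  rewrite leq_eqVlt => /predU1P[<-|uP]; first by rewrite /f leqnn subnn eqxx.
  by rewrite /f leqNgt uP.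
have f2i u v : P1 <= u -> P1 <= v -> f u = f v -> f2 (u - P1) = f2 (v - P1).
  move=> uP vP; rewrite !f2E//; case: eqP => [->|_]; case: eqP => [->|_] // E; last first.
  - by move: E => [/double_inj].
  - by have := congr1 odd E; rewrite /= !odd_double.
  - by have := congr1 odd E; rewrite /= !odd_double.
have f2V u v : P1 <= u -> f2 (u - P1) = f2 (v - P1) -> P1 <= v -> f u = f v.
  by move=> uP E vP; rewrite !f2E// E.
have ev u v : u <= P1 -> P1 <= v -> f u = f v -> f1 u = f1 P1 /\ f2 (v - P1) = f2 0.
  move=> uP vP; rewrite f1E// f2E//; case: eqP => [->/double_inj //|_ E].
  by have := congr1 odd E; rewrite /= !odd_double.
case: (leqP l P1) => lP.
  have kP := ltnW (leq_trans kl lP); have jP := ltnW (leq_trans jk kP); have iP := ltnW (leq_trans ij jP).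
  by rewrite !f1E// => /double_inj e1 /double_inj e2; rewrite (h1 _ _ _ _ ij jk kl _ e1 e2).
case: (leqP P1 i) => iP.
  have jP := leq_trans iP (ltnW ij); have kP := leq_trans jP (ltnW jk).
  move=> /(f2i _ _ iP kP) e1 /(f2i _ _ jP (ltnW lP)) e2; apply: f2V => //.
  apply: (h2 _ _ _ _ _ _ _ _ e1 e2); move: ij jk kl lN iP; clear; lia.
case: (leqP k P1) => kP.
  have jP := ltnW (leq_trans jk kP).
  rewrite (f1E k)// (f1E i (ltnW iP)) => /double_inj e1 /(ev _ _ jP (ltnW lP))[e2 _].
  rewrite f1E//; congr double; move: kP; rewrite leq_eqVlt => /predU1P[kP|kP].
    by rewrite e1 kP.
  exact: (h1 _ _ _ _ ij jk kP).
move=> /(ev _ _ (ltnW iP) (ltnW kP))[e1 e2]; case: (leqP j P1) => jP.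
  move=> /(ev _ _ jP (ltnW lP))[e3 _]; by rewrite !f1E ?(ltnW iP)// e1 e3.
move=> /(f2i _ _ (ltnW jP) (ltnW lP)) e3.
have : f2 0 = f2 (j - P1).
  apply: (h2 0 _ _ _ _ _ _ _ (esym e2) e3); move: jP jk kl lN; clear; lia.
by move=> e4; rewrite (f1E i (ltnW iP)) (f2E j (ltnW jP)) -e4 eqxx e1.
Qed.

Lemma nc_eq f g N : (forall i, i < N -> f i = g i) -> nc f N -> nc g N.
Proof.
move=> fg h i j k l ij jk kl lN; have kN := ltn_trans kl lN; have jN := ltn_trans jk kN.
rewrite -!fg//; last exact: ltn_trans jN; exact: h.
Qed.

Lemma nc_le f N M : M <= N -> nc f N -> nc f M.
Proof. by move=> MN h i j k l ij jk kl lM; apply: h => //; exact: leq_trans MN. Qed.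

(* The classes of [kap] are the components of the sub-map of monochromatic edges. *)
Lemma components c bs k (chi : nat -> bool) : wf c -> size bs = (per c).+1 -> uniq bs ->
  all (fun b => b < k) bs -> exists kap : nat -> nat, [/\
    forall e, e \in es c bs k -> chi e.1 = chi e.2 -> kap e.1 = kap e.2,
    forall u v, kap u = kap v -> chi u = chi v &
    nc (fun i => kap (nth 0 bs i)) (size bs)].
Proof.
have mrg bs' P (kap0 : nat -> nat) (E : seq (nat * nat)) : size bs' = P.+1 ->
   (forall e, e \in E -> chi e.1 = chi e.2 -> kap0 e.1 = kap0 e.2) ->
   (forall u v, kap0 u = kap0 v -> chi u = chi v) ->
   nc (fun i => kap0 (nth 0 bs' i)) (size bs') -> exists kap : nat -> nat, [/\
    forall e, e \in (last 0 bs', head 0 bs') :: E -> chi e.1 = chi e.2 -> kap e.1 = kap e.2,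
    forall u v, kap u = kap v -> chi u = chi v &
    nc (fun i => kap (nth 0 bs' i)) (size bs')].
  move=> sb h1 h2 h3; have [cE|cN] := eqVneq (chi (last 0 bs')) (chi (head 0 bs')); last first.
    exists kap0; split => // e; rewrite inE => /predU1P[->/= E'|]; last exact: h1.
    by rewrite E' eqxx in cN.
  exists (fun v => if kap0 v == kap0 (head 0 bs') then kap0 (last 0 bs') else kap0 v); split.
  - move=> e; rewrite inE => /predU1P[-> _|eE ce] /=; first by rewrite eqxx; case: eqP.
    by rewrite (h1 e).
  - move=> u v; case: eqP => [/h2 ->|_]; case: eqP => [/h2 ->|_] //; first by move/h2; rewrite -cE.
      by move/h2; rewrite -cE.
    exact: h2.
  - rewrite sb in h3 *; have := nc_merge h3; apply: nc_eq => i _.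
    by rewrite nth0 -[in RHS]nth_last sb.
elim: c bs k => [|c IH|c1 IH1 c2 IH2] bs k wc sb ub ab.
- apply: (mrg bs 1 (fun v => v.*2 + chi v) [::]) => //.
  + move=> u v E; have := congr1 odd E; rewrite !oddD !odd_double /=.
    by case: (chi u); case: (chi v).
  + rewrite sb => i j k' l; case: l => [|[|l]] //; lia.
- case/andP: (wc) => w p1.
  have sb' : size (rcons bs k) = (per c).+1 by rewrite size_rcons sb /= prednK// ltnW.
  have ub' : uniq (rcons bs k).
    by rewrite rcons_uniq ub andbT; apply/negP => /(allP ab); rewrite ltnn.
  have ab' : all (fun b => b < k.+1) (rcons bs k).
    by rewrite all_rcons ltnSn; apply: sub_all ab => b /ltnW.
  have [kap [h1 h2 h3]] := IH _ _ w sb' ub' ab'.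
  apply: (mrg bs (per (CI c)) kap) => //.
  apply: (nc_eq (f := fun i => kap (nth 0 (rcons bs k) i))) => [i iN|].
    by rewrite nth_rcons iN.
  by apply: nc_le h3; rewrite size_rcons.
case/andP: (wc) => w1 w2.
set bs1 := take (per c1).+1 bs; set bs2 := drop (per c1) bs.
have s1 : size bs1 = (per c1).+1 by rewrite size_takel// sb ltnS leq_addr.
have s2 : size bs2 = (per c2).+1 by rewrite size_drop sb /= subSn ?leq_addr// addKn.
have n1 : per c1 < size bs by rewrite sb ltnS leq_addr.
have u1 : uniq bs1 by exact: take_uniq.
have u2 : uniq bs2 by exact: drop_uniq.
have a1 : all (fun b => b < k) bs1 by apply/allP => z /mem_take /(allP ab).
have a2 : all (fun b => b < k + nin c1) bs2.
  by apply/allP => z /mem_drop /(allP ab) h; apply: leq_trans h (leq_addr _ _).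
have [k1 [h11 h12 h13]] := IH1 _ _ w1 s1 u1 a1.
have [k2 [h21 h22 h23]] := IH2 _ _ w2 s2 u2 a2.
set b := nth 0 bs (per c1).
have b1 : b \in bs1 by rewrite /bs1 (take_nth 0 n1) mem_rcons mem_head.
have L1b v : v \in labs c2 bs2 (k + nin c1) -> v \in labs c1 bs1 k -> v = b.
  rewrite !mem_labs => /orP[m2|/andP[m2 _]] /orP[m1|/andP[m1 m1']].
  - move: m1; rewrite /bs1 (take_nth 0 n1) mem_rcons inE => /predU1P[//|m1].
    move: ub; rewrite -(cat_take_drop (per c1) bs) cat_uniq => /and3P[_ /hasPn/(_ _ m2)].
    by rewrite m1.
  - by have := leq_ltn_trans m1 (allP ab _ (mem_drop m2)); rewrite ltnn.
  - by have := leq_ltn_trans (leq_trans (leq_addr (nin c1) k) m2) (allP a1 _ m1); rewrite ltnn.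
  - by have := leq_ltn_trans m2 m1'; rewrite ltnn.
pose kap v := if v \in labs c1 bs1 k then (k1 v).*2 else
  if k2 v == k2 b then (k1 b).*2 else (k2 v).*2.+1.
have bL : b \in labs c1 bs1 k by rewrite mem_labs b1.
have kap2 v : v \in labs c2 bs2 (k + nin c1) ->
    kap v = if k2 v == k2 b then (k1 b).*2 else (k2 v).*2.+1.
  by move=> vm; rewrite /kap; case: ifP => // vL; rewrite (L1b v vm vL) eqxx.
have es_lab (d : code) s m (e : nat * nat) : wf d -> size s = (per d).+1 -> e \in es d s m ->
    (e.1 \in labs d s m) /\ (e.2 \in labs d s m).
  by move=> wd sd; rewrite es_dl => /mapP[x _ ->] /=; split; exact: lab_mem.
have cE : es (CS c1 c2) bs k = (last 0 bs, head 0 bs) :: (es c1 bs1 k ++ es c2 bs2 (k + nin c1)) by [].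
rewrite cE; apply: (mrg bs _ kap) => //; first exact: sb.
- move=> e; rewrite mem_cat => /orP[em|em] ce.
    by have [m1 m2] := es_lab _ _ _ _ w1 s1 em; rewrite /kap m1 m2 (h11 e).
  have [m1 m2] := es_lab _ _ _ _ w2 s2 em; rewrite !kap2// (h21 e)//.
- have kodd (x y : nat) : x.*2 <> y.*2.+1.
    by move=> E; have := congr1 odd E; rewrite /= !odd_double.
  have ks v : kap v = (k1 b).*2 /\ chi v = chi b \/ kap v = (k1 v).*2 \/ kap v = (k2 v).*2.+1.
    rewrite /kap; case: ifP => _; first by right; left.
    by case: eqP => [/h22 ->|_]; [left|right; right].
  have d1 (x y : nat) : x.*2 = y.*2 -> x = y by exact: double_inj.
  move=> u v; case: (ks u) => [[-> ->]|[->|->]]; case: (ks v) => [[-> ->]|[->|->]] //.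
  + by move/d1/h12. + by move/kodd. + by move/d1/h12. + by move/d1/h12. + by move/kodd.
  + by move/esym/kodd. + by move/esym/kodd.
  + by move=> [/d1/h22].
- have := nc_glue (P1 := per c1) (P2 := per c2).
  rewrite s1 in h13; rewrite s2 in h23; move=> /(_ _ _ h13 h23); rewrite sb.
  apply: nc_eq => i iN /=; case: (leqP i (per c1)) => ip.
    rewrite /bs1 nth_take// /kap ifT// mem_labs.
    by rewrite -(nth_take 0 (n0 := (per c1).+1)) ?ltnS// mem_nth// s1.
  rewrite !nth_drop addn0 subnKC ?(ltnW ip)// -/b (nth_take _ (ltnSn _)) -/b kap2//.
  rewrite mem_labs; apply/orP; left.
  rewrite -(subnKC (ltnW ip)) -nth_drop mem_nth// -/bs2 s2; move: iN ip; clear; lia.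
Qed.

Definition crel c : rel nat := fun u v => adj c u v.

(** Colour the vertices by membership in the first path. If the paths were disjoint, each would be
    monochromatic, hence inside one class given by [components]; as these classes do not cross on
    the boundary, i and j would be in the same class although their colours differ. *)
Lemma paths_meet c i j k l p q : wf c -> i < j -> j < k -> k < l -> l <= per c ->
  path (crel c) i p -> last i p = k -> path (crel c) j q -> last j q = l ->
  exists2 v, v \in i :: p & v \in j :: q.
Proof.
move=> wc ij jk kl lP pp pk qp ql; apply: contrapT => ne.
pose chi v := v \in i :: p.
have [kap [h1 h2 h3]] := components chi wc (stdb_size c) (stdb_uniq c) (stdb_lt c).
have mono (x : nat) s : path (crel c) x s -> {in x :: s, forall v, chi v = chi x} -> kap (last x s) = kap x.
  elim: s x => //= y s IH x /andP[xy ys] cs.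
  have cxy : chi y = chi x by rewrite cs// !inE eqxx orbT.
  rewrite IH//; last by move=> v vs; rewrite cxy cs// inE vs orbT.
  by case/orP: xy => /h1 /= -> //; rewrite cxy.
have e1 : kap k = kap i.
  by rewrite -pk; apply: mono => // v vp; rewrite /chi vp mem_head.
have nq v : v \in j :: q -> chi v = false.
  by move=> vq; apply/negbTE/negP => vp; apply: ne; exists v.
have e2 : kap l = kap j by rewrite -ql; apply: mono => // v vq; rewrite !nq// mem_head.
have nE x : x <= per c -> nth 0 (stdb (per c)) x = x by move=> xP; rewrite nth_iota.
have kP : k <= per c by exact: leq_trans (ltnW kl) lP.
have jP : j <= per c by exact: leq_trans (ltnW jk) kP.
have iP : i <= per c by exact: leq_trans (ltnW ij) jP.
have := h3 i j k l ij jk kl; rewrite !nE// stdb_size ltnS e1 e2 => /(_ lP erefl erefl)/h2.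
by rewrite (nq j) ?mem_head// /chi mem_head.
Qed.

End Crossing.

(** * Duality of vertex extremal length *)

Module Duality.
Import structures.
Import all_boot all_order all_algebra.
Import zify ring lra.
Import boolp classical_sets reals.
Import Codes CodeMaps Labels Rotation Crossing.
Import Order.TTheory GRing.Theory Num.Theory.
Local Open Scope classical_set_scope.
Local Open Scope ring_scope.

Section vel.
Variables (R : realType) (n : nat).
Implicit Types (S T : set (seq nat)) (p q : seq nat) (f g mu nu : nat -> R).

Definition ip f g := \sum_(v < n) f v * g v.
Definition ind p : nat -> R := fun v => (v \in p)%:R.

(** Occupation measures of random paths of [S]. Binary convex combinations suffice and give an
    induction principle. *)
Inductive hull S : (nat -> R) -> Prop :=
| hull_gen p : S p -> hull S (ind p)
| hull_conv mu nu s : hull S mu -> hull S nu -> 0 <= s <= 1 ->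
    hull S (fun v => (1 - s) * mu v + s * nu v).

Lemma hull01 S mu v : hull S mu -> 0 <= mu v <= 1.
Proof.
elim=> [p _|{}mu nu s _ /andP[a0 a1] _ /andP[b0 b1] /andP[s0 s1]]; first by rewrite ler0n lern1 leq_b1.
have := mulr_ge0 s0 b0; have : 0 <= (1 - s) * mu v by rewrite mulr_ge0// subr_ge0.
have : s * nu v <= s by rewrite ler_piMr.
have : (1 - s) * mu v <= 1 - s by rewrite ler_piMr// subr_ge0.
by lra.
Qed.

Lemma ip_convl f g h s : ip (fun v => (1 - s) * f v + s * g v) h = (1 - s) * ip f h + s * ip g h.
Proof. by rewrite /ip !mulr_sumr -big_split; apply: eq_bigr => v _ /=; ring. Qed.

Lemma ipC f g : ip f g = ip g f.
Proof. by apply: eq_bigr => v _; rewrite mulrC. Qed.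

Lemma ip_conv2 f g s : ip (fun v => (1 - s) * f v + s * g v) (fun v => (1 - s) * f v + s * g v) =
  ip f f - 2 * s * (ip f f - ip f g) + s ^+ 2 * \sum_(v < n) (g v - f v) ^+ 2.
Proof.
rewrite /ip -sumrB !mulr_sumr -sumrB -big_split; apply: eq_bigr => v _ /=; ring.
Qed.

Definition meet S T := forall p q, S p -> T q -> exists v, [/\ (v < n)%N, v \in p & v \in q].

Lemma hull_meet S T mu nu : meet S T -> hull S mu -> hull T nu -> 1 <= ip mu nu.
Proof.
move=> ST; have cv (a b s : R) : 0 <= s <= 1 -> 1 <= a -> 1 <= b -> 1 <= (1 - s) * a + s * b.
  move=> /andP[s0 s1] a1 b1; have : 0 <= (1 - s) * (a - 1) by rewrite mulr_ge0// subr_ge0.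
  have : 0 <= s * (b - 1) by rewrite mulr_ge0// subr_ge0.
  by lra.
move=> hm; elim: hm nu => [p Sp|f g s _ IHf _ IHg s01] nu hn; last by rewrite ip_convl cv ?IHf ?IHg.
elim: hn => [q Tq|f g s _ IHf _ IHg s01]; last by rewrite ipC ip_convl cv// ipC.
have [v [vn vp vq]] := ST _ _ Sp Tq.
rewrite /ip (bigD1 (Ordinal vn)) //= /ind vp vq mulr1 lerDl sumr_ge0// => i _.
by rewrite mulr_ge0 ?ler0n.
Qed.

Definition adm S (rho : nat -> R) := [/\ forall v, 0 <= rho v, ip rho rho <= 2 &
  forall p, S p -> 1 <= ip (ind p) rho].

(** If all squared norms on the hull are at least 19/20, take mu almost minimising. Moving mu
    towards the indicator of a path cannot lower the norm by much, so its product with each path is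
    at least t, the squared norm minus 1/20. Then mu / t is admissible: t is at least 9/10, and (t +
    1/20) / t^2 is at most 2. The slack in the constants spares the existence of a minimiser. *)
Lemma adm_or_small S : (exists rho, adm S rho) \/ (exists2 mu, hull S mu & ip mu mu < 19 / 20).
Proof.
have [[p0 Sp0]|S0] := pselect (exists p, S p); last first.
  left; exists (fun=> 0); split => //; last by move=> p Sp; case: S0; exists p.
  by rewrite /ip big1 ?ler0n// => v _; rewrite mul0r.
have [|big] := pselect (exists2 mu, hull S mu & ip mu mu < 19 / 20); [by right|left].
pose E := [set ip mu mu | mu in hull S].
have E0 : has_inf E.
  split; first by exists (ip (ind p0) (ind p0)), (ind p0) => //; exact: hull_gen.
  by exists 0 => _ [mu _ <-]; apply: sumr_ge0 => v _; rewrite -expr2 sqr_ge0.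
pose m := inf E; have mE mu : hull S mu -> m <= ip mu mu by move=> h; apply: ge_inf; [case: E0|exists mu].
have n0 : 0 < n.+1%:R :> R by rewrite ltr0n.
(* So small that the quadratic term of the variation, at most s^2 (n + 1), does not exceed s /
   40. *)
pose s : R := (40 * n.+1%:R)^-1; have s0 : 0 < s by rewrite invr_gt0 mulr_gt0.
have sn : s * n.+1%:R = 40^-1 by rewrite /s invfM -mulrA mulVf ?mulr1// gt_eqF.
have n1 : 1 <= n.+1%:R :> R by rewrite ler1n.
have s1 : s <= 40^-1 by have := ler_wpM2l (ltW s0) n1; rewrite mulr1 sn.
have [|_ [mu hm <-] mu_lt] := inf_adherent (eps := s / 20) _ E0; first by rewrite divr_gt0.
rewrite -/m in mu_lt.
have mu95 : 19 / 20 <= ip mu mu by rewrite leNgt; apply/negP => h; apply: big; exists mu.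
pose t := ip mu mu - 20^-1; have t0 : 0 < t by rewrite /t; lra.
have key p : S p -> t <= ip mu (ind p).
  move=> Sp; have hp : hull S (ind p) by exact: hull_gen.
  have s01 : 0 <= s <= 1 by rewrite ltW//=; lra.
  have := mE _ (hull_conv hm hp s01); rewrite ip_conv2.
  have sq : \sum_(v < n) (ind p v - mu v) ^+ 2 <= n.+1%:R.
    apply: (@le_trans _ _ (\sum_(v < n) 1)); last by rewrite sumr_const card_ord ler_nat.
    apply: ler_sum => v _; have /andP[a0 a1] := hull01 v hm; have /andP[b0 b1] := hull01 v hp.
    by rewrite -real_normK ?num_real// expr_le1 ?normr_ge0// ler_norml; lra.
  have : s ^+ 2 * \sum_(v < n) (ind p v - mu v) ^+ 2 <= s * 40^-1.
    by rewrite expr2 -mulrA ler_pM2l// -sn ler_pM2l.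
  move: (\sum_(v < n) _) => Q; rewrite -/m => h1 h2; rewrite /t.
  have : s * (2 * (ip mu mu - ip mu (ind p))) <= s * (20^-1 + 40^-1).
    by move: mu_lt h1 h2; move: (ip mu mu) (ip mu (ind p)) (s ^+ 2 * Q) => a b z; lra.
  by rewrite ler_pM2l//; lra.
exists (fun v => mu v / t); split.
- by move=> v; have /andP[a _] := hull01 v hm; rewrite divr_ge0// ltW.
- have -> : ip (fun v => mu v / t) (fun v => mu v / t) = ip mu mu / t ^+ 2.
    rewrite /ip mulr_suml; apply: eq_bigr => v _; field; exact: lt0r_neq0.
  rewrite ler_pdivrMr ?exprn_gt0//; have -> : ip mu mu = t + 20^-1 by rewrite /t; lra.
  have : 9 / 10 <= t by rewrite /t; lra.
  by rewrite expr2; nra.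
- move=> p Sp; rewrite ipC; have -> : ip (fun v => mu v / t) (ind p) = ip mu (ind p) / t.
    by rewrite /ip mulr_suml; apply: eq_bigr => v _; rewrite mulrAC.
  by rewrite ler_pdivlMr// mul1r key.
Qed.

(** Otherwise both hulls contain a point of squared norm less than 19/20. Their product is at least
    1 by [hull_meet], yet at most the mean of the two squared norms. *)
Lemma adm_duality S T : meet S T -> (exists rho, adm S rho) \/ (exists rho, adm T rho).
Proof.
move=> ST; have [|[mu hm m1]] := adm_or_small S; first by left.
have [|[nu hn n1]] := adm_or_small T; first by right.
have := hull_meet ST hm hn; have : 0 <= \sum_(v < n) (mu v - nu v) ^+ 2.
  by apply: sumr_ge0 => v _; rewrite sqr_ge0.
have -> : \sum_(v < n) (mu v - nu v) ^+ 2 = ip mu mu + ip nu nu - 2 * ip mu nu.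
  by rewrite /ip mulr_sumr -big_split -sumrB; apply: eq_bigr => v _ /=; ring.
lra.
Qed.

End vel.

Section energy.
Variable R : realType.
Implicit Types (g rho : nat -> R) (B Z : pred nat).

Definition energy (E : seq (nat * nat)) g : R := \sum_(e <- E) (g e.1 - g e.2) ^+ 2.
Definition deg (E : seq (nat * nat)) v := \sum_(e <- E) ((e.1 == v) + (e.2 == v))%N.

Definition paths c B Z : set (seq nat) :=
  [set p | exists x s, [/\ p = x :: s, x \in B, last x s \in Z & path (crel c) x s]].

(** The length of an edge is the sum of the weights of its ends. Every vertex of a nontrivial path
    is then counted at least once, so a path is at least as long as its weight under an admissible
    [rho]. *)
Fixpoint cost rho (x : nat) (s : seq nat) : R :=
  if s is y :: s' then rho x + rho y + cost rho y s' else 0.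

Lemma cost_ge0 rho x s : (forall v, 0 <= rho v) -> 0 <= cost rho x s.
Proof. by move=> r0; elim: s x => //= y s IH x; rewrite addr_ge0// addr_ge0. Qed.

Lemma cost_rcons rho x s y : cost rho x (rcons s y) = cost rho x s + (rho (last x s) + rho y).
Proof. by elim: s x => [|z s IH] x /=; rewrite ?addr0 ?add0r// IH addrA. Qed.

Lemma cost_ip n rho x s : (forall v, 0 <= rho v) -> s != [::] -> ip n (ind R (x :: s)) rho <= cost rho x s.
Proof.
move=> r0; have one (p : seq nat) (y : nat) : ip n (ind R (y :: p)) rho <= rho y + ip n (ind R p) rho.
  have h : \sum_(v < n) ((v : nat) == y)%:R * rho v <= rho y.
    have [yn|yn] := ltnP y n; last first.
      rewrite big1 // => v _; case: eqP => [E|]; rewrite ?mul0r//.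
      by have := ltn_ord v; rewrite E ltnNge yn.
    rewrite (bigD1 (Ordinal yn)) //= eqxx mul1r big1 ?addr0// => v.
    by rewrite -val_eqE /= => /negbTE ->; rewrite mul0r.
  apply: (@le_trans _ _ (\sum_(v < n) ((v : nat) == y)%:R * rho v + ip n (ind R p) rho)); last by rewrite lerD2r.
  rewrite /ip -big_split /=; apply: ler_sum => v _.
  rewrite /ind inE -mulrDl ler_wpM2r// -natrD ler_nat.
  by case: (_ == _); case: (_ \in _).
have two y t : ip n (ind R (y :: t)) rho <= rho y + cost rho y t.
  elim: t y => [|z t IH] y; apply: le_trans (one _ _) _.
    by rewrite /= lerD2l /ip big1// => v _; rewrite /ind mul0r.
  rewrite lerD2l; apply: le_trans (IH z) _; rewrite /= -addrA lerDr//.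
case: s => // y t _; apply: le_trans (one _ _) _; rewrite /= -addrA lerD2l; exact: two.
Qed.

Lemma ees_lt c e : wf c -> e \in ees c -> (e.1 < vn c)%N /\ (e.2 < vn c)%N.
Proof. by move=> wc; rewrite eesE => /mapP[d _ ->] /=; split; exact: slab_mem. Qed.

Lemma sum_deg c (F : nat -> R) : wf c ->
  \sum_(e <- ees c) (F e.1 + F e.2) = \sum_(v < vn c) (deg (ees c) v)%:R * F v.
Proof.
move=> wc; have E (e : nat * nat) : e \in ees c -> F e.1 + F e.2 = \sum_(v < vn c) ((e.1 == v) + (e.2 == v))%:R * F v.
  move=> /(ees_lt wc)[h1 h2].
  have one (x : nat) : (x < vn c)%N -> F x = \sum_(v < vn c) (x == v)%:R * F v.
    move=> xn; rewrite (bigD1 (Ordinal xn)) //= eqxx mul1r big1 ?addr0// => v.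
    by rewrite -val_eqE /= eq_sym => /negbTE ->; rewrite mul0r.
  rewrite (one _ h1) (one _ h2) -big_split /=; apply: eq_bigr => v _.
  by rewrite natrD mulrDl.
rewrite big_seq (eq_bigr _ (fun e h => E e h)) -big_seq exchange_big /=; apply: eq_bigr => v _.
by rewrite /deg natr_sum mulr_suml.
Qed.

Lemma energy_metric c g rho (D : nat) : wf c -> (forall v, 0 <= rho v) ->
  (forall v, (v < vn c)%N -> (deg (ees c) v <= D)%N) ->
  (forall e, e \in ees c -> `|g e.1 - g e.2| <= rho e.1 + rho e.2) ->
  energy (ees c) g <= 2 * D%:R * ip (vn c) rho rho.
Proof.
move=> wc r0 dD gr; apply: (@le_trans _ _ (\sum_(e <- ees c) 2 * (rho e.1 ^+ 2 + rho e.2 ^+ 2))).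
  rewrite /energy !big_seq; apply: ler_sum => e ee.
  apply: (@le_trans _ _ ((rho e.1 + rho e.2) ^+ 2)).
    by rewrite -real_normK ?num_real// lerXn2r ?nnegrE ?addr_ge0// gr.
  have : 0 <= (rho e.1 - rho e.2) ^+ 2 by exact: sqr_ge0.
  by rewrite sqrrB sqrrD mulr2n; lra.
rewrite -mulr_sumr (sum_deg (fun v => rho v ^+ 2))// -mulrA ler_pM2l// /ip mulr_sumr.
apply: ler_sum => v _; rewrite -expr2 ler_wpM2r ?sqr_ge0// ler_nat.
exact: dD.
Qed.

Lemma flow c B Z rho (D : nat) : wf c -> (forall v, v \in B -> v \in Z -> False) ->
  (forall v, (v < vn c)%N -> (deg (ees c) v <= D)%N) -> adm (vn c) (paths c B Z) rho ->
  exists g, [/\ forall v, 0 <= g v <= 1, forall v, v \in B -> g v = 1,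
    forall v, v \in Z -> g v = 0 & energy (ees c) g <= 4 * D%:R].
Proof.
move=> wc BZ dD [r0 rN rP].
pose A v : set R := [set x | x = 1 \/ exists b s, [/\ b \in B, last b s = v, path (crel c) b s & x = cost rho b s]].
have A0 v : has_inf (A v).
  split; first by exists 1; left.
  by exists 0 => _ [->|[b [s [_ _ _ ->]]]] //; exact: cost_ge0.
have d0 v : 0 <= inf (A v).
  by apply: lb_le_inf; [case: (A0 v)|move=> _ [->|[b [s [_ _ _ ->]]]] //; exact: cost_ge0].
have d1 v : inf (A v) <= 1 by apply: ge_inf; [case: (A0 v)|left].
have dB v : v \in B -> inf (A v) = 0.
  move=> vB; apply/eqP; rewrite eq_le d0 andbT; apply: ge_inf; first by case: (A0 v).
  by right; exists v, [::].
have dZ v : v \in Z -> inf (A v) = 1.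
  move=> vZ; apply/eqP; rewrite eq_le d1 /=; apply: lb_le_inf; first by case: (A0 v).
  move=> _ [->//|[b [s [bB sv ps ->]]]].
  have sn : s != [::] by apply/eqP => s0; apply: (BZ v) => //; rewrite -sv s0.
  apply: le_trans (cost_ip (vn c) b r0 sn); apply: rP; exists b, s; split => //.
  by rewrite sv.
have dE u v : crel c u v -> inf (A v) <= inf (A u) + (rho u + rho v).
  move=> uv; rewrite -lerBlDr; apply: lb_le_inf; first by case: (A0 u).
  move=> x [->|[b [s [bB su ps ->]]]]; first by rewrite lerBlDr (le_trans (d1 v))// lerDl addr_ge0.
  rewrite lerBlDr; apply: ge_inf; first by case: (A0 v).
  right; exists b, (rcons s v); rewrite last_rcons rcons_path ps su; split => //.
  by rewrite cost_rcons su.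
exists (fun v => 1 - inf (A v)); split.
- by move=> v; have := d0 v; have := d1 v; lra.
- by move=> v /dB ->; rewrite subr0.
- by move=> v /dZ ->; rewrite subrr.
apply: (@le_trans _ _ (2 * D%:R * ip (vn c) rho rho)).
  apply: energy_metric => // e ee.
  have h1 : crel c e.1 e.2 by rewrite /crel /adj -surjective_pairing ee.
  have h2 : crel c e.2 e.1 by rewrite /crel /adj -surjective_pairing ee orbT.
  have := dE _ _ h1; have := dE _ _ h2; rewrite ler_norml; move: (inf _) (inf _) => a b; lra.
have : 0 <= D%:R :> R by exact: ler0n.
by move=> D0; have := ler_wpM2l D0 rN; lra.
Qed.
End energy.

End Duality.

(** * Potentials at every scale and their combination *)

Module Potentials.
Import structures.
Import all_boot all_order all_algebra.
Import zify ring lra.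
Import boolp classical_sets reals.
Import Codes CodeMaps Labels Rotation Crossing Duality.
Import Order.TTheory GRing.Theory Num.Theory.
Local Open Scope ring_scope.

Lemma es_map c bs bs' k k' (m : nat -> nat) : wf c -> size bs = (per c).+1 -> bs' = map m bs ->
  (forall j, (j < nin c)%N -> m (k + j)%N = (k' + j)%N) ->
  es c bs' k' = [seq (m e.1, m e.2) | e <- es c bs k].
Proof.
have hd (b : seq nat) n : size b = n.+1 -> (last 0%N (map m b), head 0%N (map m b)) = (m (last 0%N b), m (head 0%N b)).
  by case: b => //= x b _; rewrite last_map.
elim: c bs bs' k k' => [|c IH|c1 IH1 c2 IH2] bs bs' k k' wc sb -> mk.
- by rewrite /= (hd _ _ sb).
- case/andP: wc => wc p1; rewrite /= (hd _ _ sb); congr cons.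
  apply: IH => //.
  + by rewrite size_rcons sb /= prednK// ltnW.
  + by rewrite map_rcons -[k in m k]addn0 mk// addn0.
  + by move=> j jn; rewrite addSnnS mk ?addSnnS.
case/andP: wc => w1 w2; rewrite /= (hd _ _ sb) map_cat; congr (_ :: (_ ++ _)).
- apply: IH1 => //; first by rewrite size_takel// sb ltnS leq_addr.
    by rewrite map_take.
  by move=> j jn; apply: mk; apply: leq_trans jn (leq_addr _ _).
- apply: IH2 => //; first by rewrite size_drop sb /= subSn ?leq_addr// addKn.
    by rewrite map_drop.
  by move=> j jn; rewrite -!addnA mk//= ltn_add2l.
Qed.

Section events.
Variable R : realType.
Implicit Types (g : nat -> R) (B Z : pred nat) (kap : R).

(** The bound N on the size of the support makes the property local in the end: it is converted into
    a bound on the distance to the root in [goodv_mgood]. *)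
Definition gset c B Z kap N := exists g, [/\ forall v, 0 <= g v <= 1, forall v, B v -> g v = 1,
  forall v, Z v -> g v = 0, energy (ees c) g <= kap & (count (fun v => g v != 0%R) (iota 0 (vn c)) <= N)%N].

(** Extension by 0 from a sub-map: the edges [E] of [c] that are not edges of [c2] touch the image
    of [c2] only where the potential vanishes, so they cost nothing. *)
Lemma gset_transfer c c2 (m : nat -> nat) E B Z B2 Z2 kap N : wf c2 ->
  {in gtn (vn c2) &, injective m} -> (forall v, (v < vn c2)%N -> (m v < vn c)%N) ->
  (forall g, energy (ees c) g = energy E g + energy (ees c2) (g \o m)) ->
  (forall e y, e \in E -> (y < vn c2)%N -> m y = e.1 \/ m y = e.2 -> Z2 y) ->
  (forall i, B i -> exists y, [/\ (y < vn c2)%N, B2 y & m y = i]) ->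
  (forall i, Z i -> forall y, (y < vn c2)%N -> m y = i -> Z2 y) ->
  gset c2 B2 Z2 kap N -> gset c B Z kap N.
Proof.
move=> w2 mi ml eE eZ bE zE [g2 [g01 gB gZ ge gN]].
pose g v := if [pick y : 'I_(vn c2) | m y == v] is Some y then g2 y else 0.
have gm y : (y < vn c2)%N -> g (m y) = g2 y.
  move=> yl; rewrite /g; case: pickP => [z /eqP/mi|/(_ (Ordinal yl))]; last by rewrite /= eqxx.
  by rewrite !inE => /(_ (ltn_ord z) yl) ->.
have g0 v : (forall y, (y < vn c2)%N -> m y = v -> Z2 y) -> g v = 0.
  by move=> h; rewrite /g; case: pickP => // y /eqP yv; apply: gZ; exact: h yv.
exists g; split.
- by move=> v; rewrite /g; case: pickP => // *; rewrite lexx ler01.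
- by move=> v /bE[y [yl yB <-]]; rewrite gm// gB.
- by move=> v /zE h; exact: g0.
- rewrite eE [X in X + _](_ : _ = 0) ?add0r; last first.
    rewrite /energy big_seq big1// => e eE'.
    by rewrite !g0 ?subrr ?expr0n// => y yl ye; apply: eZ eE' yl _; [right|left].
  apply: le_trans ge; rewrite /energy le_eqVlt; apply/orP; left; apply/eqP.
  rewrite !big_seq; apply: eq_bigr => e /(ees_lt w2)[h1 h2] /=; by rewrite !gm.
- apply: leq_trans gN; rewrite -!size_filter -[X in (_ <= X)%N](size_map m); apply: uniq_leq_size.
    by rewrite filter_uniq// iota_uniq.
  move=> v; rewrite mem_filter => /andP[]; rewrite /g; case: pickP => [y /eqP <- yn _|_]; last by rewrite eqxx.
  by apply: map_f; rewrite mem_filter yn mem_iota /=.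
Qed.

Lemma gset_mono c B Z B' Z' kap kap' N N' : (forall i, B' i -> B i) -> (forall i, Z' i -> Z i) ->
  kap <= kap' -> (N <= N')%N -> gset c B Z kap N -> gset c B' Z' kap' N'.
Proof.
move=> BB ZZ kk NN [g [h1 h2 h3 h4 h5]]; exists g; split => //.
- by move=> v /BB/h2. - by move=> v /ZZ/h3. - exact: le_trans kk. - exact: leq_trans NN.
Qed.

(** Block and outside of the window on the boundary: the block starts at f and has length L, and the
    window exceeds it by ph vertices in front and by e vertices, the last one excluded from being
    nonzero at distance e, behind. *)
Definition BW f L : pred nat := fun i => (f <= i < f + L)%N.
Definition ZW P f L ph e : pred nat := fun i => ((i <= P) && ((i < f - ph) || (f + L + e <= i)))%N.

Variables (L : nat) (kap : R) (N : nat).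
Definition gam c f ph e := gset c (BW f L) (ZW (per c) f L ph e) kap N.

Lemma gam_mono c f ph ph' e e' : (ph <= ph')%N -> (e <= e')%N -> gam c f ph e -> gam c f ph' e'.
Proof.
move=> pp ee; apply: gset_mono => // i; rewrite /ZW => /andP[-> /orP[h|h]] /=; apply/orP; [left|right].
  by move: h pp; clear; lia.
by move: h ee; clear; lia.
Qed.

Lemma ends_stdb P : (last 0 (stdb P), head 0 (stdb P))%N = (P, 0)%N.
Proof. by rewrite /stdb -{1}addn1 iotaD last_cat. Qed.

Lemma ees_CI c : wf (CI c) -> ees (CI c) = (per (CI c), 0%N) :: ees c.
Proof.
case/andP=> wc p1; have pE : (per (CI c)).+1 = per c by rewrite /= prednK// ltnW.
pose P := per (CI c); have -> : ees (CI c) = (last 0%N (stdb P), head 0%N (stdb P)) :: es c (rcons (stdb P) P.+1) P.+2 by [].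
rewrite ends_stdb /ees -pE; congr (_ :: es _ _ _).
by rewrite /stdb -[(_.+2)%N]addn1 iotaD cats1.
Qed.

(** After the removal of the root edge the third corner is the last boundary vertex, of label
    [per c]. It is outside the window, and so are both ends of the root edge, so the same potential
    serves. *)
Lemma gam_CI c f ph e : wf (CI c) -> (ph < f)%N -> (f + L + e <= per (CI c))%N ->
  gam c f ph e -> gam (CI c) f ph e.
Proof.
move=> wI pf feP; case/andP: (wI) => wc p1; have pE : (per (CI c)).+1 = per c by rewrite /= prednK// ltnW.
have vE : vn (CI c) = vn c by rewrite /vn pE addnS.
apply: (@gset_transfer _ _ id [:: (per (CI c), 0%N)]) => //.
- by move=> v; rewrite vE.
- by move=> g; rewrite ees_CI// /energy big_cons big_seq1.
- move=> e' y; rewrite inE => /eqP -> _ [] /= ->; rewrite /ZW.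
    by rewrite -pE leqnSn feP orbT.
  by rewrite leq0n subn_gt0 pf.
- move=> i iB; exists i; split => //; move: iB feP; rewrite /BW /vn -pE; clear; lia.
- by move=> i /andP[iP h] y _ ->; rewrite /ZW h andbT -pE ltnW.
Qed.

Lemma mem_labs_front c1 c2 x : wf (CS c1 c2) ->
  (x \in labs c1 (take (per c1).+1 (stdb (per (CS c1 c2)))) (per (CS c1 c2)).+1) =
  ((x <= per c1) || (per (CS c1 c2) < x <= per (CS c1 c2) + nin c1))%N.
Proof.
move=> _; rewrite mem_labs take_iota mem_iota /= addSn ltnS.
by have -> : minn (per c1).+1 (per c1 + per c2).+1 = (per c1).+1 by apply/minn_idPl; rewrite ltnS leq_addr.
Qed.

Lemma es_mem_labs c bs k e : wf c -> size bs = (per c).+1 -> e \in es c bs k ->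
  (e.1 \in labs c bs k) /\ (e.2 \in labs c bs k).
Proof. by move=> wc sb; rewrite es_dl => /mapP[x _ ->] /=; split; exact: lab_mem. Qed.

Lemma ees_CS c1 c2 : let P := (per c1 + per c2)%N in ees (CS c1 c2) = (P, 0%N) ::
  es c1 (take (per c1).+1 (stdb P)) P.+1 ++ es c2 (drop (per c1) (stdb P)) (P.+1 + nin c1).
Proof. by move=> P; rewrite -(ends_stdb P). Qed.

(** The block lies on the second piece, whose boundary starts at the vertex [per c1]. The cut vertex
    and the ends of the root edge are outside the window, so the potential of the piece extends by
    0; [gam_back] is the other side. *)
Lemma gam_front c1 c2 f ph e : wf (CS c1 c2) -> (ph < f)%N -> (per c1 + f + L + e <= per (CS c1 c2))%N ->
  gam c2 f ph e -> gam (CS c1 c2) (per c1 + f) ph e.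
Proof.
move=> wS pf feP; case/andP: (wS) => w1 w2.
pose m v := (if v <= per c2 then per c1 + v else v - (per c2).+1 + ((per c1 + per c2).+1 + nin c1))%N.
pose P := (per c1 + per c2)%N.
have s1 : size (take (per c1).+1 (stdb P)) = (per c1).+1.
  by rewrite size_takel// size_iota ltnS leq_addr.
have E2 : es c2 (drop (per c1) (stdb P)) (P.+1 + nin c1) = [seq (m e.1, m e.2) | e <- ees c2].
  apply: es_map => //; first exact: stdb_size.
    rewrite drop_iota subSn ?leq_addr// addKn add0n -[per c1 in LHS]addn0 iotaDl.
    by apply/eq_in_map => i; rewrite mem_iota add0n ltnS /m => /andP[_ ->].
  by move=> j jn; rewrite /m leqNgt ltnS leq_addr /= addnC addKn addnC.
apply: (@gset_transfer _ _ m ((P, 0%N) :: es c1 (take (per c1).+1 (stdb P)) P.+1)) => //.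
- move=> x y; rewrite !inE /vn /m /= => xl yl.
  by case: (leqP x (per c2)); case: (leqP y (per c2)); move: xl yl; clear; lia.
- by move=> v; rewrite /vn /m /= => vl; case: (leqP v (per c2)); move: vl; clear; lia.
- by move=> g; rewrite ees_CS -/P E2 /energy big_cons big_cat big_map big_cons addrA.
- move=> e' y; rewrite inE => /predU1P[->|eE] yl /=.
    case=> my; rewrite /ZW; move: my feP pf yl; rewrite /m /vn /P /=; case: (leqP y (per c2)); clear; lia.
  have [h1 h2] := es_mem_labs w1 s1 eE.
  have key x : x \in labs c1 (take (per c1).+1 (stdb P)) P.+1 -> m y = x -> ZW (per c2) f L ph e y.
    rewrite mem_labs_front// /ZW => h my; move: h; rewrite -{}my /m /= => h.
    by move: h yl pf; rewrite /vn; case: (leqP y (per c2)); clear; lia.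
  by case=> my; [apply: key h1 my|apply: key h2 my].
- move=> i; rewrite /BW => h; exists (i - per c1)%N; move: h feP; rewrite /vn /m /= => h1 h2; split.
  + by move: h1 h2; clear; lia.
  + by move: h1 h2; clear; lia.
  + by rewrite ifT; move: h1 h2; clear; lia.
- by move=> i; rewrite /ZW /m /vn /= => h y yl my; move: h yl; rewrite -my; case: (leqP y (per c2)); clear; lia.
Qed.

Lemma gam_back c1 c2 f ph e : wf (CS c1 c2) -> (ph < f)%N -> (f + L + e <= per c1)%N ->
  gam c1 f ph e -> gam (CS c1 c2) f ph e.
Proof.
move=> wS pf feP; case/andP: (wS) => w1 w2.
pose P := (per c1 + per c2)%N.
pose m v := (if v <= per c1 then v else v - (per c1).+1 + P.+1)%N.
have s2 : size (drop (per c1) (stdb P)) = (per c2).+1.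
  by rewrite size_drop size_iota subSn ?leq_addr// addKn.
have E1 : es c1 (take (per c1).+1 (stdb P)) P.+1 = [seq (m e.1, m e.2) | e <- ees c1].
  apply: es_map => //; first exact: stdb_size.
    rewrite take_iota (minn_idPl _) ?ltnS ?leq_addr// -[LHS]map_id.
    by apply/eq_in_map => i; rewrite mem_iota add0n ltnS /m => /andP[_ ->].
  by move=> j jn; rewrite /m leqNgt ltnS leq_addr /= addnC addKn addnC.
apply: (@gset_transfer _ _ m ((P, 0%N) :: es c2 (drop (per c1) (stdb P)) (P.+1 + nin c1))) => //.
- move=> x y; rewrite !inE /vn /m /P /= => xl yl.
  by case: (leqP x (per c1)); case: (leqP y (per c1)); move: xl yl; clear; lia.
- by move=> v; rewrite /vn /m /P /= => vl; case: (leqP v (per c1)); move: vl; clear; lia.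
- by move=> g; rewrite ees_CS -/P E1 /energy big_cons big_cat big_map big_cons /= [X in _ + X]addrC addrA.
- have key y x : (y < vn c1)%N -> x \in labs c2 (drop (per c1) (stdb P)) (P.+1 + nin c1) -> m y = x -> ZW (per c1) f L ph e y.
    rewrite mem_labs drop_iota mem_iota /ZW /vn /m /P => yl h my; move: h; rewrite -{}my => h.
    by move: yl pf feP h; case: (leqP y (per c1)); clear; lia.
  move=> e' y; rewrite inE => /predU1P[->|eE] yl /=.
    case=> my; last by rewrite /ZW; move: my pf yl; rewrite /m /vn /P /=; case: (leqP y (per c1)); clear; lia.
    apply: key yl _ my; rewrite mem_labs drop_iota mem_iota /P; clear; lia.
  have [h1 h2] := es_mem_labs w2 s2 eE.
  by case=> my; [apply: key yl h1 my|apply: key yl h2 my].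
- move=> i; rewrite /BW => h; exists i; move: h feP; rewrite /vn /m /= => h1 h2; split => //.
  + by move: h1 h2; clear; lia.
  + by rewrite ifT; move: h1 h2; clear; lia.
- by move=> i; rewrite /ZW /m /vn /P /= => h y yl my; move: h yl; rewrite -my; case: (leqP y (per c1)); clear; lia.
Qed.

Lemma gam_rot c s f f' ph e : wf c -> (f' + s = f \/ f' + s = f + (per c).+1)%N -> (s <= per c)%N ->
  (ph <= f)%N -> (ph <= f')%N -> (f + L + e <= (per c).+1)%N -> (f' + L + e <= (per c).+1)%N ->
  gam (rotc s c) f' ph e -> gam c f ph e.
Proof.
move=> wc fs sP pf pf' fe fe'; have [sg h] := rotcP s wc.
have vE : vn (rotc s c) = vn c by rewrite /vn (rs_per h) (rs_nin h).
have key i : (i <= per c)%N -> sg i = if (i + s <= per c)%N then (i + s)%N else (i + s - (per c).+1)%N.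
  move=> iP; rewrite (rs_ext h)//; case: leqP => h1; first by rewrite modn_small.
  rewrite -{1}(subnK h1) modnDr modn_small//; move: iP sP h1; clear; lia.
apply: (@gset_transfer _ _ sg [::]) => //.
- exact: rs_wf h.
- by rewrite vE; exact: rs_inj h.
- by rewrite vE; exact: rs_lt h.
- move=> g; rewrite [X in X + _]big_nil add0r /energy.
  rewrite (rs_sum h (F := fun u v => (g u - g v) ^+ 2))// => u v.
  by rewrite -sqrrN opprB.
- move=> i; rewrite /BW => iB; exists (i + f' - f)%N; split.
  + by rewrite vE /vn; move: iB fe fe'; clear; lia.
  + by move: iB fe fe'; clear; lia.
  + rewrite key; last by move: iB fe fe'; clear; lia.
    by case: ifP; move: iB fe fe' fs; clear; lia.
move=> i; rewrite /ZW (rs_per h) => /andP[iP iZ] y yl yi.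
have yP : (y <= per c)%N.
  pose y' := ((i + (per c).+1 - s) %% (per c).+1)%N.
  have y'P : (y' <= per c)%N by rewrite -ltnS ltn_mod.
  suff -> : y = y' by [].
  apply: (rs_inj h); rewrite ?inE -?vE//; first by rewrite vE /vn; move: y'P; clear; lia.
  rewrite yi (rs_ext h)// /y' modnDml subnK; last by move: sP; clear; lia.
  by rewrite modnDr modn_small.
move: yi; rewrite key//; case: (leqP (y + s) (per c)) => ys yi; rewrite yP /=; move: iZ yi ys iP yP fs pf pf' fe fe' sP; clear; lia.
Qed.

Definition nb c f ph e : R := (~~ `[< gam c f ph e >])%:R.
Definition bad c f ph e : R := wt 1 c * nb c f ph e.

Lemma nb01 c f ph e : 0 <= nb c f ph e <= 1.
Proof. by rewrite /nb ler0n lern1 leq_b1. Qed.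

Lemma bad_ge0 c f ph e : 0 <= bad c f ph e.
Proof. by rewrite mulr_ge0 ?wt_ge0 ?ler0n. Qed.

Lemma bad_le_wt c f ph e : bad c f ph e <= wt 1 c.
Proof. by rewrite ler_piMr ?wt_ge0//; case/andP: (nb01 c f ph e). Qed.

Lemma nb_le c c' f f' ph ph' e e' : (gam c f ph e -> gam c' f' ph' e') -> nb c' f' ph' e' <= nb c f ph e.
Proof.
move=> h; rewrite /nb ler_nat; case: (asboolP (gam c f ph e)) => [/h g|_]; first by rewrite asboolT.
by rewrite leq_b1.
Qed.

Lemma sb_bad1 P f ph e : (0 < P)%N -> sb (fun c => bad c f ph e) P (av R P).
Proof. by move=> P0; apply: sb_le (lexx _) (mass_le _ P0) => c _; exact: bad_le_wt. Qed.

Lemma sb_bad_mono P f ph ph' e e' x : (ph <= ph')%N -> (e <= e')%N ->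
  sb (fun c => bad c f ph e) P x -> sb (fun c => bad c f ph' e') P x.
Proof.
move=> pp ee; apply: sb_le (lexx _) => c _; rewrite ler_wpM2l ?wt_ge0//; apply: nb_le; exact: gam_mono.
Qed.

Lemma wt_nin c c' : per c = per c' -> nin c = nin c' -> wf c -> wf c' -> wt (1 : R) c = wt 1 c'.
Proof.
have E (d : code) : wf d -> wt (1 : R) d = 9^-1 ^+ (per d + nin d) * (2 / 3) ^+ nin d.
  elim: d => [_|d IH /= /andP[/IH -> p1]|d1 IH1 d2 IH2 /= /andP[/IH1 -> /IH2 ->]].
  - by rewrite /= expr1 mulr1.
  - have -> : ((per d).-1 + (nin d).+1 = per d + nin d)%N by move: p1; clear; lia.
    by rewrite exprS; ring.
  - by rewrite addnACA !exprD; ring.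
by move=> pE nE w w'; rewrite !E// pE nE.
Qed.

Lemma sb_bad_rot P s f f' ph e x : (f' + s = f \/ f' + s = f + P.+1)%N -> (s <= P)%N ->
  (ph <= f)%N -> (ph <= f')%N -> (f + L + e <= P.+1)%N -> (f' + L + e <= P.+1)%N ->
  sb (fun c => bad c f' ph e) P x -> sb (fun c => bad c f ph e) P x.
Proof.
move=> fs sP pf pf' fe fe' /(sb_rot s); apply: sb_le (lexx _) => c /andP[wc /eqP pc].
have [sg h] := rotcP s wc.
rewrite /bad (wt_nin (rs_per h) (rs_nin h) (rs_wf h) wc) ler_wpM2l ?wt_ge0//.
by apply: nb_le; apply: gam_rot; rewrite ?pc.
Qed.

(** One peeling step for the mass of failure. A cut at k in front of the block leaves it on the
    second piece, at position f - k; a cut behind it leaves it on the first piece, of size k; for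
    any other cut the whole mass counts as failure. The pieces may be asked for narrower windows,
    [pk k] and [ek k], which is what makes short pieces usable. *)
Lemma sb_peel P f ph e (x1 : R) (pk ek : nat -> nat) (yf yb : nat -> R) :
  (0 < L)%N -> (ph < f)%N -> (f + L + e <= P)%N ->
  (forall k, (pk k <= ph)%N) -> (forall k, (ek k <= e)%N) ->
  sb (fun c => bad c f ph e) P.+1 x1 ->
  (forall k, (0 < k)%N -> (pk k + k < f)%N -> sb (fun c => bad c (f - k) (pk k) e) (P - k) (yf k)) ->
  (forall k, (f + L + ek k <= k < P)%N -> sb (fun c => bad c f ph (ek k)) k (yb k)) ->
  sb (fun c => bad c f ph e) P (2 / 3 * x1 + \sum_(1 <= k < P)
    if (pk k + k < f)%N then av R k * yf k else if (f + L + ek k <= k)%N then yb k * av R (P - k)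
    else av R k * av R (P - k)).
Proof.
move=> L0 pf feP pkp eke h1 hf hb; have P1 : (1 < P)%N by move: L0 pf feP; clear; lia.
have -> : 2 / 3 * x1 = (P == 1%N)%:R * 0 + 2 / 3 * x1 by rewrite mulr0 add0r.
have w0 c : 0 <= wt (1 : R) c by exact: wt_ge0.
apply: sb_step; rewrite ?(ltnW P1)//.
- by move=> PE; rewrite PE in P1.
- apply: sb_le (lexx _) (sbZ _ h1); last by rewrite divr_ge0.
  move=> c cP; apply: (@le_trans _ _ (2 / 3 * (wt 1 c * nb (CI c) f ph e))).
    by rewrite /bad /= mulr1 mulrA.
  rewrite ler_wpM2l ?divr_ge0// /bad ler_wpM2l//.
  have := okc_CIE (ltnW P1) cP => /andP[wI /eqP pI].
  by apply: nb_le; apply: gam_CI; rewrite ?pI.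
move=> k /andP[k0 kP]; have kP' : (0 < P - k)%N by rewrite subn_gt0.
case: ifP => hk; [|case: ifP => hk'].
- move=> s us os; apply: le_trans (sb2_mul (fun c _ => w0 c) (mass_le _ k0) (hf k k0 hk) us os).
  rewrite big_seq [leRHS]big_seq; apply: ler_sum => -[c1 c2] /(allP os) /= /andP[/andP[w1 /eqP p1] /andP[w2 /eqP p2]].
  rewrite /bad /= -mulrA ler_wpM2l// ler_wpM2l//; apply: nb_le.
  have E : (per c1 + (f - k) = f)%N by rewrite p1 subnKC//; move: hk; clear; lia.
  move=> hg; apply: (gam_mono (pkp k) (leqnn e)).
  rewrite -[X in gam (CS c1 c2) X _ _]E; apply: gam_front; rewrite /= ?w1 ?w2 ?p1 ?p2//; move: hk kP feP; clear; lia.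
- move=> s us os; apply: le_trans (sb2_mul (fun c _ => bad_ge0 c f ph (ek k)) (hb k _) (mass_le _ kP') us os); last by rewrite hk'.
  rewrite big_seq [leRHS]big_seq; apply: ler_sum => -[c1 c2] /(allP os) /= /andP[/andP[w1 /eqP p1] /andP[w2 /eqP p2]].
  rewrite /bad /= mulrAC ler_wpM2r// ler_wpM2l//; apply: nb_le => hg; apply: (gam_mono (leqnn ph) (eke k)).
  by apply: gam_back; rewrite /= ?w1 ?w2 ?p1.
- move=> s us os; apply: le_trans (sb2_mul (fun c _ => w0 c) (mass_le _ k0) (mass_le _ kP') us os).
  by apply: ler_sum => -[c1 c2] _ /=; exact: bad_le_wt (CS c1 c2) _ _ _.
Qed.
End events.

(** Degree of the tip of the root edge, of label 0 (see [deg0E]). This vertex stays the tip after a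
    removal, on the first piece in case of a split, so each removal lowers its degree by one. *)
Fixpoint deg0 c := match c with CE => 1%N | CI c => (deg0 c).+1 | CS c1 _ => (deg0 c1).+1 end.

Lemma deg_cons e E v : deg (e :: E) v = ((e.1 == v) + (e.2 == v) + deg E v)%N.
Proof. exact: big_cons. Qed.

Lemma deg_cat E1 E2 v : deg (E1 ++ E2) v = (deg E1 v + deg E2 v)%N.
Proof. exact: big_cat. Qed.

Lemma deg_out E v : (forall e, e \in E -> e.1 != v /\ e.2 != v) -> deg E v = 0%N.
Proof. by move=> h; rewrite /deg big_seq big1// => e /h[/negbTE -> /negbTE ->]. Qed.

Lemma deg_map (m : nat -> nat) E v : (forall e, e \in E -> (m e.1 == m v) = (e.1 == v) /\ (m e.2 == m v) = (e.2 == v)) ->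
  deg [seq (m e.1, m e.2) | e <- E] (m v) = deg E v.
Proof. by move=> h; rewrite /deg big_map big_seq [RHS]big_seq; apply: eq_bigr => e /h[/= -> ->]. Qed.

Lemma deg0E c bs k : wf c -> size bs = (per c).+1 -> uniq bs -> all (fun b => b < k)%N bs ->
  deg (es c bs k) (head 0%N bs) = deg0 c.
Proof.
have lh (b : seq nat) n : size b = n.+2 -> uniq b -> (last 0%N b == head 0%N b) = false.
  by case: b => [|x [|y b]] //= _ /andP[h _]; apply/negbTE; apply: contraNneq h => <-; exact: mem_last.
elim: c bs k => [|c IH|c1 IH1 c2 IH2] bs k wc sb ub ab /=.
- by rewrite deg_cons /= (lh _ _ sb ub) eqxx /deg big_nil.
- have p0 := per_gt0 wc; have lf : (last 0%N bs == head 0%N bs) = false.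
    by apply: (lh bs (per (CI c)).-1) => //; rewrite sb prednK.
  rewrite deg_cons lf eqxx add0n add1n; congr S.
  case/andP: wc => wc p1; rewrite -(IH (rcons bs k) k.+1)//.
  + by congr (deg _ _); case: (bs) sb.
  + by rewrite size_rcons sb /= prednK// ltnW.
  + by rewrite rcons_uniq ub andbT; apply/negP => /(allP ab); rewrite ltnn.
  + by rewrite all_rcons ltnSn; apply: sub_all ab => b /ltnW.
have p0 := per_gt0 wc; case/andP: (wc) => w1 w2.
have lf : (last 0%N bs == head 0%N bs) = false.
  by apply: (lh bs (per (CS c1 c2)).-1) => //; rewrite sb prednK.
rewrite deg_cons lf eqxx add0n add1n; congr S.
have s1 : size (take (per c1).+1 bs) = (per c1).+1 by rewrite size_takel// sb ltnS leq_addr.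
have s2 : size (drop (per c1) bs) = (per c2).+1 by rewrite size_drop sb /= subSn ?leq_addr// addKn.
have hE : head 0%N bs = head 0%N (take (per c1).+1 bs) by case: (bs).
rewrite deg_cat {1}hE IH1// ?take_uniq//; last by apply/allP => z /mem_take /(allP ab).
have hin : head 0%N bs \in take (per c1) bs by have := per_gt0 w1; case: (bs) sb => //= b s _; case: (per c1) => //= n _; rewrite mem_head.
rewrite deg_out ?addn0// => e /(es_mem_labs w2 s2).
have key x : x \in labs c2 (drop (per c1) bs) (k + nin c1) -> x != head 0%N bs.
  rewrite mem_labs => /orP[h|/andP[h _]].
    apply: contraL ub => /eqP xE; rewrite -(cat_take_drop (per c1) bs) cat_uniq.
    by apply/negP => /and3P[_ /hasPn/(_ _ h)]; rewrite xE hin.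
  have := allP ab _ (mem_take hin); rewrite ltn_neqAle => hk.
  by rewrite neq_ltn; apply/orP; right; move: h hk; clear; lia.
by move=> [h1 h2]; split; exact: key.
Qed.

(** Equal to 1 - (3/4)(1/8): the test function [tv] is lowered by 3/4 at size 1, a piece of weight
    [av R 1] = 1/8. *)
Definition lamD {R : realFieldType} : R := 29 / 32.

(** * Exponential tails for vertex degrees *)

Section tails.
Variable R : realType.
Local Notation lam := (@lamD R).

Lemma lam_gt0 : 0 < lam. Proof. by rewrite /lamD; lra. Qed.

Lemma av_anti k : (0 < k)%N -> av R k.+1 <= av R k.
Proof.
move=> k0; have := avSn R k0; have := av_gt0 R k0; have : 1 <= k%:R :> R by rewrite ler1n.
move: (av R k.+1) (av R k) => a b; move: (k%:R : R) => x x1 b0 E.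
have : a * (2 * (x + 2)) <= b * (2 * (x + 2)) by rewrite E ler_pM2l//; lra.
by rewrite ler_pM2r//; lra.
Qed.

(** With [av] itself there is equality without contraction in [tv_rec] for P > 1. Lowering the value
    at size 1 gains a fixed proportion at each step, since the first piece has size 1 with relative
    weight at least 1/8, [av] being decreasing. *)
Definition tv P : R := av R P * (if P == 1%N then 4^-1 else 1).

Lemma tv_rec P : (0 < P)%N -> 2 / 3 * tv P.+1 + \sum_(1 <= k < P) tv k * av R (P - k) <= lam * tv P.
Proof.
rewrite leq_eqVlt => /predU1P[<-|P1].
  by rewrite big_geq// /tv eqxx (_ : (2 == 1)%N = false)// av2 av1 /lamD; lra.
have a1 : av R P <= av R P.-1 by rewrite -{1}(prednK (ltnW P1)); apply: av_anti; rewrite -ltnS prednK// ltnW.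
have P0 := ltnW P1; have := av_rec R P0; rewrite (gtn_eqF P1) mul0r add0r conv_av_int => E.
rewrite big_ltn// subn1 in E; rewrite big_ltn// subn1 /tv (gtn_eqF P1) !mulr1 eqxx av1.
rewrite (@eq_big_nat _ _ _ 2 P _ (fun k => av R k * av R (P - k))) => [|k /andP[k1 _]]; last first.
  by rewrite gtn_eqF// mulr1.
rewrite av1 in E; move: E a1 => /=; rewrite eqSS (gtn_eqF P0) mulr1 /lamD.
move: (av R P.+1) (av R P) (av R P.-1) (\sum_(_ <= _ < _) _) => a b c s; lra.
Qed.

Lemma deg0_tail d P : (0 < P)%N ->
  sb (fun c => (d.+1 <= deg0 c)%N%:R * wt 1 c) P (4 * lam ^+ d * tv P).
Proof.
elim: d P => [|d IH] P P0.
  apply: sb_le (mass_le _ P0) => [c _|]; first by rewrite ler_piMl ?wt_ge0 ?lern1 ?leq_b1.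
  rewrite expr0 mulr1 /tv; have := av_ge0 R P; case: eqP => _ /=; move: (av R P) => a; lra.
have c0 : 0 <= 4 * lam ^+ d by rewrite mulr_ge0 ?exprn_ge0// ltW ?lam_gt0.
have tv0 k : 0 <= tv k by rewrite /tv mulr_ge0 ?av_ge0//; case: eqP => _; rewrite ?invr_ge0 ?ler0n ?ler01.
apply: (sb_le (W' := fun c => (d.+2 <= deg0 c)%N%:R * wt 1 c)
  (x' := (P == 1%N)%:R * 0 + 2 / 3 * (4 * lam ^+ d * tv P.+1) +
   \sum_(1 <= k < P) 4 * lam ^+ d * tv k * av R (P - k))) => //.
  rewrite mulr0 add0r [X in _ + X](_ : _ = 4 * lam ^+ d * \sum_(1 <= k < P) tv k * av R (P - k)).
    have := ler_wpM2l c0 (tv_rec P0); rewrite mulrDr exprS; move: (\sum_(_ <= _ < _) _) => s.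
    by move: (tv P.+1) (tv P) (lam ^+ d) => u v g; lra.
  by rewrite mulr_sumr; apply: eq_bigr => k _; rewrite !mulrA.
apply: sb_step => //.
- by move=> _ /=; rewrite mul0r.
- apply: sb_le (lexx _) (sbZ _ (IH P.+1 isT)); last by rewrite divr_ge0.
  by move=> c _ /=; rewrite ltnS mulr1 mulrCA.
- move=> k /andP[k0 kP] s us os; have kP' : (0 < P - k)%N by rewrite subn_gt0.
  have g0 (c : code) : okc k c -> 0 <= (d.+1 <= deg0 c)%N%:R * wt (1 : R) c by rewrite mulr_ge0 ?wt_ge0 ?ler0n.
  apply: le_trans (sb2_mul g0 (IH k k0) (mass_le _ kP') us os).
  by apply: ler_sum => p _ /=; rewrite ltnS mulrA.
Qed.

Lemma degR c v : (deg (ees c) v)%:R = \sum_(e <- ees c) ((e.1 == v)%:R + (e.2 == v)%:R) :> R.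
Proof. by rewrite /deg natr_sum; apply: eq_bigr => e _; rewrite natrD. Qed.

Lemma deg_rot c i : wf c -> (i <= per c)%N -> deg (ees c) i = deg0 (rotc i c).
Proof.
move=> wc iP; have [sg h] := rotcP i wc; have w' := rs_wf h.
have vE : vn (rotc i c) = vn c by rewrite /vn (rs_per h) (rs_nin h).
rewrite -(deg0E w' (stdb_size _) (stdb_uniq _) (stdb_lt _)).
apply/eqP; rewrite -(eqr_nat R); apply/eqP.
have -> : head 0%N (stdb (per (rotc i c))) = 0%N by [].
rewrite -/(ees (rotc i c)) !degR.
rewrite -(rs_sum h (F := fun u v => (u == i)%:R + (v == i)%:R : R)); last by move=> u v; rewrite addrC.
rewrite !big_seq; apply: eq_bigr => e /(ees_lt w')[h1 h2].
have s0 : sg 0%N = i by rewrite (rs_ext h)// add0n modn_small.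
have key x : (x < vn (rotc i c))%N -> (sg x == i) = (x == 0%N).
  move=> xl; apply/eqP/eqP => [xi|->//]; apply: (rs_inj h); rewrite ?inE -?vE// ?s0//.
by rewrite !key.
Qed.

Lemma deg_tail_ext d P i : (0 < P)%N -> (i <= P)%N ->
  sb (fun c => wt 1 c * (d.+1 <= deg (ees c) i)%N%:R) P (4 * lam ^+ d * av R P).
Proof.
move=> P0 iP; apply: sb_le (sb_rot i (deg0_tail d P0)).
  move=> c /andP[wc /eqP pc]; have [sg h] := rotcP i wc; rewrite mulrC deg_rot ?pc//.
  by rewrite (wt_nin _ (rs_per h) (rs_nin h) (rs_wf h) wc).
have g0 : 0 <= 4 * lam ^+ d by rewrite mulr_ge0 ?exprn_ge0// ltW ?lam_gt0.
rewrite ler_wpM2l// /tv ler_piMr ?av_ge0//.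
by case: eqP => _; lra.
Qed.

Definition bigin d c := count (fun v => d.+1 <= deg (ees c) v)%N (iota (per c).+1 (nin c)).

Lemma bigin_CS d c1 c2 : wf (CS c1 c2) -> (bigin d (CS c1 c2) <= bigin d c1 + bigin d c2)%N.
Proof.
move=> wS; case/andP: (wS) => w1 w2; pose P := (per c1 + per c2)%N.
pose m1 v := (if v <= per c1 then v else v - (per c1).+1 + P.+1)%N.
pose m2 v := (if v <= per c2 then per c1 + v else v - (per c2).+1 + (P.+1 + nin c1))%N.
have E2 : es c2 (drop (per c1) (stdb P)) (P.+1 + nin c1) = [seq (m2 e.1, m2 e.2) | e <- ees c2].
  apply: es_map => //; first exact: stdb_size.
    rewrite drop_iota subSn ?leq_addr// addKn add0n -[per c1 in LHS]addn0 iotaDl.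
    by apply/eq_in_map => i; rewrite mem_iota add0n ltnS /m2 => /andP[_ ->].
  by move=> j jn; rewrite /m2 leqNgt ltnS leq_addr /= addnC addKn addnC.
have E1 : es c1 (take (per c1).+1 (stdb P)) P.+1 = [seq (m1 e.1, m1 e.2) | e <- ees c1].
  apply: es_map => //; first exact: stdb_size.
    rewrite take_iota (minn_idPl _) ?ltnS ?leq_addr// -[LHS]map_id.
    by apply/eq_in_map => i; rewrite mem_iota add0n ltnS /m1 => /andP[_ ->].
  by move=> j jn; rewrite /m1 leqNgt ltnS leq_addr /= addnC addKn addnC.
have dE v : (P < v)%N -> deg (ees (CS c1 c2)) v =
    (deg [seq (m1 e.1, m1 e.2) | e <- ees c1] v + deg [seq (m2 e.1, m2 e.2) | e <- ees c2] v)%N.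
  move=> Pv; rewrite ees_CS -/P deg_cons /= deg_cat E1 E2 (ltn_eqF Pv).
  by rewrite (_ : (0 == v)%N = false)//; apply/negbTE; rewrite neq_ltn (leq_ltn_trans _ Pv).
have D1 v : (per c1 < v < vn c1)%N -> deg (ees (CS c1 c2)) (m1 v) = deg (ees c1) v.
  move=> vl; have Pv : (P < m1 v)%N by rewrite /m1 /P; case: (leqP v (per c1)); move: vl; clear; lia.
  rewrite dE// deg_map => [|e /(ees_lt w1)]; last first.
    move=> [a b]; split; apply/eqP/eqP => [|->//]; move: vl a b; rewrite /vn /m1 /P.
      by case: (leqP v (per c1)); case: (leqP e.1 (per c1)); clear; lia.
    by case: (leqP v (per c1)); case: (leqP e.2 (per c1)); clear; lia.
  rewrite [X in (_ + X)%N]deg_out ?addn0// => _ /mapP[e /(ees_lt w2)[a b] ->] /=; move: vl a b; rewrite /vn /m1 /m2 /P.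
  move: e.1 e.2 => x y vl xl yl; split; apply/eqP; move: vl xl yl.
    by case: (leqP v (per c1)); case: (leqP x (per c2)); clear; lia.
  by case: (leqP v (per c1)); case: (leqP y (per c2)); clear; lia.
have D2 v : (per c2 < v < vn c2)%N -> deg (ees (CS c1 c2)) (m2 v) = deg (ees c2) v.
  move=> vl; have Pv : (P < m2 v)%N by rewrite /m2 /P; case: (leqP v (per c2)); move: vl; clear; lia.
  rewrite dE// addnC deg_map => [|e /(ees_lt w2)]; last first.
    move=> [a b]; split; apply/eqP/eqP => [|->//]; move: vl a b; rewrite /vn /m2 /P.
      by case: (leqP v (per c2)); case: (leqP e.1 (per c2)); clear; lia.
    by case: (leqP v (per c2)); case: (leqP e.2 (per c2)); clear; lia.
  rewrite [X in (_ + X)%N]deg_out ?addn0// => _ /mapP[e /(ees_lt w1)[a b] ->] /=; move: vl a b; rewrite /vn /m1 /m2 /P.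
  move: e.1 e.2 => x y vl xl yl; split; apply/eqP; move: vl xl yl.
    by case: (leqP v (per c2)); case: (leqP x (per c1)); clear; lia.
  by case: (leqP v (per c2)); case: (leqP y (per c1)); clear; lia.
rewrite /bigin /= iotaD count_cat; apply: leq_add; rewrite leq_eqVlt; apply/orP; left; apply/eqP.
- have -> : iota P.+1 (nin c1) = map m1 (iota (per c1).+1 (nin c1)).
    rewrite -[P.+1]addn0 -[(per c1).+1]addn0 !iotaDl -map_comp; apply/eq_in_map => i _ /=.
    by rewrite /m1 leqNgt ltnS leq_addr /= addnC [((per c1).+1 + i)%N]addnC addnK.
  by rewrite count_map; apply/eq_in_count => v; rewrite mem_iota => vl /=; rewrite D1// /vn.
- have -> : iota (P.+1 + nin c1) (nin c2) = map m2 (iota (per c2).+1 (nin c2)).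
    rewrite -[(P.+1 + _)%N]addn0 -[(per c2).+1]addn0 !iotaDl -map_comp; apply/eq_in_map => i _ /=.
    by rewrite /m2 leqNgt ltnS leq_addr /= addnC [((per c2).+1 + i)%N]addnC addnK.
  by rewrite count_map; apply/eq_in_count => v; rewrite mem_iota => vl /=; rewrite D2// /vn.
Qed.

Lemma bigin_CI d c : wf (CI c) -> (bigin d (CI c) <= bigin d c + (d.+1 <= deg (ees c) (per c)))%N.
Proof.
move=> wI; case/andP: (wI) => wc p1; have pE : (per (CI c)).+1 = per c by rewrite /= prednK// ltnW.
rewrite /bigin pE [nin (CI c)]/= /= addnC ees_CI//.
have E v : (per (CI c) < v)%N -> deg ((per (CI c), 0%N) :: ees c) v = deg (ees c) v.
  move=> h; rewrite deg_cons /= (ltn_eqF h) (_ : (0 == v)%N = false)//.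
  by apply/negbTE; rewrite neq_ltn (leq_ltn_trans _ h).
rewrite E ?pE// leq_add2r leq_eqVlt; apply/orP; left; apply/eqP/eq_in_count => v.
by rewrite mem_iota => /andP[h _]; rewrite E// pE ltnW.
Qed.

(** Boundary vertices are treated by a union bound. An inner vertex is a boundary vertex of the
    smaller map at the [CI] node that encloses it, with all its edges already present, so [sb_lin]
    sums the boundary estimate over inner vertices. *)
Lemma deg_tail d P : (0 < P)%N ->
  sb (fun c => wt 1 c * (has (fun v => d.+1 <= deg (ees c) v)%N (iota 0 (vn c)))%:R) P
    (4 * lam ^+ d * (P.+1%:R ^+ 2) * av R P).
Proof.
move=> P0; have w0 c : 0 <= wt (1 : R) c by exact: wt_ge0.
have g0 : 0 <= 4 * lam ^+ d by rewrite mulr_ge0 ?exprn_ge0// ltW ?lam_gt0.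
have hI : sb (fun c => wt 1 c * (wf c * bigin d c)%:R) P (4 * lam ^+ d * ninsum R P).
  apply: (@sb_lin _ (fun c => (wf c * bigin d c)%:R) (fun c => (d.+1 <= deg (ees c) (per c))%N%:R)) => //.
  - move=> c wc; rewrite -natrD ler_nat wc mul1n; case: (boolP (wf (CI c))) => // wI; rewrite mul1n; exact: bigin_CI.
  - by move=> c1 c2 w1 w2; rewrite -natrD ler_nat [wf (CS _ _)]/= w1 w2 !mul1n bigin_CS//= w1.
  - move=> Q Q0; apply: sb_le (lexx _) (deg_tail_ext d Q0 (leqnn Q)) => c /andP[_ /eqP ->] //.
have hE := sb_sum (index_iota 0 P.+1) (fun i => deg_tail_ext d P0 (i := minn i P) (geq_minr _ _)).
apply: sb_le (sbD hE hI).
  move=> c /andP[wc /eqP pc]; rewrite -mulr_sumr -mulrDr ler_wpM2l// wc mul1n.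
  rewrite -natr_sum -natrD ler_nat; case: hasP => // -[v]; rewrite mem_iota /= add0n => vl vd.
  have [vP|vP] := leqP v P.
    by rewrite (bigD1_seq v) ?iota_uniq ?mem_index_iota//= (minn_idPl vP) vd -addnA leq_addr.
  rewrite -[1%N]add0n leq_add// /bigin -has_count; apply/hasP; exists v => //.
  by rewrite mem_iota pc vP -pc.
rewrite sumr_const_nat subn0 -[_ *+ P.+1]mulr_natr.
have h2 := ler_wpM2l g0 (ninsum_le R P); have a0 := av_ge0 R P.
have h3 : 0 <= 4 * lam ^+ d * av R P by exact: mulr_ge0.
have PR : P.+1%:R = P%:R + 1 :> R by rewrite -natr1.
have h4 : 0 <= P%:R :> R by exact: ler0n.
move: h2 h3 h4; rewrite PR; move: (ninsum R P) (4 * lam ^+ d) (av R P) (P%:R : R) => n g a x h2 h3 h4.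
have := mulr_ge0 h3 h4; nra.
Qed.
End tails.

(** * Averaging over root positions; pairs of boundary arcs that are cheap to separate *)

Section fin.
Variable R : realType.

Lemma rotc_okc s P c : okc P c -> okc P (rotc s c).
Proof.
by move=> /andP[wc /eqP pc]; have [sg h] := rotcP s wc; rewrite /okc (rs_wf h) (rs_per h) pc eqxx.
Qed.

Lemma sum_subset (T : eqType) (s t : seq T) (F : T -> R) : uniq s -> uniq t ->
  {subset s <= t} -> (forall x, 0 <= F x) -> \sum_(x <- s) F x <= \sum_(x <- t) F x.
Proof.
move=> us ut st F0; rewrite (perm_big [seq x <- t | x \in s]) /=; last first.
  apply: uniq_perm => //; first exact: filter_uniq.
  by move=> x; rewrite mem_filter; case: (boolP (x \in s)) => // /st ->.
rewrite big_filter big_mkcond; apply: ler_sum => x _; case: ifP => // _; exact: F0.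
Qed.

(** Re-rooting is injective and keeps the size, so the U re-rootings of a finite family all lie in
    one finite list, on which the sum over positions is bounded before exchanging the two sums. *)
Lemma sb_average P U (s : nat -> nat) (W0 F : code -> R) (W : nat -> code -> R) x : (0 < P)%N -> (0 < U)%N ->
  (forall u c, 0 <= W u c) ->
  (forall u c, (u < U)%N -> okc P c -> W0 c <= W u (rotc (s u) c)) ->
  (forall c, okc P c -> \sum_(u < U) W u c <= F c) -> sb F P x -> sb W0 P (x / U%:R).
Proof.
move=> P0 U0 Wp h0 h1 hF l ul ol.
pose lu u := map (rotc (s u)) l.
have luu u : uniq (lu u).
  rewrite map_inj_in_uniq// => c d /(allP ol)/andP[wc _] /(allP ol)/andP[wd _]; exact: rotc_inj.
pose ls := undup (flatten [seq lu u | u : 'I_U <- enum 'I_U]).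
have ols : all (okc P) ls.
  apply/allP => c; rewrite mem_undup => /flatten_mapP[u _ /mapP[d /(allP ol) od ->]].
  exact: rotc_okc.
rewrite ler_pdivlMr ?ltr0n// mulr_natr -[X in _ *+ X]card_ord -sumr_const.
apply: (@le_trans _ _ (\sum_(u < U) \sum_(c <- ls) W u c)).
  apply: ler_sum => u _; apply: (@le_trans _ _ (\sum_(c <- lu u) W u c)).
    by rewrite big_map big_seq [leRHS]big_seq; apply: ler_sum => c /(allP ol); exact: h0.
  apply: sum_subset => //; first exact: undup_uniq.
  move=> c cu; rewrite mem_undup; apply/flatten_mapP; exists u => //.
  by rewrite mem_enum.
rewrite exchange_big /=; apply: (@le_trans _ _ (\sum_(c <- ls) F c)); last first.
  by apply: hF => //; exact: undup_uniq.
by rewrite big_seq [leRHS]big_seq; apply: ler_sum => c /(allP ols); exact: h1.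
Qed.

Lemma sb_pigeon P U (s : nat -> nat) (W0 : code -> R) (W : nat -> code -> R) : (0 < P)%N -> (0 < U)%N ->
  (forall u c, 0 <= W u c) ->
  (forall u c, (u < U)%N -> okc P c -> W0 c <= W u (rotc (s u) c)) ->
  (forall c, okc P c -> \sum_(u < U) W u c <= wt 1 c) -> sb W0 P (av R P / U%:R).
Proof. by move=> P0 U0 Wp h0 h1; exact: sb_average Wp h0 h1 (mass_le R P0). Qed.

(** There is a metric of bounded norm for which [Z] and [B] are far apart; by [flow] they can then
    be separated by a cheap potential as soon as degrees are bounded. *)
Definition crossable c (Z B : pred nat) := exists rho : nat -> R, adm (vn c) (paths c Z B) rho.

Lemma crossable_rot c s (c' := rotc s c) sg (Z B Z' B' : pred nat) : wf c -> rot_spec s c c' sg ->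
  (forall x, Z x -> (x < vn c)%N) ->
  (forall y, (y < vn c)%N -> Z (sg y) -> Z' y) -> (forall y, (y < vn c)%N -> B (sg y) -> B' y) ->
  crossable c' Z' B' -> crossable c Z B.
Proof.
move=> wc h Zl ZZ BB [rho' [r0 r2 rp]].
have vE : vn c' = vn c by rewrite /vn (rs_per h) (rs_nin h).
have n0 : (0 < vn c)%N by [].
pose tau v : nat := if [pick y : 'I_(vn c) | sg y == v] is Some y then y else 0%N.
have sgt v : (v < vn c)%N -> sg (tau v) = v /\ (tau v < vn c)%N.
  move=> vl; rewrite /tau; case: pickP => [y /eqP ->|]; first by split.
  by have [x xl xv] := rs_surj h vl => /(_ (Ordinal xl)); rewrite /= xv eqxx.
have tsg y : (y < vn c)%N -> tau (sg y) = y.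
  move=> yl; have [e1 e2] := sgt _ (rs_lt h yl); exact: (rs_inj h).
pose so (y : 'I_(vn c)) : 'I_(vn c) := Ordinal (rs_lt h (ltn_ord y)).
have soI : injective so.
  move=> x y /(congr1 val) /= E; apply/val_inj/(rs_inj h) => //; exact: ltn_ord.
exists (fun v => rho' (tau v)); split => //.
- rewrite /ip (reindex_inj soI) /=; move: r2; rewrite vE /ip; congr (_ <= _).
  by apply: eq_bigr => y _; rewrite tsg.
- move=> p [x [t [-> xZ tB xt]]].
  have allv z : z \in x :: t -> (z < vn c)%N.
    elim: t x xZ xt {tB} (Zl _ xZ) => [|y t IH] x xZ /=; first by move=> _ xl; rewrite inE => /eqP ->.
    move=> /andP[xy yt] xl; rewrite inE => /predU1P[->//|].
    have yl : (y < vn c)%N by case/orP: xy => /(ees_lt wc)[].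
    by elim: t y yt yl {IH xy xZ xl} => [|u t IH] y /=; [move=> _ yl; rewrite inE => /eqP ->|
      move=> /andP[yu ut] yl; rewrite inE => /predU1P[->//|]; apply: IH => //; case/orP: yu => /(ees_lt wc)[]].
  have : 1 <= ip (vn c') (ind R (map tau (x :: t))) rho'.
    apply: rp; exists (tau x), (map tau t); split => //.
    - apply: ZZ; have [e1 e2] := sgt x (allv _ (mem_head _ _)) => //.
      by rewrite e1.
    - have [e1 e2] := sgt (last x t) (allv _ (mem_last _ _)).
      by rewrite last_map; apply: BB => //; rewrite e1.
    - move: xt allv; elim: t x {xZ tB} => //= y t IH x /andP[xy yt] al.
      rewrite IH ?andbT//; last by move=> z zt; apply: al; rewrite inE zt orbT.
      have [e1 e2] := sgt x (al _ (mem_head _ _)).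
      have [|e3 e4] := sgt y; first by apply: al; rewrite !inE eqxx orbT.
      by rewrite /crel -(rs_adj h)// e1 e3.
  rewrite vE => le1; apply: (le_trans le1); rewrite {2}/ip (reindex_inj soI) le_eqVlt; apply/orP; left.
  apply/eqP; apply: eq_bigr => y _ /=; rewrite tsg// /ind; congr ((_ : bool)%:R * _).
  rewrite -[tau x :: _]/(map tau (x :: t)); apply/idP/idP => [/mapP[z zp E]|yp]; last first.
    by apply/mapP; exists (sg y); rewrite ?tsg.
  by have [e1 _] := sgt z (allv _ zp); rewrite E e1.
Qed.

(** The U pairs (Zu u, Bu u) are mutually interleaved along the boundary. By [paths_meet] and
    [adm_duality], of any two pairs at least one has an admissible metric, so at most one pair
    fails. Each pair is the image of the given one under a re-rooting, whence the factor 1 / U. *)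
Lemma fin_cross P f L J a U : (0 < L)%N -> (0 < U)%N -> (J < a)%N -> (L <= a)%N ->
  (U * a + J <= f + a)%N -> (f + U * a + L <= P.+1)%N ->
  sb (fun c => wt 1 c * (~~ `[< crossable c [pred i | (i < J) || (i == P)]%N (BW f L) >])%:R) P (av R P / U%:R).
Proof.
move=> L0 U0 Ja La Ua fU; have a0 : (0 < a)%N := leq_trans L0 La.
have aU : (a <= U * a)%N by rewrite leq_pmull.
have P0 : (0 < P)%N by move: fU L0 U0 a0; clear; nia.
(* The arc of the first J vertices, preceded by the vertex P, is shifted by (u + 1) a: the vertex P
   becomes the one just before the multiple of a. *)
pose Zu u : pred nat := fun i => ((u.+1 * a <= i.+1) && (i < u.+1 * a + J))%N.
pose Bu u : pred nat := BW (f + u.+1 * a) L.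
apply: (@sb_pigeon P U (fun u => P.+1 - u.+1 * a)%N _
  (fun u c => wt 1 c * (~~ `[< crossable c (Zu u) (Bu u) >])%:R)) => //.
- by move=> u c; rewrite mulr_ge0 ?wt_ge0 ?ler0n.
- move=> u c uU /andP[wc /eqP pc]; set s := (P.+1 - _)%N; have [sg h] := rotcP s wc.
  have ua : (u.+1 * a <= U * a)%N by rewrite leq_pmul2r.
  have ua0 : (0 < u.+1 * a)%N by rewrite muln_gt0.
  rewrite (wt_nin R (rs_per h) (rs_nin h) (rs_wf h) wc) ler_wpM2l ?wt_ge0// ler_nat.
  case: (asboolP (crossable (rotc s c) _ _)) => [|_]; last by rewrite leq_b1.
  move=> hc; rewrite asboolT//; apply: (crossable_rot wc h) hc.
  + by move=> x /orP[|/eqP ->]; rewrite /vn pc; move: fU aU Ja L0; clear; lia.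
  + move=> y yl /=; have sgP : forall y0, (sg y0 <= P)%N -> (y0 < vn c)%N -> (y0 <= P)%N /\
        sg y0 = ((y0 + s) %% P.+1)%N.
      move=> z zP zl; pose z' := ((sg z + u.+1 * a) %% P.+1)%N.
      have z'P : (z' <= P)%N by rewrite -ltnS ltn_mod.
      suff -> : z = z' by rewrite (rs_ext h) pc.
      apply: (rs_inj h) => //; first by rewrite inE /= /vn pc; apply: leq_trans (leq_addr _ _); rewrite ltnS.
      rewrite [sg z'](rs_ext h) pc// /z' modnDml -addnA subnKC; last by move: ua fU; clear; lia.
      by rewrite modnDr modn_small.
    move=> yZ; have sP : (sg y <= P)%N by case/orP: yZ => [|/eqP ->//]; move: fU aU Ja L0; clear; lia.
    have [yP E] := sgP _ sP yl; move: yZ; rewrite E /Zu /s; move: ua fU Ua Ja ua0 yP L0 aU.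
    move: (u.+1 * a)%N (U * a)%N => x z; clear => h1 h2 h3 h4 h5 h6 h7 h8.
    case: (ltnP y x) => yx.
      by rewrite modn_small; lia.
    have -> : (y + (P.+1 - x) = (y - x) + P.+1)%N by lia.
    by rewrite modnDr modn_small; lia.
  + move=> y yl; rewrite /Bu /BW => yB.
    have sP : (sg y <= P)%N by move: yB fU; clear; lia.
    pose z' := ((sg y + u.+1 * a) %% P.+1)%N.
    have z'P : (z' <= P)%N by rewrite -ltnS ltn_mod.
    have -> : y = z'.
      apply: (rs_inj h) => //; first by rewrite inE /= /vn pc; apply: leq_trans (leq_addr _ _); rewrite ltnS.
      rewrite [sg z'](rs_ext h) pc// /z' modnDml -addnA subnKC; last by move: ua fU; clear; lia.
      by rewrite modnDr modn_small.
    rewrite /z' modn_small; move: yB ua fU; clear; lia.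
- move=> c /andP[wc /eqP pc].
  have key : forall u v : 'I_U, (u < v)%N -> crossable c (Zu u) (Bu u) \/ crossable c (Zu v) (Bu v).
    move=> u v uv; apply: adm_duality => _ _ [x [s [-> xZ sB xs]]] [y [t [-> yZ tB yt]]].
    have uvA : (u.+1 * a + a <= v.+1 * a)%N by rewrite -mulSnr leq_pmul2r.
    have vU : (v.+1 * a <= U * a)%N by rewrite leq_pmul2r.
    rewrite !unfold_in /Zu /Bu /BW in xZ sB yZ tB.
    have [||||z zx zy] := @paths_meet c x y (last x s) (last y t) s t wc _ _ _ _ xs erefl yt erefl.
    - by move: xZ yZ uvA Ja; clear; lia.
    - by move: sB yZ vU Ua; clear; lia.
    - by move: sB tB uvA La; clear; lia.
    - by move: tB vU fU; rewrite pc; clear; lia.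
    exists z; split => //; move: zx; rewrite inE => /predU1P[->|zs].
      by move: xZ; rewrite /vn pc; move: vU uvA Ua Ja fU L0 aU; clear; lia.
    elim: s x xs zs {xZ sB} => //= w s IH x /andP[xw ws]; rewrite inE => /predU1P[->|zs]; last exact: IH ws zs.
    by case/orP: xw => /(ees_lt wc)[].
  rewrite -mulr_sumr ler_piMr ?wt_ge0// -natr_sum -[1]/(1%N%:R) ler_nat.
  have [/existsP[u hu]|/existsPn hn] := boolP [exists u : 'I_U, ~~ `[< crossable c (Zu u) (Bu u) >]]; last first.
    by rewrite big1// => u _; rewrite (negbTE (hn u)).
  rewrite (bigD1 u)//= hu big1// => v vu; apply/eqP; rewrite eqb0 negbK; apply/asboolP.
  apply: contrapT => hv; move/asboolP: hu; apply.
  case: (ltngtP u v) => uv.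
  - by case: (key _ _ uv).
  - by case: (key _ _ uv).
  - by move: vu; rewrite -val_eqE /= uv eqxx.
Qed.

Lemma energy_opp E (g : nat -> R) : energy E (fun v => 1 - g v) = energy E g.
Proof. by apply: eq_bigr => e _; rewrite -sqrrN; congr (_ ^+ 2); ring. Qed.

(** Case of a short boundary behind the block: the zero set is then the first f - ph vertices and
    the vertex P, a single arc around the root edge. The three terms bound the three causes of
    failure: no admissible metric, a vertex of degree larger than D, more than M inner vertices
    (Markov's inequality with [ninsum]). *)
Lemma sb_fin P f L h ph a U D M : (0 < L)%N -> (0 < U)%N -> (f - ph < a)%N -> (L <= a)%N -> (0 < h)%N ->
  P.+1 = (f + L + h)%N ->
  (U * a + (f - ph) <= f + a)%N -> (f + U * a + L <= P.+1)%N -> (f - ph <= f)%N ->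
  sb (fun c => bad L (4 * D%:R : R) (P.+1 + M) c f ph h.-1) P
    (av R P / U%:R + 4 * lamD ^+ D * (P.+1%:R ^+ 2) * av R P + av R P * P%:R ^+ 2 / M.+1%:R).
Proof.
move=> L0 U0 Ja La h0 PE Ua fU fp.
have P0 : (0 < P)%N by move: PE L0 fU; case: (U) U0 La => // u _; case: (a) => [|a']; clear; lia.
have hM : sb (fun c => wt 1 c * (nin c)%:R / M.+1%:R) P (av R P * P%:R ^+ 2 / M.+1%:R).
  apply: (sb_le (W' := fun c => M.+1%:R^-1 * (wt 1 c * (nin c)%:R))
    (x' := M.+1%:R^-1 * ninsum R P)); last by apply: sbZ (sb_nin R P0); rewrite invr_ge0.
  - by move=> c _; rewrite mulrC.
  - by rewrite mulrC ler_wpM2r ?invr_ge0// ninsum_le.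
apply: (sb_le _ (lexx _) (sbD (sbD (fin_cross L0 U0 Ja La Ua fU) (deg_tail R D P0)) hM)).
move=> c /andP[wc /eqP pc]; rewrite /bad -mulrA -!mulrDr ler_wpM2l ?wt_ge0//.
have q0 : 0 <= (nin c)%:R / M.+1%:R :> R by rewrite divr_ge0 ?ler0n.
case: (boolP (has _ _)) => [_|/hasPn dl].
  apply: (@le_trans _ _ 1); first by rewrite -[1]/(1%N%:R) ler_nat leq_b1.
  by rewrite -[true%:R]/(1 : R) addrAC lerDr addr_ge0// ler0n.
case: asboolP => [hc|_]; last first.
  apply: (@le_trans _ _ 1); first by rewrite -[1]/(1%N%:R) ler_nat leq_b1.
  by rewrite -[(~~ false)%:R]/(1 : R) -[false%:R]/(0 : R) addr0 lerDl.
rewrite -[(~~ true)%:R]/(0 : R).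
rewrite !add0r; have [nM|nM] := leqP (nin c) M; last first.
  rewrite /nb; apply: (@le_trans _ _ 1); first by rewrite -[1]/(1%N%:R) ler_nat leq_b1.
  by rewrite ler_pdivlMr ?ltr0n// mul1r ler_nat.
rewrite /nb asboolT ?ler0n//; case: hc => rho hr.
have [||g [g01 gZ gB gE]] := @flow R c _ _ rho D wc _ _ hr.
- move=> v; rewrite !unfold_in /BW; case/orP => [|/eqP ->]; move: fp PE h0; clear; lia.
- by move=> v vl; have := dl v; rewrite mem_iota vl => /(_ isT); rewrite -leqNgt.
exists (fun v => 1 - g v); split.
- by move=> v; have := g01 v; lra.
- by move=> v vB; rewrite gB ?subr0.
- move=> v /andP[vP vZ]; rewrite gZ ?subrr//; rewrite unfold_in /=; move: vP vZ PE h0; rewrite pc; clear; lia.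
- by rewrite energy_opp.
- by apply: leq_trans (count_size _ _) _; rewrite size_iota /vn pc leq_add2l.
Qed.
End fin.

(** * Size of [av] and drift of the peeling step *)

Section asymptotics.
Variable R : realType.
Local Notation a := (av R).

Lemma av_le j k : (0 < j)%N -> (j <= k)%N -> a k <= a j.
Proof.
move=> j0; elim: k => [|k IH]; first by rewrite leqNgt j0.
rewrite leq_eqVlt => /predU1P[->//|jk]; apply: le_trans (IH jk); apply: av_anti.
exact: leq_trans j0 jk.
Qed.

(** [av k] is of order k^(-5/2). The monotonicity of k^2 av k here, and of k^3 av k in [av_cubeS],
    brackets this exponent and is all that is used of the asymptotics. *)
Lemma av_sqS k : (0 < k)%N -> k.+1%:R ^+ 2 * a k.+1 <= k%:R ^+ 2 * a k.
Proof.
move=> k0; have := avSn R k0; have := av_gt0 R k0; have : 1 <= k%:R :> R by rewrite ler1n.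
rewrite -[k.+1%:R]natr1; move: (a k.+1) (a k) (k%:R : R) => u v x x1 v0 E.
have d0 : 0 < 2 * (x + 2) by lra.
rewrite -(ler_pM2r d0).
have -> : (x + 1) ^+ 2 * u * (2 * (x + 2)) = (x + 1) ^+ 2 * (v * (2 * x - 1)) by rewrite -E; ring.
have -> : (x + 1) ^+ 2 * (v * (2 * x - 1)) = v * ((x + 1) ^+ 2 * (2 * x - 1)) by ring.
have -> : x ^+ 2 * v * (2 * (x + 2)) = v * (x ^+ 2 * (2 * (x + 2))) by ring.
rewrite ler_pM2l//; nra.
Qed.

Lemma av_cubeS k : (0 < k)%N -> k%:R ^+ 3 * a k + 3^-1 * (k%:R ^+ 2 * a k) <= k.+1%:R ^+ 3 * a k.+1.
Proof.
move=> k0; have := avSn R k0; have := av_gt0 R k0; have : 1 <= k%:R :> R by rewrite ler1n.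
rewrite -[k.+1%:R]natr1; move: (a k.+1) (a k) (k%:R : R) => u v x x1 v0 E.
have d0 : 0 < 2 * (x + 2) by lra.
rewrite -(ler_pM2r d0).
have -> : (x + 1) ^+ 3 * u * (2 * (x + 2)) = v * ((x + 1) ^+ 3 * (2 * x - 1)).
  have -> : v * ((x + 1) ^+ 3 * (2 * x - 1)) = (x + 1) ^+ 3 * (v * (2 * x - 1)) by ring.
  by rewrite -E; ring.
have -> : (x ^+ 3 * v + 3^-1 * (x ^+ 2 * v)) * (2 * (x + 2)) = v * ((x ^+ 3 + 3^-1 * x ^+ 2) * (2 * (x + 2))) by ring.
rewrite ler_pM2l//.
have x2 : 1 <= x ^+ 2 by rewrite expr2; nra.
have x3 : x ^+ 2 <= x ^+ 3 by rewrite [x ^+ 3]exprS; nra.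
have -> : (x ^+ 3 + 3^-1 * x ^+ 2) * (2 * (x + 2)) = 2 * x ^+ 4 + (14 / 3) * x ^+ 3 + (4 / 3) * x ^+ 2 by field.
have -> : (x + 1) ^+ 3 * (2 * x - 1) = 2 * x ^+ 4 + 5 * x ^+ 3 + 3 * x ^+ 2 - x - 1 by ring.
have x12 : x <= x ^+ 2 by rewrite expr2; nra.
lra.
Qed.

Lemma av_sq j k : (0 < j)%N -> (j <= k)%N -> k%:R ^+ 2 * a k <= j%:R ^+ 2 * a j.
Proof.
move=> j0; elim: k => [|k IH]; first by rewrite leqNgt j0.
rewrite leq_eqVlt => /predU1P[->//|jk]; apply: le_trans (IH jk); apply: av_sqS.
exact: leq_trans j0 jk.
Qed.

Lemma av_cube j k : (0 < j)%N -> (j <= k)%N -> j%:R ^+ 3 * a j <= k%:R ^+ 3 * a k.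
Proof.
move=> j0; elim: k => [|k IH]; first by rewrite leqNgt j0.
rewrite leq_eqVlt => /predU1P[->//|jk]; apply: le_trans (IH jk) _.
have k0 : (0 < k)%N by exact: leq_trans j0 jk.
apply: le_trans (av_cubeS k0); rewrite lerDl.
by rewrite mulr_ge0 ?mulr_ge0 ?av_ge0 ?exprn_ge0 ?ler0n// invr_ge0.
Qed.

Lemma av_scale m j k : (0 < j)%N -> (j <= k)%N -> (k <= m * j)%N -> a j <= m%:R ^+ 3 * a k.
Proof.
move=> j0 jk km; have j3 : 0 < j%:R ^+ 3 :> R by rewrite exprn_gt0// ltr0n.
rewrite -(ler_pM2l j3); apply: le_trans (av_cube j0 jk) _.
rewrite mulrA -exprMn ler_wpM2r ?av_ge0// lerXn2r ?nnegrE ?mulr_ge0 ?ler0n//.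
by rewrite -natrM ler_nat mulnC.
Qed.

(** The sum of k av k over k at least f, in closed form; the full sum is 1/3 by [sum_kav]. *)
Definition tail (f : nat) : R := (2 * f%:R - 2 / 3) * (f%:R + 1) * a f.

Lemma sum_kav F : \sum_(1 <= k < F.+1) k%:R * a k = 1 / 3 - tail F.+1.
Proof.
elim: F => [|F IH]; first by rewrite big_geq// /tail av1; field.
rewrite big_nat_recr//.
change (\sum_(1 <= k < F.+1) k%:R * a k + F.+1%:R * a F.+1 = 1 / 3 - tail F.+2).
rewrite IH /tail; have := avSn R (ltn0Sn F); rewrite -[F.+2%:R]natr1.
move: (a F.+2) (a F.+1) (F.+1%:R : R) => u v x E.
have -> : (2 * (x + 1) - 2 / 3) * (x + 1 + 1) * u = (x + 1 - 3^-1) * (u * (2 * (x + 2))) by field.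
by rewrite E; field.
Qed.

Lemma sum_kkav F : \sum_(1 <= k < F) k%:R ^+ 2 * a k <= 3 * (F%:R ^+ 3 * a F).
Proof.
elim: F => [|F IH]; first by rewrite big_geq// mulr_ge0 ?mulr_ge0 ?av_ge0 ?exprn_ge0 ?ler0n.
have [->|F0] := posnP F; first by rewrite big_geq// mulr_ge0 ?mulr_ge0 ?av_ge0 ?exprn_ge0 ?ler0n.
rewrite big_nat_recr//.
change (\sum_(1 <= k < F) k%:R ^+ 2 * a k + F%:R ^+ 2 * a F <= 3 * (F.+1%:R ^+ 3 * a F.+1)).
by have := av_cubeS F0; lra.
Qed.

Lemma tail_le F x : (0 < x)%N -> (0 < F)%N -> (x <= 2 * F)%N -> (F <= 2 * x)%N -> tail F <= 32 * (x%:R ^+ 2 * a x).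
Proof.
move=> x0 F0 xF Fx; have h1 : tail F <= 4 * (F%:R ^+ 2 * a F).
  rewrite /tail; have := av_ge0 R F; have : 1 <= F%:R :> R by rewrite ler1n.
  move: (a F) (F%:R : R) => v y y1 v0.
  have -> : 4 * (y ^+ 2 * v) = (4 * y ^+ 2) * v by ring.
  by rewrite ler_wpM2r//; nra.
apply: le_trans h1 _; have h2 : F%:R ^+ 2 * a F <= 8 * (x%:R ^+ 2 * a x).
  have [xF'|Fx'] := leqP x F.
    apply: le_trans (av_sq x0 xF') _; have : 0 <= x%:R ^+ 2 * a x by rewrite mulr_ge0 ?av_ge0 ?exprn_ge0 ?ler0n.
    lra.
  have := @av_scale 2 F x F0 (ltnW Fx') xF => h.
  have : F%:R ^+ 2 * a F <= x%:R ^+ 2 * a F.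
    by rewrite ler_wpM2r ?av_ge0// lerXn2r ?nnegrE ?ler0n// ler_nat ltnW.
  move=> h3; apply: le_trans h3 _; rewrite mulrCA ler_wpM2l ?exprn_ge0 ?ler0n//.
  by apply: le_trans h _; rewrite -natrX.
lra.
Qed.

Section step.
Variables (P F x : nat).
Hypotheses (x0 : (0 < x)%N) (xF : (x <= 2 * F)%N) (Fx : (F < 2 * x)%N) (FP : (F + F <= P)%N) (xP : (2 * x <= P)%N).
Local Notation p k := (a k * a (P - k)).

Lemma F_gt0 : (0 < F)%N. Proof. by move: x0 xF; clear; lia. Qed.
Let F0 := F_gt0.
Let P0 : (0 < P)%N. Proof. by move: F0 FP; clear; lia. Qed.
Let aP0 : 0 < a P. Proof. exact: av_gt0. Qed.

Lemma p_ge k : (0 < k < P)%N -> a k * a P <= p k.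
Proof. by move=> /andP[k0 kP]; rewrite ler_wpM2l ?av_ge0// av_le ?subn_gt0// leq_subr. Qed.

Lemma p_le m k : (0 < k)%N -> (P <= m * (P - k))%N -> p k <= m%:R ^+ 3 * a k * a P.
Proof.
move=> k0 Pm; rewrite -mulrA mulrCA ler_wpM2l ?av_ge0// av_scale ?leq_subr//.
by case: (P - k)%N Pm => //; rewrite muln0 leqn0 gtn_eqF.
Qed.

Lemma sum_kk_p : \sum_(1 <= k < F.+1) k%:R ^+ 2 * p k <= a P * (192 * (x%:R ^+ 3 * a x)).
Proof.
apply: (@le_trans _ _ (\sum_(1 <= k < F.+1) (8 * a P) * (k%:R ^+ 2 * a k))).
  rewrite big_nat [leRHS]big_nat; apply: ler_sum => k /andP[k0 kF].
  have := @p_le 2 k k0 _; rewrite (_ : 2%:R ^+ 3 = 8 :> R); last by rewrite -natrX.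
  have -> : 8 * a P * (k%:R ^+ 2 * a k) = k%:R ^+ 2 * (8 * a k * a P) by ring.
  move=> h; rewrite ler_wpM2l ?exprn_ge0 ?ler0n// h//; move: kF FP; clear; lia.
rewrite -mulr_sumr; have := sum_kkav F.+1.
have h1 : F.+1%:R ^+ 3 * a F.+1 <= 8 * (x%:R ^+ 3 * a x).
  apply: le_trans (av_cube (ltn0Sn F) (_ : (F.+1 <= 2 * x)%N)) _; first exact: Fx.
  have -> : (2 * x)%:R ^+ 3 * a (2 * x)%N = 8 * (x%:R ^+ 3 * a (2 * x)%N) by rewrite natrM; ring.
  rewrite ler_wpM2l// ler_wpM2l ?exprn_ge0 ?ler0n//.
  by apply: av_le => //; rewrite leq_pmull.
have aP1 := ltW aP0; move: (\sum_(_ <= _ < _) _) => s h2.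
have : s <= 24 * (x%:R ^+ 3 * a x) by lra.
move=> h3; have := ler_wpM2l aP1 h3; lra.
Qed.

Lemma x3_ge1 : 1 <= 8 * (x%:R ^+ 3 * a x).
Proof. by have := av_cube (isT : 0 < 1)%N x0; rewrite av1 expr1n; lra. Qed.

Lemma q_bounds : a P * (1 / 3 - 8 * (x%:R ^+ 2 * a x)) <= 1 / 3 * a P.+1 <= 1 / 3 * a P.
Proof.
apply/andP; split; last by rewrite ler_wpM2l ?divr_ge0// av_le// leqnSn.
have := avSn R P0; have x1 : 1 <= x%:R :> R by rewrite ler1n.
have Px : x%:R <= P%:R :> R by rewrite ler_nat; move: xP; clear; lia.
have x3 := x3_ge1; have aP1 := aP0.
have h : 1 / x%:R <= 8 * (x%:R ^+ 2 * a x).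
  rewrite ler_pdivrMr; last lra.
  by apply: le_trans x3 _; rewrite le_eqVlt; apply/orP; left; apply/eqP; ring.
move: h x1 Px aP1; move: (a P.+1) (a P) (a x) (P%:R : R) (x%:R : R) => u v w y z h x1 Px v0 E.
have y2 : 0 < 2 * (y + 2) by lra.
have uE : u = v - v * (5 / (2 * (y + 2))).
  by apply: (@mulIf _ (2 * (y + 2))); [exact: lt0r_neq0|rewrite E; field; lra].
have h5 : 5 / (2 * (y + 2)) <= 3 / z.
  rewrite ler_pdivrMr// mulrAC ler_pdivlMr; lra.
have h6 : 3 / z <= 24 * (z ^+ 2 * w) by have -> : 3 / z = 3 * (1 / z) by [rewrite mul1r]; lra.
have : v * (5 / (2 * (y + 2))) <= v * (24 * (z ^+ 2 * w)) by rewrite ler_pM2l//; lra.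
rewrite uE; lra.
Qed.

(** The position f of the block performs a centred walk: the removal without split, of weight 2/3,
    raises f by 1/2 on average (by the choice of the new root), and a cut at k lowers it by k. The
    two mean displacements cancel because the sum of k av k is 1/3; the error comes from stopping
    the sum at F. *)
Lemma drift : `|1 / 3 * a P.+1 - \sum_(1 <= k < F.+1) k%:R * p k| <= a P * (180 * (x%:R ^+ 2 * a x)).
Proof.
have /andP[q1 q2] := q_bounds; have aP1 := aP0.
have xa0 : 0 <= x%:R ^+ 2 * a x by rewrite mulr_ge0 ?av_ge0 ?exprn_ge0 ?ler0n.
have lo : a P * (1 / 3 - 32 * (x%:R ^+ 2 * a x)) <= \sum_(1 <= k < F.+1) k%:R * p k.
  apply: (@le_trans _ _ (a P * \sum_(1 <= k < F.+1) k%:R * a k)).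
    rewrite ler_pM2l// sum_kav lerD2l lerN2; apply: tail_le => //; move: xF Fx; clear; lia.
  rewrite mulr_sumr big_nat [leRHS]big_nat; apply: ler_sum => k /andP[k0 kF].
  rewrite mulrCA ler_wpM2l ?ler0n// mulrC; apply: p_ge; move: k0 kF FP F0; clear; lia.
have hi : \sum_(1 <= k < F.+1) k%:R * p k <= a P * (1 / 3 + 168 * (x%:R ^+ 2 * a x)).
  apply: (@le_trans _ _ (\sum_(1 <= k < F.+1) (a P * (k%:R * a k) + a P * (7 / x%:R) * (k%:R ^+ 2 * a k)))).
    rewrite big_nat [leRHS]big_nat; apply: ler_sum => k /andP[k0 kF].
    have kP : (k <= P - k)%N by move: kF FP; clear; lia.
    have Pk0 : (0 < P - k)%N by exact: leq_trans k0 kP.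
    have := av_cube Pk0 (leq_subr k P) => c3.
    have xk : x%:R <= (P - k)%:R :> R by rewrite ler_nat; move: xP FP kF Fx; clear; lia.
    have kk : k%:R <= (P - k)%:R :> R by rewrite ler_nat.
    have PE : P%:R = (P - k)%:R + k%:R :> R by rewrite -natrD subnK//; move: kP; clear; lia.
    have k1 : 0 <= k%:R :> R by exact: ler0n.
    have x1 : 1 <= x%:R :> R by rewrite ler1n.
    have b0 := av_ge0 R k; have c0 := av_ge0 R (P - k)%N.
    have key : a (P - k)%N <= a P * (1 + 7 / x%:R * k%:R).
      move: c3; rewrite PE; move: xk kk k1 x1 aP1 c0 {b0 PE q1 q2 xa0 lo}.
      move: (a (P - k)%N) (a P) ((P - k)%:R : R) (k%:R : R) (x%:R : R) => u v y z w xk kk k1 x1 v0 u0 c3.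
      have y0 : 0 < y by lra.
      have h1 : (y + z) ^+ 3 <= y ^+ 3 * (1 + 7 * (z / y)).
        have -> : y ^+ 3 * (1 + 7 * (z / y)) = y ^+ 3 + 7 * (z * y ^+ 2) by field; exact: lt0r_neq0.
        have e1 : 0 <= z * (y ^+ 2 - z * y) by rewrite mulr_ge0// expr2 -mulrBl mulr_ge0; lra.
        have e2 : 0 <= z * (y ^+ 2 - z ^+ 2) by rewrite mulr_ge0// subr_sqr mulr_ge0; lra.
        have -> : (y + z) ^+ 3 = y ^+ 3 + 3 * (z * y ^+ 2) + 3 * (z * (z * y)) + z * z ^+ 2 by ring.
        by move: e1 e2; rewrite !mulrBr; lra.
      have h2 : z / y <= z / w by rewrite ler_wpM2l// lef_pV2 ?posrE//; lra.
      have h3 : y ^+ 3 * u <= y ^+ 3 * (v * (1 + 7 * (z / y))).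
        apply: le_trans c3 _; have := ler_wpM2r (ltW v0) h1; lra.
      rewrite ler_pM2l ?exprn_gt0// in h3; apply: le_trans h3 _; rewrite ler_pM2l//.
      by rewrite lerD2l -mulrA [w^-1 * z]mulrC ler_pM2l.
    have := ler_wpM2l (mulr_ge0 k1 b0) key.
    have -> : k%:R * (a k * a (P - k)%N) = k%:R * a k * a (P - k)%N by ring.
    move/le_trans; apply; rewrite le_eqVlt; apply/orP; left; apply/eqP; field; lra.
  rewrite big_split /= -!mulr_sumr sum_kav.
  have tl0 : 0 <= tail F.+1.
    have y1 : 1 <= F.+1%:R :> R by rewrite ler1n.
    rewrite /tail mulr_ge0 ?av_ge0// mulr_ge0//; lra.
  have x1 : 1 <= x%:R :> R by rewrite ler1n.
  have h2 : (7 / x%:R) * \sum_(1 <= k < F.+1) k%:R ^+ 2 * a k <= 168 * (x%:R ^+ 2 * a x).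
    have h1 : F.+1%:R ^+ 3 * a F.+1 <= 8 * (x%:R ^+ 3 * a x).
      apply: le_trans (av_cube (ltn0Sn F) (_ : (F.+1 <= 2 * x)%N)) _; first exact: Fx.
      have -> : (2 * x)%:R ^+ 3 * a (2 * x)%N = 8 * (x%:R ^+ 3 * a (2 * x)%N) by rewrite natrM; ring.
  rewrite ler_wpM2l// ler_wpM2l ?exprn_ge0 ?ler0n//.
      by apply: av_le => //; rewrite leq_pmull.
    have := sum_kkav F.+1; move: (\sum_(_ <= _ < _) _) => s h3.
    rewrite mulrAC ler_pdivrMr; last lra.
    have -> : 168 * (x%:R ^+ 2 * a x) * x%:R = 168 * (x%:R ^+ 3 * a x) by ring.
    lra.
  rewrite -mulrA -mulrDr ler_pM2l//; lra.
rewrite ler_norml; apply/andP; split; move: lo hi q1 q2; move: (\sum_(_ <= _ < _) _) => s.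
  have : 0 <= a P * (x%:R ^+ 2 * a x) by rewrite mulr_ge0// ltW.
  by move: (x%:R ^+ 2 * a x) => w; lra.
have : 0 <= a P * (x%:R ^+ 2 * a x) by rewrite mulr_ge0// ltW.
by move: (x%:R ^+ 2 * a x) => w; lra.
Qed.

End step.
End asymptotics.

(** * A supersolution for the position of the block *)

Section trial.
Variable R : realType.
Local Notation a := (av R).
Variables (U y L l : nat).
Hypotheses (U0 : (0 < U)%N) (y1 : (1 < y)%N) (L0 : (0 < L)%N) (Ll : (L <= l)%N) (ly : (l <= y)%N).
Let x := (8 * (U * y))%N.
Let ax := a x.
(** Relative to [av R P], one peeling step reaches the favourable range of cuts with probability at
    least 2 sigma ([s2] in [step_ineq]) and cuts too close to the block with probability at most
    [DD]; [gamma] compensates the spreading of f. *)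
Let sigma : R := x%:R * ax / 108.
Let gamma : R := (200 * 200) * U%:R ^+ 2 * (x%:R * ax).
Let DD : R := 216 * (4 * l%:R) * ax.

Let l0 : (0 < l)%N. Proof. exact: leq_trans L0 Ll. Qed.
Let yU : (y <= U * y)%N. Proof. by rewrite leq_pmull. Qed.
Let x0 : (0 < x)%N. Proof. by move: y1 yU; rewrite /x; clear; lia. Qed.
Let ax0 : 0 < ax. Proof. exact: av_gt0. Qed.
Lemma sigma0 : 0 < sigma. Proof. by rewrite /sigma divr_gt0 ?mulr_gt0 ?ltr0n. Qed.
Lemma xy : x%:R = 8 * U%:R * y%:R :> R. Proof. by rewrite /x !natrM; ring. Qed.
Lemma yR2 : 2 <= y%:R :> R. Proof. by rewrite ler_nat. Qed.
Lemma UR1 : 1 <= U%:R :> R. Proof. by rewrite ler1n. Qed.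

Variables (A b0 : R).
Hypotheses (b0A : b0 <= A) (b00 : 0 <= b0).
Let G := A - b0.
Let G0 : 0 <= G. Proof. by rewrite subr_ge0. Qed.

(** Correction to the bound A after n steps from position f. The term - G n sigma is the gain of
    replacing A by b0 on favourable cuts. The square cancels this gain when f is at distance y from
    x, where the argument stops; gamma n pays for the variance of f, and n [DD] for the cuts close
    to the block. *)
Definition Wp (n : nat) (f : nat) : R :=
  n%:R * DD + G * n%:R * sigma * (gamma * n%:R - 1 + ((f%:R - x%:R) / y%:R) ^+ 2).

(** Bound on the failure after a cut at k, in this order: in front of the block, which moves to f -
    k; too close, with only the trivial bound 1; behind the block but not far, with the bound A of
    the previous scale; at a distance comparable to x, with the bound b0 of the short-boundary case;
    farther, with f unchanged. *)
Definition vk n f k : R :=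
  if (k + l <= f)%N then A + Wp n (f - k) else if (k < f + L + 2 * l)%N then 1
  else if (k < f + L + 4 * (U * y))%N then A else if (k < f + L + 16 * (U * y))%N then b0 else A + Wp n f.

Let a_near k : (x <= 2 * k)%N -> a k <= 8 * ax.
Proof.
move=> xk; have k0 : (0 < k)%N by move: xk x0; clear; lia.
have [kx|kx] := leqP x k.
  by apply: le_trans (av_le R x0 kx) _; have := ax0; rewrite -/ax; lra.
have := @av_scale R 2 k x k0 (ltnW kx) xk; rewrite -/ax; have -> : 2%:R ^+ 3 = 8 :> R by rewrite -natrX.
by [].
Qed.

Let sum_near P i j : (x <= 2 * i)%N -> (i <= j)%N -> (3 * j <= 2 * P + 3)%N ->
  \sum_(i <= k < j) a k * a (P - k) <= a P * (216 * (j - i)%:R * ax).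
Proof.
move=> xi ij jP; apply: (@le_trans _ _ (\sum_(i <= k < j) a P * (216 * ax))); last first.
  by rewrite sumr_const_nat -mulr_natr le_eqVlt; apply/orP; left; apply/eqP; ring.
rewrite big_nat [leRHS]big_nat; apply: ler_sum => k /andP[ik kj].
have k0 : (0 < k)%N by move: xi x0 ik; clear; lia.
have P0 : (0 < P)%N by move: k0 kj jP; clear; lia.
have h : a (P - k) <= 27 * a P.
  have := @av_scale R 3 (P - k) P _ _ _; rewrite (_ : 3%:R ^+ 3 = 27 :> R); last by rewrite -natrX.
  apply; move: kj jP k0 xi ik x0; clear; lia.
have hk : a k <= 8 * ax by apply: a_near; move: xi ik; clear; lia.
have -> : a P * (216 * ax) = (8 * ax) * (27 * a P) by ring.
by apply: ler_pM; rewrite ?av_ge0.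
Qed.

(** The sum is split along the five ranges of [vk]. The constant terms match by [av_rec], the term
    linear in k is cancelled by [drift], and the remaining second-order terms are absorbed by the
    increment of gamma n^2. *)
Lemma step_ineq n f P : (x < f + y)%N -> (f < x + y)%N -> (f + L + 2 * x <= P)%N -> n%:R * sigma <= 1 / 2 ->
  2 / 3 * (a P.+1 * ((A + Wp n f + (A + Wp n f.+1)) / 2)) + \sum_(1 <= k < P) a k * a (P - k) * vk n f k <=
  a P * (A + Wp n.+1 f).
Proof.
move=> xf fx fP ns; pose F := (f - l)%N.
have x8 : (x = 8 * (U * y))%N by [].
have Fl : (F + l = f)%N by rewrite subnK//; move: xf ly yU x8; clear; lia.
pose E1 := (f + L + 2 * l)%N; pose E2 := (f + L + 4 * (U * y))%N; pose E3 := (f + L + 16 * (U * y))%N.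
have nat1 : (x <= 2 * F /\ F < 2 * x /\ F + F <= P /\ 2 * x <= P)%N.
  by move: xf fx fP ly yU x8 Fl y1; clear; lia.
have [xF [Fx [FP xP]]] := nat1.
have P1 : (1 < P)%N by move: xP x0; clear; lia.
have r1 : (1 <= F.+1)%N by [].
have r2 : (F.+1 <= E1)%N by rewrite /E1; move: Fl L0; clear; lia.
have r3 : (E1 <= E2)%N by rewrite /E1 /E2; move: ly yU; clear; lia.
have r4 : (E2 <= E3)%N by rewrite /E2 /E3; clear; lia.
have r5 : (E3 <= P)%N by rewrite /E3; move: fP x8; clear; lia.
have aP0 := av_gt0 R (ltnW P1).
pose p k := a k * a (P - k).
pose m1 := \sum_(1 <= k < F.+1) p k; pose m2 := \sum_(F.+1 <= k < E1) p k.
pose m3 := \sum_(E1 <= k < E2) p k; pose s := \sum_(E2 <= k < E3) p k; pose m5 := \sum_(E3 <= k < P) p k.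
pose K1 := \sum_(1 <= k < F.+1) k%:R * p k; pose K2 := \sum_(1 <= k < F.+1) k%:R ^+ 2 * p k.
pose d : R := f%:R - x%:R; pose c : R := G * n%:R * sigma / y%:R ^+ 2.
have y0 : y%:R != 0 :> R by apply: lt0r_neq0; have := yR2; lra.
have split (g : nat -> R) : \sum_(1 <= k < P) g k = \sum_(1 <= k < F.+1) g k + \sum_(F.+1 <= k < E1) g k +
    \sum_(E1 <= k < E2) g k + \sum_(E2 <= k < E3) g k + \sum_(E3 <= k < P) g k.
  rewrite (@big_cat_nat _ _ _ F.+1)//=; last by exact: leq_trans r2 (leq_trans r3 (leq_trans r4 r5)).
  rewrite (@big_cat_nat _ _ _ E1 F.+1)//=; last by exact: leq_trans r3 (leq_trans r4 r5).
  rewrite (@big_cat_nat _ _ _ E2 E1)//=; last by exact: leq_trans r4 r5.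
  by rewrite (@big_cat_nat _ _ _ E3 E2)//= !addrA.
have tot : 2 / 3 * a P.+1 + (m1 + m2 + m3 + s + m5) = a P.
  have := av_rec R (ltnW P1); rewrite (gtn_eqF P1) mul0r add0r conv_av_int split => <-.
  by [].
have Wk k : (k <= f)%N -> Wp n (f - k) = Wp n f + c * (k%:R ^+ 2 - 2 * d * k%:R).
  by move=> kf; rewrite /Wp /c /d natrB//; field.
have W1 : Wp n f.+1 = Wp n f + c * (2 * d + 1).
  by rewrite /Wp /c /d -[f.+1%:R]natr1; field.
have T : \sum_(1 <= k < P) p k * vk n f k = (A + Wp n f) * m1 + c * (K2 - 2 * d * K1) + m2 + A * m3 + b0 * s + (A + Wp n f) * m5.
  rewrite split; congr (_ + _ + _ + _ + _).
  - rewrite /m1 /K1 /K2 !mulr_sumr -sumrB mulr_sumr -big_split /= big_nat [RHS]big_nat; apply: eq_bigr => k /andP[k0 kF].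
    rewrite /vk ifT; last by move: kF Fl; clear; lia.
    by rewrite Wk; [ring|move: kF Fl; clear; lia].
  - rewrite big_nat [RHS]big_nat; apply: eq_bigr => k /andP[Fk kE].
    rewrite /vk ifF; last by move: Fk Fl; clear; lia.
    by rewrite ifT// mulr1.
  - rewrite mulr_sumr big_nat [RHS]big_nat; apply: eq_bigr => k /andP[Fk kE].
    rewrite /vk ifF; last by move: Fk L0; rewrite /E1; clear; lia.
    rewrite ifF; last by move: Fk; rewrite /E1; clear; lia.
    by rewrite ifT// mulrC.
  - rewrite mulr_sumr big_nat [RHS]big_nat; apply: eq_bigr => k /andP[Fk kE].
    rewrite /vk ifF; last by move: Fk L0; rewrite /E2; clear; lia.
    rewrite ifF; last by move: Fk r3; rewrite /E2 /E1; clear; lia.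
    rewrite ifF; last by move: Fk; rewrite /E2; clear; lia.
    by rewrite ifT// mulrC.
  - rewrite mulr_sumr big_nat [RHS]big_nat; apply: eq_bigr => k /andP[Fk kE].
    rewrite /vk ifF; last by move: Fk L0; rewrite /E3; clear; lia.
    rewrite ifF; last by move: Fk r3 r4; rewrite /E3 /E2 /E1; clear; lia.
    rewrite ifF; last by move: Fk r4; rewrite /E3 /E2; clear; lia.
    rewrite ifF; last by move: Fk; rewrite /E3; clear; lia.
    by rewrite mulrC.
have m2D : m2 <= a P * DD.
  have := @sum_near P F.+1 E1 _ r2 _; rewrite -/p -/m2 => h; apply: le_trans (h _ _) _.
  - by move: xF; clear; lia.
  - by rewrite /E1; move: fP x8 ly Ll yU fx; clear; lia.
  rewrite ler_pM2l// /DD -!mulrA ler_pM2l// [leRHS]mulrA ler_pM2r//.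
  by rewrite -[4]/(4%:R) -natrM ler_nat /E1; move: Fl Ll; clear; lia.
have m23 : m2 + m3 <= a P * (216 * (x%:R * ax)).
  have -> : m2 + m3 = \sum_(F.+1 <= k < E2) p k by rewrite (@big_cat_nat _ _ _ E1 F.+1).
  have := @sum_near P F.+1 E2 _ (leq_trans r2 r3) _; rewrite -/p => h; apply: le_trans (h _ _) _.
  - by move: xF; clear; lia.
  - by rewrite /E2; move: fP x8 ly Ll yU fx; clear; lia.
  rewrite ler_pM2l// -!mulrA ler_pM2l// ler_pM2r// ler_nat /E2; move: Fl Ll ly yU x8; clear; lia.
have s2 : a P * (2 * sigma) <= s.
  have i1 : (E2 <= E2 + 4 * (U * y))%N by rewrite leq_addr.
  have i2 : (E2 + 4 * (U * y) <= E3)%N by rewrite /E2 /E3; clear; lia.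
  rewrite /s (@big_cat_nat _ _ _ (E2 + 4 * (U * y))%N)//=.
  apply: (@le_trans _ _ (\sum_(E2 <= k < E2 + 4 * (U * y)) p k)); last first.
    by rewrite lerDl sumr_ge0// => k _; rewrite mulr_ge0 ?av_ge0.
  apply: (@le_trans _ _ (\sum_(E2 <= k < E2 + 4 * (U * y)) a P * (ax / 27))).
    have e4 : (4 * (U * y))%:R = 4 * (U%:R * y%:R) :> R by rewrite !natrM.
    by rewrite sumr_const_nat addKn -[_ *+ (4 * _)]mulr_natr e4 /sigma xy le_eqVlt; apply/orP; left; apply/eqP; field.
  rewrite big_nat [leRHS]big_nat; apply: ler_sum => k /andP[k1 k2].
  have h1 : (x <= k)%N by move: k1 xf x8; rewrite /E2; move: y1 yU; clear; lia.
  have h2 : (k <= 3 * x)%N by move: k2 fx x8 Ll ly yU; rewrite /E2; clear; lia.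
  have h3 : (0 < k < P)%N by move: h1 x0 k2 i2 r5; clear; lia.
  apply: le_trans (p_ge R h3); rewrite mulrC ler_pM2r//.
  have := @av_scale R 3 x k x0 h1 h2; rewrite -/ax (_ : 3%:R ^+ 3 = 27 :> R); last by rewrite -natrX.
  by rewrite ler_pdivrMr// mulrC.
have dr := drift R x0 xF Fx FP xP; rewrite -/p -/K1 in dr.
have kk := sum_kk_p R x0 xF Fx FP; rewrite -/p -/K2 in kk.
have x3 := x3_ge1 R x0.
have dy : `|d| <= y%:R.
  have e1 : x%:R <= f%:R + y%:R :> R by rewrite -natrD ler_nat ltnW.
  have e2 : f%:R <= x%:R + y%:R :> R by rewrite -natrD ler_nat ltnW.
  by rewrite ler_norml /d; lra.
(* The terms linear in d = f - x form the drift. As d is at most y, which is at most x / 8,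
   everything left is of order x^3 ax. *)
have br : K2 - 2 * d * K1 + 1 / 3 * a P.+1 * (2 * d + 1) <= a P * (240 * (x%:R ^+ 3 * ax)).
  have -> : K2 - 2 * d * K1 + 1 / 3 * a P.+1 * (2 * d + 1) = K2 + 1 / 3 * a P.+1 + 2 * (d * (1 / 3 * a P.+1 - K1)) by ring.
  have h1 : d * (1 / 3 * a P.+1 - K1) <= y%:R * (a P * (180 * (x%:R ^+ 2 * ax))).
    apply: le_trans (ler_norm _) _; rewrite normrM; exact: ler_pM.
  have h2 : y%:R * (a P * (180 * (x%:R ^+ 2 * ax))) <= a P * (22 * (x%:R ^+ 3 * ax) + x%:R ^+ 3 * ax / 2).
    have -> : y%:R * (a P * (180 * (x%:R ^+ 2 * ax))) = a P * x%:R ^+ 2 * ax * (180 * y%:R) by ring.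
    have -> : a P * (22 * (x%:R ^+ 3 * ax) + x%:R ^+ 3 * ax / 2) = a P * x%:R ^+ 2 * ax * (45 / 2 * x%:R) by field.
    apply: ler_wpM2l; first by rewrite !mulr_ge0 ?exprn_ge0 ?av_ge0 ?ler0n.
    have : y%:R <= U%:R * y%:R :> R by rewrite -natrM ler_nat.
    by rewrite xy; lra.
  have h3 : a P <= a P * (8 * (x%:R ^+ 3 * ax)) by rewrite ler_peMr// ltW.
  have h4 := av_le R (ltnW P1) (leqnSn P); move: kk h1 h2 h3 h4; rewrite -/ax; move: (x%:R ^+ 3 * ax) (d * _) (y%:R * _) => z1 z2 z3; lra.
have gns0 : 0 <= G * n%:R * sigma by exact: mulr_ge0 (mulr_ge0 G0 (ler0n _ _)) (ltW sigma0).
have gam0 : 0 <= gamma by rewrite /gamma !mulr_ge0 ?ler0n ?exprn_ge0 ?ler0n// ltW.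
have gs : 0 <= G * sigma := mulr_ge0 G0 (ltW sigma0).
have c0 : 0 <= c by apply: divr_ge0 => //; rewrite exprn_ge0 ?ler0n.
have cb : c * (a P * (240 * (x%:R ^+ 3 * ax))) = a P * (G * n%:R * sigma * ((120 * 128) * U%:R ^+ 2 * (x%:R * ax))).
  by rewrite /c xy; field.
have Wm : - Wp n f <= G * n%:R * sigma.
  rewrite /Wp; have g0 := gns0.
  have h1 : 0 <= n%:R * DD by apply: mulr_ge0 => //; apply: mulr_ge0 (ltW ax0); rewrite !mulr_ge0 ?ler0n.
  have h2 : 0 <= gamma * n%:R + ((f%:R - x%:R) / y%:R) ^+ 2.
    by apply: addr_ge0 (sqr_ge0 _); apply: mulr_ge0.
  have := mulr_ge0 g0 h2; lra.
have m20 : 0 <= m2 by apply: sumr_ge0 => k _; rewrite mulr_ge0 ?av_ge0.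
have m30 : 0 <= m3 by apply: sumr_ge0 => k _; rewrite mulr_ge0 ?av_ge0.
have s0 : 0 <= s by apply: sumr_ge0 => k _; rewrite mulr_ge0 ?av_ge0.
have A0 : 0 <= A by exact: le_trans b00 b0A.
have Wn1 : Wp n f + DD + G * sigma * (2 * n%:R * gamma - 1) <= Wp n.+1 f.
  have h2 : 0 <= gamma + ((f%:R - x%:R) / y%:R) ^+ 2.
    by apply: addr_ge0 (sqr_ge0 _).
  have -> : Wp n.+1 f = Wp n f + DD + G * sigma * (2 * n%:R * gamma - 1) + G * sigma * (gamma + ((f%:R - x%:R) / y%:R) ^+ 2).
    by rewrite /Wp -[n.+1%:R]natr1; field.
  by rewrite lerDl; apply: mulr_ge0.
rewrite -/p in T *; rewrite T W1.
have -> : 2 / 3 * (a P.+1 * ((A + Wp n f + (A + (Wp n f + c * (2 * d + 1)))) / 2)) +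
  ((A + Wp n f) * m1 + c * (K2 - 2 * d * K1) + m2 + A * m3 + b0 * s + (A + Wp n f) * m5) =
  (A + Wp n f) * (2 / 3 * a P.+1 + (m1 + m2 + m3 + s + m5)) + c * (K2 - 2 * d * K1 + 1 / 3 * a P.+1 * (2 * d + 1)) +
  m2 * (1 - A) + (- Wp n f) * (m2 + m3 + s) - G * s.
  by rewrite /G; field.
rewrite tot; have := ler_wpM2l c0 br; rewrite cb => h1.
have h2 : m2 * (1 - A) <= m2 by rewrite ler_piMr// gerBl.
have h3 : (- Wp n f) * (m2 + m3 + s) <= G * n%:R * sigma * (m2 + m3 + s) by rewrite ler_wpM2r// !addr_ge0.
have gn := gns0.
have h4 := ler_wpM2l gn m23.
have h5 : G * n%:R * sigma * s <= G * s / 2.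
  have := ler_wpM2l (mulr_ge0 G0 s0) ns; lra.
have h6 : G * (a P * (2 * sigma)) <= G * s by rewrite ler_wpM2l.
have h7 := ler_wpM2l (ltW aP0) Wn1.
have h8 : a P * (G * n%:R * sigma * ((120 * 128) * U%:R ^+ 2 * (x%:R * ax))) + a P * (G * n%:R * sigma * (216 * (x%:R * ax))) <=
   a P * (G * sigma * (2 * n%:R * gamma)).
  have -> : a P * (G * sigma * (2 * n%:R * gamma)) = a P * (G * n%:R * sigma) * (2 * (200 * 200) * U%:R ^+ 2 * (x%:R * ax)).
    by rewrite /gamma; ring.
  rewrite -mulrDr -mulrDr mulrA; apply: ler_wpM2l; first by apply: mulr_ge0 (ltW aP0) gn.
  have -> : (120 * 128) * U%:R ^+ 2 * (x%:R * ax) + 216 * (x%:R * ax) = ((120 * 128) * U%:R ^+ 2 + 216) * (x%:R * ax) by ring.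
  apply: ler_wpM2r; first by apply: mulr_ge0 (ltW ax0).
  have := exprn_ege1 2 UR1; move: (U%:R ^+ 2) => z; lra.
move: h1 h2 h3 h4 h5 h6 h7 h8 m2D.
have e1 : G * n%:R * sigma * (m2 + m3 + s) = G * n%:R * sigma * (m2 + m3) + G * n%:R * sigma * s by ring.
rewrite e1.
move: (c * _) (m2 * (1 - A)) (- Wp n f * _) (G * n%:R * sigma * s) (G * n%:R * sigma * (m2 + m3)) (G * s) => q1 q2 q3 q5 q6 q7 h1 h2 h3 h4 h5 h6 h7 h8 h9.
suff H : forall q : R, q <= q6 + q5 -> (A + Wp n f) * a P + q1 + q2 + q - q7 <= a P * (A + Wp n.+1 f) by exact: H h3.
clear q3 h3 e1 => q h3.
lra.
Qed.
End trial.

(** * From a failure bound at one scale to a better one at a larger scale *)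

Section trial.
Variable R : realType.
Local Notation a := (av R).
Variables (L : nat) (kap : R) (N : nat).

Definition badB l A := forall P, (l + L + 2 * l <= P)%N -> sb (fun c => bad L kap N c l l.-1 (2 * l)) P (A * a P).

Variables (U y l : nat).
Hypotheses (U0 : (0 < U)%N) (y1 : (1 < y)%N) (L0 : (0 < L)%N) (Ll : (L <= l)%N) (ly : (l <= y)%N).
Let x := (8 * (U * y))%N.
Variables (A b0 : R).
Hypotheses (b0A : b0 <= A) (b00 : 0 <= b0).
Hypothesis hB : badB l A.
Hypothesis hF : forall P f h, (x < f + y)%N -> (f < x + y)%N -> P.+1 = (f + L + h)%N ->
  (4 * (U * y) < h)%N -> (h <= 16 * (U * y))%N ->
  sb (fun c => bad L kap N c f (x - y).-1 h.-1) P (b0 * a P).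

Local Notation W := (Wp U y l A b0).

Lemma sb_mean F P (u v : R) : sb F P u -> sb F P v -> sb F P ((u + v) / 2).
Proof. move=> h1 h2 s us os; have := h1 s us os; have := h2 s us os; lra. Qed.

Lemma back_A f P ph e : (l <= f)%N -> (f + L + 2 * l <= P)%N -> (l.-1 <= ph)%N -> (2 * l <= e)%N ->
  sb (fun c => bad L kap N c f ph e) P (A * a P).
Proof.
move=> lf fP lp le; apply: (@sb_bad_mono _ _ _ _ _ _ l.-1 _ (2 * l)%N) => //.
apply: (@sb_bad_rot _ _ _ _ _ (f - l)%N f l); rewrite ?leq_subr//.
- by left; rewrite addnC subnK.
- by move: fP; clear; lia.
- by move: lf; clear; lia.
- by rewrite leq_pred.
- exact: leqW.
- by move: lf fP; clear; lia.
- by apply: hB; move: lf fP; clear; lia.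
Qed.

(** Induction on the number of peeling steps. Once f is out of the interval of radius y around x the
    square in [Wp] is at least 1, so [Wp] is nonnegative and the bound A of the previous scale is
    enough; inside it, [sb_peel] and [step_ineq] give one more step. *)
Lemma trial_claim n : n%:R * (x%:R * a x / 108) <= 1 / 2 -> forall f P, (l <= f)%N -> (f + L + 2 * x <= P)%N ->
  sb (fun c => bad L kap N c f (minn (x - y).-1 f.-1) (2 * x)) P (a P * (A + W n f)).
Proof.
have yU : (y <= U * y)%N by rewrite leq_pmull.
have x8 : (x = 8 * (U * y))%N by [].
have x0 : (0 < x)%N by move: y1 yU; rewrite /x; clear; lia.
have ax0 : 0 < a x by exact: av_gt0.
have sg0 : 0 <= x%:R * a x / 108 by rewrite divr_ge0// mulr_ge0 ?ler0n// ltW.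
have fallback f P n' : 0 <= W n' f -> (l <= f)%N -> (f + L + 2 * x <= P)%N ->
  sb (fun c => bad L kap N c f (minn (x - y).-1 f.-1) (2 * x)) P (a P * (A + W n' f)).
  move=> w0 lf fP; apply: (@sb_le _ _ _ _ _ (A * a P) (fun c _ => lexx _)); first by rewrite mulrC ler_wpM2l ?av_ge0// lerDl.
  apply: back_A => //.
  - by move: fP ly yU x8; clear; lia.
  - by rewrite leq_min; apply/andP; split; move: lf ly yU x8; clear; lia.
  - by move: ly yU x8; clear; lia.
elim: n => [_|n IH sn] f P lf fP.
  by apply: fallback => //; rewrite /Wp !mulr0 !mul0r addr0.
have sn' : n%:R * (x%:R * a x / 108) <= 1 / 2.
  by apply: le_trans sn; rewrite ler_wpM2r// ler_nat leqnSn.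
have {}IH := IH sn'.
have [/andP[xf fx]|out] := boolP ((x < f + y) && (f < x + y))%N; last first.
  apply: fallback => //.
  have y0 : 0 < y%:R :> R by rewrite ltr0n (ltnW y1).
  have d1 : 1 <= ((f%:R - x%:R) / y%:R) ^+ 2 :> R.
    rewrite expr_div_n ler_pdivlMr ?exprn_gt0// mul1r.
    move: out; rewrite negb_and -!leqNgt => /orP[h|h].
      have : f%:R + y%:R <= x%:R :> R by rewrite -natrD ler_nat.
      move: (f%:R : R) (x%:R : R) => u v h'; rewrite -[leRHS]sqrrN; apply: lerXn2r; rewrite ?nnegrE; lra.
    have : x%:R + y%:R <= f%:R :> R by rewrite -natrD ler_nat.
    move: (f%:R : R) (x%:R : R) => u v h'; apply: lerXn2r; rewrite ?nnegrE; lra.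
  rewrite /Wp -/x; apply: addr_ge0.
    by rewrite !mulr_ge0 ?ler0n// ltW.
  apply: mulr_ge0; first by rewrite mulr_ge0// mulr_ge0 ?subr_ge0 ?ler0n.
  have g0 : 0 <= 200 * 200 * U%:R ^+ 2 * (x%:R * a x) * n.+1%:R :> R.
    by rewrite !mulr_ge0 ?exprn_ge0 ?ler0n// ltW.
  by move: d1 g0; move: (_ ^+ 2) (_ * n.+1%:R) => u v; lra.
have phf : ((x - y).-1 < f)%N by move: xf x0 lf Ll L0; clear; lia.
have -> : minn (x - y).-1 f.-1 = (x - y).-1 by apply/minn_idPl; move: phf; clear; lia.
pose pk k := minn (x - y).-1 (f - k).-1; pose ek k := minn (2 * x) (k - (f + L)).
pose yf k := a (P - k) * (if (k + l <= f)%N then A + W n (f - k) else 1).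
pose yb k := a k * (if (k < f + L + 2 * l)%N then 1
  else if (k < f + L + 4 * (U * y))%N then A else if (k < f + L + 16 * (U * y))%N then b0 else A + W n f).
(* After a removal without split the boundary has one more edge, and rotating the root by one edge
   puts the block at f + 1 in place of f. Both positions bound the same mass; their mean gives the
   upward drift 1/2. *)
have hS : sb (fun c => bad L kap N c f (x - y).-1 (2 * x)) P.+1 (a P.+1 * ((A + W n f + (A + W n f.+1)) / 2)).
  rewrite mulrA mulrDr; apply: sb_mean.
    apply: (@sb_bad_mono _ _ _ _ _ _ (minn (x - y).-1 f.-1) _ (2 * x)%N) => //; first exact: geq_minl.
    by apply: IH => //; apply: leqW.
  apply: (@sb_bad_rot _ _ _ _ _ P.+1 f f.+1) => //.
  - by right; rewrite addSnnS.
  - exact: ltnW.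
  - exact: leqW (ltnW _).
  - by rewrite leqW// leqW.
  - by rewrite !addSn !ltnS; apply: leqW.
  - have := IH f.+1 P.+1 (leqW lf); rewrite [minn _ _](minn_idPl _); last by move: phf; clear; lia.
    by apply; rewrite !addSn ltnS.
have hf k : (0 < k)%N -> (pk k + k < f)%N -> sb (fun c => bad L kap N c (f - k) (pk k) (2 * x)) (P - k) (yf k).
  move=> k0 kf; have kf' : (k < f)%N by move: kf; clear; lia.
  rewrite /yf; case: leqP => [kl|lk].
    by apply: IH; [move: kl; clear; lia|move: fP kf'; clear; lia].
  by rewrite mulr1; apply: sb_bad1; move: fP kf' x0; clear; lia.
have hb k : (f + L + ek k <= k < P)%N -> sb (fun c => bad L kap N c f (x - y).-1 (ek k)) k (yb k).
  move=> /andP[fk kP]; have flk : (f + L <= k)%N by move: fk; clear; lia.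
  rewrite /yb; case: (ltnP k (f + L + 2 * l)) => [_|k1].
    by rewrite mulr1; apply: sb_bad1; move: flk L0; clear; lia.
  have A1 : (l.-1 <= (x - y).-1)%N by move: lf ly yU x8; clear; lia.
  case: (ltnP k (f + L + 4 * (U * y))) => [_|k2].
    rewrite mulrC; apply: back_A => //.
    by rewrite leq_min; apply/andP; split; move: k1 ly yU x8; clear; lia.
  case: (ltnP k (f + L + 16 * (U * y))) => [k3|k3].
    rewrite mulrC (_ : ek k = (k.+1 - (f + L)).-1); last first.
      by rewrite subSn// /ek; apply/minn_idPr; move: k3 x8; clear; lia.
    by apply: hF => //; move: k2 k3 flk; clear; lia.
  rewrite (_ : ek k = 2 * x)%N; last by apply/minn_idPl; move: k3 x8; clear; lia.
  apply: (@sb_bad_mono _ _ _ _ _ _ (minn (x - y).-1 f.-1) _ (2 * x)%N) => //; first exact: geq_minl.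
  by apply: IH => //; move: k3 x8; clear; lia.
have pk_le k : (pk k <= (x - y).-1)%N by exact: geq_minl.
have ek_le k : (ek k <= 2 * x)%N by exact: geq_minl.
have := sb_peel L0 phf fP pk_le ek_le hS hf hb.
apply: sb_le => //.
have := @step_ineq R U y L l U0 y1 L0 Ll ly A b0 b0A b00 n f P xf fx fP sn'.
apply: le_trans; rewrite lerD2l big_nat [leRHS]big_nat; apply: ler_sum => k /andP[k0 kP].
rewrite le_eqVlt; apply/orP; left; apply/eqP.
have -> : (pk k + k < f)%N = (k < f)%N by rewrite /pk; move: phf; case: (leqP (x - y).-1 (f - k).-1); clear; lia.
have -> : (f + L + ek k <= k)%N = (f + L <= k)%N.
  by rewrite /ek; case: (leqP (2 * x) (k - (f + L))); clear; lia.
rewrite /vk /yf /yb; have [kf|fk] := ltnP k f.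
  case: (leqP (k + l) f) => h; first by rewrite mulrA.
  by rewrite ifT ?mulr1//; move: kf; clear; lia.
rewrite [(k + l <= f)%N]leqNgt (_ : (f < k + l)%N) /=; last by move: fk Ll L0; clear; lia.
have [fk'|kf] := leqP (f + L) k; first by rewrite -!mulrA [a (P - k) * _]mulrC.
by rewrite ifT ?mulr1//; move: kf; clear; lia.
Qed.

(** Start from f = x with n close to 1 / (2 gamma). The gain n sigma (1 - gamma n) is then of order
    1 / U^2 whatever the scale, and the loss n [DD] is at most 1 / C when l is at most x / C. *)
Lemma trial C : (0 < C)%N -> (C * l <= x)%N -> (2500 * U <= y)%N ->
  badB x (A - (A - b0) / (48 * 36 * 10 * (20 * 100) * U%:R ^+ 2) + 1 / (C%:R)).
Proof.
move=> C0 Cx yU25 P xP.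
have yU : (y <= U * y)%N by rewrite leq_pmull.
have x8 : (x = 8 * (U * y))%N by [].
have x0 : (0 < x)%N by move: y1 yU; rewrite /x; clear; lia.
have ax0 : 0 < a x by exact: av_gt0.
have xR : 0 < x%:R :> R by rewrite ltr0n.
have UR : 1 <= U%:R :> R by rewrite ler1n.
have CR : 0 < C%:R :> R by rewrite ltr0n.
have lx : (l <= x)%N by move: ly yU x8; clear; lia.
pose g : R := (200 * 200) * U%:R ^+ 2 * (x%:R * a x).
have g0 : 0 < g by rewrite /g !mulr_gt0 ?exprn_gt0//; lra.
have g4 : g <= 1 / 4.
  have h1 := av_sq R (isT : 0 < 1)%N x0; rewrite av1 expr1n mul1r in h1.
  have h2 : 200 * 100 * U%:R ^+ 2 <= x%:R :> R.
    have -> : 200 * 100 * U%:R ^+ 2 = (8 * (U * (2500 * U)))%:R :> R by rewrite !natrM; ring.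
    by rewrite ler_nat x8 leq_mul2l leq_mul2l yU25 orbT.
  have h3 := ler_wpM2r (mulr_ge0 (ltW xR) (ltW ax0)) h2.
  by rewrite /g; move: h1 h3; rewrite expr2; move: (U%:R ^+ 2) (a x) (x%:R : R) => u v w; lra.
(* Since g is at most 1/4, thanks to the lower bound on y, the product n g lies between 1/4 and
   1/2. *)
pose n := Num.truncn (1 / (2 * g)).
have n1 : n%:R <= 1 / (2 * g) by rewrite truncn_le// divr_ge0//; lra.
have n2 : 1 / (2 * g) < n%:R + 1 by rewrite natr1 truncnS_gt.
have ng1 : n%:R * g <= 1 / 2 by move: n1; rewrite ler_pdivlMr ?mulr_gt0//; lra.
have ng2 : 1 / 4 <= n%:R * g by move: n2; rewrite ltr_pdivrMr ?mulr_gt0//; lra.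
have sgE : x%:R * a x / 108 = g / (60 * 72 * (10 * 100) * U%:R ^+ 2).
  by rewrite /g; field; rewrite gt_eqF//; lra.
have U2 : 1 <= U%:R ^+ 2 :> R by exact: exprn_ege1.
have U2' : 0 < U%:R ^+ 2 :> R by lra.
have sn : n%:R * (x%:R * a x / 108) <= 1 / 2.
  rewrite sgE [n%:R * _]mulrA ler_pdivrMr; last by lra.
  apply: le_trans ng1 _; lra.
have := trial_claim sn lx xP; apply: sb_le => // [c _|].
  rewrite ler_wpM2l ?wt_ge0//; apply: nb_le; apply: gam_mono => //; exact: geq_minr.
rewrite mulrC ler_wpM2r ?av_ge0// /Wp -/x subrr mul0r expr0n /= addr0 -/g addrAC -addrA lerD2l.
have h1 : n%:R * (216 * (4 * l%:R) * a x) <= 1 / C%:R.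
  have -> : n%:R * (216 * (4 * l%:R) * a x) = (n%:R * g) * (24 * 36 * l%:R / (200 * 200 * U%:R ^+ 2 * x%:R)).
    by rewrite /g; field; rewrite !gt_eqF//; lra.
  apply: le_trans (_ : 1 / 2 * (24 * 36 * l%:R / (200 * 200 * U%:R ^+ 2 * x%:R)) <= _).
    by rewrite ler_wpM2r// divr_ge0 ?mulr_ge0 ?exprn_ge0 ?ler0n.
  apply: (@le_trans _ _ (l%:R / x%:R)); last first.
    by rewrite ler_pdivrMr// mulrC mulrA mulr1 ler_pdivlMr// -natrM ler_nat mulnC.
  have -> : 1 / 2 * (24 * 36 * l%:R / (200 * 200 * U%:R ^+ 2 * x%:R)) = (l%:R / x%:R) * (18 * 24 / (200 * 200 * U%:R ^+ 2)) :> R.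
    by field; rewrite !gt_eqF//; lra.
  by rewrite ler_piMr ?divr_ge0// ler_pdivrMr ?mulr_gt0//; lra.
have h2 : (A - b0) * n%:R * (x%:R * a x / 108) * (g * n%:R - 1) <= - ((A - b0) / (48 * 36 * 10 * (20 * 100) * U%:R ^+ 2)).
  rewrite sgE.
  have -> : (A - b0) * n%:R * (g / (60 * 72 * (10 * 100) * U%:R ^+ 2)) * (g * n%:R - 1) =
    - ((A - b0) * ((n%:R * g) * (1 - n%:R * g) / (60 * 72 * (10 * 100) * U%:R ^+ 2))) by field; rewrite gt_eqF//; lra.
  rewrite lerN2 ler_wpM2l ?subr_ge0// ler_pdivlMr; last by lra.
  have -> : (48 * 36 * 10 * (20 * 100) * U%:R ^+ 2)^-1 * (60 * 72 * (10 * 100) * U%:R ^+ 2) = 1 / 8 :> R by field; rewrite gt_eqF//; lra.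
  move: ng1 ng2; move: (n%:R * g) => u u1 u2; nra.
lra.
Qed.
End trial.

(** * At scale 2^t, potentials of energy O(t) exist with high probability *)

Section gamma.
Variable R : realType.
Local Notation a := (av R).

Lemma pow_small (z eps : R) : 0 <= z < 1 -> 0 < eps -> exists n, z ^+ n <= eps.
Proof.
move=> /andP[]; rewrite le_eqVlt => /predU1P[<- _|z0 z1] e0.
  by exists 1%N; rewrite expr1 ltW.
pose h := z^-1 - 1; have h0 : 0 < h by rewrite subr_gt0 invf_gt1.
exists (Num.truncn (1 / (h * eps))).+1; set n := _.+1.
have n1 : 1 / (h * eps) < n%:R by rewrite truncnS_gt.
have := @bernoulli2 R h n (ltW h0); rewrite /h subrKC exprVn => b.
have n2 : 0 <= n%:R * (n%:R - 1) / 2 * (z^-1 - 1) ^+ 2.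
  have : 0 <= n%:R - 1 :> R by rewrite subr_ge0 ler1n.
  by move=> n1'; apply: mulr_ge0 (sqr_ge0 _); apply: divr_ge0 => //; exact: mulr_ge0.
have zn : 0 < z ^+ n by rewrite exprn_gt0.
have : n%:R * h <= (z ^+ n)^-1 by rewrite /h; move: b n2; move: (_ / 2 * _) (n%:R * _) ((z ^+ n)^-1) => p q r; lra.
move: n1; rewrite ltr_pdivrMr ?mulr_gt0// => n1 n3.
have := ler_wpM2r (ltW zn) n3; rewrite mulVf ?gt_eqF// => n4.
rewrite -(@ler_pM2l _ (n%:R * h)); last by rewrite mulr_gt0 ?ltr0n.
by apply: le_trans n4 _; rewrite -mulrA ltW.
Qed.

Lemma sb_bad_N L kap N N' f ph e P v : (N <= N')%N ->
  sb (fun c => bad L kap N c f ph e) P v -> sb (fun c => bad L (kap : R) N' c f ph e) P v.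
Proof.
move=> NN; apply: sb_le (lexx _) => c _; rewrite ler_wpM2l ?wt_ge0// /nb.
case: (asboolP (gam L kap N' c f ph e)) => h'; case: (asboolP (gam L kap N c f ph e)) => h //=; rewrite ?ler01//.
by case: h'; apply: gset_mono h.
Qed.

(** Provides the hypothesis [hF] of [trial]: each of the three terms of [sb_fin] is at most 1 / U
    times [a P]. *)
Lemma fin_zone (U y L D Z : nat) : (0 < U)%N -> (0 < y)%N -> (0 < L)%N -> (L <= y)%N -> (26 * (U * y) <= Z)%N ->
  4 * lamD ^+ D * Z%:R ^+ 2 <= 1 / U%:R :> R ->
  forall P f h, (8 * (U * y) < f + y)%N -> (f < 8 * (U * y) + y)%N -> P.+1 = (f + L + h)%N ->
  (4 * (U * y) < h)%N -> (h <= 16 * (U * y))%N ->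
  sb (fun c => bad L (4 * D%:R : R) (Z + U * Z ^ 2) c f (8 * (U * y) - y).-1 h.-1) P (3 / U%:R * a P).
Proof.
move=> U0 y0 L0 Ly yZ hD P f h xf fx PE h1 h2.
have yU : (y <= U * y)%N by rewrite leq_pmull.
have PZ : (P.+1 <= Z)%N by apply: leq_trans yZ; move: PE fx h2 Ly yU; clear; lia.
apply: (@sb_bad_N _ _ (P.+1 + U * Z ^ 2)%N); first by rewrite leq_add2r.
have := @sb_fin R P f L h (8 * (U * y) - y).-1 (3 * y) U D (U * Z ^ 2) L0 U0.
move=> /(_ _ _ _ PE) H; apply: sb_le (H _ _ _ _ _ _) => //.
- have PR : P.+1%:R <= Z%:R :> R by rewrite ler_nat.
  have UR : 1 <= U%:R :> R by rewrite ler1n.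
  have e1 : 4 * lamD ^+ D * P.+1%:R ^+ 2 * a P <= 1 / U%:R * a P.
    rewrite ler_wpM2r ?av_ge0//; apply: le_trans hD.
    apply: ler_wpM2l; first by rewrite mulr_ge0 ?exprn_ge0// ltW ?lam_gt0.
    by apply: lerXn2r; rewrite ?nnegrE.
  have e2 : a P * P%:R ^+ 2 / (U * Z ^ 2).+1%:R <= 1 / U%:R * a P.
    rewrite ler_pdivrMr ?ltr0n// mulrC [leRHS]mulrAC ler_wpM2r ?av_ge0//.
    rewrite mulrC mulrA mulr1 ler_pdivlMr; last by lra.
    rewrite -natrX -natrM ler_nat; apply: leqW; rewrite mulnC leq_mul2l; apply/orP; right.
    by rewrite leq_exp2r//; exact: ltnW.
  have -> : 3 / U%:R * a P = a P / U%:R + 1 / U%:R * a P + 1 / U%:R * a P by ring.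
  by rewrite -!addrA lerD2l lerD.
- by move: xf fx y0 yU; clear; lia.
- by move: Ly; clear; lia.
- by move: h1; clear; lia.
- by move: xf fx yU; rewrite mulnCA; move: (U * y)%N => z; clear; lia.
- have e3 : (U * (3 * y) = 3 * (U * y))%N by rewrite mulnCA.
  by move: PE h1 e3; move: (U * y)%N (U * (3 * y))%N => z z'; clear; lia.
- exact: leq_subr.
Qed.

(** [trial] is iterated K times, each time multiplying the scale by M; the bounds 3 / U + (1 - 1 /
    Q)^i + Q / C are preserved exactly, and U, C, K make them smaller than beta. The perimeters in
    play are at most of order 2^t, so the degree tail must beat (2^t)^2: the factor 15 is chosen
    because (29/32)^15 times 4 is less than 1. *)
Theorem gamma_thm (beta : R) : 0 < beta -> exists w D0 : nat, (0 < w)%N /\ forall t, exists N, forall P,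
  (w * 2 ^ t + 2 ^ t + 2 * (w * 2 ^ t) <= P)%N ->
  sb (fun c => bad (2 ^ t) (4 * (15 * t + D0)%:R : R) N c (w * 2 ^ t) (w * 2 ^ t).-1 (2 * (w * 2 ^ t))) P (beta * a P).
Proof.
move=> be0.
pose U := (Num.truncn (12 / beta)).+1.
have UR : 12 / beta < U%:R by rewrite truncnS_gt.
have U1 : 1 <= U%:R :> R by rewrite ler1n.
have U0 : (0 < U)%N by [].
have b3 : 3 / U%:R <= beta / 4.
  by move: UR; rewrite ltr_pdivrMr// ler_pdivrMr; lra.
pose Q : R := 48 * 36 * 10 * (20 * 100) * U%:R ^+ 2.
have Q1 : 1 < Q by rewrite /Q; have := exprn_ege1 2 U1; move: (U%:R ^+ 2) => z; lra.
pose C := (Num.truncn (4 * Q / beta)).+1.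
have CR : 4 * Q / beta < C%:R by rewrite truncnS_gt.
have C1 : 1 <= C%:R :> R by rewrite ler1n.
have CQ : Q / C%:R <= beta / 4 by move: CR; rewrite ltr_pdivrMr// ler_pdivrMr; lra.
have Qi : 0 < Q^-1 < 1 by rewrite invr_gt0 invf_lt1; lra.
have [K hK] : exists K, (1 - Q^-1) ^+ K <= beta / 4 by apply: pow_small; lra.
pose M := (8 * (U * (C * (2500 * U))))%N.
have M0 : (0 < M)%N by [].
pose w := (M ^ K)%N; have w0 : (0 < w)%N by rewrite expn_gt0.
pose Z0 := (26 * (U * w))%N.
have Z00 : (0 < Z0)%N by rewrite !muln_gt0 w0.
have [D0 hD0] : exists D0, lamD ^+ D0 <= (4 * (Z0%:R ^+ 2) * U%:R)^-1 :> R.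
  apply: pow_small; first by rewrite /lamD; lra.
  by rewrite invr_gt0 !mulr_gt0 ?exprn_gt0 ?ltr0n.
exists w, D0; split => // t.
pose L := (2 ^ t)%N; have L0 : (0 < L)%N by rewrite expn_gt0.
pose D := (15 * t + D0)%N; pose Z := (Z0 * L)%N.
have hD : 4 * lamD ^+ D * Z%:R ^+ 2 <= 1 / U%:R :> R.
  have h1 : lamD ^+ (15 * t) * L%:R ^+ 2 <= 1 :> R.
    have -> : lamD ^+ (15 * t) * L%:R ^+ 2 = (lamD ^+ 15 * 2 ^+ 2) ^+ t :> R.
      by rewrite [RHS]exprMn [in LHS]exprM /L natrX; congr (_ * _); rewrite exprAC.
    apply: exprn_ile1.
      by rewrite mulr_ge0 ?exprn_ge0// ltW ?lam_gt0.
    by rewrite /lamD !exprS expr0; lra.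
  have -> : 4 * lamD ^+ D * Z%:R ^+ 2 = lamD ^+ (15 * t) * L%:R ^+ 2 * (4 * Z0%:R ^+ 2 * lamD ^+ D0) :> R.
    by rewrite /D /Z natrM exprD; move: (lamD ^+ D0) (lamD ^+ (15 * t)) => u v; ring.
  have zz : 0 <= 4 * Z0%:R ^+ 2 :> R by rewrite mulr_ge0 ?exprn_ge0.
  apply: le_trans (_ : 4 * Z0%:R ^+ 2 * lamD ^+ D0 <= _).
    by rewrite ler_piMl// mulr_ge0// exprn_ge0// ltW ?lam_gt0.
  apply: le_trans (ler_wpM2l zz hD0) _.
  rewrite le_eqVlt; apply/orP; left; apply/eqP; field.
  by rewrite !pnatr_eq0 -!lt0n Z00.
exists (Z + U * Z ^ 2)%N.
suff H i : (i <= K)%N -> badB L (4 * D%:R : R) (Z + U * Z ^ 2) (M ^ i * L) (3 / U%:R + ((1 - Q^-1) ^+ i + Q / C%:R)).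
  move=> P hP; have := H K (leqnn K) P hP; apply: sb_le => //.
  by rewrite ler_wpM2r ?av_ge0//; lra.
have QC0 : 0 <= Q / C%:R by rewrite divr_ge0//; lra.
elim: i => [_ P hP|i IH iK].
  have P0 : (0 < P)%N by move: hP L0; rewrite expn0; clear; lia.
  apply: sb_le (sb_bad1 _ _ _ _ _ _ P0) => //.
  rewrite expr0 ler_peMl ?av_ge0//.
  have : 0 <= 3 / U%:R :> R by rewrite divr_ge0.
  lra.
have {}IH := IH (ltnW iK).
pose l := (M ^ i * L)%N; pose y := (C * (2500 * U) * l)%N.
have l0 : (0 < l)%N by rewrite muln_gt0 expn_gt0 M0.
have Ll : (L <= l)%N by rewrite leq_pmull// expn_gt0 M0.
have ly : (l <= y)%N by rewrite leq_pmull// !muln_gt0.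
have yU : (2500 * U <= y)%N by rewrite /y -mulnA mulnCA leq_pmulr// muln_gt0.
have y1 : (1 < y)%N by apply: leq_trans yU; move: U0; clear; lia.
have xE : (8 * (U * y) = M ^ i.+1 * L)%N by rewrite /M expnS /y /l; ring.
have yZ : (26 * (U * y) <= Z)%N.
  rewrite /Z /Z0 -!mulnA leq_mul2l leq_mul2l /=.
  have : (M ^ i.+1 <= w)%N by rewrite /w leq_pexp2l.
  rewrite -(leq_pmul2r L0) -xE; apply: leq_trans.
  by rewrite mulnA leq_pmull.
pose A := 3 / U%:R + ((1 - Q^-1) ^+ i + Q / C%:R).
have b0A : 3 / U%:R <= A.
  by rewrite /A lerDl addr_ge0// exprn_ge0//; lra.
have b00 : 0 <= 3 / U%:R :> R by rewrite divr_ge0.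
have Cx : (C * l <= 8 * (U * y))%N.
  have -> : (8 * (U * y) = (8 * (U * (2500 * U))) * (C * l))%N by rewrite /y; ring.
  by rewrite leq_pmull// !muln_gt0.
have := @trial R L (4 * D%:R) (Z + U * Z ^ 2) U y l U0 y1 L0 Ll ly A (3 / U%:R) b0A b00 IH
  (fin_zone U0 (ltnW y1) L0 (leq_trans Ll ly) yZ hD) C isT Cx yU.
rewrite -/Q xE => H P hP; apply: sb_le (H P hP) => //.
rewrite ler_wpM2r ?av_ge0// /A exprS le_eqVlt; apply/orP; left; apply/eqP.
by field; rewrite !gt_eqF//; lra.
Qed.
End gamma.

(** * Laplacian and near-minimisers of the energy *)

Section laplacian.
Variable R : realType.
Variable E : seq (nat * nat).
Implicit Types f g : nat -> R.

Definition dip f g : R := \sum_(e <- E) (f e.1 - f e.2) * (g e.1 - g e.2).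
(** Sign convention: the current leaving v, nonnegative at a maximum of [g]. *)
Definition lap g (v : nat) : R :=
  \sum_(e <- E) ((e.1 == v)%:R * (g e.1 - g e.2) + (e.2 == v)%:R * (g e.2 - g e.1)).

Lemma energyE g : energy E g = dip g g.
Proof. by apply: eq_bigr => e _; rewrite expr2. Qed.

Lemma dipC f g : dip f g = dip g f.
Proof. by apply: eq_bigr => e _; rewrite mulrC. Qed.

Lemma dip_sum (I : Type) (r : seq I) (F : I -> nat -> R) g :
  dip (fun v => \sum_(i <- r) F i v) g = \sum_(i <- r) dip (F i) g.
Proof.
rewrite /dip exchange_big; apply: eq_bigr => e _ /=.
by rewrite -sumrB mulr_suml.
Qed.

Lemma dipZ x f g : dip (fun v => x * f v) g = x * dip f g.
Proof. by rewrite /dip mulr_sumr; apply: eq_bigr => e _; ring. Qed.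

Lemma energyZ x g : energy E (fun v => x * g v) = x ^+ 2 * energy E g.
Proof. by rewrite !energyE dipZ dipC dipZ mulrA. Qed.

Lemma energy_add f g s : energy E (fun v => f v + s * g v) = energy E f + 2 * s * dip f g + s ^+ 2 * energy E g.
Proof. by rewrite /energy /dip !mulr_sumr -!big_split; apply: eq_bigr => e _ /=; ring. Qed.

Lemma energy_ge0 g : 0 <= energy E g.
Proof. by apply: sumr_ge0 => e _; exact: sqr_ge0. Qed.

Lemma dip_ind f v : dip (fun u => (u == v)%:R) f = lap f v.
Proof. by apply: eq_bigr => e _; ring. Qed.

Lemma energy_ind v : energy E (fun u => (u == v)%:R) <= (size E)%:R :> R.
Proof.
rewrite -sum1_size natr_sum; apply: ler_sum => e _.
by case: (e.1 == v) (e.2 == v) => -[]; rewrite ?subrr ?expr0n ?ler01// ?subr0 ?sub0r ?sqrrN ?expr1n.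
Qed.

Lemma lap_le g v : (forall u, 0 <= g u) -> lap g v <= 2 * (size E)%:R * g v.
Proof.
move=> g0; rewrite -sum1_size natr_sum mulr_sumr mulr_suml; apply: ler_sum => e _; rewrite mulr1.
have := g0 e.1; have := g0 e.2; have := g0 v.
by case: eqP => [->|_]; case: eqP => [->|_]; rewrite /= -?[true%:R]/(1 : R) -?[false%:R]/(0 : R); lra.
Qed.

Lemma lap_opp g v : lap (fun u => 1 - g u) v = - lap g v.
Proof. by rewrite /lap -sumrN; apply: eq_bigr => e _; ring. Qed.

Lemma lap_ge g v : (forall u, g u <= 1) -> - (2 * (size E)%:R * (1 - g v)) <= lap g v.
Proof.
move=> g1; rewrite -[lap g v]opprK lerN2 -lap_opp; apply: (@lap_le (fun u => 1 - g u) v) => u.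
by rewrite subr_ge0.
Qed.

Lemma dip_lap n f g : (forall e, e \in E -> (e.1 < n)%N /\ (e.2 < n)%N) -> dip f g = \sum_(v < n) f v * lap g v.
Proof.
move=> En; under [RHS]eq_bigr do rewrite mulr_sumr.
rewrite exchange_big /= /dip !big_seq; apply: eq_bigr => e /En[e1 e2].
under eq_bigr do rewrite mulrDr.
rewrite big_split /=.
rewrite (bigD1 (Ordinal e1))//= eqxx mul1r big1 ?addr0; last first.
  by move=> i /negbTE; rewrite -val_eqE /= => ie; rewrite eq_sym ie mul0r mulr0.
rewrite (bigD1 (Ordinal e2))//= eqxx mul1r big1 ?addr0; last first.
  by move=> i /negbTE; rewrite -val_eqE /= => ie; rewrite eq_sym ie mul0r mulr0.
ring.
Qed.

(* A near-minimiser of the energy is almost harmonic off the constrained set,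
   since replacing one value by (almost) the average of its neighbours gains
   [lap ^ 2] up to a constant. *)
Lemma near_min (B Z : set nat) g0 (de : R) : 0 < de -> (forall v, 0 <= g0 v <= 1) ->
  (forall v, B v -> g0 v = 1) -> (forall v, Z v -> g0 v = 0) ->
  exists g, [/\ forall v, 0 <= g v <= 1, forall v, B v -> g v = 1, forall v, Z v -> g v = 0,
    energy E g <= energy E g0 & forall v, ~ B v -> ~ Z v -> `|lap g v| <= de].
Proof.
move=> de0 g01 gB gZ; pose M : R := 2 * (size E)%:R + 1.
have M1 : 1 <= M by rewrite lerDr mulr_ge0.
pose A := [set x | exists g, [/\ forall v, 0 <= g v <= 1, forall v, B v -> g v = 1, forall v, Z v -> g v = 0,
   energy E g <= energy E g0 & x = energy E g]]%classic.
have hA : has_inf A.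
  split; first by exists (energy E g0), g0.
  by exists 0 => _ [g [_ _ _ _ ->]]; exact: energy_ge0.
have [|_ [g [g1 gB' gZ' gE ->]] gi] := @inf_adherent _ A (de ^+ 2 / M) _ hA.
  by rewrite divr_gt0 ?exprn_gt0//; lra.
exists g; split => // v nB nZ.
pose s := - (lap g v / M); pose h u := g u + s * (u == v)%:R.
have hE : energy E h <= energy E g - lap g v ^+ 2 / M.
  rewrite energy_add dipC dip_ind.
  have : s ^+ 2 * energy E (fun u => (u == v)%:R) <= s ^+ 2 * M.
    apply: ler_wpM2l; first exact: sqr_ge0.
    apply: le_trans (energy_ind v) _; rewrite /M; have := ler0n R (size E); lra.
  have -> : s ^+ 2 * M = lap g v ^+ 2 / M by rewrite /s; field; rewrite gt_eqF//; lra.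
  have -> : 2 * s * lap g v = - 2 * (lap g v ^+ 2 / M) by rewrite /s; ring.
  lra.
have hA' : A (energy E h).
  exists h; split => //.
  - move=> u; rewrite /h; case: eqP => [->|_]; last by rewrite mulr0 addr0.
    rewrite mulr1 /s; have /andP[v0 v1] := g1 v.
    have l1 : lap g v / M <= g v.
      rewrite ler_pdivrMr; last lra.
      apply: le_trans (lap_le v (fun u => (andP (g1 u)).1)) _.
      rewrite mulrC ler_wpM2l// /M; lra.
    have l2 : - (1 - g v) <= lap g v / M.
      rewrite ler_pdivlMr; last lra.
      apply: le_trans (lap_ge v (fun u => (andP (g1 u)).2)).
      rewrite mulNr lerN2 mulrC ler_wpM2l ?subr_ge0// /M; lra.
    by move: l1 l2; move: (_ / M) => q; lra.
  - move=> u Bu; rewrite /h; case: eqP Bu => [->|_ /gB' ->] //; by rewrite mulr0 addr0.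
  - move=> u Zu; rewrite /h; case: eqP Zu => [->|_ /gZ' ->] //; by rewrite mulr0 addr0.
  - apply: le_trans hE _; apply: le_trans gE; rewrite gerBl divr_ge0 ?sqr_ge0//; lra.
have := ge_inf hA.2 hA' => hi.
have : lap g v ^+ 2 / M <= de ^+ 2 / M by move: hE hi gi; lra.
rewrite ler_pM2r ?invr_gt0; last lra.
by rewrite -[lap g v ^+ 2]real_normK ?num_real// ler_pXn2r ?nnegrE// ltW.
Qed.

End laplacian.

Section counting.
Variable R : realType.

Lemma count_window (n a b : nat) : (\sum_(j < n) (a <= j < b) <= b - a)%N.
Proof.
rewrite -(big_mkord xpredT (fun j => (a <= j < b)%N : nat)).
elim: n => [|n IH]; first by rewrite big_geq.
have [nb|bn] := leqP b n.
  by rewrite big_nat_recr//= ltnNge nb andbF addn0.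
apply: (@leq_trans (n.+1 - a)); last by apply: leq_sub2r.
elim: n {IH} bn => [|n IH] bn; first by rewrite big_nat1; move: bn; case: a b => [|a] [|b].
rewrite big_nat_recr//=; apply: leq_trans (leq_add (IH (ltnW bn)) (leqnn _)) _.
by case: (leqP a n.+1) => h; rewrite ?bn ?andbT /=; move: h; lia.
Qed.

Lemma sum_window (n a b : nat) (F : nat -> R) : (forall j, 0 <= F j <= 1) ->
  (forall j, (j < n)%N -> F j != 0 -> (a <= j < b)%N) -> \sum_(j < n) F j <= (b - a)%:R.
Proof.
move=> F01 Fz; have F0 j := (andP (F01 j)).1; have F1 j := (andP (F01 j)).2.
apply: (@le_trans _ _ (\sum_(j < n) ((a <= j < b)%N)%:R)).
  apply: ler_sum => j _; have [e|/(Fz _ (ltn_ord j)) ->] := eqVneq (F j) 0; last exact: F1.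
  by rewrite e ler0n.
by rewrite -natr_sum ler_nat count_window.
Qed.

Lemma block_count (n i L : nat) : (0 < L)%N -> (i.+1 * L <= n)%N -> L%:R <= \sum_(j < n) (j %/ L == i)%N%:R :> R.
Proof.
move=> L0 iLn; rewrite -(big_mkord xpredT (fun j => (j %/ L == i)%N%:R)).
rewrite (@big_cat_nat _ _ _ (i * L))//=; last by apply: leq_trans iLn; rewrite mulSn leq_addl.
rewrite (@big_cat_nat _ _ _ (i.+1 * L) (i * L))//=; last by rewrite mulSn leq_addl.
rewrite addrCA -[leLHS]addr0 lerD//; last by rewrite addr_ge0// sumr_ge0.
rewrite big_nat (eq_bigr (fun=> 1)) => [|j /andP[h1 h2]].
  by rewrite -big_nat sumr_const_nat mulSn addnK.
rewrite (_ : j %/ L = i)%N ?eqxx//; apply/eqP; rewrite eqn_leq leq_divRL// h1 andbT -ltnS ltn_divLR//.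
Qed.

Lemma ratio_le (x : R) : 0 <= x -> 2 / (x + 2) <= 3 / (x + 3).
Proof.
move=> x0; have x3 : 0 < x + 3 by lra.
have x2 : 0 < x + 2 by lra.
by rewrite ler_pdivrMr// mulrAC ler_pdivlMr//; lra.
Qed.

(** The geometric weights concentrate on s close to T, where 1 / (s + 1) is comparable to 1 / (T +
    1). This bounds the interaction of one scale with all smaller ones. *)
Lemma halves (T : nat) : \sum_(s < T) (2 ^+ s / 2 ^+ T / s.+1%:R) <= 3 / T.+1%:R :> R.
Proof.
elim: T => [|T IH]; first by rewrite big_ord0 divr_ge0.
rewrite big_ord_recr /=.
have -> : \sum_(s < T) 2 ^+ s / 2 ^+ T.+1 / s.+1%:R = (\sum_(s < T) (2 ^+ s / 2 ^+ T / s.+1%:R)) / 2 :> R.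
  rewrite mulr_suml; apply: eq_bigr => s _; rewrite exprS; field.
  by rewrite nat1r pnatr_eq0 expf_neq0//= pnatr_eq0.
have -> : 2 ^+ T / 2 ^+ T.+1 / T.+1%:R = (T.+1%:R)^-1 / 2 :> R.
  by rewrite exprS; field; rewrite nat1r pnatr_eq0 expf_neq0//= pnatr_eq0.
case: T IH => [_|T IH]; first by rewrite big_ord0 invr1; lra.
have h := ratio_le (ler0n R T).
have T2 : T.+2%:R = T%:R + 2 :> R by rewrite -addn2 natrD.
have T3 : T.+3%:R = T%:R + 3 :> R by rewrite -addn3 natrD.
move: IH h; rewrite T2 T3; move: (\sum_(_ < _) _) ((T%:R + 2)^-1) (3 / (T%:R + 3)) => u v z; clear T2 T3; lra.
Qed.
End counting.

(** * Averaging the potentials over scales *)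

Section comb.
Variables (R : realType) (c : code) (w S : nat) (kap : nat -> R) (N : nat -> nat) (K0 : R).
Hypotheses (wc : wf c) (w0 : (0 < w)%N) (S0 : (0 < S)%N) (kap0 : forall t, 0 <= kap t)
  (kapK : forall t, kap t <= K0 * t.+1%:R).
Local Notation P := (per c).
Local Notation E := (ees c).

Definition inr t i := ((w <= i) && (i.+1 * 2 ^ t + 2 * (w * 2 ^ t) <= P))%N.
Definition okG t i := inr t i && `[< gam (2 ^ t) (kap t) (N t) c (i * 2 ^ t) (w * 2 ^ t).-1 (2 * (w * 2 ^ t)) >].

(** Tolerance in the near-harmonicity: small enough to be added up over S scales. *)
Let de : R := S%:R^-1.
Let de0 : 0 < de. Proof. by rewrite invr_gt0 ltr0n. Qed.
Let de1 : de <= 1. Proof. by rewrite invf_le1 ?ltr0n// ler1n. Qed.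
Let K00 : 0 <= K0.
Proof. by have := le_trans (kap0 0) (kapK 0); rewrite mulr1. Qed.

Lemma edge_lt e : e \in E -> (e.1 < vn c)%N /\ (e.2 < vn c)%N.
Proof. exact: ees_lt. Qed.

Definition blk t (i j : nat) : R := (j %/ 2 ^ t == i)%N%:R.

(** When the block i fails at scale t, the zero function is allowed, so that every pair (t, i) has a
    potential. By [poD], pairing with a function valued in [0, 1] sees at most the charge on the
    block, up to the tolerance. *)
Record potential (t i : nat) (g : nat -> R) : Prop := Potential {
  po01 : forall v, 0 <= g v <= 1;
  po1 : okG t i -> forall j, (j <= P)%N -> (j %/ 2 ^ t)%N = i -> g j = 1;
  po0 : forall v, (v <= P)%N -> g v != 0 -> (i * 2 ^ t < v + w * 2 ^ t)%N /\ (v < i.+1 * 2 ^ t + 2 * (w * 2 ^ t))%N;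
  poE : energy E g <= kap t;
  poN : (count (fun v => g v != 0%R) (iota 0 (vn c)) <= N t)%N;
  poL : forall v, (v %/ 2 ^ t)%N = i -> 0 <= (okG t i)%:R * lap E g v;
  poD : forall phi, (forall v, 0 <= phi v <= 1) -> dip E phi g <=
     \sum_(v < P.+1) blk t i v * phi v * ((okG t i)%:R * lap E g v) + de;
  poS : \sum_(v < P.+1) blk t i v * ((okG t i)%:R * lap E g v) <= kap t + de }.

(** A near-minimiser has nonnegative Laplacian on the block, where it is maximal, nonpositive
    Laplacian where it is forced to vanish, and a negligible one elsewhere; summation by parts
    ([dip_lap]) then gives [poD] and, with the potential itself as test function, [poS]. *)
Lemma potential_ex t i : exists g, potential t i g.
Proof.
have L0 : (0 < 2 ^ t)%N by rewrite expn_gt0.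
have [|] := boolP (okG t i); last first.
  move=> /negbTE nG; exists (fun=> 0); split; rewrite ?nG //.
  - by move=> v; rewrite lexx ler01.
  - by move=> v; rewrite eqxx.
  - by rewrite /energy big1// => e _; rewrite subrr expr0n.
  - by rewrite (eq_count (a2 := pred0)) ?count_pred0// => v; rewrite /= eqxx.
  - by move=> v _; rewrite mul0r.
  - move=> phi _; rewrite /dip big1 ?addr_ge0 ?(ltW de0)//; last by move=> e _; rewrite subrr mulr0.
    by apply: sumr_ge0 => v _; rewrite mul0r mulr0.
  - rewrite big1 ?addr_ge0 ?(ltW de0)// => v _; by rewrite mul0r mulr0.
move=> G; have := G; rewrite /okG => /andP[/andP[wi iP] /asboolP[g0 [g01 gB gZ gE gN]]].
have [|g [h01 hB hZ hE hl]] := @near_min R E [set v | BW (i * 2 ^ t) (2 ^ t) v]%classic [set v | g0 v = 0]%classic g0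
    (de / (vn c).+1%:R) _ g01 gB (fun v h => h).
  by rewrite divr_gt0.
have BWE v : BW (i * 2 ^ t) (2 ^ t) v = (v %/ 2 ^ t == i)%N.
  by rewrite /BW -mulSnr -leq_divRL// -ltn_divLR// ltnS -eqn_leq eq_sym.
have BP v : (v %/ 2 ^ t == i)%N -> (v <= P)%N.
  by rewrite -BWE /BW => /andP[_ h]; move: h iP; rewrite mulSn; clear; lia.
have lapB v : BW (i * 2 ^ t) (2 ^ t) v -> 0 <= lap E g v.
  move=> Bv; have := lap_ge E v (fun u => (andP (h01 u)).2); rewrite hB// subrr mulr0 oppr0.
  by [].
have lapZ v : g0 v = 0 -> lap E g v <= 0.
  move=> Zv; have := lap_le E v (fun u => (andP (h01 u)).1); rewrite hZ// mulr0.
  by [].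
have main phi : (forall v, 0 <= phi v <= 1) -> `|dip E phi g - \sum_(v < P.+1) blk t i v * phi v * lap E g v
      - \sum_(v < vn c) (g0 v == 0)%:R * phi v * lap E g v| <= de.
  move=> p01; rewrite (dip_lap _ _ edge_lt).
  have -> : \sum_(v < P.+1) blk t i v * phi v * lap E g v = \sum_(v < vn c) blk t i v * phi v * lap E g v.
    rewrite /vn -!(big_mkord xpredT (fun v => blk t i v * phi v * lap E g v)).
    rewrite [RHS](@big_cat_nat _ _ _ P.+1)//= ?leq_addr// [X in _ + X]big_nat [X in _ + X]big1 ?addr0// => v /andP[Pv _].
    rewrite /blk; case: eqP => [/eqP/BP|]; last by rewrite !mul0r.
    by rewrite leqNgt Pv.
  rewrite -!sumrB; apply: le_trans (ler_norm_sum _ _ _) _.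
  apply: (@le_trans _ _ (\sum_(v < vn c) de / (vn c).+1%:R)); last first.
    rewrite sumr_const card_ord -[_ *+ vn c]mulr_natr mulrAC ler_pdivrMr ?ltr0n// ler_pM2l// ler_nat; exact: leqnSn.
  apply: ler_sum => v _; have dpos : 0 <= de / (vn c).+1%:R by rewrite divr_ge0// ltW.
  have [Bv|nB] := boolP (v %/ 2 ^ t == i)%N.
    have /negbTE -> : g0 v != 0 by rewrite gB ?BWE// oner_eq0.
    by rewrite /blk Bv mul1r !mul0r subr0 subrr normr0.
  have [Zv|nZ] := eqVneq (g0 v) 0.
    by rewrite /blk (negbTE nB) mul1r !mul0r subr0 subrr normr0.
  rewrite /blk (negbTE nB) !mul0r !subr0 normrM.
  have /andP[p0 p1] := p01 v; rewrite (ger0_norm p0).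
  apply: le_trans (_ : 1 * `|lap E g v| <= _); first by rewrite ler_wpM2r.
  rewrite mul1r; apply: hl => /=; [rewrite BWE; exact/negP|exact/eqP].
have hBt : (okG t i)%:R = 1 :> R by rewrite G.
exists g; split => //; rewrite ?hBt.
- by move=> _ j jP /eqP ji; apply: hB; rewrite /= BWE.
- move=> v vP gv; suff : ~~ ZW P (i * 2 ^ t) (2 ^ t) (w * 2 ^ t).-1 (2 * (w * 2 ^ t)) v.
    rewrite /ZW vP /= negb_or -!leqNgt -ltnNge => /andP[h1 h2]; split; last by rewrite mulSnr.
    have wL : (0 < w * 2 ^ t)%N by rewrite muln_gt0 w0.
    have : (w * 2 ^ t <= i * 2 ^ t)%N by rewrite leq_mul2r wi orbT.
    by move: h1 wL; clear; lia.
  by apply: contraNN gv => /gZ /hZ ->.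
- exact: le_trans gE.
- apply: leq_trans gN; apply: sub_count => v /=; apply: contraNneq => /eqP h; by rewrite hZ//=; exact/eqP.
- by move=> v /eqP vi; rewrite mul1r lapB ?BWE.
- move=> phi p01; have := le_trans (ler_norm _) (main _ p01).
  have : \sum_(v < vn c) (g0 v == 0)%:R * phi v * lap E g v <= 0.
    apply: sumr_le0 => v _; case: eqP => [/lapZ h|_]; last by rewrite !mul0r.
    by rewrite mul1r; have /andP[p0 _] := p01 v; rewrite mulr_ge0_le0.
  have -> : \sum_(v < P.+1) blk t i v * phi v * (1 * lap E g v) = \sum_(v < P.+1) blk t i v * phi v * lap E g v.
    by apply: eq_bigr => v _; rewrite mul1r.
  move: (dip _ _ _) (\sum_(v < vn c) _) (\sum_(v < P.+1) _) => x y z; lra.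
- have := main _ h01; rewrite ler_norml => /andP[h _].
  have h2 : \sum_(v < vn c) (g0 v == 0)%:R * g v * lap E g v = 0.
    by apply: big1 => v _; case: eqP => [/hZ ->|_]; rewrite ?mulr0 !mul0r.
  have h3 : \sum_(v < P.+1) blk t i v * (1 * lap E g v) = \sum_(v < P.+1) blk t i v * g v * lap E g v.
    apply: eq_bigr => v _; rewrite mul1r /blk; case: eqP => [/eqP h'|_]; last by rewrite !mul0r.
    by rewrite hB/= ?BWE// mulr1.
  rewrite h3; move: h; rewrite h2 -energyE => h; have := le_trans hE gE.
  move: h; move: (energy _ _) (\sum_(v < P.+1) _) => x y; lra.
Qed.

Variable g : nat -> nat -> nat -> R.
Hypothesis gP : forall t i, potential t i (g t i).

Definition gat t j := g t (j %/ 2 ^ t)%N.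
Definition ex t v := (okG t (v %/ 2 ^ t))%:R * lap E (gat t v) v.

Lemma ex_ge0 t v : 0 <= ex t v.
Proof. exact: (poL (gP t (v %/ 2 ^ t)%N)). Qed.

Lemma blk_ex t i v : blk t i v * ex t v = blk t i v * ((okG t i)%:R * lap E (g t i) v).
Proof. by rewrite /blk /ex /gat; case: eqP => [->//|_]; rewrite !mul0r. Qed.

(** The charge of a block is about its energy, at most kap t, and there are about P / 2^t blocks;
    counting each vertex of the boundary with its whole block turns this into the factor 2^t on the
    left. *)
Lemma ex_total t : 2 ^+ t * \sum_(v < P.+1) ex t v <= P.+1%:R * (kap t + de).
Proof.
rewrite mulr_sumr; apply: (@le_trans _ _ (\sum_(v < P.+1) \sum_(j < P.+1) blk t (j %/ 2 ^ t)%N v * ex t v)).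
  apply: ler_sum => v _; rewrite -mulr_suml; have [ok|nok] := boolP (okG t (v %/ 2 ^ t)); last first.
    by rewrite /ex (negbTE nok) mul0r !mulr0.
  apply: ler_wpM2r; first exact: ex_ge0.
  have -> : \sum_(j < P.+1) blk t (j %/ 2 ^ t)%N v = \sum_(j < P.+1) (j %/ 2 ^ t == v %/ 2 ^ t)%N%:R :> R.
    by apply: eq_bigr => j _; rewrite /blk eq_sym.
  rewrite -natrX; apply: block_count; first by rewrite expn_gt0.
  by case/andP: ok => /andP[_ h] _; move: h; clear; lia.
rewrite exchange_big /=; apply: (@le_trans _ _ (\sum_(j < P.+1) (kap t + de))); last first.
  by rewrite sumr_const card_ord -[_ *+ P.+1]mulr_natl.
apply: ler_sum => j _; under eq_bigr do rewrite blk_ex.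
exact: poS (gP t _).
Qed.

Lemma window s v : (v <= P)%N -> \sum_(j < P.+1) gat s j v <= ((3 * w + 2) * 2 ^ s)%:R.
Proof.
move=> vP; apply: le_trans (sum_window (F := fun j => gat s j v) (a := v.+1 - (2 * w + 1) * 2 ^ s) (b := v + (w + 1) * 2 ^ s) _ _) _.
- by move=> j; exact: po01 (gP _ _) _.
- move=> j jP /(po0 (gP s _) vP)[h1 h2].
  have L0 : (0 < 2 ^ s)%N by rewrite expn_gt0.
  have h3 := leq_divM j (2 ^ s); have h4 := ltn_ceil j L0.
  have e1 : ((2 * w + 1) * 2 ^ s = 2 * (w * 2 ^ s) + 2 ^ s)%N by rewrite mulnDl mul1n mulnA.
  have e2 : ((w + 1) * 2 ^ s = w * 2 ^ s + 2 ^ s)%N by rewrite mulnDl mul1n.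
  move: h1 h2 h3 h4; rewrite e1 e2 mulSn.
  move: (j %/ 2 ^ s * 2 ^ s)%N (w * 2 ^ s)%N (2 ^ s)%N => p q z; clear; lia.
- have e1 : ((2 * w + 1) * 2 ^ s = 2 * (w * 2 ^ s) + 2 ^ s)%N by rewrite mulnDl mul1n mulnA.
  have e2 : ((w + 1) * 2 ^ s = w * 2 ^ s + 2 ^ s)%N by rewrite mulnDl mul1n.
  have e3 : ((3 * w + 2) * 2 ^ s = 3 * (w * 2 ^ s) + 2 * 2 ^ s)%N by rewrite mulnDl mulnA.
  rewrite ler_nat e1 e2 e3; move: (w * 2 ^ s)%N (2 ^ s)%N => q z; clear; lia.
Qed.

(** Summed over j, the potentials of scale s at a given boundary vertex contribute O(2^s), the
    number of positions whose window contains it; the charge of scale t has density O(kap t / 2^t).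
    For s < t the interaction thus decays like 2^(s - t). *)
Lemma cross s t : \sum_(j < P.+1) dip E (gat s j) (gat t j) <=
  P.+1%:R * ((3 * w + 2)%:R * (2 ^+ s / 2 ^+ t) * (kap t + de) + de).
Proof.
apply: (@le_trans _ _ (\sum_(j < P.+1) (\sum_(v < P.+1) blk t (j %/ 2 ^ t)%N v * gat s j v * ex t v + de))).
  apply: ler_sum => j _; apply: le_trans (poD (gP t _) (po01 (gP s _))) _.
  rewrite lerD2r; apply: ler_sum => v _.
  by rewrite [X in X <= _]mulrAC [leRHS]mulrAC blk_ex.
rewrite big_split /= sumr_const card_ord -[de *+ _]mulr_natl mulrDr lerD2r exchange_big /=.
apply: (@le_trans _ _ (\sum_(v < P.+1) ((3 * w + 2) * 2 ^ s)%:R * ex t v)).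
  apply: ler_sum => v _; rewrite -mulr_suml; apply: ler_wpM2r; first exact: ex_ge0.
  apply: le_trans (window s (ltn_ord v)); apply: ler_sum => j _.
  have /andP[h _] := po01 (gP s (j %/ 2 ^ s)%N) v.
  by rewrite /blk; case: eqP; rewrite ?mul1r ?mul0r.
have t0 : 0 < 2 ^+ t :> R by rewrite exprn_gt0.
rewrite -mulr_sumr natrM natrX.
have -> : P.+1%:R * ((3 * w + 2)%:R * (2 ^+ s / 2 ^+ t) * (kap t + de)) =
  ((3 * w + 2)%:R * 2 ^+ s / 2 ^+ t) * (P.+1%:R * (kap t + de)) by ring.
apply: le_trans (ler_wpM2l _ (ex_total t)); last by rewrite divr_ge0 ?mulr_ge0 ?exprn_ge0.
by rewrite mulrA mulfVK// gt_eqF.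
Qed.

Definition Hs T : R := \sum_(t < T) t.+1%:R^-1.
Definition fT T j v := \sum_(t < T) t.+1%:R^-1 * gat t j v.
Definition K1 : R := 6 * (3 * w + 2)%:R * (K0 + 1) + 2 + K0.

(** Adding scale T with weight 1 / (T + 1) adds its own energy, O(T + 1) divided by (T + 1)^2, and
    cross terms that [halves] bounds by O(1 / (T + 1)) as well. The mean energy grows like the
    harmonic sum [Hs T]; since values at good vertices grow like [Hs T] too, normalising them to 1
    leaves an energy of order 1 / [Hs T]. *)
Lemma energy_fT T : (T <= S)%N -> \sum_(j < P.+1) energy E (fT T j) <= P.+1%:R * (K1 * Hs T).
Proof.
elim: T => [_|T IH TS].
  rewrite /Hs big_ord0 !mulr0 big1// => j _; rewrite /energy big1// => e _.
  by rewrite /fT !big_ord0 subrr expr0n.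
have {}IH := IH (ltnW TS).
have T1 : 1 <= T.+1%:R :> R by rewrite ler1n.
have hE j : energy E (fT T.+1 j) <= energy E (fT T j) + 2 / T.+1%:R * \sum_(s < T) s.+1%:R^-1 * dip E (gat s j) (gat T j) + K0 / T.+1%:R.
  have -> : energy E (fT T.+1 j) = energy E (fun v => fT T j v + T.+1%:R^-1 * gat T j v).
    by rewrite /energy; apply: eq_bigr => e _; rewrite /fT !big_ord_recr.
  rewrite energy_add /fT dip_sum; under eq_bigr do rewrite dipZ.
  rewrite lerD2l.
  have := poE (gP T (j %/ 2 ^ T)%N); rewrite -/(gat T j) => h1.
  have h2 := le_trans h1 (kapK T).
  have := ler_wpM2l (sqr_ge0 (T.+1%:R^-1)) h2.
  by have -> : T.+1%:R^-1 ^+ 2 * (K0 * T.+1%:R) = K0 / T.+1%:R by field; rewrite nat1r pnatr_eq0.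
apply: (@le_trans _ _ (\sum_(j < P.+1) (energy E (fT T j) + 2 / T.+1%:R * \sum_(s < T) s.+1%:R^-1 * dip E (gat s j) (gat T j) + K0 / T.+1%:R))).
  by apply: ler_sum => j _; exact: hE.
rewrite !big_split /= sumr_const card_ord -[_ *+ P.+1]mulr_natl -mulr_sumr [X in _ + _ * X + _]exchange_big /=.
under [X in _ + _ * X + _]eq_bigr do rewrite -mulr_sumr.
have P0 : 0 <= P.+1%:R :> R by [].
have kd : kap T + de <= (K0 + 1) * T.+1%:R by have := kapK T; have := de1; lra.
have h1 : \sum_(s < T) s.+1%:R^-1 * \sum_(j < P.+1) dip E (gat s j) (gat T j) <=
   P.+1%:R * (3 * (3 * w + 2)%:R * (K0 + 1) + 1).
  apply: (@le_trans _ _ (\sum_(s < T) (P.+1%:R * ((3 * w + 2)%:R * ((K0 + 1) * T.+1%:R) * (2 ^+ s / 2 ^+ T / s.+1%:R)) + P.+1%:R * de))).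
    apply: ler_sum => s _; apply: le_trans (ler_wpM2l _ (cross s T)) _; first by rewrite invr_ge0.
    have s1 : s.+1%:R^-1 <= 1 :> R by rewrite invf_le1 ?ltr0n// ler1n.
    have s0 : 0 <= s.+1%:R^-1 :> R by rewrite invr_ge0.
    have q0 : 0 <= (3 * w + 2)%:R * (2 ^+ s / 2 ^+ T) :> R by rewrite mulr_ge0 ?divr_ge0 ?exprn_ge0.
    rewrite -mulrDr mulrCA ler_wpM2l// mulrDr; apply: lerD; last by rewrite ler_piMl// ltW.
    have := ler_wpM2l (mulr_ge0 s0 q0) kd; move: q0.
    move: (2 ^+ s / 2 ^+ T) (s.+1%:R^-1) ((3 * w + 2)%:R) => a b d _.
    move: (kap T + de) (K0 + 1) (T.+1%:R) => x y z h; lra.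
  rewrite big_split /= -!mulr_sumr sumr_const card_ord -[_ *+ T]mulr_natl -mulrDr ler_wpM2l//.
  apply: lerD.
    have := @halves R T; rewrite ler_pdivlMr ?ltr0n// => h.
    have q : 0 <= (3 * w + 2)%:R * (K0 + 1) :> R by rewrite mulr_ge0// addr_ge0.
    have := ler_wpM2l q h; move: (\sum_(_ < _) _) ((3 * w + 2)%:R) (T.+1%:R) => a b d; lra.
  by rewrite mulrC ler_pdivrMl ?ltr0n// mulr1 ler_nat ltnW.
have -> : Hs T.+1 = Hs T + T.+1%:R^-1 by rewrite /Hs big_ord_recr.
have i0 : 0 <= 2 / T.+1%:R :> R by rewrite divr_ge0.
have := ler_wpM2l i0 h1; move: IH; rewrite /K1.
move: (\sum_(i < P.+1) energy E (fT T i)) (\sum_(i < T) i.+1%:R^-1 * \sum_(j < P.+1) dip E (gat i j) (gat T j)).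
move: (T.+1%:R^-1 : R) (Hs T) ((3 * w + 2)%:R : R) (P.+1%:R : R) => a b d e f h; lra.
Qed.

End comb.

(** * Most boundary vertices have small capacity *)

Section good.
Variable R : realType.

Lemma energy_min E (g : nat -> R) : energy E (fun v => Order.min 1 (g v)) <= energy E g.
Proof.
apply: ler_sum => e _; rewrite -[leLHS]real_normK ?num_real// -[leRHS]real_normK ?num_real//.
rewrite ler_pXn2r ?nnegrE//; move: (g e.1) (g e.2) => a b.
by rewrite !ler_norml /Order.min; case: ifP; case: ifP => h1 h2; rewrite ?ler_norml; case: (lerP 0 (a - b)) => h; rewrite ?(ger0_norm h) ?(ltr0_norm h); lra.
Qed.

(** The capacity of j relative to the outside of some set of at most N vertices is at most dl, that
    is, the resistance is at least 1 / dl. *)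
Definition goodv c j (dl : R) N := gset c (pred1 j) pred0 dl N.

Section one.
Variables (c : code) (w S : nat) (kap : nat -> R) (N : nat -> nat) (K0 dl : R).
Hypotheses (wc : wf c) (w0 : (0 < w)%N) (S0 : (0 < S)%N) (kap0 : forall t, 0 <= kap t)
  (kapK : forall t, kap t <= K0 * t.+1%:R) (dl0 : 0 < dl).
Local Notation P := (per c).
Local Notation ok := (okG c w kap N).
Let H := Hs R S.
Let H0 : 0 < H.
Proof.
rewrite /H /Hs; case: S S0 => // n _; rewrite big_ord_recl ltr_pwDl ?invr_gt0//.
by apply: sumr_ge0 => t _; rewrite invr_ge0.
Qed.

(** If the failing scales at j weigh at most H / 2, then the combined potential [f j] is at least H
    / 2 at j; if moreover its energy is at most dl H^2 / 4, truncating 2 / H times [f j] at 1 shows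
    that j is good. The two terms are Markov bounds for the two ways this may fail. *)
Lemma sum_notgood : \sum_(j < P.+1) (~~ `[< goodv c j dl (\sum_(t < S) N t)%N >])%:R <=
  2 / H * \sum_(j < P.+1) \sum_(t < S) t.+1%:R^-1 * (~~ ok t (j %/ 2 ^ t)%N)%:R + P.+1%:R * (4 * K1 w K0 / (dl * H)).
Proof.
have /choice[g' gP'] : forall ti : nat * nat, exists g, potential c w S kap N ti.1 ti.2 g.
  by move=> ti; apply: potential_ex.
pose g t i := g' (t, i); have gP t i : potential c w S kap N t i (g t i) by exact: (gP' (t, i)).
have := energy_fT S0 kap0 kapK gP (leqnn S).
pose f j := fT (fun t i => g' (t, i)) S j; rewrite -/H => hE.
have pt j : (j <= P)%N -> (~~ `[< goodv c j dl (\sum_(t < S) N t)%N >])%:R <=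
   2 / H * \sum_(t < S) t.+1%:R^-1 * (~~ ok t (j %/ 2 ^ t)%N)%:R + 4 / (dl * H ^+ 2) * energy (ees c) (f j).
  move=> jP; set X := \sum_(t < S) (_ * _); set Y := energy _ _.
  have X0 : 0 <= X by apply: sumr_ge0 => t _; rewrite mulr_ge0 ?invr_ge0.
  have Y0 : 0 <= Y by exact: energy_ge0.
  have dH : 0 < dl * H ^+ 2 by rewrite mulr_gt0 ?exprn_gt0.
  have X0' : 0 <= 2 / H * X by rewrite mulr_ge0 ?divr_ge0// ltW.
  have Y0' : 0 <= 4 / (dl * H ^+ 2) * Y by rewrite mulr_ge0 ?divr_ge0// ltW.
  case: asboolP => /= ng; first by rewrite addr_ge0.
  have [XH|XH] := ltP (H / 2) X.
    apply: (@le_trans _ _ (2 / H * X)); last by rewrite lerDl.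
    by rewrite mulrAC ler_pdivlMr// mul1r; lra.
  have [YH|YH] := ltP (dl * H ^+ 2 / 4) Y.
    apply: (@le_trans _ _ (4 / (dl * H ^+ 2) * Y)); last by rewrite lerDr.
    by rewrite mulrAC ler_pdivlMr// mul1r; lra.
  exfalso; apply: ng.
  have f0 v : 0 <= f j v.
    by apply: sumr_ge0 => t _; rewrite mulr_ge0 ?invr_ge0// (andP (po01 (gP _ _) v)).1.
  have fj : H / 2 <= f j j.
    have : H - X <= f j j.
      rewrite /H /Hs /X /f /fT -sumrB; apply: ler_sum => t _.
      have t0 : 0 <= t.+1%:R^-1 :> R by rewrite invr_ge0.
      case: (boolP (ok t (j %/ 2 ^ t)%N)) => o /=; last by rewrite mulr1 subrr mulr_ge0// (andP (po01 (gP _ _) j)).1.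
      have e1 : g' (nat_of_ord t, (j %/ 2 ^ t)%N) j = 1 := po1 (gP t (j %/ 2 ^ t)%N) o jP erefl.
      by rewrite /gat e1 mulr0 subr0 mulr1.
    lra.
  exists (fun v => Order.min 1 (2 / H * f j v)); split.
  - move=> v; rewrite ge_min lexx /= andbT le_min ler01 mulr_ge0 ?divr_ge0// ltW//.
  - move=> v /eqP ->; apply/min_idPl; rewrite mulrAC ler_pdivlMr// mul1r; lra.
  - by [].
  - apply: le_trans (energy_min _ _) _; rewrite energyZ.
    apply: le_trans (ler_wpM2l (sqr_ge0 _) YH) _.
    by rewrite le_eqVlt; apply/orP; left; apply/eqP; field; rewrite gt_eqF.
  - apply: (@leq_trans (\sum_(t < S) count (fun v => gat (fun t i => g' (t, i)) t j v != 0%R) (iota 0 (vn c)))%N); last first.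
      by apply: leq_sum => t _; exact: (poN (gP t (j %/ 2 ^ t)%N)).
    move: (iota 0 (vn c)) => r; rewrite -sum1_count big_mkcond /=; under [leqRHS]eq_bigr do rewrite -sum1_count big_mkcond /=.
    rewrite exchange_big /=; apply: leq_sum => v _; case: ifP => // h.
    suff [t tn] : exists t : 'I_S, gat (fun t i => g' (t, i)) t j v != 0 by rewrite (bigD1 t)//= tn.
    apply/existsP; move: h; apply: contraNT; rewrite negb_exists => /forallP z.
    have -> : f j v = 0 by apply: big1 => t _; move: (z t); rewrite negbK => /eqP ->; rewrite mulr0.
    by rewrite mulr0 minEle ler10.
apply: le_trans (ler_sum _ (fun (j : 'I_P.+1) _ => pt j (ltn_ord j))) _.
rewrite big_split /= -!mulr_sumr lerD2l.
apply: le_trans (ler_wpM2l _ hE) _; first by rewrite divr_ge0 ?mulr_ge0 ?exprn_ge0// ltW.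
by rewrite le_eqVlt; apply/orP; left; apply/eqP; rewrite -/H; field; rewrite !gt_eqF.
Qed.

End one.

Lemma harmonic_large (M : R) : exists S, (0 < S)%N /\ M <= Hs R S.
Proof.
have h k : k%:R / 2 <= Hs R (2 ^ k).
  elim: k => [|k IH]; first by rewrite mul0r sumr_ge0// => t _; rewrite invr_ge0.
  rewrite expnS mul2n -addnn /Hs big_split_ord /= -natr1 mulrDl lerD//.
  apply: (@le_trans _ _ (\sum_(t < 2 ^ k) (2 ^ k.+1)%:R^-1)).
    by rewrite sumr_const card_ord -[_ *+ (2 ^ k)]mulr_natr expnS natrM invfM -mulrA mulVf ?mulr1 ?mul1r// pnatr_eq0 -lt0n expn_gt0.
  apply: ler_sum => t _; rewrite lef_pV2 ?posrE ?ltr0n ?expn_gt0// ler_nat expnS mul2n -addnn -addnS leq_add2l.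
  exact: ltn_ord.
exists (2 ^ (Num.truncn (2 * M)).+1)%N; rewrite expn_gt0; split => //.
by apply: le_trans (h _); rewrite ler_pdivlMr// mulrC ltW// truncnS_gt.
Qed.

Lemma goodv_rot c u dl N : wf c -> (u <= per c)%N -> goodv (rotc (per c - u) c) u dl N -> goodv c (per c) dl N.
Proof.
move=> wc uP; have [sg h] := rotcP (per c - u) wc.
have vE : vn (rotc (per c - u) c) = vn c by rewrite /vn (rs_per h) (rs_nin h).
apply: (@gset_transfer _ _ _ sg [::]) => //.
- exact: rs_wf h.
- by rewrite vE; exact: rs_inj h.
- by rewrite vE; exact: rs_lt h.
- move=> g; rewrite [X in X + _]big_nil add0r /energy.
  rewrite (rs_sum h (F := fun u v => (g u - g v) ^+ 2))// => a b.
  by rewrite -sqrrN opprB.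
- move=> i /eqP ->; exists u; split; rewrite ?inE//.
  + by rewrite vE /vn; move: uP; clear; lia.
  + by rewrite (rs_ext h)// subnKC// modn_small.
Qed.

Lemma count_windowR n a b : \sum_(j < n) (a <= j < b)%N%:R <= (b - a)%:R :> R.
Proof. by rewrite -natr_sum ler_nat count_window. Qed.

(** Positions within O(2^S) of the ends of the boundary have no room for a window, but they are a
    negligible fraction once P is large. [gamma_thm] handles the others, and averaging over all P +
    1 re-rootings moves the conclusion to the vertex P, the origin of the root. *)
Theorem good_root (dl eps : R) : 0 < dl -> 0 < eps -> exists N P0, forall P, (P0 <= P)%N ->
  sb (fun c => wt 1 c * (~~ `[< goodv c P dl N >])%:R) P (eps * av R P).
Proof.
move=> dl0 e0; have [|w [D0 [w0 hw]]] := @gamma_thm R (eps / 6); first by rewrite divr_gt0.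
have /choice[N hN] := hw.
pose kap t : R := 4 * (15 * t + D0)%:R; pose K0 : R := (60 + 4 * D0)%:R.
have kap0 t : 0 <= kap t by rewrite /kap mulr_ge0.
have kapK t : kap t <= K0 * t.+1%:R.
  rewrite /kap /K0 -[4]/(4%:R) -!natrM ler_nat; rewrite mulnS mulnDl; move: (4 * D0 * t)%N => z; lia.
have K00 : 0 <= K0 by [].
pose K := K1 w K0; have Kp : 0 < K.
  by rewrite /K /K1 ltr_pwDl// ltr_pwDr// mulr_ge0// ?mulr_ge0// addr_ge0.
have [S [S0 hS]] := harmonic_large (12 * K / (dl * eps)).
pose H := Hs R S; have H0 : 0 < H by apply: lt_le_trans hS; rewrite divr_gt0 ?mulr_gt0.
pose Q := ((3 * w + 2) * 2 ^ S)%N.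
exists (\sum_(t < S) N t)%N, (Num.truncn (6 * Q%:R / eps)).+1 => P hP.
have P0 : (0 < P)%N by exact: leq_trans hP.
have PQ : 2 * Q%:R <= eps / 3 * P.+1%:R.
  have : 6 * Q%:R / eps < P.+1%:R by apply: lt_le_trans (truncnS_gt _) _; rewrite ler_nat; exact: leqW.
  by rewrite ltr_pdivrMr//; lra.
pose F c := wt 1 c * (2 / H * \sum_(j < P.+1) \sum_(t < S) t.+1%:R^-1 * (~~ okG c w kap N t (j %/ 2 ^ t)%N)%:R
   + P.+1%:R * (4 * K / (dl * H))).
have key t j : sb (fun c => wt 1 c * (~~ okG c w kap N t (j %/ 2 ^ t)%N)%:R) P
    ((eps / 6 + (~~ ((w <= j %/ 2 ^ t) && ((j %/ 2 ^ t).+1 * 2 ^ t + 2 * (w * 2 ^ t) <= P)))%N%:R) * av R P).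
  have [/andP[h1 h2]|no] := boolP ((w <= j %/ 2 ^ t) && ((j %/ 2 ^ t).+1 * 2 ^ t + 2 * (w * 2 ^ t) <= P))%N; last first.
    apply: sb_le (mass_le _ P0); last by rewrite ler_peMl ?av_ge0// lerDr divr_ge0// ltW.
    by move=> c _; rewrite ler_piMr ?wt_ge0// lern1 leq_b1.
  rewrite addr0; set i := (j %/ 2 ^ t)%N in h1 h2 *.
  have wi : (w * 2 ^ t <= i * 2 ^ t)%N by rewrite leq_mul2r h1 orbT.
  rewrite mulSn in h2.
  have hb : sb (fun c => bad (2 ^ t) (kap t) (N t) c (i * 2 ^ t) (w * 2 ^ t).-1 (2 * (w * 2 ^ t))) P (eps / 6 * av R P).
    apply: (@sb_bad_rot _ _ _ _ _ (i * 2 ^ t - w * 2 ^ t)%N _ (w * 2 ^ t)%N).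
    - by left; rewrite subnKC.
    - by move: h2; clear; lia.
    - by move: wi; clear; lia.
    - exact: leq_pred.
    - by move: h2; clear; lia.
    - by move: h2 wi; clear; lia.
    - by apply: hN; move: h2 wi; clear; lia.
  apply: sb_le (hb) => // c /andP[wc /eqP pc]; rewrite /bad /nb /okG /inr pc h1 mulSn h2 /=.
  by [].
have cnt t : (t < S)%N -> \sum_(j < P.+1) (~~ ((w <= j %/ 2 ^ t) && ((j %/ 2 ^ t).+1 * 2 ^ t + 2 * (w * 2 ^ t) <= P)))%N%:R <= Q%:R :> R.
  move=> tS; have L0 : (0 < 2 ^ t)%N by rewrite expn_gt0.
  have LS : (2 ^ t <= 2 ^ S)%N by rewrite leq_pexp2l// ltnW.
  have wLS : (w * 2 ^ t <= w * 2 ^ S)%N by rewrite leq_mul2l LS orbT.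
  apply: (@le_trans _ _ (\sum_(j < P.+1) (((0 <= j < w * 2 ^ t)%N)%:R + ((P.+1 - (2 * (w * 2 ^ t) + 2 ^ t) <= j < P.+1)%N)%:R))).
    apply: ler_sum => j _; rewrite -natrD ler_nat.
    have h4 := leq_divM j (2 ^ t); have h3 : (w <= j %/ 2 ^ t)%N = (w * 2 ^ t <= j)%N by rewrite leq_divRL.
    have jP := ltn_ord j; rewrite h3 mulSn {h3}; move: h4 jP.
    move: (j %/ 2 ^ t * 2 ^ t)%N => p; move: (w * 2 ^ t)%N => q; move: (2 ^ t)%N => z h4 jP.
    case: (leqP q j) => h5 /=; last by rewrite leq_addr.
    case: (leqP (z + p + 2 * q) P) => h6 //=.
    have -> : (P.+1 - (2 * q + z) <= j)%N by move: h4 h6; clear; lia.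
    by rewrite jP.
  rewrite big_split; apply: le_trans (lerD (count_windowR _ _ _) (count_windowR _ _ _)) _; rewrite -natrD ler_nat.
  have e3 : ((3 * w + 2) * 2 ^ S = 3 * (w * 2 ^ S) + 2 * 2 ^ S)%N by rewrite mulnDl mulnA.
  by rewrite /Q e3; move: LS wLS; clear; lia.
have hF : sb F P (P.+1%:R * (eps * av R P)).
  have a0 (t : nat) : 0 <= t.+1%:R^-1 :> R by rewrite invr_ge0.
  have hs := sb_sum (index_enum 'I_P.+1) (fun j => sb_sum (index_enum 'I_S) (fun t => sbZ (a0 t) (key t j))).
  have q0 : 0 <= P.+1%:R * (4 * K / (dl * H)) by rewrite mulr_ge0// divr_ge0 ?mulr_ge0// ltW.
  have i0 : 0 <= 2 / H by rewrite divr_ge0// ltW.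
  have := sbD (sbZ i0 hs) (sbZ q0 (mass_le R P0)); apply: sb_le => [c _|].
    rewrite /F mulrDr [wt 1 c * (P.+1%:R * _)]mulrC lerD2r mulrCA ler_wpM2l// mulr_sumr le_eqVlt; apply/orP; left; apply/eqP.
    by apply: eq_bigr => j _; rewrite mulr_sumr; apply: eq_bigr => t _; rewrite mulrCA.
  have h1 : P.+1%:R * (4 * K / (dl * H)) * av R P <= P.+1%:R * (eps / 3) * av R P.
    rewrite ler_wpM2r ?av_ge0// ler_wpM2l// ler_pdivrMr ?mulr_gt0//.
    by move: hS; rewrite -/H ler_pdivrMr ?mulr_gt0//; lra.
  have h2 : \sum_(j < P.+1) \sum_(t < S) t.+1%:R^-1 * ((eps / 6 + (~~ ((w <= j %/ 2 ^ t) &&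
      ((j %/ 2 ^ t).+1 * 2 ^ t + 2 * (w * 2 ^ t) <= P)))%N%:R) * av R P) <= H * ((P.+1%:R * (eps / 6) + Q%:R) * av R P).
    rewrite exchange_big /= /H /Hs mulr_suml; apply: ler_sum => t _.
    rewrite -mulr_sumr ler_wpM2l// -mulr_suml ler_wpM2r ?av_ge0// big_split /= sumr_const card_ord -[_ *+ P.+1]mulr_natl.
    by rewrite lerD2l cnt.
  have h3 := ler_wpM2l i0 h2; apply: le_trans (lerD h3 h1) _.
  have -> : 2 / H * (H * ((P.+1%:R * (eps / 6) + Q%:R) * av R P)) = 2 * ((P.+1%:R * (eps / 6) + Q%:R) * av R P).
    by field; rewrite gt_eqF.
  have := ler_wpM2r (av_ge0 R P) PQ; move: (Q%:R : R) (av R P) (P.+1%:R : R) => u v z; lra.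
have := @sb_average R P P.+1 (fun u => P - u)%N _ F (fun u c => wt 1 c * (~~ `[< goodv c u dl (\sum_(t < S) N t)%N >])%:R)
  _ P0 isT _ _ _ hF; move=> /(_ (fun c => wt 1 c * (~~ `[< goodv c P dl (\sum_(t < S) N t)%N >])%:R)) h.
rewrite mulrAC mulfV ?pnatr_eq0// mul1r in h; apply: h.
- by move=> u c; rewrite mulr_ge0 ?wt_ge0.
- move=> u c uP /andP[wc /eqP pc].
  have [sg hr] := rotcP (P - u) wc.
  rewrite (wt_nin R (rs_per hr) (rs_nin hr) (rs_wf hr) wc) ler_wpM2l ?wt_ge0// ler_nat.
  case: asboolP => //= h1; case: asboolP => //= h2; case: h1.
  by rewrite -pc; apply: (@goodv_rot c u); rewrite ?pc.
- move=> c /andP[wc /eqP pc]; rewrite -mulr_sumr /F ler_wpM2l ?wt_ge0//.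
  have := sum_notgood N wc w0 S0 kap0 kapK dl0; rewrite pc; exact.
Qed.
End good.

End Potentials.

(** * Coded maps as rooted maps, and conversely *)

Module PlaneMaps.
Import structures.
Import all_boot all_order all_algebra all_fingroup.
Import finmap zify.
Import all_classical all_reals all_analysis.
Import Defs Codes Euler CodeMaps Peeling Labels Rotation.
Local Open Scope classical_set_scope.
Local Open Scope card_scope.

Lemma card_seq (T : choiceType) (s : seq T) : uniq s -> [set` s] #= `I_(size s).
Proof.
move=> us; have -> : [set` s] = [set` [fset x in s]%fset] by apply/seteqP; split=> x /=; rewrite inE.
by apply/card_eq_fsetP; rewrite card_fseq undup_id.
Qed.

Lemma card_mem (D : finType) (A : {set D}) (T : Type) (g : D -> T) :
  injective g -> [set g x | x in [set x | x \in A]] #= `I_#|A|.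
Proof.
move=> gi; apply: card_eq_trans (inj_card_eq _) _; first by move=> x y _ _; exact: gi.
have -> : [set x | x \in A] = [set` enum A] by apply/seteqP; split=> x /=; rewrite mem_enum.
by rewrite cardE; apply: card_seq; exact: enum_uniq.
Qed.

Lemma set_iota a n k : [set` iota a n] k <-> (a <= k < a + n)%N.
Proof. by rewrite /= mem_iota. Qed.

Section orbits.
Variables (T : Type) (D : finType) (g : D -> T) (f : T -> T) (s : {perm D}).
Hypotheses (gi : injective g) (gs : forall t, exists x, g x = t) (gf : forall x, g (s x) = f (g x)).

Lemma iter_orb k x : iter k f (g x) = g (iter k s x).
Proof. by elim: k => //= k ->; rewrite gf. Qed.

Lemma orbitE x : orbit_of f (g x) = [set g y | y in [set y | y \in porbit s x]].
Proof.
apply/seteqP; split=> t /=.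
  move=> [k _ <-]; exists (iter k s x); last by rewrite iter_orb.
  by rewrite /= porbit_fconnect fconnect_iter.
by move=> [y + <-]; rewrite /= porbit_fconnect => /iter_findex <-; exists (findex s x y) => //; rewrite iter_orb.
Qed.

Lemma orbit_card x : orbit_of f (g x) #= `I_#|porbit s x|.
Proof. by rewrite orbitE; exact: card_mem. Qed.

Lemma orbits_card : range (orbit_of f) #= `I_(cyc s [set: D]%SET).
Proof.
have -> : range (orbit_of f) = [set [set g y | y in [set y | y \in B]] | B in [set B | B \in porbit s @: [set: D]%SET]].
  apply/seteqP; split => A /=.
    move=> [t _ <-]; have [x <-] := gs t; exists (porbit s x); first by rewrite /= imset_f.
    by rewrite orbitE.
  by move=> [B /= /imsetP[x _ ->] <-]; exists (g x) => //; rewrite orbitE.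
apply: card_mem => B C BC; apply/setP => y; apply/idP/idP => h.
  have : [set g y | y in [set y | y \in B]] (g y) by exists y.
  by rewrite BC => -[z /= zC /gi <-].
have : [set g y | y in [set y | y \in C]] (g y) by exists y.
by rewrite -BC => -[z /= zC /gi <-].
Qed.

Lemma orbit_eq x y : orbit_of f (g x) = orbit_of f (g y) <-> y \in porbit s x.
Proof.
split=> [E|]; last by rewrite -porbit_eq !orbitE => /eqP ->.
have : orbit_of f (g x) (g y) by rewrite E; exists 0%N.
by rewrite orbitE => -[z /= + /gi <-].
Qed.
End orbits.

Section code_map.
Variables (c : code).
Hypothesis wc : wf c.

(* A subtype of [nat] rather than [dt c] itself, whose universe is too large for [dart]. *)
Definition cdart : Set := {i : nat | (i < #|dt c|)%N}.
Definition cd (d : dt c) : cdart := exist _ (enum_rank d : nat) (ltn_ord _).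
Definition cv (i : cdart) : dt c := enum_val (Ordinal (proj2_sig i)).
Lemma cdK : cancel cd cv.
Proof. by move=> d; rewrite /cv -[RHS]enum_rankK; congr enum_val; apply: val_inj. Qed.
Lemma cvK : cancel cv cd.
Proof. by move=> i; apply: val_inj; rewrite /= enum_valK. Qed.
Lemma cd_inj : injective cd. Proof. exact: can_inj cdK. Qed.
Lemma cd_surj i : exists d, cd d = i. Proof. by exists (cv i); rewrite cvK. Qed.

Definition cedge (i : cdart) := cd (alpha (cv i)).
Definition crot (i : cdart) := cd (rt (cv i)).

Lemma cedgeK : involutive cedge.
Proof. by move=> i; rewrite /cedge cdK alphaK cvK. Qed.

Lemma cedge_neq i : cedge i <> i.
Proof. by move/(congr1 cv); rewrite cdK; apply/eqP; exact: alpha_neq. Qed.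

Lemma iter_crot k d : iter k crot (cd d) = cd (iter k (@rt c) d).
Proof. by elim: k => //= k ->; rewrite /crot cdK. Qed.

Lemma crot_periodic i : exists2 k, (0 < k)%N & iter k crot i = i.
Proof.
exists (fingraph.order (@rt c) (cv i)); first exact: fingraph.order_gt0.
by rewrite -{2}[i]cvK iter_crot iter_order ?cvK//; exact: rt_inj.
Qed.

Lemma crot_connected (A : set cdart) : A (cd (root c)) -> (forall d, A d -> A (cedge d) /\ A (crot d)) -> A = setT.
Proof.
move=> Ar Ac; pose B : {set dt c} := [set d | `[< A (cd d) >]]%SET.
have inB d : (d \in B) <-> A (cd d) by rewrite /B finset.inE; split => /asboolP.
have BT : B = [set: dt c]%SET.
  apply: (alpha_phi_closed wc); first exact/inB.
  - by move=> d /inB h; apply/inB; have [+ _] := Ac _ h; rewrite /cedge cdK.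
  - move=> d /inB h; apply/inB; have [h1 _] := Ac _ h.
    by have [_] := Ac _ h1; rewrite /crot /cedge !cdK /rt alphaK.
apply/seteqP; split => // i _; have /inB : cv i \in B by rewrite BT finset.inE.
by rewrite cvK.
Qed.

Definition code_map : rmap := RMap cedgeK cedge_neq crot_periodic crot_connected.

Let grt d : cd ((pal c * pph wc)%g d) = crot (cd d).
Proof. by rewrite prtE /crot cdK. Qed.
Let gph d : cd (pph wc d) = (crot \o cedge) (cd d).
Proof. by rewrite pphE /crot /cedge /= !cdK /rt alphaK. Qed.
Let gal d : cd (pal c d) = cedge (cd d).
Proof. by rewrite palE /cedge cdK. Qed.

Definition F k : set (dart code_map) := [set i : cdart | slab (cv i) = k].

Lemma code_vertexE d : @vertex code_map (cd d) = F (slab d).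
Proof.
rewrite /vertex (orbitE grt d); apply/seteqP; split => x /=.
  by move=> [y /= + <-]; rewrite porbit_rt -slab_eq// /F /= cdK => /eqP.
by move=> E; exists (cv x); rewrite ?cvK//= porbit_rt -slab_eq// E.
Qed.

Lemma code_vertex_eq d d' : @vertex code_map (cd d) = @vertex code_map (cd d') <-> slab d = slab d'.
Proof.
rewrite !code_vertexE; split=> [E|-> //]; have : F (slab d) (cd d) by rewrite /F /= cdK.
by rewrite E /F /= cdK.
Qed.

Lemma code_faceE : @face code_map (cd (root c)) = [set cd d | d in [set` ext c]].
Proof.
rewrite /face (orbitE gph).
by apply/seteqP; split => x /= [y /= + <-]; [rewrite ext_porbit|rewrite -(ext_porbit wc)]; exists y.
Qed.

Lemma code_face_root d : @face code_map (cd (root c)) (cd d) <-> d \in ext c.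
Proof. by rewrite code_faceE; split=> [[x /= + /cd_inj <-]|]//; exists d. Qed.

Lemma code_face_card : @face code_map (cd (root c)) #= `I_(per c).+1.
Proof.
rewrite code_faceE; apply: card_eq_trans (inj_card_eq _) _; first by move=> ? ? _ _; exact: cd_inj.
by rewrite -(size_ext wc); apply: card_seq; exact: inv_uniq (invP wc).
Qed.

Lemma code_vertices (a n : nat) : (a + n <= vn c)%N -> F @` [set` iota a n] #= `I_n.
Proof.
move=> an; apply: card_eq_trans (inj_card_eq _) _; last by rewrite -{2}(size_iota a n); exact/card_seq/iota_uniq.
move=> k l; rewrite !inE => /set_iota/andP[_ kn] _ E.
have [x xk] : exists x : dt c, slab x = k by apply: (slab_surj wc); apply: leq_trans kn an.
have : F k (cd x) by rewrite /F /= cdK.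
by rewrite E /F /= cdK xk.
Qed.

Lemma code_verticesE : vertices code_map = F @` [set` iota 0 (vn c)].
Proof.
apply/seteqP; split => A.
  move=> [i _ <-]; have [d <-] := cd_surj i.
  by exists (slab d); [apply/set_iota; exact: (slab_mem wc)|rewrite code_vertexE].
move=> [k /set_iota] /(slab_surj wc)[x <-] <-; exists (cd x) => //; exact: code_vertexE.
Qed.

Lemma code_boundaryE : @vertex code_map @` face (cd (root c) : dart code_map) = F @` [set` iota 0 (per c).+1].
Proof.
rewrite code_faceE; have lE : map (@slab c) (ext c) = per c :: iota 0 (per c) by rewrite /= slab_tl// slab_root.
apply/seteqP; split => A.
  move=> [_ [d de <-] <-]; exists (slab d); last by rewrite code_vertexE.
  by apply/set_iota; rewrite /= add0n ltnS; exact: ext_lab.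
move=> [k /set_iota]; rewrite add0n ltnS /= => kP <-.
have : k \in map (@slab c) (ext c) by rewrite lE inE mem_iota /= add0n; move: kP; rewrite leq_eqVlt.
by move=> /mapP[d de ->]; exists (cd d); [exists d|rewrite code_vertexE].
Qed.

Lemma code_internal : vertices code_map `\` (@vertex code_map @` face (cd (root c) : dart code_map)) #= `I_(nin c).
Proof.
have -> : vertices code_map `\` (@vertex code_map @` face (cd (root c) : dart code_map)) = F @` [set` iota (per c).+1 (nin c)].
  rewrite code_verticesE code_boundaryE; apply/seteqP; split => A.
    move=> [[k /set_iota]]; rewrite add0n => kn <- h; exists k => //; apply/set_iota.
    apply/andP; split; last by case/andP: kn.
    by rewrite ltnNge; apply/negP => kP; apply: h; exists k => //; apply/set_iota; rewrite add0n ltnS.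
  move=> [k /set_iota /andP[Pk kn]] <-; split; first by exists k => //; apply/set_iota; rewrite add0n.
  move=> [l /set_iota]; rewrite add0n ltnS /= => lP E.
  have [x xk] : exists x : dt c, slab x = k by exact: (slab_surj wc).
  have : F k (cd x) by rewrite /F /= cdK.
  by rewrite -E /F /= cdK xk => kl; move: Pk; rewrite kl ltnNge lP.
exact: code_vertices.
Qed.

Lemma code_polygon : (2 <= per c)%N -> polygon_triangulation (nin c) (per c).+1 code_map.
Proof.
move=> P2; have [eE fE] := card_codesE wc; split.
- exact: ltnW.
- exists (vn c), (2 * per c - 1 + 3 * nin c)%N, (per c + 2 * nin c)%N; split.
  + by rewrite code_verticesE; exact: code_vertices.
  + by rewrite -eE; apply: (orbits_card cd_inj cd_surj gal).
  + by rewrite -fE; apply: (orbits_card cd_inj cd_surj gph).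
  + by move: P2; rewrite /vn; clear; lia.
- exact: code_face_card.
- move=> x y; have [d <-] := cd_surj x; have [d' <-] := cd_surj y.
  rewrite !inE => /code_face_root de /code_face_root de' /code_vertex_eq E; congr cd.
  by apply: (ext_vertex wc) => //; rewrite -(slab_eq wc); apply/eqP.
(* An edge with both sides on the outer face would make this face the cycle of its two darts,
   whereas it has at least three darts. *)
- move=> i; have [d <-] := cd_surj i; rewrite [edge _]/(cedge _) /cedge cdK => /code_face_root de /code_face_root ae.
  have phiE x : x \in ext c -> phi x \in ext c.
    by rewrite !(ext_fconnect wc) => h; apply: connect_trans h (fconnect1 _ _).
  have h1 : alpha d = phi d.
    by apply: (ext_vertex wc) => //; [exact: phiE|rewrite -[in phi d](alphaK d); exact: fconnect1].
  have h2 : d = phi (alpha d).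
    by apply: (ext_vertex wc) => //; [exact: phiE|exact: fconnect1].
  have : {subset ext c <= [:: d; alpha d]}.
    move=> x; rewrite (ext_fconnect wc) => rx.
    have : fconnect (@phi c) d x.
      apply: connect_trans rx; rewrite fconnect_sym; last exact: inv_phi (invP wc).
      by rewrite -(ext_fconnect wc).
    move=> /iter_findex <-; elim: (findex _ _ _) => [|n] /=; first by rewrite mem_head.
    by rewrite !inE => /orP[/eqP ->|/eqP ->]; rewrite -?h1 -?h2 eqxx ?orbT.
  move/(uniq_leq_size (inv_uniq (invP wc))); rewrite size_ext//= => h; by move: P2 h; case: (per c) => [|[]].
- move=> i; have [d <-] := cd_surj i; rewrite code_face_root => /negP de.
  rewrite -(@card_porbit3 _ (pph wc) d); first exact: (orbit_card cd_inj gph).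
    by rewrite pphE; case: (inv_tri (invP wc) de).
  by rewrite !pphE; case: (inv_tri (invP wc) de).
- move=> i; have [d <-] := cd_surj i; rewrite [edge _]/(cedge _) /cedge cdK => /code_vertex_eq/eqP.
  by rewrite eq_sym (slab_eq wc) (negbTE (no_loop wc d)).
- exact: code_internal.
Qed.
End code_map.

Lemma code_map_iso c c' (wc : wf c) (wc' : wf c') : rmap_iso (code_map wc) (code_map wc') -> c = c'.
Proof.
move=> [f [fb f0 fe fr]]; apply: (@rooted_code c c' (fun d => cv (f (cd d)))) => //.
have fe' x : cv (f (cd (alpha x))) = alpha (cv (f (cd x))).
  have := fe (cd x); rewrite [edge _]/(cedge _) [X in _ = X -> _]/(cedge _) /cedge cdK => ->.
  by rewrite cdK.
have fr' x : cv (f (cd (rt x))) = rt (cv (f (cd x))).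
  have := fr (cd x); rewrite [rot _]/(crot _) [X in _ = X -> _]/(crot _) /crot cdK => ->.
  by rewrite cdK.
split => //.
- by move=> x y /(can_inj (@cvK c')) /(bij_inj fb) /cd_inj.
- by have := f0; rewrite [root_dart]/(cd (root c)) [X in _ = X -> _]/(cd (root c')) => ->; rewrite cdK.
- by move=> x; have := fr' (alpha x); rewrite {1}/rt alphaK => ->; rewrite fe' /rt alphaK.
Qed.

Lemma rmap_rot_inj (G : rmap) : injective (@rot G).
Proof.
move=> a b ab; have [k k0 ka] := rot_periodic a; have [l l0 lb] := rot_periodic b.
have M j x p : iter p rot x = x -> iter (j * p) rot x = x :> dart G.
  by move=> px; elim: j => // j IH; rewrite mulSn iterD IH.
rewrite -(M l a k ka) -(M k b l lb) [(k * l)%N]mulnC.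
have : (0 < l * k)%N by rewrite muln_gt0 l0.
by case: (l * k)%N => // p _; rewrite !iterSr ab.
Qed.

Section encode.
Variables (n m : nat) (G : rmap).
Hypotheses (T : polygon_triangulation n m G) (m3 : (2 < m)%N).

Lemma dart_finite : finite_set [set: dart G].
Proof.
have [v [e [f [_ eE _ _]]]] := pt_planar T.
have -> : [set: dart G] = \bigcup_(A in edges G) A.
  by apply/seteqP; split => // d _; exists (orbit_of edge d); [exists d|exists 0%N].
apply: bigcup_finite; first by exists e.
move=> _ [d _ <-]; apply: (@sub_finite_set _ _ [set d; edge d]); last exact: finite_set2.
move=> x [k _ <-]; elim: k => [|k IH]; [by left|rewrite iterS].
by case: IH => ->; [right|left; rewrite /= edgeK].
Qed.

Let X := fset_set [set: dart G].
Let D : finType := X.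
Lemma inX d : d \in X. Proof. by rewrite in_fset_set ?mem_setE//; [exact: in_setT|exact: dart_finite]. Qed.
Let to (d : dart G) : D := FSetSub (inX d).
Let g (x : D) : dart G := val x.
Let gK d : g (to d) = d. Proof. by []. Qed.
Let toK x : to (g x) = x. Proof. exact: val_inj. Qed.
Let gi : injective g. Proof. exact: val_inj. Qed.
Let gs t : exists x, g x = t. Proof. by exists (to t). Qed.

Let al_inj : injective (fun x => to (edge (g x))).
Proof. by move=> x y /(congr1 g); rewrite !gK => /(inv_inj (@edgeK G))/gi. Qed.
Let f_inj : injective (fun x => to (rot (edge (g x)))).
Proof. by move=> x y /(congr1 g); rewrite !gK => /rmap_rot_inj /(inv_inj (@edgeK G))/gi. Qed.
Let al : {perm D} := perm al_inj.
Let f : {perm D} := perm f_inj.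
Let r := to root_dart.

Let gal x : g (al x) = edge (g x). Proof. by rewrite permE gK. Qed.
Let gf x : g (f x) = (rot \o edge) (g x). Proof. by rewrite permE gK. Qed.
Let gr x : g ((al * f)%g x) = rot (g x). Proof. by rewrite permM gf /= gal edgeK. Qed.
Let alK x : al (al x) = x. Proof. by apply: gi; rewrite !gal edgeK. Qed.

Let faceE x : face (g x) #= `I_#|porbit f x|. Proof. exact: (orbit_card gi gf). Qed.

Let face_rootE x : face root_dart (g x) <-> x \in porbit f r.
Proof.
rewrite -[root_dart](gK root_dart) -/r /face (orbitE gf); split=> [[y /= + /gi <-]//|h].
by exists x.
Qed.

Let fr_card : #|porbit f r| = m.
Proof.
have h := faceE r; rewrite gK in h; apply/esym/card_eq_II.
by apply: card_eq_trans h; exact: card_esym (pt_boundary T).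
Qed.

Lemma tri_map : tri al [set: D]%SET f r.
Proof.
have neq x : al x != x.
  by apply/eqP => h; apply: (@edge_neq G (g x)); rewrite -gal h.
split; rewrite ?finset.inE//.
- move=> C rC _ Cal Cf; apply/fintype.subsetP => x _.
  have := @rmap_connected G [set d | to d \in C] rC; move=> /(_ _)/seteqP[|_ h].
    move=> d /= dC; have a1 := Cal _ dC; split; first by rewrite permE gK in a1.
    by have := Cf _ a1; rewrite permE gal gK edgeK.
  by have := h (g x) I; rewrite /= toK.
- have [v [e [k [vE eE fE E]]]] := pt_planar T.
  have v' : v = cyc (al * f)%g [set: D]%SET.
    by apply/card_eq_II; apply: card_eq_trans (orbits_card gi gs gr); exact: card_esym vE.
  have e' : e = cyc al [set: D]%SET.
    by apply/card_eq_II; apply: card_eq_trans (orbits_card gi gs gal); exact: card_esym eE.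
  have k' : k = cyc f [set: D]%SET.
    by apply/card_eq_II; apply: card_eq_trans (orbits_card gi gs gf); exact: card_esym fE.
  have : ((cyc al [set: D]%SET).*2 = #|[set: D]%SET|)%N.
    rewrite cardsT -(card_cycles al) /cyc -sum1_card -muln2 big_distrl /=; apply: eq_bigr => _ /imsetP[x _ ->].
    by rewrite card_porbit2.
  by rewrite -v' -e' -k'; move: (#|_|) E => q; clear; lia.
- apply/eqP => h; move: fr_card m3; suff -> : porbit f r = [set r]%SET by rewrite cards1 => <-.
  apply/setP => y; rewrite finset.in_set1 porbit_fconnect; apply/idP/eqP => [/iter_findex <-|->]; last exact: connect0.
  by elim: (findex _ _ _) => //= i ->.
- move=> x y /face_rootE fx /face_rootE fy /(orbit_eq gi gr) E.
  by apply: gi; apply: (pt_simple T); rewrite ?inE.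
- move=> x _ nx; have c3 : #|porbit f x| = 3.
    apply/esym/card_eq_II; apply: card_eq_trans (faceE x); apply: card_esym; apply: (pt_triangle T).
    by move/face_rootE; exact/negP.
  split; last by rewrite -[RHS](iter_porbit f x) c3.
  apply/eqP => h; suff : porbit f x = [set x]%SET by move=> E; move: c3; rewrite E cards1.
  apply/setP => y; rewrite finset.in_set1 porbit_fconnect; apply/idP/eqP => [/iter_findex <-|->]; last exact: connect0.
  by elim: (findex _ _ _) => //= i ->.
- move=> x _; apply/negP => /(orbit_eq gi gr); rewrite gal => /esym; exact: (pt_loopless T).
Qed.

(** The finite set of darts is made a finite type so that [tri_coded] applies; the isomorphism then
    transports the outer face and the inner vertices, which gives the two counts. *)
Lemma encode : exists c (wc : wf c), [/\ per c = m.-1, nin c = n & rmap_iso (code_map wc) G].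
Proof.
have [||c [h [wc hi hT hr hm]]] := tri_coded _ _ tri_map.
- exact: alK.
- by move=> x; apply/eqP => e; apply: (@edge_neq G (g x)); rewrite -gal e.
have hs x : exists d, h d = x.
  have : x \in (h @: [set: dt c])%SET by rewrite hT finset.inE.
  by move=> /imsetP[d _ ->]; exists d.
pose F (i : cdart c) := g (h (cv i)).
have Fi : injective F by move=> i j /gi /hi /(can_inj (@cvK c)).
have Fs t : exists i, F i = t.
  by have [x xt] := gs t; have [d dx] := hs x; exists (cd d); rewrite /F cdK dx.
have Fb : bijective F.
  have /choice[F' F'K] := Fs; exists F' => // i; apply: Fi; exact: F'K.
have F0 : F (cd (root c)) = root_dart by rewrite /F cdK hr gK.
have Fe i : F (cedge i) = edge (F i) by rewrite /F /cedge cdK (hm _).1 gal.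
have Fr i : F (crot i) = rot (F i).
  by rewrite /F /crot cdK /rt (hm _).2 (hm _).1 gf /= gal edgeK.
have iso : rmap_iso (code_map wc) G by exists F.
have orbF (k : cdart c -> cdart c) (k' : dart G -> dart G) : (forall i, F (k i) = k' (F i)) ->
    forall i, orbit_of k' (F i) = F @` orbit_of k i.
  move=> kF i; have it j : iter j k' (F i) = F (iter j k i) by elim: j => //= j ->; rewrite kF.
  by apply/seteqP; split => t /=; [move=> [j _ <-]; exists (iter j k i); [exists j|]|move=> [_ [j _ <-] <-]; exists j].
have vF i : vertex (F i) = F @` (@vertex (code_map wc) i) by exact: orbF.
have fF i : face (F i) = F @` (@face (code_map wc) i).
  by apply: orbF => j /=; rewrite Fr Fe.
have pE : per c = m.-1.
  have : (per c).+1 = m.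
    apply/card_eq_II; apply: card_eq_trans (pt_boundary T); apply: card_eq_trans (card_esym (code_face_card wc)) _.
    by rewrite -F0 fF; apply: card_esym; apply: inj_card_eq => i j _ _; exact: Fi.
  by move=> <-.
have imi : injective (fun A : set (cdart c) => F @` A).
  have sub (A B : set (cdart c)) : F @` A = F @` B -> A `<=` B.
    move=> E i Ai; have : (F @` B) (F i) by rewrite -E; exists i.
    by move=> [j Bj /Fi <-].
  by move=> A B E; apply/seteqP; split; apply: sub.
exists c, wc; split => //.
apply/card_eq_II; apply: card_eq_trans (pt_internal T); apply: card_eq_trans (card_esym (code_internal wc)) _.
have -> : vertices G `\` (@vertex G @` face root_dart) =
   (fun A : set (cdart c) => F @` A) @` (vertices (code_map wc) `\` (@vertex (code_map wc) @` face (cd (root c) : dart (code_map wc)))).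
  apply/seteqP; split => A.
    move=> [[t _ <-] nb]; have [i it] := Fs t; subst t; exists (@vertex (code_map wc) i); last by rewrite vF.
    split; first by exists i.
    by move=> [j fj vj]; apply: nb; exists (F j); [rewrite -F0 fF; exists j|rewrite !vF vj].
  move=> [_ [[i _ <-] nb] <-]; rewrite -vF; split; first by exists (F i).
  move=> [t]; rewrite -F0 fF => -[j fj <-]; rewrite !vF => /imi vj.
  by apply: nb; exists j.
by apply: card_esym; apply: inj_card_eq => A B _ _; exact: imi.
Qed.
End encode.

End PlaneMaps.

(** * From small capacity to recurrence, and passage to the limit *)

Module Walk.
Import structures.
Import all_boot all_order all_algebra.
Import finmap zify lra ring.
Import all_classical all_reals all_analysis.
Import Defs Codes Euler CodeMaps Peeling Labels Rotation Duality Potentials PlaneMaps.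
Import Order.TTheory GRing.Theory Num.Theory.
Import numFieldNormedType.Exports.
Local Open Scope classical_set_scope.
Local Open Scope card_scope.
Local Open Scope ring_scope.

Section map_good.
Variable R : realType.

(** A potential on vertices is encoded as a function on darts invariant under [rot]. The sum runs
    over darts, so each edge counts twice, and finite lists of darts give a meaning to the energy on
    an infinite map. *)
Definition mgood (G : rmap) (dl : R) (N : nat) : Prop := exists phi : dart G -> R,
  [/\ forall d, 0 <= phi d <= 1, forall d, phi (rot d) = phi d, phi root_dart = 1,
      forall d, phi d != 0 -> dist_le N d
    & forall s : seq (dart G), uniq s -> \sum_(d <- s) (phi d - phi (edge d)) ^+ 2 <= dl].

(** The support of the potential may be disconnected. Keeping only its component at the root does
    not increase the energy, and a connected set of at most N vertices is within distance N of the
    root. *)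
Lemma goodv_mgood c (wc : wf c) dl N : goodv c (per c) dl N -> mgood (code_map wc) (2 * dl) N.
Proof.
move=> [g [g01 g1 _ gE gN]].
pose lo (d : dt c) : 'I_(vn c) := Ordinal (slab_mem wc d).
pose e : rel 'I_(vn c) := fun u v => [exists d, (lo d == u) && (lo (alpha d) == v)] && (g v != 0).
pose C d := connect e (lo (root c)) (lo d).
pose phi' d := if C d then g (slab d) else 0.
have C_e d : C d -> g (slab (alpha d)) != 0 -> C (alpha d).
  move=> Cd ga; apply: connect_trans Cd _; apply: connect1; rewrite /e ga andbT.
  by apply/existsP; exists d; rewrite !eqxx.
have dist u p : path e u p -> forall k, (forall d, lo d = u -> @dist_le (code_map wc) k (cd d)) ->
    forall d, lo d = last u p -> @dist_le (code_map wc) (k + size p) (cd d).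
  elim: p u => [u _ k h d /= du|v p IH u /= /andP[/andP[/existsP[d0 /andP[/eqP d0u /eqP d0v]] _] ep] k h d dv].
    by rewrite addn0; exact: h.
  rewrite -addSnnS; apply: (IH v ep) => // d' d'v; right; exists (cd (alpha d0)).
    by rewrite code_vertexE /F /= cdK; have := congr1 val (etrans d'v (esym d0v)) => /= ->.
  by rewrite [edge _]/(cedge _) /cedge cdK alphaK; exact: h.
have C_dist d : C d -> @dist_le (code_map wc) N (cd d).
  move=> /connectP[p0 ep0 lE]; case/shortenP: ep0 lE => p ep up _ lE.
  have h0 : forall d', lo d' = lo (root c) -> @dist_le (code_map wc) 0 (cd d').
    by move=> d' /(congr1 val) /= E; rewrite /= code_vertexE /F /= cdK.
  apply: near_le (dist _ _ ep 0%N h0 d lE); rewrite add0n.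
  apply: leq_trans gN; rewrite -size_filter; apply: (@leq_trans (size (map val (lo (root c) :: p)))).
    by rewrite size_map /= leqnSn.
  apply: uniq_leq_size; first by rewrite map_inj_uniq//; exact: val_inj.
  move=> x /mapP[v vp ->]; rewrite mem_filter mem_iota /= add0n ltn_ord andbT.
  move: vp; rewrite inE => /predU1P[->|vp]; first by rewrite /= slab_root g1 ?oner_eq0//=.
  have : all (fun v : 'I_(vn c) => g v != 0) p.
    elim: p (lo (root c)) ep {up lE vp} => //= w p IH u /andP[/andP[_ gw]] /IH ->; by rewrite gw.
  by move/allP; apply.
exists (fun i => phi' (cv i)); split.
- by move=> d; rewrite /phi'; case: ifP => _; rewrite ?lexx ?ler01.
- move=> i; rewrite [rot i]/(crot i) /crot cdK.
  have E : lo (rt (cv i)) = lo (cv i).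
    by apply: val_inj; apply/eqP => /=; rewrite eq_sym slab_eq//; exact: fconnect1.
  by rewrite /phi' /C E; have /= -> := congr1 val E.
- by rewrite [root_dart]/(cd (root c)) cdK /phi' /C connect0 slab_root// g1//=.
- move=> i; rewrite /phi'; case: ifP => [Ci _|]; last by rewrite eqxx.
  by have := C_dist _ Ci; rewrite cvK.
- move=> s us; have ucv : uniq (map (@cv c) s) by rewrite (@map_inj_uniq (dart (code_map wc)) _ (@cv c))//; exact: (can_inj (@cvK c)).
  apply: (@le_trans _ _ (\sum_(d <- map (@cv c) s) (phi' d - phi' (alpha d)) ^+ 2)).
    by rewrite big_map le_eqVlt; apply/orP; left; apply/eqP; apply: eq_bigr => i _; rewrite [edge i]/(cedge i) /cedge cdK.
  apply: (@le_trans _ _ (\sum_(d <- enum (dt c)) (phi' d - phi' (alpha d)) ^+ 2)).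
    by apply: sum_subset => // [|x _|x]; [exact: enum_uniq|rewrite mem_enum|exact: sqr_ge0].
  apply: (@le_trans _ _ (\sum_(d <- enum (dt c)) (g (slab d) - g (slab (alpha d))) ^+ 2)).
    apply: ler_sum => d _; rewrite /phi'; case: (boolP (C d)) => Cd; case: (boolP (C (alpha d))) => Ca //.
    - have [->//|/(C_e _ Cd)] := eqVneq (g (slab (alpha d))) 0; by rewrite (negbTE Ca).
    - have [->//|h] := eqVneq (g (slab d)) 0; have := C_e _ Ca; rewrite alphaK => /(_ h); by rewrite (negbTE Cd).
    - by rewrite subrr expr0n sqr_ge0.
  rewrite big_enum /= -(@sum_ees _ c (fun u v => (g u - g v) ^+ 2)).
    by rewrite mulr2n; move: gE; rewrite /energy; lra.
  by move=> u v; rewrite -sqrrN opprB.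
Qed.

Lemma dist_ball (G : rmap) k (d : dart G) : dist_le k d -> dart_ball G k.+1 d.
Proof.
move=> h; split; first exact: near_le h.
by right; exists (edge d); [exact: vertex_refl|rewrite edgeK].
Qed.

(** The edges that carry energy lie in the ball of radius N + 1. One more unit is needed because an
    isomorphism of balls controls distances only strictly inside its radius ([near_ball]). *)
Lemma mgood_ball (G G' : rmap) dl N : ball_iso N.+2 G G' -> mgood G dl N -> mgood G' dl N.
Proof.
move=> [f fP] [phi [p01 pr p1 pd pE]].
have [g [gP gf fg]] := ball_isom_inv (ltn0Sn _) fP.
have [[gsub _ _] g0 ge gn] := gP; have [_ f0 fe fn] := fP.
have gv := @ball_iso_vertex _ _ _ _ g (fun a b Aa Ab => (gn a b Aa Ab).1).
have fv := @ball_iso_vertex _ _ _ _ f (fun a b Aa Ab => (fn a b Aa Ab).1).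
have gd := near_ball (ltnSn N.+1) g0 ge gv; have fd := near_ball (ltnSn N.+1) f0 fe fv.
pose psi d' := if `[< dist_le N.+1 d' >] then phi (g d') else 0.
have pv d d' : vertex d d' -> phi d' = phi d.
  by move=> [k _ <-]; elim: k => //= k <-; rewrite pr.
have back d' : dart_ball G' N.+2 d' -> phi (g d') != 0 -> dist_le N d'.
  move=> bd /pd h; rewrite -(fg _ bd); apply: (fd N (leqnSn N)) => //; exact: gsub.
have psiE d' : dart_ball G' N.+2 d' -> psi d' = phi (g d').
  move=> bd; rewrite /psi; case: asboolP => // nd; apply/esym/eqP/negPn/negP => /(back _ bd) h.
  by apply: nd; exact: near_le h.
have psi_ball d' : psi d' != 0 -> dist_le N d'.
  by rewrite /psi; case: asboolP => [h|]; [exact: back (dist_ball h)|rewrite eqxx].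
exists psi; split => //.
- by move=> d; rewrite /psi; case: ifP => _; rewrite ?lexx ?ler01.
- move=> d; rewrite /psi; have vr : vertex d (rot d) by exists 1%N.
  have -> : `[< dist_le N.+1 (rot d) >] = `[< dist_le N.+1 d >].
    by apply/asboolP/asboolP; apply: near_vertex => //; exact: vertex_sym.
  case: asboolP => // h; apply: pv; apply: gv => //; first exact: dist_ball h.
  by apply: dist_ball; exact: near_vertex h.
- rewrite psiE ?g0//; exact: dart_ball_root.
- move=> s us; pose b d := (psi d != 0) || (psi (edge d) != 0).
  have bb d : b d -> dart_ball G' N.+2 d.
    move=> /orP[/psi_ball h|/psi_ball h].
      by apply: (@dart_ball_le _ N.+1) => //; exact: dist_ball.
    rewrite -[d]edgeK; apply: dart_ball_edge; apply: (@dart_ball_le _ N.+1) => //; exact: dist_ball.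
  rewrite (bigID b) /= [X in _ + X]big1 ?addr0; last first.
    by move=> d; rewrite negb_or !negbK => /andP[/eqP -> /eqP ->]; rewrite subrr expr0n.
  rewrite -big_filter; have ut : uniq (map g [seq d <- s | b d]).
    rewrite map_inj_in_uniq ?filter_uniq// => x y; rewrite !mem_filter => /andP[/bb bx _] /andP[/bb by' _] E.
    by rewrite -(fg _ bx) -(fg _ by') E.
  apply: le_trans (pE _ ut); rewrite big_map le_eqVlt; apply/orP; left; apply/eqP.
  rewrite big_seq [RHS]big_seq; apply: eq_bigr => d; rewrite mem_filter => /andP[/bb bd _].
  by rewrite psiE// psiE ?ge//; exact: dart_ball_edge.
Qed.

Lemma local_dist_ball (G G' : local_map R) k : local_dist R G G' < expR (- k%:R) -> ball_iso k G G'.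
Proof.
move=> h; have : (expeR (- agreement_radius R G G') < (expR (- k%:R))%:E)%E by rewrite expeR_agreement lte_fin.
have -> : (expR (- k%:R) : R)%:E = expeR (- (k%:R)%:E) by [].
rewrite lte_expeR lteN2 => /ereal_sup_gt[_ [r rP <-]]; rewrite lte_fin ltr_nat => kr.
by case: rP => [r0|]; [move: kr; rewrite r0|apply: ball_iso_le; exact: ltnW].
Qed.

Definition mgood_ind dl N (G : local_map R) : R := (`[< mgood G dl N >])%:R.

Lemma mgood_ind_continuous dl N : continuous (mgood_ind dl N).
Proof.
move=> G; apply: cvg_near_cst; first exact: (nbhs_filter G).
apply/(@nbhs_ballP R (local_map R)); exists (expR (- N.+2%:R)); first exact: expR_gt0.
move=> G' /= h; have b := local_dist_ball h; rewrite /mgood_ind; congr (_%:R : R); apply: congr1.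
apply/asboolP/asboolP; apply: mgood_ball => //; exact: ball_iso_sym.
Qed.

Lemma mgood_iso (G G' : rmap) dl N : rmap_iso G G' -> mgood G dl N -> mgood G' dl N.
Proof. by move=> /(@rmap_iso_ball N.+2); exact: mgood_ball. Qed.

Lemma mgood_open dl N : open [set G : local_map R | mgood G dl N].
Proof.
rewrite openE => G Gg; apply/nbhs_ballP; exists (expR (- N.+2%:R)); first exact: expR_gt0.
by move=> G' /= /local_dist_ball b; exact: mgood_ball b Gg.
Qed.
End map_good.

HB.instance Definition _ := gen_choiceMixin code.

Lemma rmap_iso_refl (G : rmap) : rmap_iso G G.
Proof. by exists id; split => //; exists id. Qed.

Lemma rmap_iso_sym (G G' : rmap) : rmap_iso G G' -> rmap_iso G' G.
Proof.
move=> [f [[g gf fg] f0 fe fr]]; exists g; split.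
- by exists f.
- by rewrite -f0 gf.
- by move=> d; rewrite -[in LHS](fg d) -fe gf.
- by move=> d; rewrite -[in LHS](fg d) -fr gf.
Qed.

Lemma rmap_iso_trans (G1 G2 G3 : rmap) : rmap_iso G1 G2 -> rmap_iso G2 G3 -> rmap_iso G1 G3.
Proof.
move=> [f [bf f0 fe fr]] [g [bg g0 ge gr]]; exists (g \o f); split => [||d|d] /=.
- exact: bij_comp. - by rewrite f0. - by rewrite fe ge. - by rewrite fr gr.
Qed.

(** Makes the codes of given size and number of inner vertices a finite set, enumerated by
    [cods]. *)
Lemma hgt_le c : wf c -> (hgt c < 2 * (per c + nin c) + nin c)%N.
Proof.
elim: c => //= [c IH /andP[/IH h p1]|c1 IH1 c2 IH2 /andP[w1 w2]]; first by move: h p1; lia.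
have := IH1 w1; have := IH2 w2; have := per_gt0 w1; have := per_gt0 w2; lia.
Qed.

Lemma codesd_mem d P c : (0 < P)%N -> okc P c -> (hgt c <= d)%N -> c \in codesd d P.
Proof.
elim: d P c => [|d IH] P c P0; first by rewrite leqn0 (gtn_eqF (hgt_gt0 c)).
case: c => [|c|c1 c2] /andP[/= w /eqP pE]; rewrite ?ltnS => h; rewrite !mem_cat.
- by rewrite -pE mem_head.
- case/andP: w => w p1; rewrite (map_f CI) ?orbT//; apply: IH => //; rewrite /okc w /= -pE; apply/eqP; lia.
case/andP: w => w1 w2; move: h; rewrite geq_max => /andP[h1 h2].
have p1 := per_gt0 w1; have p2 := per_gt0 w2.
apply/orP; right; apply/orP; right; apply/allpairsPdep; exists (per c1), (c1, c2); split => //.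
  by rewrite mem_iota; lia.
apply/allpairsP; exists (c1, c2); split => //=; apply: IH => //; rewrite /okc ?w1 ?w2 ?eqxx//=; [lia|].
by apply/eqP; lia.
Qed.

Definition cods P n := [seq c <- codesd (2 * (P + n) + n) P | nin c == n].

Lemma mem_cods P n c : (0 < P)%N -> (c \in cods P n) = okc P c && (nin c == n).
Proof.
move=> P0; rewrite mem_filter andbC; case: (nin c =P n) => [nE|]; rewrite ?andbF// !andbT.
apply/idP/idP => [/(codesd_ok P0)//|ok]; apply: codesd_mem => //.
by case/andP: ok => w /eqP <-; rewrite -nE ltnW// hgt_le.
Qed.

Lemma cods_uniq P n : (0 < P)%N -> uniq (cods P n).
Proof. by move=> P0; rewrite filter_uniq// codesd_uniq. Qed.

Definition cm (c : code) : rmap := if pselect (wf c) is left w then code_map w else single_edge.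

Lemma cmE c (w : wf c) : cm c = code_map w.
Proof. by rewrite /cm; case: pselect => // w'; rewrite (bool_irrelevance w' w). Qed.

(** * Uniform triangulations with a fixed number of inner vertices *)

Section mean.
Variable R : realType.

Lemma classesE P n : (2 <= P)%N ->
  triangulation_classes R n P.+1 = (fun c => @iso_class R (cm c)) @` [set` cods P n].
Proof.
move=> P2; have P0 : (0 < P)%N by exact: ltnW.
apply/seteqP; split => A.
  move=> [G /= T <-]; have [c [w [pE nE iso]]] := encode T P2; exists c.
    by rewrite /= mem_cods// /okc w pE nE !eqxx.
  rewrite (cmE w); apply/seteqP; split => G' /=; rewrite /iso_class /=; first exact: rmap_iso_trans (rmap_iso_sym iso).
  exact: rmap_iso_trans iso.
move=> [c /=]; rewrite mem_cods// => /andP[/andP[w /eqP pE] /eqP nE] <-; exists (cm c) => //.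
by rewrite /= (cmE w) -pE -nE; apply: code_polygon; rewrite pE.
Qed.

Lemma class_inj P n : (0 < P)%N -> set_inj [set` cods P n] (fun c => @iso_class R (cm c)).
Proof.
move=> P0 c c'; rewrite !inE /= !mem_cods// => /andP[/andP[w _] _] /andP[/andP[w' _] _] E.
have : iso_class (cm c : local_map R) (cm c') by rewrite E; exact: rmap_iso_refl.
by rewrite /iso_class /= (cmE w) (cmE w'); exact: code_map_iso.
Qed.

Lemma uniform_meanE P n (phi : local_map R -> R) : (2 <= P)%N ->
  (forall G G' : rmap, rmap_iso G G' -> phi G = phi G') ->
  uniform_mean n P.+1 phi = (\sum_(c <- cods P n) phi (cm c)) / (size (cods P n))%:R.
Proof.
move=> P2 hphi; have P0 : (0 < P)%N by exact: ltnW.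
rewrite /uniform_mean classesE// (@card_fset_set _ _ (size (cods P n))); last first.
  by apply: card_eq_trans (inj_card_eq (class_inj P0)) _; exact/card_seq/cods_uniq.
congr (_ / _); rewrite fsbig_image; last exact: class_inj.
rewrite -fsbig_seq ?cods_uniq//; apply: eq_bigr => c _; apply/esym/hphi.
by apply: (@getPex _ (iso_class (cm c : local_map R))); exists (cm c); exact: rmap_iso_refl.
Qed.

(** At least half of the mass [av R P] is carried by codes with more than om inner vertices, by
    [mass_ge] and the first bound. The weight is constant on [cods P n], so if the proportion of [W]
    exceeded 4 eps for each such n, the mass of [W] would be at least 2 eps [av R P]. *)
Lemma pick_nin P om (W : code -> bool) (eps : R) : (0 < P)%N -> 0 < eps ->
  sb (fun c => (nin c <= om)%N%:R * wt 1 c) P (1 / 4 * av R P) ->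
  sb (fun c => wt 1 c * (W c)%:R) P (eps * av R P) ->
  exists n, [/\ (om < n)%N, (0 < size (cods P n))%N & (count W (cods P n))%:R <= 4 * eps * (size (cods P n))%:R].
Proof.
move=> P0 e0 hlow hW; apply: contrapT => /forallNP nex.
have aP := av_gt0 R P0.
have [s [us os sW]] := @mass_ge R P (Num.truncn (4 * nodesum R P / av R P)) P0.
have {}sW : 3 / 4 * av R P <= \sum_(c <- s) wt 1 c.
  apply: le_trans sW; have := truncnS_gt (4 * nodesum R P / av R P).
  move: ((Num.truncn (4 * nodesum R P / av R P)).+1%:R : R) => u; rewrite ltr_pdivrMr// => hu.
  have u0 : 0 < u by have := nodesum_ge0 R P; nra.
  suff : nodesum R P / u <= 1 / 4 * av R P by lra.
  rewrite ler_pdivrMr//; lra.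
(* Exceeds the number of inner vertices of every code of [s], so that only finitely many values of n
   are compared. *)
pose K := (\sum_(c <- s) nin c)%N.
pose t := [seq c <- codesd (2 * (P + K) + K) P | (om < nin c <= K)%N].
have ut : uniq t by rewrite filter_uniq// codesd_uniq.
have ot : all (okc P) t by apply/allP => c; rewrite mem_filter => /andP[_ /(codesd_ok P0)].
have tE c : (c \in t) = okc P c && (om < nin c <= K)%N.
  rewrite mem_filter andbC; case: (boolP (om < nin c <= K)%N) => [/andP[_ nK]|_]; rewrite ?andbF// !andbT.
  apply/idP/idP => [/(codesd_ok P0)//|ok]; apply: codesd_mem => //.
  case/andP: ok => w /eqP <-; apply: ltnW (leq_trans (hgt_le w) _).
  by rewrite leq_add// leq_mul2l leq_add2l nK orbT.
have part (F : code -> R) : \sum_(c <- t) F c = \sum_(n < K.+1 | (om < n)%N) \sum_(c <- cods P n) F c.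
  rewrite big_seq (partition_big (fun c => inord (nin c) : 'I_K.+1) (fun n : 'I_K.+1 => (om < n)%N)) /=; last first.
    by move=> c; rewrite tE => /and3P[_ h1 h2]; rewrite inordK.
  apply: eq_bigr => n on; rewrite -big_seq_cond -big_filter; apply: perm_big.
  apply: uniq_perm; [exact: filter_uniq|exact: cods_uniq|] => c; rewrite mem_filter tE mem_cods//.
  have [/andP[hc1 hc2]|nhc] := boolP (om < nin c <= K)%N.
    by rewrite andbT -val_eqE /= inordK// andbC.
  rewrite !andbF; apply/esym/negbTE; apply: contra nhc => /andP[_ /eqP ->]; rewrite on /=.
  by rewrite -ltnS ltn_ord.
have tW : 1 / 2 * av R P <= \sum_(c <- t) wt 1 c.
  have := hlow s us os; move: sW; rewrite (bigID (fun c => (nin c <= om)%N)) /=.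
  have -> : \sum_(c <- s | (nin c <= om)%N) wt 1 c = \sum_(c <- s) (nin c <= om)%N%:R * wt 1 c :> R.
    by rewrite [LHS]big_mkcond; apply: eq_bigr => c _; case: ifP; rewrite ?mul1r ?mul0r.
  have : \sum_(c <- s | ~~ (nin c <= om)%N) wt 1 c <= \sum_(c <- t) wt 1 c :> R.
    rewrite -big_filter; apply: sum_subset => //; first exact: filter_uniq.
      move=> c; rewrite mem_filter -ltnNge => /andP[h cs]; rewrite tE h (allP os c cs) /=.
      by rewrite /K (big_rem c cs) leq_addr.
    by move=> c; exact: wt_ge0.
  lra.
have := hW t ut ot; rewrite part leNgt => /negP; apply.
apply: (@lt_le_trans _ _ (4 * eps * \sum_(c <- t) wt 1 c)).
  have : 4 * eps * (1 / 2 * av R P) <= 4 * eps * \sum_(c <- t) wt 1 c by rewrite ler_wpM2l// mulr_ge0// ltW.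
  have := mulr_gt0 e0 aP; lra.
rewrite part mulr_sumr; apply: ler_sum => n on.
have wE c c' : c \in cods P n -> c' \in cods P n -> wt 1 c = wt 1 c' :> R.
  rewrite !mem_cods// => /andP[/andP[w /eqP p] /eqP nn] /andP[/andP[w' /eqP p'] /eqP nn'].
  by apply: wt_nin; rewrite ?p ?p' ?nn ?nn'.
case E : (cods P n) => [|c0 r]; first by rewrite !big_nil mulr0.
have c0n : c0 \in cods P n by rewrite E mem_head.
rewrite -E; have s1 : \sum_(c <- cods P n) wt 1 c = wt 1 c0 * (size (cods P n))%:R :> R.
  rewrite big_seq (eq_bigr (fun=> wt 1 c0)) => [|c cn]; last exact: wE.
  by rewrite -big_seq big_const_seq iter_addr_0 count_predT mulr_natr.
have s2 : \sum_(c <- cods P n) wt 1 c * (W c)%:R = wt 1 c0 * (count W (cods P n))%:R :> R.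
  rewrite big_seq (eq_bigr (fun c => wt 1 c0 * (W c)%:R)) => [|c cn]; last by rewrite (wE _ _ cn c0n).
  rewrite -big_seq -mulr_sumr -sum1_count natr_sum [in RHS]big_mkcond; congr (_ * _).
  by apply: eq_bigr => c _; case: (W c).
rewrite s1 s2 mulrCA ler_wpM2l ?wt_ge0// leNgt; apply/negP => h; apply: (nex n); split => //.
  by rewrite E.
exact: ltW.
Qed.

(** One N serves for all k, while k can be taken as large as desired: the perimeter is at least k
    and n / m exceeds k, as convergence to the half-plane map requires. *)
Theorem mean_good (dl eps : R) : 0 < dl -> 0 < eps -> exists N, forall k, exists n P,
  [/\ (k <= P)%N, (k * P.+1 < n)%N & 1 - eps <= uniform_mean n P.+1 (mgood_ind dl N)].
Proof.
move=> dl0 e0; have [||N [P0 hN]] := @good_root R (dl / 2) (eps / 4); rewrite ?divr_gt0//.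
exists N => k; have [|P1 hP1] := @nin_large R k (1 / 4); first by rewrite divr_gt0.
pose P := maxn (maxn P0 P1) (maxn k 2).
have [h0 h1 h2 h3] : [/\ P0 <= P, P1 <= P, k <= P & 2 <= P]%N by rewrite /P; split; lia.
have [||n [kn sn cn]] := @pick_nin P (k * P.+1) (fun c => ~~ `[< goodv c P (dl / 2) N >]) (eps / 4) (ltnW h3) _ (hP1 P h1) _.
- by rewrite divr_gt0.
- exact: hN.
exists n, P; split => //; rewrite uniform_meanE//; last first.
  move=> G G' iso; rewrite /mgood_ind; congr (_%:R : R); apply: congr1; apply/asboolP/asboolP; apply: mgood_iso => //.
  exact: rmap_iso_sym.
rewrite ler_pdivlMr ?ltr0n//.
have : (size (cods P n))%:R - (count (fun c => ~~ `[< goodv c P (dl / 2) N >]) (cods P n))%:R <= \sum_(c <- cods P n) mgood_ind dl N (cm c).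
  rewrite -sum1_size -sum1_count !natr_sum [X in _ - X]big_mkcond -sumrB /= big_seq [leRHS]big_seq; apply: ler_sum => c.
  rewrite mem_cods ?(ltnW h3)// => /andP[/andP[w /eqP pE] _]; rewrite /mgood_ind (cmE w).
  case: asboolP => /= g; last by rewrite subrr ler0n.
  rewrite subr0; case: asboolP => // ng; exfalso; apply: ng.
  have -> : dl = 2 * (dl / 2) by lra.
  by apply: goodv_mgood; rewrite pE.
lra.
Qed.
End mean.

Lemma cvg_sum_seq (R : realType) (I : Type) (s : seq I) (f : nat -> I -> R) (l : I -> R) :
  (forall i, f k i @[k --> \oo] --> l i) -> \sum_(i <- s) f k i @[k --> \oo] --> \sum_(i <- s) l i.
Proof.
move=> h; elim: s => [|i s IH].
  by rewrite big_nil (_ : (fun k => _) = (fun=> 0)); [exact: cvg_cst|apply/funext => k; rewrite big_nil].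
rewrite big_cons (_ : (fun k => _) = (fun k => f k i + \sum_(j <- s) f k j)); last first.
  by apply/funext => k; rewrite big_cons.
exact: cvgD.
Qed.

(** * Escape probability and energy *)

Section harmonic.
Variables (R : realType) (G : rmap).
Implicit Types (d e : dart G) (F : dart G -> R).

Lemma vertex_eq d e : vertex d e -> vertex e = vertex d.
Proof.
move=> de; apply/seteqP; split => x; first exact: vertex_trans.
by apply: vertex_trans; exact: vertex_sym.
Qed.

Lemma vertex_finite d : finite_set (vertex d).
Proof.
have [p p0 pd] := rot_periodic d.
apply: (@sub_finite_set _ _ ((fun k => iter k rot d) @` `I_p)); last by apply: finite_image; exact: finite_II.
have M k : iter (k * p) rot d = d by elim: k => // k IH; rewrite mulSn iterD IH.
move=> x [k _ <-]; exists (k %% p)%N; first exact: ltn_pmod.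
by rewrite {2}(divn_eq k p) addnC iterD M.
Qed.

Definition orb d := fset_set (vertex d).
Lemma in_orb d e : (e \in orb d) = `[< vertex d e >].
Proof. by rewrite in_fset_set; [apply/idP/asboolP; rewrite inE|exact: vertex_finite]. Qed.

Definition dg d : R := #|` orb d|%:R.
Lemma dg_gt0 d : 0 < dg d.
Proof.
by rewrite ltr0n cardfs_gt0; apply/fset0Pn; exists d; rewrite in_orb; apply/asboolP; exact: vertex_refl.
Qed.

Definition avg F d : R := (\sum_(e <- orb d) F e) / dg d.

Lemma avg_vertex F d e : vertex d e -> avg F e = avg F d.
Proof. by move=> h; rewrite /avg /dg /orb (vertex_eq h). Qed.

Lemma avg_le F F' d : (forall e, vertex d e -> F e <= F' e) -> avg F d <= avg F' d.
Proof.
move=> h; rewrite /avg ler_wpM2r ?invr_ge0 ?(ltW (dg_gt0 d))// big_seq [leRHS]big_seq.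
by apply: ler_sum => e; rewrite in_orb => /asboolP; exact: h.
Qed.

Lemma avg_cst (a : R) d : avg (fun=> a) d = a.
Proof.
rewrite /avg big_const_seq iter_addr_0 count_predT -mulr_natr mulfK//.
exact: lt0r_neq0 (dg_gt0 d).
Qed.

(** Finite form of the reversibility of the walk: averaging over the darts of each vertex preserves
    sums over whole vertices. *)
Lemma sum_avg (s : seq (dart G)) F : uniq s -> (forall d e, d \in s -> vertex d e -> e \in s) ->
  \sum_(d <- s) avg F d = \sum_(d <- s) F d.
Proof.
move=> us sv.
have E d : d \in s -> avg F d = \sum_(e <- s) (`[< vertex d e >])%:R / dg d * F e.
  move=> ds; under eq_bigr do rewrite -in_orb.
  rewrite (bigID (fun e => e \in orb d)) /= [X in _ = _ + X]big1 ?addr0; last by move=> e /negbTE ->; rewrite !mul0r.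
  rewrite -[RHS]big_filter; have p : perm_eq (orb d) [seq e <- s | e \in orb d].
    apply: uniq_perm; rewrite ?filter_uniq ?fset_uniq// => e; rewrite mem_filter.
    case: (boolP (e \in orb d)) => //=; rewrite in_orb => /asboolP de; by rewrite (sv _ _ ds de).
  rewrite -(perm_big _ p) /avg mulr_suml [LHS]big_seq [RHS]big_seq; apply: eq_bigr => e ->; by rewrite mul1r mulrC.
rewrite big_seq (eq_bigr _ E) -big_seq exchange_big /= !big_seq; apply: eq_bigr => e es.
rewrite -mulr_suml -[RHS]mul1r; congr (_ * _).
rewrite -[RHS](avg_cst 1 e) /avg mulr_suml.
have h d : (`[< vertex d e >])%:R / dg d = (d \in orb e)%:R / dg e.
  rewrite in_orb; have -> : `[< vertex d e >] = `[< vertex e d >] by apply/asboolP/asboolP; exact: vertex_sym.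
  by case: asboolP => [/vertex_eq h|_]; rewrite ?mul0r// /dg /orb h.
under eq_bigr do rewrite h.
rewrite (bigID (fun d => d \in orb e)) /= [X in _ + X]big1 ?addr0; last by move=> d /negbTE ->; rewrite !mul0r.
rewrite -big_filter; have p : perm_eq (orb e) [seq d <- s | d \in orb e].
  apply: uniq_perm; rewrite ?filter_uniq ?fset_uniq// => d; rewrite mem_filter.
  case: (boolP (d \in orb e)) => //=; rewrite in_orb => /asboolP ed; by rewrite (sv _ _ es ed).
by rewrite -(perm_big _ p) /= !big_seq; apply: eq_bigr => d ->.
Qed.

Lemma near_finite N : finite_set [set d | @dist_le G N d].
Proof.
elim: N => [|N IH]; first exact: vertex_finite.
apply: (@sub_finite_set _ _ ([set d | dist_le N d] `|` \bigcup_(d in edge @` [set d | @dist_le G N d]) vertex d)).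
  move=> d /= [h|[d' dd' h]]; [by left|right]; exists d'; last exact: vertex_sym.
  by exists (edge d') => //; rewrite edgeK.
by rewrite finite_setU; split => //; apply: bigcup_finite; [exact: finite_image|move=> *; exact: vertex_finite].
Qed.

(* Summation by parts: [phi^2 / h * (h - h') + phi'^2 / h' * (h' - h) <= (phi - phi')^2]. *)
Lemma edge_ineq (a b p q : R) : 0 < a -> 0 < b ->
  p ^+ 2 / a * (a - b) + q ^+ 2 / b * (b - a) <= (p - q) ^+ 2.
Proof.
move=> a0 b0; rewrite -subr_ge0.
have -> : (p - q) ^+ 2 - (p ^+ 2 / a * (a - b) + q ^+ 2 / b * (b - a)) = (p * b - q * a) ^+ 2 / (a * b).
  by field; rewrite !gt_eqF.
by rewrite divr_ge0 ?sqr_ge0// mulr_ge0// ltW.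
Qed.

Section energy.
Variables (dx : dart G) (q0 : R) (h : dart G -> R).
Hypotheses (h01 : forall d, 0 <= h d <= 1) (hv : forall d e, vertex d e -> h e = h d) (hx : h dx = 1) (q00 : 0 <= q0).
Hypothesis hh : forall d, h d - avg (fun e => h (edge e)) d = if `[< vertex dx d >] then q0 else 0.

(** The equation for [h] is tested against phi^2 / H, which has finite support; [edge_ineq] bounds
    the result by the energy of phi, with no control of [h] far away. Taking H = h + 1 keeps the
    denominator positive; its value 2 at [dx] is compensated by each edge being counted twice. *)
Lemma energy_bound dl N (phi : dart G -> R) : (forall d, phi (rot d) = phi d) -> (forall d, phi d != 0 -> dist_le N d) ->
  (forall s : seq (dart G), uniq s -> \sum_(d <- s) (phi d - phi (edge d)) ^+ 2 <= dl) ->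
  phi dx ^+ 2 * q0 <= dl.
Proof.
move=> pr pN pE; pose H d := h d + 1; pose c d := phi d ^+ 2 / H d.
have H0 d : 0 < H d by have /andP[? _] := h01 d; rewrite /H; lra.
have pv d e : vertex d e -> phi e = phi d.
  by move=> [k _ <-]; elim: k => //= k <-; rewrite pr.
pose S := fset_set ([set d | phi d != 0] `|` [set d | phi (edge d) != 0]).
have finA : finite_set [set d | phi d != 0].
  by apply: sub_finite_set (near_finite N) => d; exact: pN.
have finS : finite_set ([set d | phi d != 0] `|` [set d | phi (edge d) != 0]).
  rewrite finite_setU; split => //; apply: (@sub_finite_set _ _ (edge @` [set d | phi d != 0])).
    by move=> d /= h'; exists (edge d) => //; rewrite edgeK.
  exact: finite_image.
have inS d : (d \in S) = (phi d != 0) || (phi (edge d) != 0).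
  rewrite in_fset_set//; apply/idP/orP; rewrite inE; by move=> [|]; [left|right].
pose A := fset_set [set d | phi d != 0].
have inA d : (d \in A) = (phi d != 0) by rewrite in_fset_set//; apply/idP/idP; rewrite inE.
have eS : perm_eq S (map edge S).
  apply: uniq_perm; rewrite ?fset_uniq ?map_inj_uniq ?fset_uniq//; first exact: (inv_inj (@edgeK G)).
  move=> d; rewrite inS; apply/idP/mapP => [dS|[e]]; last by rewrite inS => es ->; rewrite edgeK orbC.
  by exists (edge d); rewrite ?edgeK// inS edgeK orbC.
have lo : \sum_(d <- A) c d * (H d - H (edge d)) = \sum_(d <- S) c d * (H d - H (edge d)).
  rewrite [RHS](bigID (fun d => phi d != 0)) /= [X in _ = _ + X]big1 ?addr0; last first.
    by move=> d; rewrite negbK => /eqP; rewrite /c => ->; rewrite expr0n !mul0r.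
  rewrite -[RHS]big_filter; apply: perm_big; apply: uniq_perm; rewrite ?filter_uniq ?fset_uniq// => d.
  by rewrite mem_filter inA inS; case: (phi d != 0).
have up : 2 * \sum_(d <- S) c d * (H d - H (edge d)) <= dl.
  apply: le_trans (pE S (fset_uniq _)).
  have e1 : \sum_(d <- S) c d * (H d - H (edge d)) = \sum_(d <- S) c (edge d) * (H (edge d) - H d).
    by rewrite (perm_big _ eS) big_map; apply: eq_bigr => d _; rewrite edgeK.
  rewrite mulr_natl mulr2n {2}e1 -big_split; apply: ler_sum => d _ /=; exact: edge_ineq.
have cv d e : vertex d e -> c e = c d by move=> de; rewrite /c /H (pv _ _ de) (hv de).
have eqA : \sum_(d <- A) c d * (H d - H (edge d)) = \sum_(d <- A) c d * (if `[< vertex dx d >] then q0 else 0).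
  rewrite -sum_avg ?fset_uniq//; last first.
    by move=> d e; rewrite !inA => h1 h2; rewrite (pv _ _ h2).
  apply: eq_bigr => d _; rewrite -hh /avg -[h d](avg_cst _ d) /avg -mulrBl -sumrB mulrA; congr (_ / _).
  rewrite mulr_sumr big_seq [RHS]big_seq; apply: eq_bigr => e; rewrite in_orb => /asboolP de.
  by rewrite (cv _ _ de) /H (hv de); congr (_ * _); lra.
have dl0 : 0 <= dl by have := pE [::] isT; rewrite big_nil.
have [p0|p0] := eqVneq (phi dx) 0; first by rewrite p0 expr0n mul0r.
have : c dx * q0 <= \sum_(d <- A) c d * (H d - H (edge d)).
  rewrite eqA (big_rem dx) ?inA//= asboolT ?lerDl; last exact: vertex_refl.
  apply: sumr_ge0 => d _; apply: mulr_ge0; first by rewrite /c divr_ge0 ?sqr_ge0// ltW.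
  by case: ifP.
rewrite lo /c /H hx => h1; move: up.
move: h1; have -> : phi dx ^+ 2 / (1 + 1) * q0 = (phi dx ^+ 2 * q0) / 2 by field.
lra.
Qed.
End energy.

Section hit.
Variable dx : dart G.

Definition at_x d := `[< vertex dx d >].
(** Probability that the walk started at the vertex of d avoids the vertex of [dx] at times 1 to
    k. *)
Fixpoint qd k d : R := if k is k.+1 then avg (fun e => if at_x (edge e) then 0 else qd k (edge e)) d else 1.

Lemma qd01 k d : 0 <= qd k d <= 1.
Proof.
elim: k d => [|k IH] d /=; first by rewrite ler01 lexx.
apply/andP; split; [rewrite -[leLHS](avg_cst _ d)|rewrite -[leRHS](avg_cst _ d)]; apply: avg_le => e _;
  by case: ifP => _; rewrite ?lexx ?ler01//; case/andP: (IH (edge e)).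
Qed.

Lemma qd_dec k d : qd k.+1 d <= qd k d.
Proof.
elim: k d => [|k IH] d; first by have /andP[] := qd01 1 d.
apply: avg_le => e _; case: ifP => // _; exact: IH.
Qed.

Lemma qd_vertex k d e : vertex d e -> qd k e = qd k d.
Proof. by case: k => // k; exact: avg_vertex. Qed.

Lemma at_x_vertex d e : vertex d e -> at_x e = at_x d.
Proof.
by move=> de; apply/asboolP/asboolP => h; apply: vertex_trans h _ => //; exact: vertex_sym.
Qed.

(** The limit q of the avoidance probabilities is harmonic once set to 0 at x, except at x where the
    defect is [q dx], the escape probability. [energy_bound] makes phi(dx)^2 [q dx] at most dl. A
    good potential is 1 at the root and varies by at most the square root of dl along an edge, so it
    is at least 1/2 at x, and dl is arbitrary. *)
Lemma no_escape : (forall dl : R, 0 < dl -> exists N, mgood G dl N) -> qd k dx @[k --> \oo] --> (0 : R).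
Proof.
move=> good.
have cv d : cvgn (fun k => qd k d).
  apply: nonincreasing_is_cvgn; first by apply/nonincreasing_seqP => k; exact: qd_dec.
  by exists 0 => _ [k _ <-]; case/andP: (qd01 k d).
pose q d := limn (fun k => qd k d).
have qc d : qd k d @[k --> \oo] --> q d by exact: cv.
have q01 d : 0 <= q d <= 1.
  apply/andP; split; [apply: limr_ge (cv d) _|apply: limr_le (cv d) _]; by apply: nearW => k; case/andP: (qd01 k d).
have qv d e : vertex d e -> q e = q d.
  by move=> de; congr (limn _); apply/funext => k; exact: qd_vertex.
have qE d : q d = avg (fun e => if at_x (edge e) then 0 else q (edge e)) d.
  have h1 : qd k.+1 d @[k --> \oo] --> q d by have := qc d; rewrite -cvg_shiftS.
  have h2 : qd k.+1 d @[k --> \oo] --> avg (fun e => if at_x (edge e) then 0 else q (edge e)) d.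
    rewrite /= /avg; apply: cvgMr_tmp; apply: cvg_sum_seq => e.
    by case: ifP => _; [exact: cvg_cst|exact: qc].
  by rewrite -(cvg_lim (@Rhausdorff R) h1) (cvg_lim (@Rhausdorff R) h2).
suff -> : (0 : R) = q dx by exact: qc.
have /andP[qx0 _] := q01 dx.
pose u d := if at_x d then 0 else q d.
pose h d := 1 - u d.
have u01 d : 0 <= u d <= 1 by rewrite /u; case: ifP; rewrite ?lexx ?ler01.
have [L hL] : exists L, dist_le L dx.
  have := @rmap_connected G [set d | exists k, dist_le k d]; move=> /(_ _ _)/seteqP[||_ hA]; last exact: (hA dx I).
  - by exists 0%N; exact: vertex_refl.
  - move=> d [k kd]; split.
      by exists k.+1; right; exists (edge d); [exact: vertex_refl|rewrite edgeK].
    by exists k; apply: near_vertex kd; exists 1%N.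
apply/esym/eqP; rewrite eq_le qx0 andbT leNgt; apply/negP => qpos.
pose eta : R := (2 * L.+1%:R)^-1; have L1 : 1 <= L.+1%:R :> R by rewrite ler1n.
have eta0 : 0 < eta by rewrite invr_gt0 mulr_gt0//; lra.
(* The first bound keeps phi above 1/2 along L edges; the second contradicts (1/2)^2 [q dx] being at
   most dl. *)
pose dl := Num.min (eta ^+ 2) (q dx / 8).
have dl0 : 0 < dl by rewrite lt_min exprn_gt0//= divr_gt0.
have [N [phi [p01 pr p1 pN pE]]] := good dl dl0.
have step d : `|phi d - phi (edge d)| <= eta.
  have := pE [:: d] isT; rewrite big_seq1 => /le_trans/(_ (_ : dl <= eta ^+ 2)); rewrite ge_min lexx => /(_ isT).
  by rewrite -[X in X <= _]real_normK ?num_real// ler_pXn2r ?nnegrE// ltW.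
have pv d e : vertex d e -> phi e = phi d.
  by move=> [k _ <-]; elim: k => //= k <-; rewrite pr.
have path k : forall d, dist_le k d -> 1 - phi d <= k%:R * eta.
  elim: k => [|k IH] d /=; first by move=> /pv ->; rewrite p1 subrr mul0r.
  move=> [/IH h1|[d' /pv <- /IH h1]]; rewrite -natr1 mulrDl mul1r; first by lra.
  have := step d'; rewrite ler_norml => /andP[]; lra.
have px : 1 / 2 <= phi dx.
  have h1 : L%:R * eta <= 1 / 2.
    have h2 : L%:R <= L.+1%:R :> R by rewrite ler_nat.
    by rewrite /eta ler_pdivrMr ?mulr_gt0//; lra.
  by have := path L dx hL; lra.
have := @energy_bound dx (q dx) h _ _ _ qx0 _ dl N phi pr pN pE.
have hxx : at_x dx by apply/asboolP; exact: vertex_refl.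
move=> /(_ _ _ _ _) H; have : phi dx ^+ 2 * q dx <= dl.
  apply: H.
  - by move=> d; have /andP[? ?] := u01 d; rewrite /h; apply/andP; split; lra.
  - by move=> d e de; rewrite /h /u (at_x_vertex de) (qv _ _ de).
  - by rewrite /h /u hxx subr0.
  move=> d; have -> : avg (fun e => h (edge e)) d = 1 - q d.
    rewrite qE -[in RHS](avg_cst 1 d) /avg -mulrBl -sumrB; congr (_ / _).
  rewrite /h /u -/(at_x d); case: (boolP (at_x d)) => [/asboolP /qv ->|_]; lra.
have : (1 / 2) ^+ 2 * q dx <= phi dx ^+ 2 * q dx.
  by rewrite ler_wpM2r// ler_pXn2r ?nnegrE//; lra.
have : dl <= q dx / 8 by rewrite ge_min lexx orbT.
have -> : (1 / 2) ^+ 2 = 1 / 4 :> R by field.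
lra.
Qed.
End hit.
End harmonic.

(** * Return probabilities from cylinder probabilities *)

Section split.
Variables (R : realType) (d : measure_display) (Omega : measurableType d) (P : probability Omega R).

Definition fprob (A : set Omega) : R := fine (P A).

Lemma prE A : measurable A -> P A = (fprob A)%:E.
Proof. by move=> mA; rewrite /fprob fineK// fin_num_measure. Qed.

Lemma pr_ge0 A : 0 <= fprob A.
Proof. by rewrite fine_ge0. Qed.

Lemma pr_le A B : measurable A -> measurable B -> A `<=` B -> fprob A <= fprob B.
Proof.
move=> mA mB AB; rewrite fine_le ?fin_num_measure//.
by apply: le_measure => //; rewrite inE.
Qed.

Lemma prDI A B : measurable A -> measurable B -> fprob A = fprob (A `\` B) + fprob (A `&` B).
Proof.
move=> mA mB; apply: EFin_inj; rewrite EFinD -!prE//; [exact: measureDI|exact: measurableI|exact: measurableD].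
Qed.

(** The sets [D i] are not assumed to cover [C]: the last term bounds what they miss. In [avoid_pr]
    it vanishes because the transition probabilities to the neighbours sum to 1, so no sum over all
    vertices is involved. *)
Lemma pr_split (I : eqType) (s : seq I) (D : I -> set Omega) C N : uniq s ->
  measurable C -> measurable N -> (forall i, measurable (D i)) ->
  (forall i, i \in s -> D i `<=` C) -> (forall i j, i != j -> D i `&` D j = set0) ->
  fprob (C `&` N) <= \sum_(i <- s) fprob (D i `&` N) + (fprob C - \sum_(i <- s) fprob (D i)).
Proof.
elim: s C => [|i s IH] C /=.
  by move=> _ mC mN _ _ _; rewrite !big_nil add0r subr0; apply: pr_le => //; exact: measurableI.
move=> /andP[ns us] mC mN mD DC dis; rewrite !big_cons.
have mCD : measurable (C `\` D i) by exact: measurableD.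
have := IH (C `\` D i) us mCD mN mD _ dis.
have h : forall j, j \in s -> D j `<=` C `\` D i.
  move=> j js w Dw; split; first by apply: (DC j) => //; rewrite inE js orbT.
  move=> Diw; have : (D i `&` D j) w by [].
  by rewrite dis//; apply: contraNneq ns => ->.
move=> /(_ h); have -> : fprob (C `\` D i) = fprob C - fprob (D i).
  by rewrite (prDI mC (mD i)) (setIidr (DC i (mem_head _ _))) addrK.
have -> : fprob (C `&` N) = fprob ((C `\` D i) `&` N) + fprob (D i `&` N).
  rewrite (prDI (measurableI _ _ mC mN) (mD i)); congr (fprob _ + fprob _).
    by rewrite !setDE setIAC.
  by rewrite setIAC (setIidr (DC i (mem_head _ _))).
lra.
Qed.
End split.

Section walk.
Variables (R : realType) (G : rmap) (dx : dart G).
Variables (d : measure_display) (Omega : measurableType d) (P : probability Omega R) (X : nat -> Omega -> set (dart G)).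
Hypothesis srw : simple_random_walk (vertex dx) P X.
Local Notation x := (vertex dx).
Local Notation pr := (fprob P).

Let mX i v : measurable [set w | X i w = v]. Proof. by case: srw. Qed.

Definition cyl (v : nat -> set (dart G)) k := [set w | forall i, (i <= k)%N -> X i w = v i].
Definition avoid j k := [set w | forall i, (j < i <= k)%N -> X i w <> x].

Lemma cyl_meas v k : measurable (cyl v k).
Proof.
have -> : cyl v k = \bigcap_i (if (i <= k)%N then [set w | X i w = v i] else setT).
  apply/seteqP; split => w /= h i; first by move=> _; case: ifP => // /h.
  by move=> ik; have := h i I; rewrite ik.
by apply: bigcapT_measurable => i; case: ifP.
Qed.

Lemma avoid_meas j k : measurable (avoid j k).
Proof.
have -> : avoid j k = \bigcap_i (if (j < i <= k)%N then ~` [set w | X i w = x] else setT).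
  apply/seteqP; split => w /= h i; first by move=> _; case: ifP => // /h.
  by move=> ik; have := h i I; rewrite ik.
by apply: bigcapT_measurable => i; case: ifP => // _; exact: measurableC.
Qed.

Lemma cyl_pr v k : (forall i, vertices G (v i)) -> v 0%N = x ->
  pr (cyl v k) = \prod_(i < k) walk_step R (v i) (v i.+1).
Proof. by case: srw => _ _ h hv v0; rewrite /fprob /cyl h. Qed.

Lemma step_sum e0 (f : set (dart G) -> R) :
  \sum_(u <- undup [seq vertex (edge e) | e <- orb e0]) walk_step R (vertex e0) u * f u =
  avg (fun e => f (vertex (edge e))) e0.
Proof.
pose s := undup [seq vertex (edge e) | e <- orb e0]; rewrite -/s /avg.
have E u : walk_step R (vertex e0) u * f u = (\sum_(e <- orb e0) (vertex (edge e) == u)%:R * f u) / dg R e0.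
  rewrite /walk_step mulrAC -mulr_suml; congr (_ * _ / _).
  have -> : fset_set [set e | vertex e0 e /\ vertex (edge e) = u] = [fset e in orb e0 | vertex (edge e) == u]%fset.
    apply/fsetP => e; rewrite in_fset_set; last by apply: sub_finite_set (vertex_finite e0) => y [].
    rewrite !inE /= in_orb; apply/idP/andP => [|[/asboolP h /eqP h']]; first by rewrite inE => -[h ->]; split => //; exact/asboolP.
    by rewrite inE.
  rewrite card_fset_sum1 natr_sum big_fset /= big_mkcond /=.
  by apply: eq_bigr => e _; case: ifP.
under eq_bigr do rewrite E.
rewrite -mulr_suml exchange_big /=; congr (_ / _); rewrite !big_seq; apply: eq_bigr => e eo.
have es : vertex (edge e) \in s by rewrite mem_undup; apply/mapP; exists e.
rewrite (bigD1_seq (vertex (edge e)))//= ?undup_uniq// eqxx mul1r big1 ?addr0// => u /negbTE.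
by rewrite eq_sym => ->; rewrite mul0r.
Qed.

(** The law of the walk is known only through cylinders, so the Markov property takes this form: the
    past is a fixed trajectory, extended by each neighbour in turn, with induction on the number of
    steps to come. *)
Lemma avoid_pr r j v e0 : (forall i, vertices G (v i)) -> v 0%N = x -> v j = vertex e0 ->
  pr (cyl v j `&` avoid j (j + r)) <= (\prod_(i < j) walk_step R (v i) (v i.+1)) * qd R dx r e0.
Proof.
elim: r j v e0 => [|r IH] j v e0 hv v0 vj.
  by rewrite /= mulr1 -cyl_pr//; apply: pr_le; [exact: measurableI (cyl_meas _ _) (avoid_meas _ _)|exact: cyl_meas|exact: subIsetl].
pose ext u i := if (i <= j)%N then v i else u.
pose D u := cyl (ext u) j.+1.
pose s := undup [seq vertex (edge e) | e <- orb e0].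
pose p := \prod_(i < j) walk_step R (v i) (v i.+1).
have sP u : u \in s -> exists e, u = vertex e.
  by rewrite mem_undup => /mapP[e _ ->]; exists (edge e).
have hext u : u \in s -> (forall i, vertices G (ext u i)) /\ ext u 0%N = x.
  by move=> us; split=> [i|]; rewrite /ext//; case: ifP => // _; have [e ->] := sP u us; exists e.
have pD u : u \in s -> \prod_(i < j.+1) walk_step R (ext u i) (ext u i.+1) = p * walk_step R (vertex e0) u.
  move=> us; rewrite big_ord_recr /= /ext leqnn ltnn vj; congr (_ * _).
  by apply: eq_bigr => i _; rewrite (ltnW (ltn_ord i)) ltn_ord.
have DC u : D u `<=` cyl v j by move=> w h i ij; rewrite h ?leqW// /ext ij.
have := @pr_split _ _ _ P _ s D (cyl v j) (avoid j (j + r.+1)) (undup_uniq _) (cyl_meas _ _) (avoid_meas _ _)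
  (fun u => cyl_meas _ _) (fun u _ => DC u) _.
have dis : forall u u', u != u' -> D u `&` D u' = set0.
  move=> u u' /eqP uu'; apply/seteqP; split => // w [/(_ j.+1 (leqnn _)) h1 /(_ j.+1 (leqnn _)) h2].
  by apply: uu'; move: h1 h2; rewrite /ext ltnn => -> ->.
move=> /(_ dis) /le_trans; apply.
have e1 : pr (cyl v j) - \sum_(u <- s) pr (D u) = 0.
  rewrite cyl_pr// -/p big_seq (eq_bigr (fun u => p * walk_step R (vertex e0) u)) => [|u us]; last first.
    by have [h1 h2] := hext u us; rewrite cyl_pr// pD.
  rewrite -big_seq -mulr_sumr; have := step_sum e0 (fun=> 1); rewrite avg_cst => h.
  rewrite (eq_bigr (fun u => walk_step R (vertex e0) u * 1)) => [|u _]; last by rewrite mulr1.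
  by rewrite h mulr1 subrr.
rewrite e1 addr0.
pose f u : R := if u == x then 0 else qd R dx r (xget e0 u).
have -> : qd R dx r.+1 e0 = avg (fun e => f (vertex (edge e))) e0.
  rewrite /= /avg; congr (_ / _); apply: eq_bigr => e _; rewrite /f.
  have -> : (vertex (edge e) == x) = at_x dx (edge e).
    by apply/eqP/asboolP => [<-|/vertex_eq //]; exact: vertex_refl.
  case: ifP => // _; apply/esym/qd_vertex.
  by case: xgetP => [y -> //|/(_ (edge e)) []]; exact: vertex_refl.
rewrite -step_sum mulr_sumr -/s big_seq [leRHS]big_seq; apply: ler_sum => u us.
have [h1 h2] := hext u us; rewrite mulrA -pD// /f; case: eqP => [ux|/eqP ux].
  rewrite mulr0; suff -> : D u `&` avoid j (j + r.+1) = set0 by rewrite /fprob measure0.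
  apply/seteqP; split => // w [/(_ j.+1 (leqnn _)) h /(_ j.+1)].
  by rewrite ltnSn /= addnS ltnS leq_addr => /(_ isT); rewrite h /ext ltnn ux.
have [e ue] := sP u us.
have -> : qd R dx r (xget e0 u) = qd R dx r e.
  by rewrite ue; apply: qd_vertex; case: xgetP => [y -> //|/(_ e) []]; exact: vertex_refl.
have uE : ext u j.+1 = vertex e by rewrite /ext ltnn.
apply: le_trans (IH j.+1 (ext u) e h1 h2 uE); apply: pr_le.
- exact: measurableI (cyl_meas _ _) (avoid_meas _ _).
- exact: measurableI (cyl_meas _ _) (avoid_meas _ _).
move=> w [Dw aw]; split => // i /andP[ji ik]; apply: aw; rewrite (ltnW ji) /=.
by move: ik; rewrite addSnnS.
Qed.

Lemma no_return k : pr (avoid 0 k) <= qd R dx k dx.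
Proof.
pose v := fun _ : nat => x; have hv i : vertices G (v i) by exists dx.
have := @avoid_pr k 0%N v dx hv erefl erefl; rewrite big_ord0 mul1r add0n; apply: le_trans.
(* The cylinder of length 0 has an empty product as its probability: the walk starts at x almost
   surely. *)
have c0 : pr (cyl v 0) = 1 by rewrite cyl_pr// big_ord0.
have mc := cyl_meas v 0; have ma := avoid_meas 0 k.
have a1 : pr (cyl v 0 `|` avoid 0 k) <= 1.
  by rewrite -[leRHS]/(fine (1%:E)) fine_le ?fin_num_measure//; [exact: measurableU|apply: probability_le1; exact: measurableU].
have : pr (cyl v 0 `|` avoid 0 k) = pr (cyl v 0) + pr (avoid 0 k) - pr (cyl v 0 `&` avoid 0 k).
  rewrite (prDI P (measurableU _ _ mc ma) mc) (prDI P ma mc).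
  by rewrite setDUl setDv set0U (setIidr (@subsetUl _ _ _)) setIC; ring.
lra.
Qed.

Lemma recurrence : (forall dl : R, 0 < dl -> exists N, mgood G dl N) ->
  {ae P, forall w, exists2 k, (0 < k)%N & X k w = x}.
Proof.
move=> good; have cv := no_escape dx good.
exists (\bigcap_k avoid 0 k); split.
- by apply: bigcapT_measurable => k; exact: avoid_meas.
- have mM : measurable (\bigcap_k avoid 0 k) by apply: bigcapT_measurable => k; exact: avoid_meas.
  rewrite prE//; congr EFin; apply/eqP; rewrite eq_le pr_ge0 andbT.
  have : pr (\bigcap_k avoid 0 k) <= limn (fun k => qd R dx k dx).
    apply: limr_ge; first by apply/cvg_ex; exists 0; exact: cv.
    apply: nearW => k; apply: le_trans (no_return k); apply: pr_le => //; first exact: avoid_meas.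
    by move=> w; apply.
  by rewrite (cvg_lim _ cv).
move=> w /= nex k _ i /andP[i0 _] Xi; apply: nex; by exists i.
Qed.
End walk.

Theorem recurrent_of_good (R : realType) (G : rmap) :
  (forall dl : R, 0 < dl -> exists N, mgood G dl N) -> recurrent R G.
Proof. by move=> good _ [dx _ <-] d Omega P X srw; exact: recurrence. Qed.

(** * The half-plane map *)

Section limit.
Variables (R : realType) (d : measure_display) (Omega : measurableType d) (P : probability Omega R).
Variable H : {RV P >-> borel_map R}.
Hypothesis huiptH : is_HUIPT H.

Definition good_event (dl : R) N := [set w | mgood (H w) dl N].

Lemma good_event_meas dl N : measurable (good_event dl N).
Proof.
rewrite -[good_event dl N]setTI.
have -> : good_event dl N = H @^-1` [set G | mgood G dl N] by [].
have mH : measurable_fun setT (H : Omega -> borel_map R) by exact: measurable_funPT.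
apply: mH => //.
by apply: sub_sigma_algebra; exact: mgood_open.
Qed.

(** Convergence holds along all admissible sequences, in particular along the one chosen by
    [mean_good], and the indicator of a good root is bounded and locally constant for the local
    topology. *)
Lemma good_event_prob dl eps : 0 < dl -> 0 < eps -> exists N, ((1 - eps)%:E <= P (good_event dl N))%E.
Proof.
move=> dl0 e0; have [N hN] := mean_good dl0 e0; exists N.
have /choice[f hf] : forall k, exists nP : nat * nat, [/\ (k <= nP.2)%N, (k * nP.2.+1 < nP.1)%N &
    1 - eps <= uniform_mean nP.1 nP.2.+1 (mgood_ind dl N)].
  by move=> k; have [n [Q h]] := hN k; exists (n, Q).
have cvm : (f k).2.+1 @[k --> \oo] --> \oo.
  apply/cvgnyPge => A; exists A => // k /= Ak; have [h _ _] := hf k.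
  exact: leq_trans Ak (leqW h).
have cvr : ((f k).1%:R / (f k).2.+1%:R : R) @[k --> \oo] --> +oo.
  apply/cvgryPge => A; exists (Num.truncn `|A|).+1 => // k /= Ak; have [_ h _] := hf k.
  rewrite ler_pdivlMr ?ltr0n//; apply: (@le_trans _ _ (k * (f k).2.+1)%:R); last by rewrite ler_nat ltnW.
  rewrite natrM ler_wpM2r//; apply: le_trans (ler_norm _) _; apply: ltW.
  by apply: lt_le_trans (truncnS_gt _) _; rewrite ler_nat.
have bd : bounded_fun (mgood_ind dl N : local_map R -> R).
  exists 1; split; first exact: num_real.
  move=> M M1 G _; apply: le_trans (ltW M1).
  by rewrite /mgood_ind normr_nat lern1 leq_b1.
have := huiptH cvm cvr (@mgood_ind_continuous R dl N) bd.
have -> : mgood_ind dl N \o H = \1_(good_event dl N) :> (Omega -> R).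
  apply/funext => w; rewrite indicE /mgood_ind /=.
  by case: asboolP => h; [rewrite mem_set|rewrite memNset].
rewrite expectation_indic; last exact: good_event_meas.
move=> cv; rewrite -(cvg_lim _ cv)//; apply: lime_ge.
  by apply/cvg_ex; eexists; exact: cv.
by apply: nearW => k; rewrite lee_fin; case: (hf k).
Qed.

(** N depends on eps, but all these events lie in their union, whose probability is therefore 1. *)
Lemma ae_good dl : 0 < dl -> P.-negligible (~` \bigcup_N good_event dl N).
Proof.
move=> dl0; have mU : measurable (\bigcup_N good_event dl N).
  by apply: bigcupT_measurable => N; exact: good_event_meas.
exists (~` \bigcup_N good_event dl N); split => //; first exact: measurableC.
have mC := measurableC mU.
rewrite (prE P mC); congr EFin; apply/eqP; rewrite eq_le pr_ge0 andbT leNgt; apply/negP => p0.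
have [N hN] := good_event_prob dl0 (divr_gt0 p0 (ltr0n R 2)).
have := pr_le P (good_event_meas dl N) mU (@bigcup_sup _ _ N setT (good_event dl) I).
have := prDI P measurableT mU; rewrite setTD setTI.
have -> : fprob P setT = 1 by rewrite /fprob probability_setT.
by move: hN; rewrite prE ?lee_fin; [lra|exact: good_event_meas].
Qed.

Lemma huipt_recurrent : {ae P, forall w, recurrent R (H w)}.
Proof.
have : P.-negligible (\bigcup_k ~` \bigcup_N good_event (k.+1%:R^-1) N).
  by apply: negligible_bigcup => k; apply: ae_good; rewrite invr_gt0 ltr0n.
apply: negligibleS => w /= nr; apply: contrapT => nb; apply: nr; apply: recurrent_of_good => dl dl0.
have [k kd] : exists k, k.+1%:R^-1 <= dl.
  exists (Num.truncn dl^-1); rewrite -[leRHS]invrK lef_pV2 ?posrE ?invr_gt0 ?ltr0n//.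
  exact/ltW/truncnS_gt.
have [N _ [phi [h1 h2 h3 h4 h5]]] : (\bigcup_N good_event (k.+1%:R^-1) N) w.
  by apply: contrapT => h; apply: nb; exists k.
by exists N, phi; split => // s us; apply: le_trans kd; exact: h5.
Qed.
End limit.

End Walk.

Require Import Defs.
From mathcomp Require Import all_boot all_order all_algebra.
From mathcomp Require Import all_classical all_reals all_analysis.
Import Walk.

Theorem theorem1 (R : realType) (d : measure_display)
  (Omega : measurableType d) (P : probability Omega R)
  (H : {RV P >-> borel_map R}) (huiptH : is_HUIPT H) :
  {ae P, forall w, recurrent R (H w)}.
Proof. exact: huipt_recurrent. Qed.
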